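(* The reduced HOMFLY homology of the braid $\sigma_1^2\sigma_2^2$ on three strands (whose closure is the connect sum of two Hopf links) is given as follows, as graded right $R$-modules, with all other groups zero: $$\overline{\mathrm{HHH}}^{A=0}:\quad T=0:\ R(-4),\qquad T=2:\ R/(\alpha_t)\oplus R/(\alpha_s),\qquad T=4:\ \Bbbk(4);$$ $$\overline{\mathrm{HHH}}^{A=1}:\quad T=0:\ R\oplus R,\qquad T=2:\ \big(R/(\alpha_t)\big)(4)\oplus\big(R/(\alpha_s)\big)(4);$$ $$\overline{\mathrm{HHH}}^{A=2}:\quad T=0:\ R(4).$$ Consequently its Poincaré series is $$\overline{\mathscr P}(A,Q,T)=\Big(\tfrac{Q^4}{(1-Q^2)^2}+\tfrac{2T^2}{1-Q^2}+Q^{-4}T^4\Big)+A\Big(\tfrac{2}{(1-Q^2)^2}+\tfrac{2T^2Q^{-4}}{1-Q^2}\Big)+A^2\,\tfrac{Q^{-4}}{(1-Q^2)^2}.$$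
   Context: $\Bbbk$ is a field of characteristic $0$, $R=\Bbbk[\alpha_s,\alpha_t]$ with $\deg\alpha_s=\deg\alpha_t=2$, on which $S_3=\langle s,t\rangle$ acts by the geometric (reflection) representation: $s(\alpha_s)=-\alpha_s$, $s(\alpha_t)=\alpha_s+\alpha_t$, and symmetrically for $t$. $R^e=R\otimes_\Bbbk R$; $M(1)_d=M_{d+1}$; $\Bbbk=R/(\alpha_s,\alpha_t)$. $B_i=R\otimes_{R^i}R(1)$. Rouquier complexes (bounded complexes of graded bimodules up to homotopy): $F(\sigma_1)=(B_s\to R(1))$ with $B_s$ in cohomological degree $0$ and differential the multiplication map $f\otimes g\mapsto fg$; $F(\sigma_2)$ is the same with $t$; $F$ of a product is the tensor product over $R$. $\mathrm{HH}^k(M)=\bigoplus_\ell\mathrm{Ext}^k_{R^e}(R,M(\ell))$ (graded bimodules), with internal grading by $\ell$ and right $R$-action through $M$. $\overline{\mathrm{HHH}}^{A=k}(\beta)$ is the cohomology of the complex $\mathrm{HH}^k(F(\beta))$ obtained by applying $\mathrm{HH}^k$ termwise; its part in cohomological degree $j$ is the part $T=j$. The Poincaré series is $\sum A^kT^jQ^d\dim_\Bbbk(\overline{\mathrm{HHH}}^{A=k,T=j})_d$. *)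

(* Defs.v *)
From HB Require Import structures.
From mathcomp Require Import all_boot all_order all_algebra.
From mathcomp Require Import generic_quotient ring_quotient.
From mathcomp Require Import boolp functions.
From mathcomp Require Import freeg mpoly.

Set Implicit Arguments.
Unset Strict Implicit.
Unset Printing Implicit Defensive.

Import GRing.Theory Quotient.

Local Open Scope ring_scope.
Local Open Scope quotient_scope.

Section Submodules.
Variables (A : nzRingType) (V : lmodType A).

Record submod := Submod {
  submod_mem :> V -> Prop;
  submod_zero : submod_mem 0;
  submod_lin : forall a u v,
    submod_mem u -> submod_mem v -> submod_mem (a *: u + v) }.

Inductive span (X : V -> Prop) : V -> Prop :=
| span0 : span X 0
| spanS a x v of X x & span X v : span X (a *: x + v).

Lemma span_lin X a u v : span X u -> span X v -> span X (a *: u + v).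
Proof.
elim=> [|b x w Xx _ IH] Xv; first by rewrite scaler0 add0r.
by rewrite scalerDr scalerA -addrA; apply: spanS Xx (IH Xv).
Qed.

Definition spanM X := Submod (@span0 X) (@span_lin X).

Lemma span_gen X x : X x -> span X x.
Proof. by move=> Xx; rewrite -[x]addr0 -[x]scale1r; apply: spanS Xx (span0 _). Qed.

Definition submod_pred (S : submod) : {pred V} := fun v => `[< S v >].

Lemma submod_predP (S : submod) v : reflect (S v) (v \in submod_pred S).
Proof. exact: asboolP. Qed.

Lemma submod_pred_closed S : submod_closed (submod_pred S).
Proof.
split=> [|a u v /submod_predP Su /submod_predP Sv].
  exact/submod_predP/submod_zero.
exact/submod_predP/submod_lin.
Qed.
HB.instance Definition _ S :=
  GRing.isSubmodClosed.Build A V (submod_pred S) (submod_pred_closed S).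

Record sub (S : submod) := Sub_ { sub_val : V; sub_valP : sub_val \in submod_pred S }.
HB.instance Definition _ S := [isSub for @sub_val S].
HB.instance Definition _ S := [Choice of sub S by <:].
HB.instance Definition _ S := [SubChoice_isSubLmodule of sub S by <:].

Definition quotm (S : submod) : Type := quot (submod_pred S).
HB.instance Definition _ S := GRing.Zmodule.on (quotm S).

Definition qpi (S : submod) (v : V) : quotm S := \pi_(quot (submod_pred S)) v.

Lemma qpi_eq S u v : qpi S u = qpi S v <-> S (u - v).
Proof.
split=> [/eqP|Suv]; first by rewrite -idealrBE => /submod_predP.
by apply/eqP; rewrite -idealrBE; apply/submod_predP.
Qed.

Lemma qpiD S u v : qpi S (u + v) = qpi S u + qpi S v.
Proof. exact: (raddfD (\pi_(quot (submod_pred S)))). Qed.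

Lemma qpiE S (q : quotm S) : qpi S (repr q) = q.
Proof. exact: reprK. Qed.

Definition qscale S (a : A) (q : quotm S) : quotm S := qpi S (a *: repr q).

Lemma qpiZ S a v : qscale a (qpi S v) = qpi S (a *: v).
Proof.
apply/qpi_eq; rewrite -scalerBr -[_ *: _]addr0.
by apply: submod_lin (submod_zero S); apply/qpi_eq; rewrite qpiE.
Qed.

Lemma qscaleA S a b (q : quotm S) : qscale a (qscale b q) = qscale (a * b) q.
Proof. by rewrite -[q]qpiE !qpiZ scalerA. Qed.
Lemma qscale1 S : left_id 1 (@qscale S).
Proof. by move=> q; rewrite -[q]qpiE qpiZ scale1r. Qed.
Lemma qscaleDr S : right_distributive (@qscale S) +%R.
Proof.
by move=> a q r; rewrite -[q]qpiE -[r]qpiE -qpiD !qpiZ scalerDr qpiD.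
Qed.
Lemma qscaleDl S (q : quotm S) : {morph (@qscale S)^~ q : a b / a + b}.
Proof. by move=> a b; rewrite -[q]qpiE !qpiZ scalerDl qpiD. Qed.
HB.instance Definition _ S := GRing.Zmodule_isLmodule.Build A (quotm S)
  (@qscaleA S) (@qscale1 S) (@qscaleDr S) (@qscaleDl S).

Lemma qpi_linear S : linear (qpi S).
Proof. by move=> a u v; rewrite qpiD; congr (_ + _); rewrite -qpiZ. Qed.
HB.instance Definition _ S :=
  GRing.isLinear.Build A V (quotm S) _ (qpi S) (qpi_linear S).

End Submodules.

Section DependentProduct.
Variables (A : nzRingType) (I : Type) (V : I -> lmodType A).

Definition dprod : Type := forall i, V i.
HB.instance Definition _ := gen_eqMixin dprod.
HB.instance Definition _ := gen_choiceMixin dprod.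

Definition dprod_zero : dprod := fun i => 0.
Definition dprod_opp (f : dprod) : dprod := fun i => - f i.
Definition dprod_add (f g : dprod) : dprod := fun i => f i + g i.
Definition dprod_scale a (f : dprod) : dprod := fun i => a *: f i.

Lemma dprod_addA : associative dprod_add.
Proof. by move=> f g h; apply: functional_extensionality_dep => i; apply: addrA. Qed.
Lemma dprod_addC : commutative dprod_add.
Proof. by move=> f g; apply: functional_extensionality_dep => i; apply: addrC. Qed.
Lemma dprod_add0 : left_id dprod_zero dprod_add.
Proof. by move=> f; apply: functional_extensionality_dep => i; apply: add0r. Qed.
Lemma dprod_addN : left_inverse dprod_zero dprod_opp dprod_add.
Proof. by move=> f; apply: functional_extensionality_dep => i; apply: addNr. Qed.
HB.instance Definition _ :=
  GRing.isZmodule.Build dprod dprod_addA dprod_addC dprod_add0 dprod_addN.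

Lemma dprod_scaleA a b f : dprod_scale a (dprod_scale b f) = dprod_scale (a * b) f.
Proof. by apply: functional_extensionality_dep => i; apply: scalerA. Qed.
Lemma dprod_scale1 : left_id 1 dprod_scale.
Proof. by move=> f; apply: functional_extensionality_dep => i; apply: scale1r. Qed.
Lemma dprod_scaleDr : right_distributive dprod_scale +%R.
Proof. by move=> a f g; apply: functional_extensionality_dep => i; apply: scalerDr. Qed.
Lemma dprod_scaleDl f : {morph dprod_scale^~ f : a b / a + b}.
Proof. by move=> a b; apply: functional_extensionality_dep => i; apply: scalerDl. Qed.
HB.instance Definition _ := GRing.Zmodule_isLmodule.Build A dprod
  dprod_scaleA dprod_scale1 dprod_scaleDr dprod_scaleDl.

End DependentProduct.

(* Restriction of scalars along f. *)
Definition restr (A B : nzRingType) (f : {rmorphism A -> B}) (V : lmodType B)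
  : Type := V.

Section Restriction.
Variables (A B : nzRingType) (f : {rmorphism A -> B}) (V : lmodType B).
Local Notation W := (restr f V).

HB.instance Definition _ := GRing.Zmodule.copy W V.

Definition restr_scale (a : A) (v : W) : W := f a *: (v : V).
Lemma restr_scaleA a b v : restr_scale a (restr_scale b v) = restr_scale (a * b) v.
Proof. by rewrite /restr_scale scalerA rmorphM. Qed.
Lemma restr_scale1 : left_id 1 restr_scale.
Proof. by move=> v; rewrite /restr_scale rmorph1 scale1r. Qed.
Lemma restr_scaleDr : right_distributive restr_scale +%R.
Proof. by move=> a u v; apply: scalerDr. Qed.
Lemma restr_scaleDl v : {morph restr_scale^~ v : a b / a + b}.
Proof. by move=> a b; rewrite /restr_scale rmorphD scalerDl. Qed.
HB.instance Definition _ := GRing.Zmodule_isLmodule.Build A W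
  restr_scaleA restr_scale1 restr_scaleDr restr_scaleDl.

End Restriction.

Section GradedModules.
Variables (k : fieldType) (n : nat).
Local Notation A := {mpoly k[n]}.

(* Internal degree on k[x_0, ..., x_(n-1)], every variable having degree 2. *)
Definition pdeg (d : int) (p : A) : Prop :=
  forall m, m \in msupp p -> (2 * mdeg m)%N = d :> int.

Inductive kspan (V : lmodType A) (X : V -> Prop) : V -> Prop :=
| kspan0 : kspan X 0
| kspanS c x v of X x & kspan X v : kspan X (c%:MP *: x + v).

Lemma kspan_lin (V : lmodType A) (X : V -> Prop) c u v :
  kspan X u -> kspan X v -> kspan X (c%:MP *: u + v).
Proof.
elim=> [|b x w Xx _ IH] Xv; first by rewrite scaler0 add0r.
by rewrite scalerDr scalerA -mpolyCM -addrA; apply: kspanS Xx (IH Xv).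
Qed.

(* [gdeg d x]: x belongs to the component of degree d. The axioms of a graded
   module form the separate predicate [graded]; they are imposed wherever a
   graded module is quantified over. *)
Record gmod := GMod { gsort :> lmodType A; gdeg : int -> gsort -> Prop }.

Record graded (M : gmod) : Prop := Graded {
  gdeg0 : forall d, gdeg d (0 : M);
  gdegD : forall d (x y : M), gdeg d x -> gdeg d y -> gdeg d (x + y);
  gdegZ : forall i d p (x : M), pdeg i p -> gdeg d x -> gdeg (i + d) (p *: x);
  gdeg_sum : forall x : M, exists (s : seq int) (c : int -> M),
    [/\ uniq s, forall d, gdeg d (c d) & x = \sum_(d <- s) c d];
  gdeg_direct : forall (s : seq int) (c : int -> M), uniq s ->
    (forall d, gdeg d (c d)) -> \sum_(d <- s) c d = 0 ->
    forall d, d \in s -> c d = 0 }.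

Record gmor (M N : gmod) := GMor {
  gfun :> {linear M -> N};
  gmorP : forall d x, gdeg d x -> gdeg d (gfun x) }.

Definition giso (M N : gmod) : Prop :=
  exists (f : gmor M N) (g : gmor N M), cancel f g /\ cancel g f.

Definition gtrivial (M : gmod) : Prop := forall x : M, x = 0.

(* dim_k M_d = r *)
Definition gdim (M : gmod) (d : int) (r : nat) : Prop :=
  exists e : 'I_r -> M, (forall i, gdeg d (e i)) /\
    forall x, gdeg d x ->
      exists! c : 'rV[k]_r, x = \sum_(i < r) (c 0 i)%:MP *: e i.

(* M(l)_d = M_(d+l) *)
Definition gshift (l : int) (M : gmod) : gmod :=
  GMod (fun d (x : M) => gdeg (d + l) x).

Definition gshift_mor l M N (f : gmor M N) : gmor (gshift l M) (gshift l N) :=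
  @GMor (gshift l M) (gshift l N) f (fun d x => @gmorP M N f (d + l) x).

Definition gzero : gmod := @GMod 'rV[A]_0 (fun _ _ => True).

Definition gsub (M : gmod) (S : submod M) : gmod :=
  @GMod (sub S) (fun d x => gdeg d (\val x)).

Definition gquot (M : gmod) (S : submod M) : gmod :=
  @GMod (quotm S) (fun d q => exists2 x, gdeg d x & q = qpi S x).

Definition gsum (M N : gmod) : gmod :=
  @GMod (M * N)%type (fun d x => gdeg d x.1 /\ gdeg d x.2).

Definition gprod (I : Type) (M : I -> gmod) : gmod :=
  @GMod (dprod (fun i => gsort (M i))) (fun d x => forall i, gdeg d (x i)).

Definition greg : gmod := @GMod A^o pdeg.

Definition gquot_ideal (X : A -> Prop) : gmod := gquot (@spanM A greg X).

Definition projective (P : gmod) : Prop :=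
  forall (M N : gmod) (g : gmor M N) (f : gmor P N), graded M -> graded N ->
    (forall y, exists x, g x = y) -> exists h : gmor P M, forall x, g (h x) = f x.

Record resolution (M : gmod) := Resolution {
  robj :> nat -> gmod;
  rdif : forall i, gmor (robj i.+1) (robj i);
  raug : gmor (robj 0) M;
  robj_graded : forall i, graded (robj i);
  robj_projective : forall i, projective (robj i);
  raug_surj : forall y, exists x, raug x = y;
  raug_exact : forall x, raug x = 0 <-> exists y, x = rdif 0 y;
  rdif_exact : forall i x, rdif i x = 0 <-> exists y, x = rdif i.+1 y }.

(* Cochain complexes concentrated in cohomological degrees >= 0. *)
Record cplx := Cplx {
  cobj :> nat -> gmod;
  cdif : forall j, gmor (cobj j) (cobj j.+1);
  cdif2 : forall j x, cdif j.+1 (cdif j x) = 0 }.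

Section Cohomology.
Variable C : cplx.

Lemma cocycle_lin j (a : A) (u v : C j) :
  cdif C j u = 0 -> cdif C j v = 0 -> cdif C j (a *: u + v) = 0.
Proof. by move=> u0 v0; rewrite linearP u0 v0 scaler0 addr0. Qed.

Definition cocycle j : submod (C j) := Submod (linear0 (cdif C j)) (@cocycle_lin j).

Definition is_coboundary j : C j -> Prop :=
  if j is i.+1 then fun x => exists y, x = cdif C i y else fun x => x = 0.

Lemma coboundary_zero j : @is_coboundary j (\val (0 : sub (cocycle j))).
Proof. by case: j => [|j] //=; exists 0; rewrite linear0. Qed.

Lemma coboundary_lin j a (u v : sub (cocycle j)) :
  is_coboundary (\val u) -> is_coboundary (\val v) ->
  is_coboundary (\val (a *: u + v)).
Proof.
rewrite linearP; case: j u v => [|j] u v /=.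
  by move=> -> ->; rewrite scaler0 add0r.
by move=> [x ->] [y ->]; exists (a *: x + y); rewrite linearP.
Qed.

Definition coboundary j : submod (gsub (cocycle j)) :=
  @Submod A (gsub (cocycle j)) (fun x => is_coboundary (\val x))
    (@coboundary_zero j) (@coboundary_lin j).

Definition coh (j : nat) : gmod := gquot (coboundary j).

End Cohomology.

End GradedModules.

Section FreeModule.
Variables (A : nzRingType) (K : choiceType) (W : lmodType A) (b : K -> W).

Lemma fgliftD : {morph fglift b : u v / u + v}.
Proof.
move=> u v; have H := lift_is_additive b.
have e0 : fglift b 0 = 0 by rewrite -(subrr (0 : {freeg K / A})) H subrr.
have eN w : fglift b (- w) = - fglift b w by rewrite -sub0r H e0 sub0r.
by rewrite -{1}[v]opprK H eN opprK.
Qed.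

Lemma fglift0 : fglift b 0 = 0.
Proof. by apply: (addrI (fglift b 0)); rewrite -fgliftD !addr0. Qed.

Lemma fgliftN u : fglift b (- u) = - fglift b u.
Proof. by apply: (addrI (fglift b u)); rewrite -fgliftD !subrr fglift0. Qed.

Lemma fglift_sum (I : Type) (r : seq I) (G : I -> {freeg K / A}) :
  fglift b (\sum_(i <- r) G i) = \sum_(i <- r) fglift b (G i).
Proof. exact: (big_morph _ fgliftD fglift0). Qed.

Lemma fglift_lin : linear (fglift b).
Proof.
move=> a u v; rewrite fgliftD; congr (_ + _).
rewrite -{2}[u]freeg_sumE fglift_sum scaler_sumr [a *: u]/(fgscale a u) fglift_sum.
by apply: eq_bigr => p _; rewrite !liftU scalerA.
Qed.

Lemma fgliftZ a u : fglift b (a *: u) = a *: fglift b u.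
Proof. by rewrite -[a *: u]addr0 fglift_lin fglift0 addr0. Qed.

End FreeModule.

Section CohomologyMaps.
Variables (k : fieldType) (n : nat).
Local Notation A := {mpoly k[n]}.
Local Notation gmod := (gmod k n).

Definition cocycle_map (C D : cplx k n) (j : nat) (f : gmor (C j) (D j))
    (fP : forall x, cdif C j x = 0 -> cdif D j (f x) = 0) :
    gsub (cocycle C j) -> gsub (cocycle D j) :=
  fun x => @Sub_ A (D j) (cocycle D j) (f (\val x))
    (introT (submod_predP (cocycle D j) _)
      (fP _ (elimT (submod_predP (cocycle C j) _) (valP x)))).

Record cmor (C D : cplx k n) := CMor {
  cmap :> forall j, gmor (C j) (D j);
  cmapP : forall j x, cmap j.+1 (cdif C j x) = cdif D j (cmap j x) }.

Variables (C D : cplx k n) (f : cmor C D) (j : nat).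

Lemma cmap_cocycle x : cdif C j x = 0 -> cdif D j (f j x) = 0.
Proof. by rewrite -cmapP => ->; rewrite linear0. Qed.

Lemma cmap_coboundary x : is_coboundary x -> is_coboundary (f j x).
Proof.
case: j x => [|i] x /=; first by move=> ->; rewrite linear0.
by move=> [y ->]; exists (f i y); rewrite cmapP.
Qed.

Definition coh_fun (q : coh C j) : coh D j :=
  qpi (coboundary D j) (cocycle_map cmap_cocycle (repr q)).

Lemma coh_funE z :
  coh_fun (qpi (coboundary C j) z) =
  qpi (coboundary D j) (cocycle_map cmap_cocycle z).
Proof.
apply/qpi_eq => /=.
have /qpi_eq /= : qpi (coboundary C j) (repr (qpi (coboundary C j) z)) =
  qpi (coboundary C j) z by rewrite qpiE.
by move=> /cmap_coboundary; rewrite linearB.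
Qed.

Lemma coh_fun_linear : linear coh_fun.
Proof.
move=> a x y; rewrite -[x]qpiE -[y]qpiE -linearP !coh_funE -linearP.
by congr (qpi _ _); apply: val_inj; rewrite /= !linearP.
Qed.
HB.instance Definition _ :=
  GRing.isLinear.Build A (coh C j) (coh D j) _ coh_fun coh_fun_linear.

Lemma coh_fun_deg d x : gdeg d x -> gdeg d (coh_fun x).
Proof.
move=> [z dz ->]; exists (cocycle_map cmap_cocycle z); last exact: coh_funE.
exact: gmorP.
Qed.

Definition coh_map : gmor (coh C j) (coh D j) := GMor coh_fun_deg.

End CohomologyMaps.

Section Hom.
Variables (k : fieldType) (n : nat).
Local Notation A := {mpoly k[n]}.
Local Notation gmod := (gmod k n).

(* A graded homomorphism P -> M(l). *)
Definition hom_deg (P M : gmod) (l : int) (f : P -> M) : Prop :=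
  linear f /\ forall d x, gdeg d x -> gdeg (d + l) (f x).

Definition homM (P M : gmod) : submod (P -> M) :=
  spanM (fun f => exists l, hom_deg l f).

(* The direct sum over l of the Hom(P, M(l)), realised inside the functions
   P -> M; for graded P and M these spaces already add up to an A-submodule,
   so taking the A-span adds nothing. *)
Definition ghom (P M : gmod) : gmod :=
  @GMod k n (sub (homM P M)) (fun l f => hom_deg l (\val f)).

Section PostComposition.
Variables (P M N : gmod) (g : gmor M N).

Lemma post_hom f : homM P M f -> homM P N (g \o f).
Proof.
elim=> [|a x v [l [xl xd]] _ IH].
  rewrite (_ : _ \o _ = 0); first exact: span0.
  by apply/funext => p /=; rewrite linear0.
set gx := g \o x; set gv := g \o v; rewrite (_ : _ \o _ = a *: gx + gv).
  apply: spanS IH; exists l; split=> [b u w|d u du].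
    by rewrite /gx /= xl linearP.
  exact/gmorP/xd.
by apply/funext => p; rewrite /= linearP.
Qed.

Definition post_fun (f : ghom P M) : ghom P N :=
  @Sub_ A _ (homM P N) (g \o \val f) (introT (submod_predP (homM P N) _)
    (post_hom (elimT (submod_predP (homM P M) _) (valP f)))).

Lemma post_fun_linear : linear post_fun.
Proof.
by move=> a x y; apply: val_inj; apply/funext => p; rewrite /= linearP.
Qed.
HB.instance Definition _ :=
  GRing.isLinear.Build A (ghom P M) (ghom P N) _ post_fun post_fun_linear.

Lemma post_fun_deg d f : gdeg d f -> gdeg d (post_fun f).
Proof.
move=> [fl fd]; split=> [a x y|e x ex] /=; first by rewrite fl linearP.
exact/gmorP/fd.
Qed.

Definition ghom_post : gmor (ghom P M) (ghom P N) := GMor post_fun_deg.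

End PostComposition.

Section PreComposition.
Variables (P Q M : gmod) (h : gmor P Q).

Lemma pre_hom f : homM Q M f -> homM P M (f \o h).
Proof.
elim=> [|a x v [l [xl xd]] _ IH]; first exact: span0.
apply: (@spanS _ _ _ a (x \o h) (v \o h)) IH; exists l.
split=> [b u w|d u du] /=; first by rewrite linearP xl.
exact/xd/gmorP.
Qed.

Definition pre_fun (f : ghom Q M) : ghom P M :=
  @Sub_ A _ (homM P M) (\val f \o h) (introT (submod_predP (homM P M) _)
    (pre_hom (elimT (submod_predP (homM Q M) _) (valP f)))).

Lemma pre_fun_linear : linear pre_fun.
Proof. by move=> a x y; apply: val_inj. Qed.
HB.instance Definition _ :=
  GRing.isLinear.Build A (ghom Q M) (ghom P M) _ pre_fun pre_fun_linear.

Lemma pre_fun_deg d f : gdeg d f -> gdeg d (pre_fun f).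
Proof.
move=> [fl fd]; split=> [a x y|e x ex] /=; first by rewrite linearP fl.
exact/fd/gmorP.
Qed.

Definition ghom_pre : gmor (ghom Q M) (ghom P M) := GMor pre_fun_deg.

End PreComposition.

Section Ext.
Variables (X : gmod) (P : resolution X).

Lemma homM_linear (Q M : gmod) (f : ghom Q M) : linear (\val f).
Proof.
have /submod_predP /= := valP f; move: (\val f) => g.
elim=> [|a x v [l [xl _]] _ IH] b u w; first by rewrite /= scaler0 addr0.
have E y : (a *: x + v) y = a *: x y + v y by [].
by rewrite !E xl IH !scalerDr !scalerA [b * a]mulrC addrACA.
Qed.

Lemma hom_cplx2 M j (f : ghom (P j) M) :
  ghom_pre M (rdif P j.+1) (ghom_pre M (rdif P j) f) = 0.
Proof.
apply: val_inj; apply/funext => p /=.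
have -> : rdif P j (rdif P j.+1 p) = 0 by apply/rdif_exact; exists p.
have := homM_linear f (-1) 0 0; rewrite scaler0 addr0 scaleN1r addNr.
exact.
Qed.

Definition hom_cplx (M : gmod) : cplx k n :=
  @Cplx k n (fun i => ghom (P i) M) (fun i => ghom_pre M (rdif P i))
    (@hom_cplx2 M).

Lemma hom_cplx_mapP M N (f : gmor M N) j (x : hom_cplx M j) :
  ghom_post (P j.+1) f (cdif (hom_cplx M) j x) =
  cdif (hom_cplx N) j (ghom_post (P j) f x).
Proof. by apply: val_inj. Qed.

Definition hom_cplx_map M N (f : gmor M N) : cmor (hom_cplx M) (hom_cplx N) :=
  @CMor k n (hom_cplx M) (hom_cplx N) (fun i => ghom_post (P i) f)
    (@hom_cplx_mapP M N f).

(* The direct sum over l of the Ext^i(X, M(l)), graded by l, with Ext taken in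
   graded A-modules and computed with the projective resolution P of X; A acts
   through M. *)
Definition gext (i : nat) (M : gmod) : gmod := coh (hom_cplx M) i.

Definition gext_map i M N (f : gmor M N) : gmor (gext i M) (gext i N) :=
  coh_map (hom_cplx_map f) i.

Lemma gext_map2 i (C : cplx k n) j (x : gext i (C j)) :
  gext_map i (cdif C j.+1) (gext_map i (cdif C j) x) = 0.
Proof.
rewrite -[x]qpiE /= !coh_funE -[RHS](linear0 (qpi _)).
congr (qpi _ _); apply: val_inj; apply: val_inj; apply/funext => p /=.
exact: cdif2.
Qed.

Definition gext_cplx (i : nat) (C : cplx k n) : cplx k n :=
  @Cplx k n (fun j => gext i (C j)) (fun j => gext_map i (cdif C j))
    (@gext_map2 i C).

End Ext.

End Hom.

Section Bimodules.
Variables (k : fieldType) (n : nat).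
Local Notation R := {mpoly k[n]}.
(* The enveloping algebra R \otimes_k R, in the variables x_i \otimes 1 (the
   first n) and 1 \otimes x_i (the last n). A graded R-bimodule is a graded
   Re-module. *)
Local Notation Re := {mpoly k[n + n]}.
Local Notation gbimod := (gmod k (n + n)).

(* r |-> r \otimes 1 *)
Definition lft : R -> Re := comp_mpoly [tuple 'X_(lshift n i) | i < n].
HB.instance Definition _ := GRing.RMorphism.on lft.
(* r |-> 1 \otimes r *)
Definition rgt : R -> Re := comp_mpoly [tuple 'X_(rshift n i) | i < n].
HB.instance Definition _ := GRing.RMorphism.on rgt.
(* r \otimes r' |-> r r' *)
Definition mult : Re -> R := comp_mpoly
  [tuple 'X_(match fintype.split i with inl j => j | inr j => j end) | i < n + n].
HB.instance Definition _ := GRing.RMorphism.on mult.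

Lemma mult_lft r : mult (lft r) = r.
Proof.
rewrite [RHS]mpolyE /lft comp_mpolyEX rmorph_sum; apply: eq_bigr => m _.
rewrite [LHS]comp_mpolyZ comp_mpolyX rmorph_prod [in RHS]mpolyXE_id.
congr (_ *: _); apply: eq_bigr => i _; rewrite rmorphXn /= !tnth_mktuple.
by rewrite comp_mpolyXU -tnth_nth tnth_mktuple (unsplitK (inl i)).
Qed.

Lemma mult_rgt r : mult (rgt r) = r.
Proof.
rewrite [RHS]mpolyE /rgt comp_mpolyEX rmorph_sum; apply: eq_bigr => m _.
rewrite [LHS]comp_mpolyZ comp_mpolyX rmorph_prod [in RHS]mpolyXE_id.
congr (_ *: _); apply: eq_bigr => i _; rewrite rmorphXn /= !tnth_mktuple.
by rewrite comp_mpolyXU -tnth_nth tnth_mktuple (unsplitK (inr i)).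
Qed.

(* R as a bimodule over itself. *)
Definition gdiag : gbimod := @GMod k (n + n) (restr mult R^o) (@pdeg k n).

(* The right R-module underlying a bimodule. *)
Definition gright (M : gbimod) : gmod k n :=
  @GMod k n (restr rgt M) (@gdeg _ _ M).

Section Tensor.
Variables (S : R -> Prop) (M N : gbimod).

(* The tensor product of M and N over the subring S of R, for the right action
   on M and the left action on N: the Re-module generated by the symbols
   x \otimes y subject to biadditivity, to the compatibility with the outer
   actions (r x) \otimes y = r (x \otimes y), x \otimes (y r) = (x \otimes y) r,
   and to S-balancedness. *)
Local Notation F := {freeg (M * N) / Re}.
Inductive tens_rel : F -> Prop :=
| tens_addl x x' y : tens_rel (<< (x + x', y) >> - << (x, y) >> - << (x', y) >>)
| tens_addr x y y' : tens_rel (<< (x, y + y') >> - << (x, y) >> - << (x, y') >>)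
| tens_actl r x y : tens_rel (<< (lft r *: x, y) >> - lft r *: << (x, y) >>)
| tens_actr r x y : tens_rel (<< (x, rgt r *: y) >> - rgt r *: << (x, y) >>)
| tens_bal h x y of S h :
    tens_rel (<< (rgt h *: x, y) >> - << (x, lft h *: y) >>).

Definition tens_type : lmodType Re := quotm (spanM tens_rel).

Definition tens (x : M) (y : N) : tens_type := qpi (spanM tens_rel) << (x, y) >>.

Definition gtens : gbimod := @GMod k (n + n) tens_type
  (fun d => kspan (fun t => exists i j x y,
     [/\ gdeg i x, gdeg j y, i + j = d & t = tens x y])).

End Tensor.
End Bimodules.

Section TensorMaps.
Variables (k : fieldType) (n : nat).
Local Notation R := {mpoly k[n]}.
Local Notation Re := {mpoly k[n + n]}.
Local Notation gbimod := (gmod k (n + n)).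

Section Lift.
Variables (S : R -> Prop) (M N : gbimod) (W : lmodType Re) (b : M -> N -> W).

Record balanced : Prop := Balanced {
  balDl : forall x x' y, b (x + x') y = b x y + b x' y;
  balDr : forall x y y', b x (y + y') = b x y + b x y';
  balZl : forall r x y, b (lft r *: x) y = lft r *: b x y;
  balZr : forall r x y, b x (rgt r *: y) = rgt r *: b x y;
  balS : forall h x y, S h -> b (rgt h *: x) y = b x (lft h *: y) }.

Let bb (p : (M * N)%type) : W := b p.1 p.2.

Lemma tens_lift_rel (bP : balanced) u :
  spanM (@tens_rel k n S M N) u -> fglift bb u = 0.
Proof.
have fg1 p : fglift bb << p >> = bb p by rewrite liftU scale1r.
elim=> [|a x v rx _ IH]; first exact: fglift0.
rewrite fglift_lin IH addr0 (_ : fglift bb x = 0) ?scaler0 //.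
case: rx => [x1 x2 y|x1 y1 y2|r x1 y|r x1 y|h x1 y Sh];
  rewrite ?(fgliftD, fgliftN, fgliftZ, fg1) /bb /=.
- by rewrite (balDl bP) -addrA addrACA !subrr addr0.
- by rewrite (balDr bP) -addrA addrACA !subrr addr0.
- by rewrite (balZl bP) subrr.
- by rewrite (balZr bP) subrr.
- by rewrite (balS bP) // subrr.
Qed.

Definition tens_lift (bP : balanced) : gtens S M N -> W := fun q => fglift bb (repr q).

Lemma tens_lift_qpi (bP : balanced) u : tens_lift bP (qpi _ u) = fglift bb u.
Proof.
apply/eqP; rewrite -subr_eq0 -fgliftN -fgliftD; apply/eqP/(tens_lift_rel bP).
by apply/qpi_eq; rewrite qpiE.
Qed.

Lemma tens_liftE (bP : balanced) x y : tens_lift bP (tens S x y) = b x y.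
Proof. by rewrite tens_lift_qpi liftU scale1r. Qed.

Lemma tens_lift_linear (bP : balanced) : linear (tens_lift bP).
Proof.
by move=> a u v; rewrite -[u]qpiE -[v]qpiE -linearP !tens_lift_qpi fglift_lin.
Qed.
HB.instance Definition _ (bP : balanced) :=
  GRing.isLinear.Build Re (gtens S M N) W _ (tens_lift bP) (tens_lift_linear bP).

End Lift.

Section Pure.
Variables (S : R -> Prop) (M N : gbimod).
Local Notation t := (@tens k n S M N).

Lemma tens_balanced : balanced S t.
Proof.
have E u v : tens_rel S (u - v) ->
    qpi (spanM (@tens_rel k n S M N)) u = qpi (spanM (@tens_rel k n S M N)) v.
  by move=> ruv; apply/qpi_eq/span_gen.
split=> [x x' y|x y y'|r x y|r x y|h x y Sh]; rewrite /tens -?linearD -?linearZ;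
  apply: E; rewrite ?opprD ?addrA.
- exact: tens_addl.
- exact: tens_addr.
- exact: tens_actl.
- exact: tens_actr.
- exact: tens_bal.
Qed.

Lemma tens_ext (W : lmodType Re) (f g : {linear gtens S M N -> W}) :
  (forall x y, f (t x y) = g (t x y)) -> f =1 g.
Proof.
move=> fg q; rewrite -[q]qpiE -[repr q]freeg_sumE !linear_sum.
apply: eq_bigr => -[x y] _; set c := coeff _ _.
have -> : << c *g (x, y) >> = c *: << (x, y) >> :> {freeg (M * N) / Re}.
  by apply/eqP/freeg_eqP => z; rewrite coeffZ !coeffU mul1r.
by rewrite !linearZ; congr (_ *: _); apply: fg.
Qed.

End Pure.

Section Map.
Variables (S : R -> Prop) (M N M' N' : gbimod) (f : gmor M M') (g : gmor N N').

Lemma tens_map_balanced : balanced S (fun x y => tens S (f x) (g y)).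
Proof.
have tP := tens_balanced S M' N'.
split=> [x x' y|x y y'|r x y|r x y|h x y Sh].
- by rewrite linearD (balDl tP).
- by rewrite linearD (balDr tP).
- by rewrite linearZ (balZl tP).
- by rewrite linearZ (balZr tP).
- by rewrite !linearZ (balS tP).
Qed.

Definition tens_map_fun : {linear gtens S M N -> gtens S M' N'} :=
  tens_lift tens_map_balanced.

Lemma tens_map_funE x y : tens_map_fun (tens S x y) = tens S (f x) (g y).
Proof. exact: tens_liftE. Qed.

Lemma tens_map_deg d q : gdeg d q -> gdeg d (tens_map_fun q).
Proof.
elim=> [|c x v [i [j [m [l [mi lj ij ->]]]]] _ IH]; first by rewrite linear0; left.
rewrite linearP tens_map_funE; right=> //.
by exists i, j, (f m), (g l); split=> //; apply: gmorP.
Qed.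

Definition tens_map : gmor (gtens S M N) (gtens S M' N') := GMor tens_map_deg.

Lemma tens_mapE x y : tens_map (tens S x y) = tens S (f x) (g y).
Proof. exact: tens_map_funE. Qed.

End Map.
End TensorMaps.

Section TensorComplex.
Variables (k : fieldType) (n : nat).
Local Notation R := {mpoly k[n]}.
Local Notation Re := {mpoly k[n + n]}.
Local Notation gbimod := (gmod k (n + n)).

Definition gtensR (M N : gbimod) : gbimod := gtens (fun _ : R => True) M N.

Definition gid (M : gbimod) : gmor M M := @GMor k (n + n) M M idfun (fun _ _ => id).

Lemma gmorZ (M N : gbimod) (f : gmor M N) a x : f (a *: x) = a *: f x.
Proof. exact: linearZ. Qed.

Variables C D : cplx k (n + n).

Record tens_idx (j : nat) := Idx { idxl : nat; idxr : nat; _ : (idxl + idxr == j)%N }.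

(* The sum of the C^a \otimes_R D^b over a + b = j. *)
Definition tens_obj (j : nat) : gbimod :=
  gprod (fun p : tens_idx j => gtensR (C (idxl p)) (D (idxr p))).

Lemma idx_predr j a b : (a + b.+1 == j.+1)%N -> (a + b == j)%N.
Proof. by rewrite addnS. Qed.

(* The components of d(x \otimes y) = dx \otimes y + (-1)^a x \otimes dy,
   for x in C^a. *)
Definition tens_difl j (w : tens_obj j) (a b : nat) :
    (a + b == j.+1)%N -> gtensR (C a) (D b) :=
  match a with
  | 0 => fun _ => 0
  | a'.+1 => fun e => tens_map _ (cdif C a') (gid (D b)) (w (@Idx j a' b e))
  end.

Definition tens_difr j (w : tens_obj j) (a b : nat) :
    (a + b == j.+1)%N -> gtensR (C a) (D b) :=
  match b with
  | 0 => fun _ => 0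
  | b'.+1 => fun e => (-1) ^+ a *:
      tens_map _ (gid (C a)) (cdif D b') (w (@Idx j a b' (idx_predr e)))
  end.

Lemma tens_difl_lin j c (u v : tens_obj j) a b (e : (a + b == j.+1)%N) :
  tens_difl (c *: u + v) e = c *: tens_difl u e + tens_difl v e.
Proof.
case: a e => [|a] e; first by rewrite /= scaler0 addr0.
exact: (linearP (tens_map _ (cdif C a) (gid (D b))) c (u (Idx _)) (v (Idx _))).
Qed.

Lemma tens_difr_lin j c (u v : tens_obj j) a b (e : (a + b == j.+1)%N) :
  tens_difr (c *: u + v) e = c *: tens_difr u e + tens_difr v e.
Proof.
case: b e => [|b] e; first by rewrite /= scaler0 addr0.
rewrite [RHS]/= scalerA mulrC -scalerA -scalerDr; congr (_ *: _).
exact: (linearP (tens_map _ (gid (C a)) (cdif D b)) c (u (Idx _)) (v (Idx _))).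
Qed.

Definition tens_dif_fun j (w : tens_obj j) : tens_obj j.+1 := fun p =>
  let: Idx a b e := p in tens_difl w e + tens_difr w e.

Lemma tens_dif_linear j : linear (@tens_dif_fun j).
Proof.
move=> c u v; apply: functional_extensionality_dep => -[a b e].
rewrite [LHS]/tens_dif_fun tens_difl_lin tens_difr_lin addrACA -scalerDr.
by [].
Qed.
HB.instance Definition _ j :=
  GRing.isLinear.Build Re (tens_obj j) (tens_obj j.+1) _ (@tens_dif_fun j)
    (@tens_dif_linear j).

Lemma tens_dif_deg j d w : gdeg d w -> gdeg d (@tens_dif_fun j w).
Proof.
move=> dw [a b e].
have dl : gdeg d (tens_difl w e).
  case: a e => [|a] e; first exact: kspan0.
  exact: (gmorP (tens_map _ (cdif C a) (gid (D b))) (dw (Idx _))).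
have dr : gdeg d (tens_difr w e).
  case: b e {dl} => [|b] e; first exact: kspan0.
  rewrite /tens_difr -[X in gdeg _ X]addr0.
  have -> : (-1) ^+ a = ((-1) ^+ a)%:MP :> Re.
    by rewrite rmorphXn /= mpolyCN mpolyC1.
  apply: kspan_lin; last exact: kspan0.
  exact: (gmorP (tens_map _ (gid (C a)) (cdif D b)) (dw (Idx _))).
have := kspan_lin 1 dl dr; rewrite mpolyC1 scale1r.
exact.
Qed.

Definition tens_dif j : gmor (tens_obj j) (tens_obj j.+1) := GMor (@tens_dif_deg j).

Lemma tens_map_l0 S (M M' M'' N : gbimod) (f : gmor M M') (g : gmor M' M'') q :
  (forall x, g (f x) = 0) ->
  tens_map S g (gid N) (tens_map S f (gid N) q) = 0.
Proof.
move=> gf.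
apply: (@tens_ext _ _ _ _ _ _ (tens_map S g (gid N) \o tens_map S f (gid N)) \0).
move=> x y; apply: (etrans (congr1 (tens_map S g (gid N)) (tens_mapE S f _ x y))).
apply: (etrans (tens_mapE _ _ _ _ _)); rewrite gf.
by have := balZl (tens_balanced S M'' N) 0 0 y; rewrite rmorph0 !scale0r.
Qed.

Lemma tens_map_r0 S (M N N' N'' : gbimod) (f : gmor N N') (g : gmor N' N'') q :
  (forall x, g (f x) = 0) ->
  tens_map S (gid M) g (tens_map S (gid M) f q) = 0.
Proof.
move=> gf.
apply: (@tens_ext _ _ _ _ _ _ (tens_map S (gid M) g \o tens_map S (gid M) f) \0).
move=> x y; apply: (etrans (congr1 (tens_map S (gid M) g) (tens_mapE S _ f x y))).
apply: (etrans (tens_mapE _ _ _ _ _)); rewrite gf.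
by have := balZr (tens_balanced S M N'') 0 x 0; rewrite rmorph0 !scale0r.
Qed.

Lemma tens_mapC S (M M' N N' : gbimod) (f : gmor M M') (g : gmor N N') q :
  tens_map S f (gid N') (tens_map S (gid M) g q) =
  tens_map S (gid M') g (tens_map S f (gid N) q).
Proof.
apply: (@tens_ext _ _ _ _ _ _ (tens_map S f (gid N') \o tens_map S (gid M) g)
  (tens_map S (gid M') g \o tens_map S f (gid N))) => x y.
apply: (etrans (congr1 (tens_map S f (gid N')) (tens_mapE S _ g x y))).
apply: (etrans (tens_mapE _ _ _ _ _)); apply: esym.
apply: (etrans (congr1 (tens_map S (gid M') g) (tens_mapE S f _ x y))).
exact: tens_mapE.
Qed.

Lemma tens_dif2 j w : tens_dif j.+1 (tens_dif j w) = 0.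
Proof.
apply: functional_extensionality_dep => -[a b e].
rewrite -[LHS]/(tens_difl (tens_dif j w) e + tens_difr (tens_dif j w) e).
rewrite -[RHS]/(0 : gtensR (C a) (D b)).
pose T := fun _ : R => True.
have El a' (e' : (a'.+1 + b == j.+2)%N) : tens_difl (tens_dif j w) e' =
    tens_map T (cdif C a') (gid (D b)) (tens_difl w (e' : (a' + b == j.+1)%N)) +
    tens_map T (cdif C a') (gid (D b)) (tens_difr w (e' : (a' + b == j.+1)%N)).
  exact: (linearD (tens_map _ _ _)).
have Er b' (e' : (a + b'.+1 == j.+2)%N) : tens_difr (tens_dif j w) e' =
    (-1) ^+ a *:
    (tens_map T (gid (C a)) (cdif D b') (tens_difl w (idx_predr e')) +
     tens_map T (gid (C a)) (cdif D b') (tens_difr w (idx_predr e'))).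
  by congr (_ *: _); exact: (linearD (tens_map _ _ _)).
have Ell a' (e' : (a'.+1 + b == j.+2)%N) :
    tens_map T (cdif C a') (gid (D b)) (tens_difl w (e' : (a' + b == j.+1)%N)) = 0.
  case: a' e' {El} => [|a'] e'; first exact: (linear0 (tens_map _ _ _)).
  by apply: tens_map_l0 => x; apply: cdif2.
have Err b' (e' : (a + b'.+1 == j.+2)%N) :
    tens_map T (gid (C a)) (cdif D b') (tens_difr w (idx_predr e')) = 0.
  case: b' e' {Er} => [|b'] e'; first exact: (linear0 (tens_map _ _ _)).
  rewrite [tens_difr _ _]/=; apply: (etrans (gmorZ (tens_map _ _ _) _ _)).
  rewrite (_ : tens_map _ _ _ _ = 0) ?scaler0 //.
  by apply: tens_map_r0 => x; apply: cdif2.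
case: a e El Er Ell Err => [|a] e El Er Ell Err.
  case: b e El Er Ell Err => [|b] e El Er Ell Err; first by rewrite /= addr0.
  by rewrite Er Err addr0 /= linear0 scaler0 addr0.
rewrite El Ell add0r.
case: b e El Er Ell Err => [|b] e El Er Ell Err.
  by rewrite /= linear0 addr0.
rewrite Er Err addr0 exprS mulN1r scaleNr.
apply/eqP; rewrite subr_eq0; apply/eqP.
rewrite [tens_difr w _]/=; apply: (etrans (gmorZ (tens_map _ _ _) _ _)).
congr (_ *: _); rewrite [tens_difl w _]/=.
apply: (etrans (tens_mapC (cdif C a) (cdif D b) _)).
apply: (congr1 (fun q => tens_map T (gid _) (cdif D b)
  (tens_map T (cdif C a) (gid _) (w (Idx q))))).
exact: bool_irrelevance.
Qed.

Definition tens_cplx : cplx k (n + n) := Cplx tens_dif2.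

End TensorComplex.

Section Multiplication.
Variables (k : fieldType) (n : nat).
Local Notation R := {mpoly k[n]}.
Local Notation Re := {mpoly k[n + n]}.
Local Notation gdiag := (gdiag k n).
Variable S : R -> Prop.

Lemma pdeg_lin d (c : k) (p q : R) :
  pdeg d p -> pdeg d q -> pdeg d (c *: p + q).
Proof.
move=> dp dq m /msuppD_le; rewrite mem_cat => /orP[/msuppZ_le|].
  exact: dp.
exact: dq.
Qed.

Lemma pdegM d e (p q : R) : pdeg d p -> pdeg e q -> pdeg (d + e) (p * q).
Proof.
move=> dp eq m /msuppM_le /allpairsP[[u v] /= [/dp <- /eq <- ->]].
by rewrite mdegD mulnDr PoszD.
Qed.

Lemma mul_balanced : balanced S (fun x y : gdiag => (x : R) * (y : R) : gdiag).
Proof.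
split=> [x x' y|x y y'|r x y|r x y|h x y Sh]; rewrite /GRing.scale /= /restr_scale.
- exact: mulrDl.
- exact: mulrDr.
- by rewrite /GRing.scale /= mulrA.
- by rewrite /GRing.scale /= mulrCA.
- by rewrite /GRing.scale /= mult_lft mult_rgt mulrCA mulrA.
Qed.

Definition mul_fun : {linear gtens S gdiag gdiag -> gdiag} := tens_lift mul_balanced.

Lemma mul_funE x y : mul_fun (tens S x y) = (x : R) * (y : R).
Proof. exact: tens_liftE. Qed.

Lemma mul_deg d q : gdeg d q -> gdeg d (mul_fun q).
Proof.
elim=> [|c x v [i [j [f [g [fi gj ij ->]]]]] _ IH].
  by rewrite linear0 => m; rewrite msupp0.
rewrite linearP mul_funE -ij.
have -> : c%:MP *: ((f : R) * (g : R) : gdiag) = c *: ((f : R) * (g : R)).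
  rewrite [LHS]/(mult _ * (f * g)) /mult comp_mpolyC; exact: mul_mpolyC.
by apply: pdeg_lin; [apply: pdegM | rewrite ij].
Qed.

Definition mul_mor : gmor (gtens S gdiag gdiag) gdiag := GMor mul_deg.

End Multiplication.

Section Rouquier.
Variable k : fieldType.
(* alpha_s and alpha_t are the variables of index 0 and 1. *)
Local Notation R := {mpoly k[2]}.
Local Notation gbimod := (gmod k (2 + 2)).

(* s_i(alpha_i) = - alpha_i, s_i(alpha_j) = alpha_i + alpha_j *)
Definition refl (i : 'I_2) (p : R) : R :=
  p \mPo [tuple if j == i then - 'X_i else 'X_i + 'X_j | j < 2].

Definition invariant (i : 'I_2) (p : R) : Prop := refl i p = p.

(* B_i = R \otimes_{R^i} R(1) *)
Definition Bs (i : 'I_2) : gbimod :=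
  gshift 1 (gtens (invariant i) (gdiag k 2) (gdiag k 2)).

Definition gto0 (M : gbimod) : gmor M (gzero k (2 + 2)) :=
  @GMor k (2 + 2) M (gzero k (2 + 2)) \0 (fun _ _ _ => I).

Definition F_obj (i : 'I_2) (j : nat) : gbimod :=
  match j with
  | 0 => Bs i
  | 1 => gshift 1 (gdiag k 2)
  | _ => gzero k (2 + 2)
  end.

Definition F_dif (i : 'I_2) (j : nat) : gmor (F_obj i j) (F_obj i j.+1) :=
  match j with
  | 0 => gshift_mor 1 (mul_mor (invariant i))
  | j'.+1 => gto0 (F_obj i j'.+1)
  end.

Lemma F_dif2 i j x : F_dif i j.+1 (F_dif i j x) = 0.
Proof. by []. Qed.

Definition F (i : 'I_2) : cplx k (2 + 2) := Cplx (@F_dif2 i).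

Definition unit_obj (j : nat) : gbimod :=
  if j is 0 then gdiag k 2 else gzero k (2 + 2).

Definition unit_cplx : cplx k (2 + 2) :=
  @Cplx k (2 + 2) unit_obj (fun j => gto0 (unit_obj j)) (fun _ _ => erefl).

(* The braid word is read as the product of its letters, the letter i of 'I_2
   being the generator sigma_(i+1). *)
Definition rouquier (w : seq 'I_2) : cplx k (2 + 2) :=
  if w is i :: w' then foldl (fun C j => tens_cplx C (F j)) (F i) w'
  else unit_cplx.

(* The cohomology in degree T = t of the complex HH^a(F(w)), HH^a being
   [gext P a] for a projective resolution P of R by graded bimodules. *)
Definition HHH (P : resolution (gdiag k 2)) (w : seq 'I_2) (a t : nat) : gmod k 2 :=
  gright (coh (gext_cplx P a (rouquier w)) t).

End Rouquier.

(* The coefficient of Q^d in the Laurent expansion of Q^c / (1 - Q^2)^n at Q = 0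
   (see [qfrac0] and [qfracS]). *)
Definition qfrac (c : int) (n : nat) (d : int) : nat :=
  if (d - c)%R is Posz e then if odd e then 0%N else 'C((n + e./2).-1, e./2) else 0%N.

Lemma qfrac0 c d : qfrac c 0 d = (d == c).
Proof.
rewrite /qfrac -subr_eq0; case: (d - c) => [[|[|e]]|e] //=.
by rewrite negbK; case: odd => //; rewrite bin_small.
Qed.

Lemma qfracS c n d : qfrac c n.+1 d = (qfrac c n d + qfrac c n.+1 (d - 2))%N.
Proof.
rewrite /qfrac addrAC; case: (d - c) => [[|[|e]]|e] //=.
  by rewrite !addn0 !bin0.
rewrite negbK add0n !subSS subn0; case: odd => //.
by rewrite !addnS /= binS addnC.
Qed.

(* The coefficient of A^a T^t Q^d in A^a0 T^t0 Q^c / (1 - Q^2)^n. *)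
Definition term (a0 t0 : nat) (c : int) (n a t : nat) (d : int) : nat :=
  if (a == a0) && (t == t0) then qfrac c n d else 0%N.

Definition poincare (a t : nat) (d : int) : nat :=
  (term 0 0 4 2 a t d + 2 * term 0 2 0 1 a t d + term 0 4 (- 4) 0 a t d
   + 2 * term 1 0 0 2 a t d + 2 * term 1 2 (- 4) 1 a t d
   + term 2 0 (- 4) 2 a t d)%N.

Section Resolutions.
Variables (k : fieldType) (n : nat).
Local Notation A := {mpoly k[n]}.
Local Notation gmod := (gmod k n).

Lemma pdegP d (p : A) :
  pdeg d p <-> (forall m, (2 * mdeg m)%N != d :> int -> p@_m = 0).
Proof.
split=> [dp m|dp m]; first by apply: contraNeq; rewrite -mcoeff_msupp => /dp ->.
by apply: contraTeq => /dp; rewrite mcoeff_msupp negbK => ->.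
Qed.

Lemma pdeg0 d : pdeg d (0 : A).
Proof. by move=> m; rewrite msupp0. Qed.

Lemma pdegD d (p q : A) : pdeg d p -> pdeg d q -> pdeg d (p + q).
Proof. by move=> dp; rewrite -[p]scale1r; apply: pdeg_lin. Qed.

Lemma pdegC c : pdeg 0 (c%:MP : A).
Proof.
apply/pdegP => m ne; rewrite mcoeffC (_ : (m == 0%MM) = false) ?mulr0 //.
by apply: contraNF ne => /eqP ->; rewrite mdeg0.
Qed.

Definition pcomp (d : int) (p : A) : A :=
  \sum_(m <- msupp p | (2 * mdeg m)%N == d :> int) p@_m *: 'X_[m].

Lemma pcompE d p m : (pcomp d p)@_m = if (2 * mdeg m)%N == d :> int then p@_m else 0.
Proof.
rewrite /pcomp raddf_sum /=; under eq_bigr do rewrite mcoeffZ mcoeffX.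
have [ms|ms] := boolP (m \in msupp p); last first.
  rewrite memN_msupp_eq0 // if_same big_seq_cond big1 // => m' /andP[ms' _].
  by case: eqP => [E|_]; [rewrite -E ms' in ms | rewrite mulr0].
rewrite big_mkcond (bigD1_seq m) //= eqxx mulr1 big1 ?addr0 // => m' ne.
by case: ifP => // _; rewrite (negPf ne) mulr0.
Qed.

Lemma pdeg_pcomp d p : pdeg d (pcomp d p).
Proof. by apply/pdegP => m /negPf; rewrite pcompE => ->. Qed.

Definition pdegs (p : A) : seq int := [seq Posz (2 * mdeg m) | m <- msupp p].

Lemma pcomp_sum (s : seq int) p : uniq s -> {subset pdegs p <= s} ->
  p = \sum_(d <- s) pcomp d p.
Proof.
move=> us sub; apply/mpolyP => m; rewrite raddf_sum /=.
under eq_bigr do rewrite pcompE.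
have [ms|/memN_msupp_eq0 ->] := boolP (m \in msupp p); last first.
  by rewrite big1 // => d _; case: ifP.
have ds : Posz (2 * mdeg m) \in s by apply/sub/map_f.
rewrite (bigD1_seq _ ds us) /= eqxx big1 ?addr0 // => d /negPf.
by rewrite eq_sym => ->.
Qed.

Lemma gdeg_sums (M : gmod) (I : Type) (s : seq I) (c : I -> M) d :
  graded M -> (forall i, gdeg d (c i)) -> gdeg d (\sum_(i <- s) c i).
Proof.
move=> gM dc; elim/big_ind: _ => //; first exact: gdeg0.
by move=> *; apply: gdegD.
Qed.

Section Free.
Variables (I : choiceType) (deg : I -> int).

(* The free graded module on generators i of degree deg i. *)
Definition gfree : gmod := @GMod k n {freeg I / A}
  (fun d f => forall i, pdeg (d - deg i) (coeff i f)).

Lemma gfree_graded : graded gfree.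
Proof.
split=> [d i|d x y dx dy i|e d p x ep dx i|x|s c us dc sc0 d ds] /=.
- by rewrite coeff0; apply: pdeg0.
- by rewrite coeffD; apply: pdegD.
- by rewrite coeffZ -addrA; apply: pdegM.
- pose s := undup (flatten [seq [seq e + deg i | e <- pdegs (coeff i x)] | i <- dom x]).
  pose c d : gfree := \sum_(i <- dom x) << pcomp (d - deg i) (coeff i x) *g i >>.
  exists s, c; split=> [|d i|]; first exact: undup_uniq.
    rewrite raddf_sum; elim/big_ind: _ => [|p q|j _]; [exact: pdeg0|exact: pdegD|].
    rewrite /= coeffU; case: eqP => [->|_]; last by rewrite mulr0; apply: pdeg0.
    by rewrite mulr1; apply: pdeg_pcomp.
  rewrite exchange_big /= -[LHS]freeg_sumE big_seq [RHS]big_seq.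
  apply: eq_bigr => i ix.
  apply/eqP/freeg_eqP => j; rewrite raddf_sum /= coeffU.
  under eq_bigr do rewrite coeffU.
  rewrite -mulr_suml; congr (_ * _).
  rewrite [LHS](@pcomp_sum [seq d - deg i | d <- s]) ?big_map //.
    by rewrite map_inj_uniq ?undup_uniq // => u v /addIr.
  move=> e ep; apply/mapP; exists (e + deg i); last by rewrite addrK.
  rewrite mem_undup; apply/flattenP; eexists; first by apply: map_f; exact: ix.
  exact: map_f.
apply/eqP/freeg_eqP => i; rewrite coeff0; apply/mpolyP => m; rewrite mcoeff0.
have [E|ne] := eqVneq (Posz (2 * mdeg m)) (d - deg i); last first.
  exact: (iffLR (pdegP _ _) (dc d i)).
have := congr1 (fun f => (coeff i f)@_m) sc0; rewrite coeff0 mcoeff0 !raddf_sum /=.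
rewrite (bigD1_seq _ ds us) /= big1 ?addr0 // => e ne.
apply: (iffLR (pdegP _ _) (dc e i)); rewrite E; apply: contraNneq ne => /addIr ->.
by [].
Qed.

End Free.

Lemma gcompE (N : gmod) (s : seq int) (c : int -> N) y d :
  graded N -> uniq s -> (forall e, gdeg e (c e)) -> gdeg d y ->
  y = \sum_(e <- s) c e -> y = if d \in s then c d else 0.
Proof.
move=> gN us dc dy yE.
pose c' e := if e == d then (if d \in s then c d else 0) - y else c e.
pose s' := if d \in s then s else d :: s.
have us' : uniq s' by rewrite /s'; case: ifP => //= ->.
have ds' : d \in s' by rewrite /s'; case: ifP => //; rewrite mem_head.
have gdegN e (x : N) : gdeg e x -> gdeg e (- x).
  move=> ex; rewrite -scaleN1r -[e]add0r; apply: gdegZ => //.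
  by rewrite -mpolyC1 -mpolyCN; apply: pdegC.
have dc' e : gdeg e (c' e).
  rewrite /c'; case: eqP => [->|_] //; apply: gdegD => //; last exact: gdegN.
  by case: ifP => // _; apply: gdeg0.
suff s0 : \sum_(e <- s') c' e = 0.
  have := gdeg_direct gN us' dc' s0 ds'; rewrite /c' eqxx => /eqP.
  by rewrite subr_eq0 => /eqP ->.
rewrite (bigD1_seq _ ds' us') /= {1}/c' eqxx.
rewrite (eq_bigr c) => [|e /negPf ne]; last by rewrite /c' ne.
rewrite /s' {s' us' ds'}; case: ifP => [ds|nds].
  by rewrite addrAC -(bigD1_seq _ ds us) /= -yE subrr.
rewrite big_cons eqxx /= sub0r [X in _ + X](_ : _ = y) ?addNr // yE.
rewrite big_seq_cond [RHS]big_seq; apply: eq_bigl => e.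
by case es: (e \in s) => //=; apply: contraFneq nds => <-.
Qed.

Lemma gdeg_lift (M N : gmod) (g : gmor M N) d y : graded M -> graded N ->
  (forall y, exists x, g x = y) -> gdeg d y -> exists x, gdeg d x /\ g x = y.
Proof.
move=> gM gN g_surj dy; have [x gx] := g_surj y.
have [s [c [us dc xE]]] := gdeg_sum gM x.
have := @gcompE N s (g \o c) y d gN us (fun e => gmorP g (dc e)) dy.
rewrite -gx xE linear_sum => /(_ erefl) ->.
by case: ifP => _; [exists (c d) | exists 0; rewrite linear0; split=> //; apply: gdeg0].
Qed.

Section Cover.
Variables (I : choiceType) (deg : I -> int).
Local Notation gfree := (gfree deg).

Section Ext.
Variables (M : gmod) (b : I -> M).
Hypotheses (gM : graded M) (db : forall i, gdeg (deg i) (b i)).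

Definition free_ext_fun : gfree -> M := fglift b.
HB.instance Definition _ :=
  GRing.isLinear.Build A gfree M _ free_ext_fun (fglift_lin b).

Lemma free_extU i : free_ext_fun << i >> = b i.
Proof. by rewrite [LHS]liftU scale1r. Qed.

Lemma free_extE f : free_ext_fun f = \sum_(i <- dom f) coeff i f *: b i.
Proof.
rewrite -{1}[f]freeg_sumE [LHS]linear_sum; apply: eq_bigr => i _; exact: liftU.
Qed.

Lemma free_ext_deg d f : gdeg d f -> gdeg d (free_ext_fun f).
Proof.
move=> df; rewrite free_extE; apply: gdeg_sums => // i.
rewrite -[d](subrK (deg i)); apply: gdegZ => //; exact: df.
Qed.

Definition free_ext : gmor gfree M := GMor free_ext_deg.
End Ext.

Lemma gfree_gen i : gdeg (deg i) (<< i >> : gfree).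
Proof.
move=> j; rewrite coeffU mul1r; case: eqP => [->|_]; last exact: pdeg0.
by rewrite subrr -mpolyC1; apply: pdegC.
Qed.

Lemma gfree_projective : projective gfree.
Proof.
move=> M N g f gM gN g_surj.
have /choice [b bP] i : exists x, gdeg (deg i) x /\ g x = f << i >>.
  by apply: gdeg_lift => //; apply: gmorP; apply: gfree_gen.
exists (free_ext gM (fun i => (bP i).1)) => x.
apply: (etrans (congr1 g (free_extE b x))).
rewrite linear_sum -[in RHS](freeg_sumE x) linear_sum.
apply: eq_bigr => i _; rewrite linearZ (bP i).2.
have -> : << coeff i x *g i >> = coeff i x *: << i >> :> {freeg I / A}.
  by apply/eqP/freeg_eqP => z; rewrite coeffZ !coeffU mul1r.
by rewrite linearZ.
Qed.
End Cover.

Section Kernel.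
Variables (M N : gmod) (f : gmor M N).

Lemma ker_lin a u v : f u = 0 -> f v = 0 -> f (a *: u + v) = 0.
Proof. by move=> u0 v0; rewrite linearP u0 v0 scaler0 addr0. Qed.

Definition kerM : submod M := Submod (linear0 f) ker_lin.

Definition ker_val : gmor (gsub kerM) M :=
  @GMor k n (gsub kerM) M (val : {linear sub kerM -> M}) (fun _ _ => id).

Lemma ker_valP (x : gsub kerM) : f (val x) = 0.
Proof. exact: (elimT (submod_predP kerM _) (valP x)). Qed.

Lemma ker_graded : graded M -> graded N -> graded (gsub kerM).
Proof.
move=> gM gN; split=> [d|d x y dx dy|i d p x ip dx|x|s c us dc sc0 d ds].
- exact: (gdeg0 gM d).
- exact: (gdegD gM dx dy).
- exact: (gdegZ gM ip dx).
- have [s [c [us dc xE]]] := gdeg_sum gM (val x).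
  have c0 e : e \in s -> f (c e) = 0.
    apply: (gdeg_direct gN us (fun e => gmorP f (dc e))).
    by rewrite -linear_sum -xE ker_valP.
  have c'P e : (if e \in s then c e else 0) \in submod_pred kerM.
    by apply/submod_predP => /=; case: ifP => [/c0 //|_]; rewrite linear0.
  exists s, (fun e => Sub_ (c'P e)); split=> // [e|] /=.
    by case: ifP => // _; apply: gdeg0.
  apply: val_inj; rewrite linear_sum /= xE big_seq [RHS]big_seq.
  by apply: eq_bigr => e ->.
apply: val_inj; apply: (gdeg_direct gM us (c := val \o c)) => //.
by rewrite -linear_sum sc0 linear0.
Qed.
End Kernel.

Section Canonical.

Definition cover_idx (N : gmod) : choiceType :=
  {x : N * int | `[< gdeg x.2 x.1 >]}.
Definition cover_deg (N : gmod) (i : cover_idx N) : int := (val i).2.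

Lemma cover_gdeg N (i : cover_idx N) : gdeg (cover_deg i) (val i).1.
Proof. exact: (elimT (asboolP _) (valP i)). Qed.

Definition cover (N : gmod) : gmod := gfree (@cover_deg N).
Definition cover_map (N : gmod) (gN : graded N) : gmor (cover N) N :=
  free_ext gN (@cover_gdeg N).

Lemma cover_surj N gN y : exists x, @cover_map N gN x = y.
Proof.
have [s [c [us dc ->]]] := gdeg_sum gN y.
have cP d : `[< gdeg (c d, d).2 (c d, d).1 >] by apply/asboolP.
exists (\sum_(d <- s) << (exist _ (c d, d) (cP d) : cover_idx N) >>).
by rewrite linear_sum; apply: eq_bigr => d _; apply: free_extU.
Qed.

Definition syzygy (N : {N : gmod | graded N}) : {N : gmod | graded N} :=
  exist _ (gsub (kerM (cover_map (proj2_sig N))))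
    (ker_graded (cover_map (proj2_sig N)) (gfree_graded _) (proj2_sig N)).

Variables (M : gmod) (gM : graded M).

Definition syz i := iter i syzygy (exist _ M gM).

Definition comp_gmor (X Y Z : gmod) (g : gmor Y Z) (f : gmor X Y) : gmor X Z :=
  @GMor k n X Z (g \o f) (fun d x dx => gmorP g (gmorP f dx)).

Definition syz_dif i : gmor (cover (sval (syz i.+1))) (cover (sval (syz i))) :=
  comp_gmor (ker_val (cover_map (proj2_sig (syz i)))) (cover_map (proj2_sig (syz i.+1))).

Lemma syz_exact i x :
  cover_map (proj2_sig (syz i)) x = 0 <-> exists y, x = syz_dif i y.
Proof.
split=> [x0|[y ->]]; last exact: ker_valP.
have xP : x \in submod_pred (kerM (cover_map (proj2_sig (syz i)))) by apply/submod_predP.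
have [y yE] := cover_surj (proj2_sig (syz i.+1)) (Sub_ xP).
by exists y; rewrite [RHS]/(val (cover_map (proj2_sig (syz i.+1)) y)) yE.
Qed.

(* With [gdiag_graded] below: the resolutions through which HH is computed do
   exist. *)
Lemma resolution_exists : inhabited (resolution M).
Proof.
split; apply: (@Resolution k n M (fun i => cover (sval (syz i))) syz_dif
  (cover_map (proj2_sig (syz 0)))).
- by move=> i; apply: gfree_graded.
- by move=> i; apply: gfree_projective.
- exact: cover_surj.
- exact: syz_exact.
move=> i x; rewrite -syz_exact; split=> [x0|x0]; first exact/val_inj.
by rewrite [LHS]/(val (cover_map (proj2_sig (syz i.+1)) x)) x0.
Qed.
End Canonical.
End Resolutions.

Lemma mult_pdeg (k : fieldType) (n : nat) d p : pdeg d p -> pdeg d (@mult k n p).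
Proof.
have pdegX j e : pdeg (2 * e)%N ('X_j ^+ e : {mpoly k[n]}).
  by move=> m; rewrite mpolyXn msuppX inE => /eqP ->; rewrite mdegMn mdeg1 mul1n.
move=> dp; rewrite /mult [comp_mpoly _ p]comp_mpolyE big_seq.
elim/big_ind: _ => [|f g|m mp]; [exact: pdeg0|exact: pdegD|].
rewrite -[_ *: _]addr0; apply: pdeg_lin; last exact: pdeg0.
rewrite -(dp m mp) mdegE; elim/big_rec2: _ => [|i e f _ ef].
  by rewrite -mpolyC1; apply: pdegC.
by rewrite tnth_mktuple mulnDr PoszD; apply: pdegM.
Qed.

Lemma gdiag_graded (k : fieldType) (n : nat) : graded (gdiag k n).
Proof.
split=> [d|d x y|e d p x ep dx|x|s c us dc sc0 d ds].
- exact: pdeg0.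
- exact: pdegD.
- by apply: pdegM => //; apply: mult_pdeg.
- pose s := undup (pdegs x); exists s, (fun d => pcomp d x).
  split=> [|d|]; [exact: undup_uniq|exact: pdeg_pcomp|].
  by apply: pcomp_sum => [|d]; rewrite ?undup_uniq // mem_undup.
apply/mpolyP => m; rewrite mcoeff0.
have [E|ne] := eqVneq (Posz (2 * mdeg m)) d; last exact: (iffLR (pdegP _ _) (dc d)).
have := congr1 (mcoeff m) sc0; rewrite mcoeff0 raddf_sum /=.
rewrite (bigD1_seq _ ds us) /= big1 ?addr0 // => e ne.
by apply: (iffLR (pdegP _ _) (dc e)); rewrite E eq_sym.
Qed.

(* Main.v *)
(** The Koszul complex on the differences z_i of the left and right actions of alpha_i
    resolves R over R^e, so that HH^a is Koszul cohomology. The functor - \otimes_(R^i) R is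
    modelled by M + M alpha_i, and B_i B_i = B_i (1) + B_i (-1) reduces F(sigma_i)^2 to the
    three-term complex B_i (-1) -> B_i (1) -> R (2). Hence F(sigma_1^2 sigma_2^2) retracts
    onto the product of two such complexes. The first map of each of them is the difference
    of two actions of alpha_i, which vanishes on Koszul cohomology. The Koszul cohomology
    groups of R, B_s, B_t and B_s B_t are free over R, and the multiplication maps between
    them are explicit matrices with entries in R, from which the cohomology is read off. *)
From HB Require Import structures.
Require Import Defs.
From mathcomp Require Import all_boot all_order all_algebra.
From mathcomp Require Import boolp functions.
From mathcomp Require Import freeg mpoly.
From mathcomp Require Import ring lra zify.

Set Implicit Arguments.
Unset Strict Implicit.
Unset Printing Implicit Defensive.

Import GRing.Theory.
Local Open Scope ring_scope.

(** [HHH] uses an arbitrary projective resolution, and its tensor products are quotients of free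
    modules on symbols; neither allows direct calculation. The comparison with the Koszul complex is
    therefore kept as a relation between Ext classes and cochains, and every tensor product is
    replaced by pairs of elements with an explicit action. The constant 1/2 comes from alpha_j +
    alpha_i / 2, which s_i fixes. On B_j the element z_i acts as - z_j / 2, so z_j + z_i / 2 acts as
    3/4 of z_j; this is the origin of 1/3 and of 4/3. Write V, S, U, Y for B_s B_t, B_s, B_t, R
    without their shifts. The reduced complex has the terms V; V + V; U + V + S; U + S; Y in degrees
    0 to 4. Once the difference maps vanish, it splits on Koszul cohomology into V alone, V -> U, V
    -> S and V -> U + S -> Y. The first piece gives T = 0, the cokernels of the next two give T = 2,
    and the last is exact except at Y, which gives T = 4. *)

Section PolynomialInduction.
Variables (k : fieldType) (n : nat).
Local Notation A := {mpoly k[n]}.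

Lemma mpoly_ring_ind (Q : A -> Prop) :
  (forall c, Q c%:MP) -> (forall i, Q 'X_i) ->
  (forall p q, Q p -> Q q -> Q (p + q)) ->
  (forall p q, Q p -> Q q -> Q (p * q)) -> forall p, Q p.
Proof.
move=> QC QX QD QM p; rewrite [p]mpolyE; apply: (big_ind Q) => //.
  by rewrite -mpolyC0; apply: QC.
move=> m _; rewrite -mul_mpolyC; apply: (QM) => //; rewrite mpolyXE_id.
apply: (big_ind Q) => [|*|i _]; [by rewrite -mpolyC1; apply: QC|by apply: QM|].
elim: (m i) => [|e IH]; first by rewrite expr0 -mpolyC1; apply: QC.
by rewrite exprS; apply: QM.
Qed.

Lemma mpoly_rmorph_ext (B : nzRingType) (f g : {rmorphism A -> B}) :
  (forall c, f c%:MP = g c%:MP) -> (forall i, f 'X_i = g 'X_i) -> f =1 g.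
Proof.
move=> fgC fgX; apply: mpoly_ring_ind => // p q; first by rewrite !rmorphD => -> ->.
by rewrite !rmorphM => -> ->.
Qed.

Lemma mpoly_scale_ind (V : lmodType A) (Q : V -> Prop) :
  (forall x y, Q x -> Q y -> Q (x + y)) ->
  (forall c x, Q x -> Q (c%:MP *: x)) -> (forall i x, Q x -> Q ('X_i *: x)) ->
  forall p x, Q x -> Q (p *: x).
Proof.
move=> QD QC QX; apply: mpoly_ring_ind => // [p q Qp Qq x Qx|p q Qp Qq x Qx].
  by rewrite scalerDl; apply: QD; [apply: Qp|apply: Qq].
by rewrite -scalerA; apply/Qp/Qq.
Qed.

Lemma pdegX i : pdeg 2 ('X_i : A).
Proof. by move=> m; rewrite msuppX inE => /eqP ->; rewrite mdeg1. Qed.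

End PolynomialInduction.

(** * Congruences with explicit cofactors *)

Section IdealIdentities.
Variable A : comNzRingType.
Implicit Types x y p q m n a b c d : A.

(** Splits p q - m n as (p - m) q + m (q - n), so that an induction over polynomials can carry the
    cofactors of a membership in the ideal (x, y). *)
Lemma sub_ideal_mul x y p q m n a b c d :
  p - m = x * a + y * b -> q - n = x * c + y * d ->
  p * q - m * n = x * (a * q + m * c) + y * (b * q + m * d).
Proof. by move=> /(canRL (subrK _)) -> /(canRL (subrK _)) ->; ring. Qed.

Lemma sub_ideal_add x y p q m n a b c d :
  p - m = x * a + y * b -> q - n = x * c + y * d ->
  p + q - (m + n) = x * (a + c) + y * (b + d).
Proof. by move=> /(canRL (subrK _)) -> /(canRL (subrK _)) ->; ring. Qed.

Lemma ideal_l x y : x = x * 1 + y * 0. Proof. by ring. Qed.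
Lemma ideal_r x y : y = x * 0 + y * 1. Proof. by ring. Qed.
Lemma ideal_0 x y p : p - p = x * 0 + y * 0. Proof. by ring. Qed.

End IdealIdentities.

(** * The regular sequence of the two differences in R^e *)

Section Koszul.
Variable k : fieldType.
Local Notation R := {mpoly k[2]}.
Local Notation A := {mpoly k[2 + 2]}.
Local Notation s := (ord0 : 'I_2).
Local Notation t := (ord_max : 'I_2).

Definition zel (i : 'I_2) : A := lft 'X_i - rgt 'X_i.

Lemma zel_def (i : 'I_2) : zel i = lft 'X_i - rgt 'X_i.
Proof. by []. Qed.

Lemma lftX i : lft ('X_i : R) = 'X_(lshift 2 i).
Proof. by rewrite [LHS]comp_mpolyXU -tnth_nth tnth_mktuple. Qed.

Lemma rgtX i : rgt ('X_i : R) = 'X_(rshift 2 i).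
Proof. by rewrite [LHS]comp_mpolyXU -tnth_nth tnth_mktuple. Qed.

Lemma lftC c : lft (c%:MP : R) = c%:MP. Proof. exact: comp_mpolyC. Qed.
Lemma rgtC c : rgt (c%:MP : R) = c%:MP. Proof. exact: comp_mpolyC. Qed.
Lemma multC c : mult (c%:MP : A) = c%:MP. Proof. exact: comp_mpolyC. Qed.

Lemma ord2P (Q : 'I_2 -> Prop) : Q s -> Q t -> forall i, Q i.
Proof.
move=> Qs Qt; case=> [[|[|//]] p].
  by rewrite (_ : Ordinal p = s) //; apply: val_inj.
by rewrite (_ : Ordinal p = t) //; apply: val_inj.
Qed.

Lemma enveloping_ind (Q : A -> Prop) :
  (forall c, Q c%:MP) -> (forall i, Q (lft 'X_i)) -> (forall i, Q (rgt 'X_i)) ->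
  (forall p q, Q p -> Q q -> Q (p + q)) ->
  (forall p q, Q p -> Q q -> Q (p * q)) -> forall p, Q p.
Proof.
move=> QC Ql Qr; apply: mpoly_ring_ind => // i; rewrite -[i]splitK.
by case: (fintype.split i) => j /=; rewrite -?lftX -?rgtX.
Qed.

(** Modulo the two differences each left variable becomes the right one, so by induction they
    generate the kernel of [mult]. *)
Lemma mult_ideal (p : A) : exists a b, p - rgt (mult p) = zel s * a + zel t * b.
Proof.
elim/enveloping_ind: p => [c|i|i|p q [a [b ab]] [c [d cd]]|p q [a [b ab]] [c [d cd]]].
- by exists 0, 0; rewrite multC rgtC; apply: ideal_0.
- rewrite mult_lft; elim/ord2P: i; [exists 1, 0|exists 0, 1];
    [exact: ideal_l|exact: ideal_r].
- by exists 0, 0; rewrite mult_rgt; apply: ideal_0.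
- by exists (a + c), (b + d); rewrite !rmorphD; apply: sub_ideal_add.
by eexists; eexists; rewrite !rmorphM; apply: sub_ideal_mul ab cd.
Qed.

(** The quotient by [zel i], realised inside R^e itself by substituting a right variable for a left
    one; its values lie in a domain. *)
Definition kill (i : 'I_2) : {rmorphism A -> A} :=
  comp_mpoly [tuple if j == lshift 2 i then 'X_(rshift 2 i) else 'X_j | j < 2 + 2].

Lemma killX i j : kill i 'X_j = if j == lshift 2 i then 'X_(rshift 2 i) else 'X_j.
Proof. by rewrite [LHS]comp_mpolyXU -tnth_nth tnth_mktuple. Qed.

Lemma kill_ideal i p : exists a, p - kill i p = zel i * a + 0 * 0.
Proof.
elim/mpoly_ring_ind: p => [c|j|p q [a ap] [b bq]|p q [a ap] [b bq]].
- by exists 0; rewrite [kill i _]comp_mpolyC; apply: ideal_0.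
- rewrite killX; case: eqP => [->|_]; last by exists 0; apply: ideal_0.
  by exists 1; rewrite /zel lftX rgtX; apply: ideal_l.
- by exists (a + b); rewrite rmorphD (sub_ideal_add ap bq) addr0.
by exists (a * q + kill i p * b); rewrite rmorphM (sub_ideal_mul ap bq) !mul0r.
Qed.

Lemma zel_neq0 i : zel i != 0.
Proof.
apply/eqP => z0; have /eqP := congr1 (fun p : A => p@_U_(lshift 2 i)) z0.
rewrite /zel lftX rgtX raddfB /= !mcoeffX mcoeff0 eqxx eq_mnm1 eq_rlshift.
by rewrite subr0 oner_eq0.
Qed.

(** [kill s] annihilates [zel s] and fixes [zel t], so it annihilates b, which is then divisible by
    [zel s]. Cancelling [zel s] in the equation gives a. *)
Lemma koszul_exact1 a b : zel s * a + zel t * b = 0 ->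
  exists e, a = - (zel t * e) /\ b = zel s * e.
Proof.
move=> ab0; have kt : kill s (zel t) = zel t.
  by rewrite /zel rmorphB /= lftX rgtX !killX eq_rlshift (inj_eq (@lshift_inj _ _)).
have ks : kill s (zel s) = 0.
  by rewrite /zel rmorphB /= lftX rgtX !killX eqxx eq_rlshift subrr.
have kb : kill s b = 0.
  have /eqP := congr1 (kill s) ab0; rewrite rmorphD !rmorphM /= ks kt mul0r add0r.
  by rewrite rmorph0 mulf_eq0 (negPf (zel_neq0 t)) => /eqP.
have [e] := kill_ideal s b; rewrite kb subr0 mul0r addr0 => be; exists e; split=> //.
apply/eqP; rewrite -addr_eq0; apply/eqP.
have /eqP : zel s * (a + zel t * e) = 0 by rewrite mulrDr mulrCA -be.
by rewrite mulf_eq0 (negPf (zel_neq0 s)) => /eqP.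
Qed.

End Koszul.

(** * Lifting through projective graded modules *)

Section GradedLifting.
Variables (k : fieldType) (n : nat).
Local Notation A := {mpoly k[n]}.
Local Notation gmod := (gmod k n).

Definition mkgmor (M N : gmod) (f : M -> N) (fl : linear f)
    (fd : forall d x, gdeg d x -> gdeg d (f x)) : gmor M N :=
  @GMor k n M N (HB.pack_for {linear M -> N} f (GRing.isLinear.Build A M N _ f fl)) fd.

Lemma gdegN (M : gmod) d (x : M) : graded M -> gdeg d x -> gdeg d (- x).
Proof.
move=> gM dx; rewrite -scaleN1r -[d]add0r -mpolyC1 -mpolyCN.
by apply: gdegZ => //; apply: pdegC.
Qed.

Lemma greg_graded : graded (greg k n).
Proof.
split=> [d|d x y|e d p x|x|s c us dc sc0 d ds].
- exact: pdeg0.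
- exact: pdegD.
- exact: pdegM.
- exists (undup (pdegs x)), (fun d => Defs.pcomp d x).
  split=> [|d|]; [exact: undup_uniq|exact: pdeg_pcomp|].
  by apply: pcomp_sum => [|d]; rewrite ?undup_uniq // mem_undup.
apply/mpolyP => m; rewrite mcoeff0.
have [E|ne] := eqVneq (Posz (2 * mdeg m)) d; last exact: (iffLR (pdegP _ _) (dc d)).
have := congr1 (mcoeff m) sc0; rewrite mcoeff0 raddf_sum /=.
rewrite (bigD1_seq _ ds us) /= big1 ?addr0 // => e ne.
by apply: (iffLR (pdegP _ _) (dc e)); rewrite E eq_sym.
Qed.

Section Image.
Variables (M N : gmod) (g : gmor M N).

Lemma im_zero : exists x, 0 = g x. Proof. by exists 0; rewrite linear0. Qed.
Lemma im_lin a u v :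
  (exists x, u = g x) -> (exists x, v = g x) -> exists x, a *: u + v = g x.
Proof. by move=> [x ->] [y ->]; exists (a *: x + y); rewrite linearP. Qed.

Definition imM : submod N := Submod im_zero im_lin.

Lemma im_graded : graded M -> graded N -> graded (gsub imM).
Proof.
move=> gM gN; split=> [d|d x y dx dy|i d p x ip dx|y|s c us dc sc0 d ds].
- exact: (gdeg0 gN d).
- exact: (gdegD gN dx dy).
- exact: (gdegZ gN ip dx).
- have /submod_predP [x yE] := valP y.
  have [s [c [us dc xE]]] := gdeg_sum gM x.
  have cP e : g (c e) \in submod_pred imM by apply/submod_predP; exists (c e).
  exists s, (fun e => Sub_ (cP e)); split=> // [e|]; first exact: (gmorP g (dc e)).
  by apply: val_inj; rewrite linear_sum /= yE xE linear_sum.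
apply: val_inj; apply: (gdeg_direct gN us (c := val \o c)) => //.
by rewrite -linear_sum sc0 linear0.
Qed.

Variables (P : gmod) (u : gmor P N).
Hypothesis ug : forall x, exists a, u x = g a.

Lemma corestrictP x : u x \in submod_pred imM.
Proof. exact/submod_predP/ug. Qed.

Definition corestrict_fun (x : P) : gsub imM := Sub_ (corestrictP x).

Lemma corestrict_lin : linear corestrict_fun.
Proof. by move=> a x y; apply: val_inj; rewrite /= linearP. Qed.

Definition corestrict : gmor P (gsub imM) :=
  mkgmor corestrict_lin (fun d x dx => gmorP u dx).

Lemma corestrictE x : val (corestrict x) = u x. Proof. by []. Qed.
End Image.

Lemma corestrict_surj (M N : gmod) (g : gmor M N) (gg : forall x, exists a, g x = g a) y :
  exists x, corestrict gg x = y.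
Proof.
by have /submod_predP [x yE] := valP y; exists x; apply: val_inj; rewrite yE.
Qed.

(** Projectivity is stated for surjections, so the target is first cut down to the image of g. *)
Lemma proj_lift (P M N : gmod) (g : gmor M N) (u : gmor P N) :
  projective P -> graded M -> graded N -> (forall x, exists a, u x = g a) ->
  exists h : gmor P M, forall x, g (h x) = u x.
Proof.
move=> projP gM gN ug; have gg x : exists a, g x = g a by exists x.
have [h hP] := projP M (gsub (imM g)) (corestrict gg) (corestrict ug) gM
  (im_graded g gM gN) (corestrict_surj gg).
by exists h => x; rewrite -[LHS](corestrictE gg) hP.
Qed.

Lemma homog_lift (M N : gmod) (g : gmor M N) d y : graded M -> graded N ->
  (exists x, y = g x) -> gdeg d y -> exists x, gdeg d x /\ g x = y.
Proof.
move=> gM gN yg dy; have gg x : exists a, g x = g a by exists x.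
have yP : y \in submod_pred (imM g) by apply/submod_predP.
have [x [dx xE]] := @gdeg_lift k n M (gsub (imM g)) (corestrict gg) d (Sub_ yP) gM
  (im_graded g gM gN) (corestrict_surj gg) dy.
by exists x; split=> //; rewrite -(corestrictE gg) xE.
Qed.

(** Coefficients found pointwise need not depend linearly on x. Lifting u through the free module on
    the [b i] chooses them linearly and homogeneously. *)
Lemma proj_coords (I : finType) (deg : I -> int) (P N : gmod) (b : I -> N)
    (u : gmor P N) : projective P -> graded N -> (forall i, gdeg (deg i) (b i)) ->
  (forall x, exists c : I -> A, u x = \sum_i c i *: b i) ->
  exists w : forall i, gmor P (gshift (- deg i) (greg k n)),
    forall x, u x = \sum_i (w i x : A) *: b i.
Proof.
move=> projP gN db ub; pose g := free_ext gN db.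
have gE f : g f = \sum_i coeff i f *: b i.
  rewrite -[in LHS](_ : \sum_i coeff i f *: << i >> = f).
    by rewrite linear_sum; apply: eq_bigr => i _; rewrite linearZ [g _]free_extU.
  apply/eqP/freeg_eqP => j; rewrite raddf_sum /= (bigD1 j) //= coeffZ coeffU eqxx.
  rewrite !mulr1 big1 ?addr0 // => i /negPf ij.
  by rewrite coeffZ coeffU mul1r ij mulr0.
have ug x : exists a, u x = g a.
  have [c ->] := ub x; exists (\sum_i c i *: << i >>).
  by rewrite linear_sum; apply: eq_bigr => i _; rewrite linearZ [g _]free_extU.
have [h hP] := proj_lift projP (@gfree_graded k n I deg) gN ug.
have wl i : linear (fun x => coeff i (h x) : greg k n).
  by move=> a x y; rewrite linearP coeffD coeffZ.
exists (fun i => @mkgmor P (gshift (- deg i) (greg k n)) _ (wl i)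
  (fun d x dx => gmorP h dx i)) => x.
by rewrite -hP gE.
Qed.

End GradedLifting.

Section GradedMorphisms.
Variables (k : fieldType) (n : nat).
Local Notation A := {mpoly k[n]}.
Local Notation gmod := (gmod k n).

Lemma gshift_graded l (M : gmod) : graded M -> graded (gshift l M).
Proof.
move=> gM; split=> [d|d x y|i d p x ip dx|x|s c us dc sc0 d ds].
- exact: (gdeg0 gM).
- exact: (gdegD gM).
- by rewrite /= -addrA; apply: (gdegZ gM).
- have [s [c [us dc xE]]] := gdeg_sum gM x.
  exists [seq d - l | d <- s], (fun d => c (d + l)); split=> [|d|].
  + by rewrite map_inj_uniq // => u v /addIr.
  + exact: dc.
  + by rewrite big_map [LHS]xE; apply: eq_bigr => d _; rewrite subrK.
rewrite -[d](addrK l); apply: (gdeg_direct gM (s := [seq d + l | d <- s])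
  (c := fun d => c (d - l))).
- by rewrite map_inj_uniq // => u v /addIr.
- by move=> e; have := dc (e - l); rewrite /= subrK.
- by rewrite big_map -[RHS]sc0; apply: eq_bigr => e _; rewrite addrK.
exact: map_f.
Qed.

Lemma gmor_sub_lin (M N : gmod) (f g : gmor M N) : linear (fun x => f x - g x).
Proof. by move=> a x y; rewrite (linearP f) (linearP g) opprD addrACA scalerBr. Qed.

Lemma gmor_sub_deg (M N : gmod) (f g : gmor M N) d x : graded N ->
  gdeg d x -> gdeg d (f x - g x).
Proof. by move=> gN dx; apply: gdegD => //; [|apply: gdegN => //]; apply: gmorP. Qed.

Definition gmor_sub (M N : gmod) (gN : graded N) (f g : gmor M N) : gmor M N :=
  mkgmor (gmor_sub_lin f g) (fun d x => gmor_sub_deg f g gN).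

Lemma functional_lin e (M N : gmod) (u : gmor M (gshift (- e) (greg k n))) (q : N) :
  linear (fun x => (u x : A) *: q).
Proof. by move=> a x y; rewrite (linearP u) scalerDl scalerA. Qed.

Lemma functional_deg e (M N : gmod) (u : gmor M (gshift (- e) (greg k n))) (q : N) d x :
  graded N -> gdeg e q -> gdeg d x -> gdeg d ((u x : A) *: q).
Proof.
move=> gN dq dx; rewrite -[d](subrK e); apply: gdegZ => //; exact: (gmorP u dx).
Qed.

Definition functional_mor e (M N : gmod) (u : gmor M (gshift (- e) (greg k n))) (q : N)
    (gN : graded N) (dq : gdeg e q) : gmor M N :=
  mkgmor (functional_lin u q) (fun d x => functional_deg u gN dq).

Lemma gmor_add_lin (M N : gmod) (f g : gmor M N) : linear (fun x => f x + g x).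
Proof. by move=> a x y; rewrite (linearP f) (linearP g) addrACA scalerDr. Qed.

Lemma gmor_add_deg (M N : gmod) (f g : gmor M N) d x : graded N ->
  gdeg d x -> gdeg d (f x + g x).
Proof. by move=> gN dx; apply: gdegD => //; apply: gmorP. Qed.

Definition gmor_add (M N : gmod) (gN : graded N) (f g : gmor M N) : gmor M N :=
  mkgmor (gmor_add_lin f g) (fun d x => gmor_add_deg f g gN).

End GradedMorphisms.

Lemma big_unit (V : nmodType) (F : unit -> V) : \sum_i F i = F tt.
Proof. by rewrite (bigD1 tt) //= big1 ?addr0 // => -[]. Qed.

Lemma big_ord2 (V : nmodType) (F : 'I_2 -> V) : \sum_i F i = F ord0 + F ord_max.
Proof. by rewrite big_ord_recl big_ord1; congr (_ + F _); apply: val_inj. Qed.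

(** * Comparison of a projective resolution of R with the Koszul complex *)

Section KoszulFrame.
Variable k : fieldType.
Local Notation R := {mpoly k[2]}.
Local Notation A := {mpoly k[2 + 2]}.
Local Notation s := (ord0 : 'I_2).
Local Notation t := (ord_max : 'I_2).
Local Notation Asft e := (gshift (- e) (greg k (2 + 2))).
Variable P : resolution (gdiag k 2).

(* The comparison of P with the Koszul complex of (zel s, zel t): the u's are the
   components of a chain map from P, the q's are the values on the basis of a chain
   map to P. *)
Record koszul_frame := KoszulFrame {
  ku0 : gmor (P 0) (Asft 0); kus : gmor (P 1) (Asft 2); kut : gmor (P 1) (Asft 2);
  ku2 : gmor (P 2) (Asft 4);
  kq0 : P 0; kqs : P 1; kqt : P 1; kq2 : P 2;
  kq0_deg : gdeg 0 kq0; kqs_deg : gdeg 2 kqs; kqt_deg : gdeg 2 kqt; kq2_deg : gdeg 4 kq2;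
  kqs_dif : rdif P 0 kqs = zel k s *: kq0;
  kqt_dif : rdif P 0 kqt = zel k t *: kq0;
  kq2_dif : rdif P 1 kq2 = zel k s *: kqt - zel k t *: kqs;
  ku0_dif : forall x, (ku0 (rdif P 0 x) : A) =
    zel k s * (kus x : A) + zel k t * (kut x : A);
  kus_dif : forall x, (kus (rdif P 1 x) : A) = - (zel k t * (ku2 x : A));
  kut_dif : forall x, (kut (rdif P 1 x) : A) = zel k s * (ku2 x : A);
  ku2_dif : forall x, (ku2 (rdif P 2 x) : A) = 0;
  kq0_aug : forall x, raug P ((ku0 x : A) *: kq0) = raug P x;
  kq0_norm : exists a b, (ku0 kq0 : A) - 1 = zel k s * a + zel k t * b }.

Lemma gdiagZ (p : A) (f : gdiag k 2) : p *: f = mult p * (f : R).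
Proof. by []. Qed.

Lemma gdiagZ1 (p : A) : p *: ((1 : R) : gdiag k 2) = mult p.
Proof. by rewrite gdiagZ mulr1. Qed.

Lemma rdif2 n x : rdif P n (rdif P n.+1 x) = 0.
Proof. by apply/rdif_exact; exists x. Qed.

Lemma zel_deg i : pdeg 2 (zel k i).
Proof.
rewrite /zel lftX rgtX; apply: (@pdegD k (2+2)); first exact: pdegX.
by rewrite -scaleN1r -[_ *: _]addr0; apply: pdeg_lin; [apply: pdegX|apply: pdeg0].
Qed.

(** The comparison theorem made explicit: the functionals exist because P is projective and the
    Koszul complex exact, the elements because P is exact and homogeneous elements have homogeneous
    lifts. *)
Lemma koszul_frame_exists : inhabited koszul_frame.
Proof.
have gR := greg_graded k (2 + 2); have gD := gdiag_graded k 2.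
have gP := @robj_graded _ _ _ P; have pP := @robj_projective _ _ _ P.
have [w0 w0P] : exists u0 : gmor (P 0) (Asft 0),
    forall x, raug P x = (u0 x : A) *: ((1 : R) : gdiag k 2).
  have [||w wP] := @proj_coords k _ unit (fun _ => 0) (P 0) (gdiag k 2) (fun _ => (1 : R))
    (raug P) (pP 0) gD.
  - by move=> _; apply: (@pdegC k 2 1).
  - move=> x; exists (fun _ => rgt (raug P x)); rewrite big_unit.
    by rewrite gdiagZ1 mult_rgt.
  by exists (w tt) => x; rewrite wP big_unit.
have w0m x : mult (w0 x : A) = raug P x by rewrite w0P gdiagZ1.
(* The augmentation vanishes on boundaries, so the values of [w0] there lie in the kernel of [mult],
   which the differences generate. *)
have [w1 w1P] : exists w : forall i : 'I_2, gmor (P 1) (Asft 2),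
    forall x, (w0 (rdif P 0 x) : A) = zel k s * (w s x : A) + zel k t * (w t x : A).
  have [||w wP] := @proj_coords k _ 'I_2 (fun _ => 2) (P 1) (Asft 0) (zel k)
    (comp_gmor w0 (rdif P 0)) (pP 1) (gshift_graded _ gR).
  - by move=> i; apply: zel_deg.
  - move=> x; have [a [b ab]] := mult_ideal (w0 (rdif P 0 x) : A).
    have aug0 : raug P (rdif P 0 x) = 0 by apply/raug_exact; exists x.
    exists (fun i => if i == s then a else b); rewrite big_ord2 /=.
    suff E : (w0 (rdif P 0 x) : A) = a * zel k s + b * zel k t by exact: E.
    rewrite (mulrC a) (mulrC b) -ab w0m aug0.
    by rewrite (rmorph0 (@rgt k 2)) subr0.
  exists w => x; have := wP x; rewrite big_ord2 => E.
  by rewrite [zel k s * _]mulrC [zel k t * _]mulrC; apply: E.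
have w1e x : exists e, (w1 s (rdif P 1 x) : A) = - (zel k t * e) /\
    (w1 t (rdif P 1 x) : A) = zel k s * e.
  by apply: koszul_exact1; rewrite -w1P rdif2 linear0.
have [w2 w2P] : exists w : gmor (P 2) (Asft 4),
    forall x, (w1 t (rdif P 1 x) : A) = zel k s * (w x : A).
  have [||w wP] := @proj_coords k _ unit (fun _ => 4) (P 2) (Asft 2) (fun _ => zel k s)
    (comp_gmor (w1 t) (rdif P 1)) (pP 2) (gshift_graded _ gR).
  - by move=> i; apply: (@zel_deg s).
  - move=> x; have [e [_ ee]] := w1e x; exists (fun _ => e).
    by rewrite big_unit [LHS]ee mulrC.
  by exists (w tt) => x; have := wP x; rewrite big_unit mulrC.
(* [w2] was chosen for the component t; cancelling [zel s] shows that it also serves the component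
   s. *)
have w2s x : (w1 s (rdif P 1 x) : A) = - (zel k t * (w2 x : A)).
  have [e [-> et]] := w1e x; congr (- (_ * _)); apply: (mulfI (zel_neq0 k s)).
  by rewrite -et w2P.
have w2d x : (w2 (rdif P 2 x) : A) = 0.
  by apply: (mulfI (zel_neq0 k s)); rewrite mulr0 -w2P rdif2 linear0.
have [q0 [q0d q0E]] := @gdeg_lift k _ _ _ (raug P) 0 ((1 : R) : gdiag k 2) (gP 0) gD
  (raug_surj P) (@pdegC k 2 1).
have qi i : exists x, gdeg 2 x /\ rdif P 0 x = zel k i *: q0.
  apply: homog_lift => //.
    apply/raug_exact; rewrite linearZ /= q0E gdiagZ1 rmorphB /= mult_lft mult_rgt.
    by rewrite subrr.
  exact: (gdegZ (gP 0) (@zel_deg i) q0d).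
have [qs [qsd qsE]] := qi s; have [qt [qtd qtE]] := qi t.
have [q2 [q2d q2E]] : exists x, gdeg 4 x /\ rdif P 1 x = zel k s *: qt - zel k t *: qs.
  apply: homog_lift => //.
    apply/rdif_exact; rewrite linearB !linearZ /= qsE qtE !scalerA (mulrC (zel k s)).
    by rewrite scalerN scalerA subrr.
  apply: gdegD => //; first exact: (gdegZ (gP 1) (@zel_deg s) qtd).
  apply: gdegN => //; exact: (gdegZ (gP 1) (@zel_deg t) qsd).
split; apply: (@KoszulFrame w0 (w1 s) (w1 t) w2 q0 qs qt q2) => //.
  by move=> x; rewrite linearZ /= q0E w0P.
have [a [b ab]] := mult_ideal (w0 q0 : A); exists a, b.
by rewrite -ab w0m q0E -mpolyC1 rgtC.
Qed.

Variable K : koszul_frame.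
Let gP := @robj_graded _ _ _ P.

(** The round trip from P to the Koszul complex and back. Above degree 2 it is the zero morphism,
    written as the difference of two identities. *)
Definition koszul_proj (n : nat) : gmor (P n) (P n) :=
  match n with
  | 0 => functional_mor (ku0 K) (gP 0) (kq0_deg K)
  | 1 => gmor_add (gP 1) (functional_mor (kus K) (gP 1) (kqs_deg K))
           (functional_mor (kut K) (gP 1) (kqt_deg K))
  | 2 => functional_mor (ku2 K) (gP 2) (kq2_deg K)
  | n.+3 => gmor_sub (gP n.+3) (gid (P n.+3)) (gid (P n.+3))
  end.

Lemma koszul_proj0 x : koszul_proj 0 x = (ku0 K x : A) *: kq0 K. Proof. by []. Qed.
Lemma koszul_proj1 x :
  koszul_proj 1 x = (kus K x : A) *: kqs K + (kut K x : A) *: kqt K.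
Proof. by []. Qed.
Lemma koszul_proj2 x : koszul_proj 2 x = (ku2 K x : A) *: kq2 K. Proof. by []. Qed.
Lemma koszul_projS n x : koszul_proj n.+3 x = 0. Proof. exact: subrr. Qed.

Lemma koszul_proj_dif n x :
  koszul_proj n (rdif P n x) = rdif P n (koszul_proj n.+1 x).
Proof.
case: n x => [|[|[|n]]] x.
- rewrite koszul_proj0 koszul_proj1 ku0_dif linearD !linearZ /= kqs_dif kqt_dif.
  by rewrite [LHS]scalerDl !scalerA; congr (_ *: _ + _ *: _); apply: mulrC.
- rewrite koszul_proj1 koszul_proj2 kus_dif kut_dif linearZ /= kq2_dif.
  rewrite [RHS]scalerBr !scalerA addrC scaleNr.
  by congr (_ *: _ - _ *: _); apply: mulrC.
- by rewrite koszul_proj2 ku2_dif scale0r koszul_projS linear0.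
- by rewrite !koszul_projS linear0.
Qed.

Lemma koszul_homotopy0 : exists h : gmor (P 0) (P 1),
  forall x, x = koszul_proj 0 x + rdif P 0 (h x).
Proof.
have [|h hP] := @proj_lift k _ (P 0) _ _ (rdif P 0)
  (gmor_sub (gP 0) (gid (P 0)) (koszul_proj 0)) (@robj_projective _ _ _ P 0) (gP 1) (gP 0).
  move=> x; apply/raug_exact; rewrite [gmor_sub _ _ _ x]/(x - (ku0 K x : A) *: kq0 K).
  by rewrite linearB /= kq0_aug subrr.
by exists h => x; rewrite hP [gmor_sub _ _ _ x]/(x - koszul_proj 0 x) addrC subrK.
Qed.

(** The round trip lifts the identity of R, so it is homotopic to the identity. The error in each
    degree is a cycle and lifts by projectivity. *)
Lemma koszul_homotopy n : exists (g : gmor (P n) (P n.+1)) (h : gmor (P n.+1) (P n.+2)),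
  forall x, x = koszul_proj n.+1 x + g (rdif P n x) + rdif P n.+1 (h x).
Proof.
have step m (g : gmor (P m) (P m.+1)) :
    (forall x, rdif P m x = koszul_proj m (rdif P m x) + rdif P m (g (rdif P m x))) ->
    exists h : gmor (P m.+1) (P m.+2),
    forall x, x = koszul_proj m.+1 x + g (rdif P m x) + rdif P m.+1 (h x).
  move=> gE; pose u := gmor_sub (gP m.+1) (gid (P m.+1))
    (gmor_add (gP m.+1) (koszul_proj m.+1) (comp_gmor g (rdif P m))).
  have uE x : u x = x - (koszul_proj m.+1 x + g (rdif P m x)) by [].
  have [|h hP] := @proj_lift k _ (P m.+1) _ _ (rdif P m.+1) u
    (@robj_projective _ _ _ P m.+1) (gP m.+2) (gP m.+1).
    move=> x; apply/rdif_exact; rewrite uE linearB linearD /= -koszul_proj_dif.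
    by rewrite -gE subrr.
  by exists h => x; rewrite hP uE addrC subrK.
elim: n => [|n [g [h hE]]].
  have [g gE] := koszul_homotopy0.
  by have [|h hE] := step 0 g; [move=> x; apply: gE | exists g, h].
(* [step] asks for the homotopy formula on boundaries, where the term containing g disappears
   because the differential squares to zero. *)
have [|h' hE'] := step _ h; last by exists h, h'.
by move=> x; rewrite {1}[rdif P n.+1 x]hE rdif2 linear0 addr0.
Qed.

End KoszulFrame.

(** * Gradings without uniqueness of decompositions *)

Section WeaklyGraded.
Variables (k : fieldType) (n : nat).
Local Notation A := {mpoly k[n]}.
Local Notation gmod := (gmod k n).

(* The part of [graded] that survives without uniqueness of homogeneous
   decompositions, and is all that is needed of the coefficients of Ext. *)
Record wgraded (M : gmod) : Prop := WGraded {
  wgdeg0 : forall d, gdeg d (0 : M);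
  wgdegD : forall d (x y : M), gdeg d x -> gdeg d y -> gdeg d (x + y);
  wgdegZ : forall i d p (x : M), pdeg i p -> gdeg d x -> gdeg (i + d) (p *: x);
  wgdeg_ind : forall Q : M -> Prop, (forall d x, gdeg d x -> Q x) ->
    (forall x y, Q x -> Q y -> Q (x + y)) -> forall x, Q x }.

Lemma graded_wgraded (M : gmod) : graded M -> wgraded M.
Proof.
move=> gM; split; [exact: gdeg0|exact: gdegD|exact: gdegZ|].
move=> Q Qd QD x; have [s [c [_ dc ->]]] := gdeg_sum gM x.
by apply: (big_ind Q) => [|//|d _]; [apply/(Qd 0)/(gdeg0 gM)|apply/Qd/dc].
Qed.

Lemma wgdegN (M : gmod) d (x : M) : wgraded M -> gdeg d x -> gdeg d (- x).
Proof.
move=> gM dx; rewrite -scaleN1r -[d]add0r -mpolyC1 -mpolyCN.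
by apply: wgdegZ => //; apply: pdegC.
Qed.

Lemma gshift_wgraded l (M : gmod) : wgraded M -> wgraded (gshift l M).
Proof.
move=> gM; split=> [d|d x y|i d p x ip dx|Q Qd].
- exact: (wgdeg0 gM).
- exact: (wgdegD gM).
- by rewrite /= -addrA; apply: (wgdegZ gM).
- by apply: (wgdeg_ind gM) => d x dx; apply: (Qd (d - l)); rewrite /= subrK.
Qed.

Lemma gsum_wgraded (M N : gmod) : wgraded M -> wgraded N -> wgraded (gsum M N).
Proof.
move=> gM gN; split=> [d|d x y [x1 x2] [y1 y2]|i d p x ip [x1 x2]|Q Qd QD [x y]].
- by split; apply: wgdeg0.
- by split; apply: wgdegD.
- by split; apply: wgdegZ.
have -> : (x, y) = (x, 0) + (0, y) :> gsum M N.
  by congr pair; rewrite /= ?addr0 ?add0r.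
apply: (QD); [elim/(wgdeg_ind gM): x|elim/(wgdeg_ind gN): y].
- by move=> d x dx; apply: (Qd d); split=> //; apply: wgdeg0.
- move=> x x' Qx Qx'; suff -> : (x + x', 0) = (x, 0) + (x', 0) :> gsum M N by apply: (QD).
  by congr pair; rewrite /= addr0.
- by move=> d y dy; apply: (Qd d); split=> //; apply: wgdeg0.
move=> y y' Qy Qy'; suff -> : (0, y + y') = (0, y) + (0, y') :> gsum M N by apply: (QD).
by congr pair; rewrite /= addr0.
Qed.

Lemma gzero_wgraded : wgraded (gzero k n).
Proof. by split=> // Q Qd _ x; apply: (Qd 0). Qed.

Lemma wgraded_iso (M N : gmod) (f : gmor M N) :
  (forall x y, f x = f y -> x = y) ->
  (forall d y, gdeg d y -> exists x, gdeg d x /\ f x = y) ->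
  (forall d x, gdeg d (f x) -> gdeg d x) -> wgraded N -> wgraded M.
Proof.
move=> finj fsur fdeg gN; split=> [d|d x y dx dy|i d p x ip dx|Q Qd QD x].
- by apply: fdeg; rewrite linear0; apply: wgdeg0.
- by apply: fdeg; rewrite linearD; apply: wgdegD => //; apply: gmorP.
- by apply: fdeg; rewrite linearZ; apply: wgdegZ => //; apply: gmorP.
suff: exists x', Q x' /\ f x' = f x by move=> [x' [Qx' /finj <-]].
elim/(wgdeg_ind gN): (f x) => [d y /fsur[x' [dx' <-]]|y z [u [Qu <-]] [v [Qv <-]]].
  by exists x'; split=> //; apply: (Qd) dx'.
by exists (u + v); split; [apply: (QD)|rewrite linearD].
Qed.

End WeaklyGraded.

(** * Koszul cocycles and coboundaries *)

Section KoszulCochains.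
Variables (A : comNzRingType) (zs zt : A).

(* Koszul cochains of M with respect to (zs, zt) are pairs of elements of M, of which
   only degree 1 uses the second component and degrees above 2 use none. *)
Definition kcocycle (M : lmodType A) (a : nat) (c : M * M) : Prop :=
  match a with
  | 0 => [/\ zs *: c.1 = 0, zt *: c.1 = 0 & c.2 = 0]
  | 1 => zs *: c.2 = zt *: c.1
  | 2 => c.2 = 0
  | _ => c = 0
  end.

Definition kcoboundary (M : lmodType A) (a : nat) (c : M * M) : Prop :=
  match a with
  | 0 => c = 0
  | 1 => exists m, c = (zs *: m, zt *: m)
  | 2 => exists m n, c = (zs *: n - zt *: m, 0)
  | _ => c = 0
  end.

Lemma kcocycle_lin (M : lmodType A) a p (c d : M * M) :
  kcocycle a c -> kcocycle a d -> kcocycle a (p *: c + d).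
Proof.
case: a => [|[|[|a]]] /=.
- move=> [c1 c2 c3] [d1 d2 d3]; rewrite !scalerDr !scalerA ![_ * p]mulrC -!scalerA.
  by rewrite c1 c2 c3 d1 d2 d3 !scaler0 !addr0.
- by move=> c1 d1; rewrite !scalerDr !scalerA ![_ * p]mulrC -!scalerA c1 d1.
- by move=> -> ->; rewrite scaler0 addr0.
- by move=> -> ->; rewrite scaler0 addr0.
Qed.

Lemma kcoboundary_lin (M : lmodType A) a p (c d : M * M) :
  kcoboundary a c -> kcoboundary a d -> kcoboundary a (p *: c + d).
Proof.
case: a => [|[|[|a]]] /=.
- by move=> -> ->; rewrite scaler0 addr0.
- move=> [m ->] [m' ->]; exists (p *: m + m'); congr pair;
    by rewrite /= [in RHS]scalerDr !scalerA [_ * p]mulrC.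
- move=> [m [n ->]] [m' [n' ->]]; exists (p *: m + m'), (p *: n + n').
  congr pair; rewrite /= ?scaler0 ?addr0 //.
  rewrite [zs *: (_ + _)]scalerDr [zt *: (_ + _)]scalerDr !scalerA ![_ * p]mulrC.
  by rewrite opprD [in RHS]addrACA -!scalerA -scalerBr.
- by move=> -> ->; rewrite scaler0 addr0.
Qed.

Lemma kcoboundary0 (M : lmodType A) a : kcoboundary a (0 : M * M).
Proof.
case: a => [|[|[|a]]] //=; first by exists 0; rewrite !scaler0.
by exists 0, 0; rewrite !scaler0 subrr.
Qed.

Lemma kcocycle0 (M : lmodType A) a : kcocycle a (0 : M * M).
Proof. by case: a => [|[|[|a]]] //=; rewrite !scaler0. Qed.

Lemma kcoboundaryZ (M : lmodType A) a p (c : M * M) : kcoboundary a c -> kcoboundary a (p *: c).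
Proof. by move=> /(kcoboundary_lin p) /(_ (kcoboundary0 M a)); rewrite addr0. Qed.

Lemma kcoboundaryD (M : lmodType A) a (c d : M * M) :
  kcoboundary a c -> kcoboundary a d -> kcoboundary a (c + d).
Proof. by move=> /(kcoboundary_lin 1) /[apply]; rewrite scale1r. Qed.

Lemma kcoboundaryN (M : lmodType A) a (c : M * M) : kcoboundary a c -> kcoboundary a (- c).
Proof. by move=> /(kcoboundaryZ (-1)); rewrite scaleN1r. Qed.

Lemma kcoboundaryB (M : lmodType A) a (c d : M * M) :
  kcoboundary a c -> kcoboundary a d -> kcoboundary a (c - d).
Proof. by move=> ? ?; apply: kcoboundaryD => //; apply: kcoboundaryN. Qed.

Lemma kcocycleZ (M : lmodType A) a p (c : M * M) : kcocycle a c -> kcocycle a (p *: c).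
Proof. by move=> /(kcocycle_lin p) /(_ (kcocycle0 M a)); rewrite addr0. Qed.

Lemma kcocycleD (M : lmodType A) a (c d : M * M) :
  kcocycle a c -> kcocycle a d -> kcocycle a (c + d).
Proof. by move=> /(kcocycle_lin 1) /[apply]; rewrite scale1r. Qed.

Lemma kcocycleB (M : lmodType A) a (c d : M * M) :
  kcocycle a c -> kcocycle a d -> kcocycle a (c - d).
Proof. by move=> zc /(kcocycle_lin (-1)) /(_ zc); rewrite scaleN1r addrC. Qed.

Lemma kcoboundary_cocycle (M : lmodType A) a (c : M * M) : kcoboundary a c -> kcocycle a c.
Proof.
case: a => [|[|[|a]]] //=.
- by move=> -> /=; rewrite !scaler0.
- by move=> [m ->] /=; rewrite !scalerA mulrC.
- by move=> [m [n ->]].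
Qed.

Definition kmap (M N : lmodType A) (f : M -> N) (c : M * M) : N * N := (f c.1, f c.2).

Lemma kmap_cocycle (M N : lmodType A) (f : {linear M -> N}) a c :
  kcocycle a c -> kcocycle a (kmap f c).
Proof.
case: a c => [|[|[|a]]] [x y] /=.
- by move=> [x1 x2 ->]; rewrite -!linearZ x1 x2 !linear0.
- by move=> xy; rewrite -!linearZ xy.
- by move=> ->; rewrite linear0.
- by move=> [-> ->]; rewrite /kmap /= !linear0.
Qed.

Lemma kmap_coboundary (M N : lmodType A) (f : {linear M -> N}) a c :
  kcoboundary a c -> kcoboundary a (kmap f c).
Proof.
case: a c => [|[|[|a]]] [x y] /=.
- by move=> [-> ->]; rewrite /kmap /= !linear0.
- by move=> [m [-> ->]]; exists (f m); rewrite /kmap /= !linearZ.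
- move=> [m [n [-> ->]]]; exists (f m), (f n).
  by rewrite /kmap /= linearB !linearZ linear0.
- by move=> [-> ->]; rewrite /kmap /= !linear0.
Qed.

(** Contraction against the first basis vector is a null homotopy for multiplication by [zs]. *)
Lemma zs_kcoboundary (M : lmodType A) a (c : M * M) :
  kcocycle a c -> kcoboundary a (zs *: c).
Proof.
case: a c => [|[|[|a]]] [x y] /=.
- by move=> [x1 x2 ->]; congr pair; rewrite /= ?scaler0.
- by move=> xy; exists x; congr pair.
- by move=> ->; exists 0, x; congr pair; rewrite /= ?scaler0 ?subr0.
- by move=> ->; rewrite scaler0.
Qed.

Lemma zt_kcoboundary (M : lmodType A) a (c : M * M) :
  kcocycle a c -> kcoboundary a (zt *: c).
Proof.
case: a c => [|[|[|a]]] [x y] /=.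
- by move=> [x1 x2 ->]; congr pair; rewrite /= ?scaler0.
- by move=> xy; exists y; congr pair; rewrite /= xy.
- move=> ->; exists (- x), 0; congr pair; rewrite /= ?scaler0 //.
  by rewrite scalerN opprK add0r.
- by move=> ->; rewrite scaler0.
Qed.

Lemma ideal_kcoboundary (M : lmodType A) a (c : M * M) u v :
  kcocycle a c -> kcoboundary a ((zs * u + zt * v) *: c).
Proof.
move=> zc; rewrite scalerDl ![_ * u]mulrC ![_ * v]mulrC -!scalerA.
by apply: kcoboundaryD; apply: kcoboundaryZ;
  [apply: zs_kcoboundary|apply: zt_kcoboundary].
Qed.

End KoszulCochains.

Section DiagonalAction.
Variable k : fieldType.

(** The left and right copies of r have the same image under [mult], so they differ by an element of
    the ideal (z_s, z_t). On Koszul cohomology the two actions of R therefore agree. *)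
Lemma diag_kcoboundary (M : lmodType {mpoly k[2 + 2]}) a (c : M * M) (r : {mpoly k[2]}) :
  kcocycle (zel k ord0) (zel k ord_max) a c ->
  kcoboundary (zel k ord0) (zel k ord_max) a (lft r *: c - rgt r *: c).
Proof.
have [u [v]] := mult_ideal (lft r); rewrite mult_lft -scalerBl => ->.
exact: ideal_kcoboundary.
Qed.

End DiagonalAction.

Local Opaque zel.

Section KoszulNormalization.
Variables (A : comNzRingType) (zs zt : A) (V : lmodType A).
Implicit Types (w a b e f : A) (x y : V).

(** The matrix is that of [koszul_frame_matrix], the composite from the Koszul complex to P and
    back. It acts as the identity on cohomology because w is 1 modulo (zs, zt). *)
Lemma koszul_norm1 w a b e f x y : w - 1 = zs * a + zt * b -> zs *: y = zt *: x ->
  kcoboundary zs zt 1 ((x, y) - ((w - zt * e) *: x + (zs * e) *: y,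
                                 - (zt * f) *: x + (w + zs * f) *: y)).
Proof.
move=> /(canRL (subrK _)) -> xy; exists (- (a *: x + b *: y)).
have zx p : (zs * p) *: y = (zt * p) *: x.
  by rewrite [zs * p]mulrC [zt * p]mulrC -!scalerA xy.
congr pair; rewrite /= scalerN scalerDr !scalerA.
  rewrite !zx -!scalerDl -{1}[x]scale1r -scalerBl -scaleNr.
  by congr (_ *: _); ring.
rewrite -!zx scaleNr -zx -scaleNr -!scalerDl -{1}[y]scale1r -scalerBl -scaleNr.
by congr (_ *: _); ring.
Qed.

Lemma subDDK (p q : A) : p - (p + q) + q = 0. Proof. by ring. Qed.
Lemma addBDK (p q : A) : p + (q - (p + q)) = 0. Proof. by ring. Qed.

Lemma koszul_norm_id w e f :
  zs * - (zt * f) - zt * (- (zt * e) + w) = - (zt * (w - zt * e + zs * f)).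
Proof. by ring. Qed.

Lemma koszul_norm2 w a b e f x : w - 1 = zs * a + zt * b ->
  kcoboundary zs zt 2 ((x, 0) - ((w - zt * e + zs * f) *: x, 0)).
Proof.
move=> /(canRL (subrK _)) ->; exists ((b - e) *: x), (- ((a + f) *: x)).
congr pair; rewrite /= ?subrr // scalerN !scalerA -opprD -scalerDl -!scaleNr -{1}[x]scale1r -scalerDl.
by congr (_ *: _); ring.
Qed.

End KoszulNormalization.

(** * Ext over R^e as Koszul cohomology *)

Section KoszulExt.
Variable k : fieldType.
Local Notation A := {mpoly k[2 + 2]}.
Local Notation gmod := (gmod k (2 + 2)).
Local Notation Asft e := (gshift (- e) (greg k (2 + 2))).
Local Notation zs := (zel k ord0).
Local Notation zt := (zel k ord_max).
Local Notation KZ := (kcocycle zs zt).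
Local Notation KB := (kcoboundary zs zt).
Variables (P : resolution (gdiag k 2)) (K : koszul_frame P).

(** A chain endomorphism of the Koszul complex that multiplies by w in degree 0 differs from w in
    degree 1 by syzygies of (zs, zt); these are multiples of a single one, whence the two parameters
    e and f. *)
Lemma koszul_frame_matrix : exists e f,
  [/\ (kus K (kqs K) : A) = (ku0 K (kq0 K) : A) - zt * e, (kut K (kqs K) : A) = zs * e,
      (kus K (kqt K) : A) = - (zt * f), (kut K (kqt K) : A) = (ku0 K (kq0 K) : A) + zs * f
    & (ku2 K (kq2 K) : A) = (ku0 K (kq0 K) : A) - zt * e + zs * f].
Proof.
set w : A := ku0 K (kq0 K).
have Es : zs * w = zs * (kus K (kqs K) : A) + zt * (kut K (kqs K) : A).
  by rewrite -ku0_dif kqs_dif linearZ.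
have Et : zt * w = zs * (kus K (kqt K) : A) + zt * (kut K (kqt K) : A).
  by rewrite -ku0_dif kqt_dif linearZ.
have [e [e1 e2]] : exists e, (kus K (kqs K) : A) - w = - (zt * e) /\
    (kut K (kqs K) : A) = zs * e.
  by apply: koszul_exact1; rewrite mulrBr Es; apply: subDDK.
have [f [f1 f2]] : exists f, (kus K (kqt K) : A) = - (zt * f) /\
    (kut K (kqt K) : A) - w = zs * f.
  by apply: koszul_exact1; rewrite mulrBr Et; apply: addBDK.
exists e, f; split=> //.
- by rewrite -[LHS](subrK w) e1 addrC.
- by rewrite -[LHS](subrK w) f2 addrC.
apply: (mulfI (zel_neq0 k ord_max)); apply: oppr_inj; rewrite -kus_dif kq2_dif.
rewrite linearB !linearZ /=.
rewrite [LHS](_ : _ = zs * (kus K (kqt K) : A) - zt * (kus K (kqs K) : A)); last first.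
  exact: (congr1 (+%R (zs * (kus K (kqt K) : A))) (scalerN zt (kus K (kqs K)))).
by rewrite f1 (canRL (subrK _) e1); apply: koszul_norm_id.
Qed.

Section OneModule.
Variable M : gmod.
Local Notation Z a := (gsub (cocycle (hom_cplx P M) a)).

Definition hfun a (z : Z a) : P a -> M := sub_val (sub_val z : ghom (P a) M).

Lemma hfun_homM a (z : Z a) : homM (P a) M (hfun z).
Proof. exact: (elimT (submod_predP (homM _ _) _) (sub_valP (sub_val z : ghom (P a) M))). Qed.

Lemma hfun_linear a (z : Z a) : linear (hfun z).
Proof. exact: (homM_linear (sub_val z : ghom (P a) M)). Qed.

Lemma hfunD a (z : Z a) x y : hfun z (x + y) = hfun z x + hfun z y.
Proof. by rewrite -[x]scale1r hfun_linear !scale1r. Qed.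

Lemma hfun0 a (z : Z a) : hfun z 0 = 0.
Proof. by apply: (addrI (hfun z 0)); rewrite -hfunD !addr0. Qed.

Lemma hfunZ a (z : Z a) p x : hfun z (p *: x) = p *: hfun z x.
Proof. by rewrite -[p *: x]addr0 hfun_linear hfun0 addr0. Qed.

Lemma hfunN a (z : Z a) x : hfun z (- x) = - hfun z x.
Proof. by rewrite -scaleN1r hfunZ scaleN1r. Qed.

Lemma hfun_dif a (z : Z a) x : hfun z (rdif P a x) = 0.
Proof.
have /submod_predP E := sub_valP z.
exact: (congr1 (fun f : ghom (P a.+1) M => sub_val f x) E).
Qed.

Lemma hfun_make a (f : P a -> M) : homM (P a) M f -> (forall x, f (rdif P a x) = 0) ->
  exists z : Z a, hfun z = f.
Proof.
move=> hf fd; have hP : f \in submod_pred (homM (P a) M) by apply/submod_predP.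
have zP : (Sub_ hP : hom_cplx P M a) \in submod_pred (cocycle (hom_cplx P M) a).
  by apply/submod_predP; apply: val_inj; apply: functional_extensionality_dep.
by exists (Sub_ zP).
Qed.

Lemma hfun_coboundary a (z : Z a.+1) : coboundary (hom_cplx P M) a.+1 z <->
  exists g, homM (P a) M g /\ hfun z = g \o rdif P a.
Proof.
split=> [[g gE]|[g [hg gE]]].
  exists (sub_val (g : ghom (P a) M)); split.
    exact: (elimT (submod_predP (homM _ _) _) (sub_valP (g : ghom (P a) M))).
  exact: (congr1 (fun f : ghom (P a.+1) M => sub_val f) gE).
have hP : g \in submod_pred (homM (P a) M) by apply/submod_predP.
by exists (Sub_ hP); apply: val_inj.
Qed.

Lemma hfun_coboundary0 (z : Z 0) : coboundary (hom_cplx P M) 0 z <-> forall x, hfun z x = 0.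
Proof.
split=> [z0 x|z0]; first exact: (congr1 (fun f : ghom (P 0) M => sub_val f x) z0).
by apply: val_inj; apply: functional_extensionality_dep.
Qed.

(* The Koszul cochain of a cochain of P, pulled back along the q's. *)
Definition kev (a : nat) : (P a -> M) -> M * M :=
  match a with
  | 0 => fun f => (f (kq0 K), 0)
  | 1 => fun f => (f (kqs K), f (kqt K))
  | 2 => fun f => (f (kq2 K), 0)
  | _ => fun f => 0
  end.

Lemma kev_cocycle a (z : Z a) : KZ a (kev (hfun z)).
Proof.
case: a z => [|[|[|a]]] z //=.
- by split=> //; rewrite -hfunZ -?kqs_dif -?kqt_dif hfun_dif.
apply/eqP; rewrite -subr_eq0 -!hfunZ -hfunN -hfunD -kq2_dif hfun_dif.
exact: eqxx.
Qed.

Lemma homM_ext a (f g : P a -> M) : f =1 g -> homM (P a) M f -> homM (P a) M g.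
Proof. by move=> fg; have -> : f = g by apply: functional_extensionality_dep. Qed.

Lemma homM_lin a p (f g : P a -> M) :
  homM (P a) M f -> homM (P a) M g -> homM (P a) M (fun x => p *: f x + g x).
Proof. exact: (@span_lin _ _ _ p). Qed.

Lemma homMD a (f g : P a -> M) :
  homM (P a) M f -> homM (P a) M g -> homM (P a) M (fun x => f x + g x).
Proof.
by move=> hf /(homM_lin 1 hf); apply: homM_ext => x; rewrite scale1r.
Qed.

Lemma functional_hom_deg a e l (u : gmor (P a) (Asft e)) (m : M) : wgraded M ->
  gdeg (l + e) m -> hom_deg l (fun x => (u x : A) *: m).
Proof.
move=> gM dm; split=> [p x y|d x dx]; first exact: functional_lin.
rewrite (_ : d + l = d - e + (l + e)); last by rewrite addrACA addNr addr0.
apply: wgdegZ => //; exact: (gmorP u dx).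
Qed.

Lemma functional_homM a e (u : gmor (P a) (Asft e)) (m : M) : wgraded M ->
  homM (P a) M (fun x => (u x : A) *: m).
Proof.
move=> gM; elim/(wgdeg_ind gM): m => [d m dm|m n hm hn].
  apply: span_gen; exists (d - e); apply: functional_hom_deg => //.
  by rewrite subrK.
by apply: homM_ext (homMD hm hn) => x; rewrite scalerDr.
Qed.

(** The cocycle is applied to the formula of [koszul_homotopy]: the last term dies, the middle one
    is a coboundary, and the round trip contributes the Koszul values of z multiplied by the
    functionals of the frame. *)
Lemma kev_inj a (z : Z a) : wgraded M -> KB a (kev (hfun z)) ->
  coboundary (hom_cplx P M) a z.
Proof.
move=> gM; case: a z => [|a] z.
  move=> /= -[q0]; apply/hfun_coboundary0 => x; have [h hE] := koszul_homotopy0 K.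
  by rewrite [x]hE hfunD hfun_dif koszul_proj0 hfunZ q0 scaler0 addr0.
have [g [h hE]] := koszul_homotopy K a.
have zE x : hfun z x = hfun z (koszul_proj K a.+1 x) + hfun z (g (rdif P a x)).
  by rewrite {1}[x]hE !hfunD hfun_dif addr0.
move=> kz; apply/hfun_coboundary; have hg := pre_hom g (hfun_homM z).
case: a z g h hE zE kz hg => [|[|a]] z g h hE zE.
- move=> [m [qs qt]] hg; exists (fun x => (ku0 K x : A) *: m + hfun z (g x)); split.
    by apply: homMD => //; apply: functional_homM.
  apply: functional_extensionality_dep => x; rewrite zE koszul_proj1 /=.
  by rewrite hfunD !hfunZ qs qt !scalerA -scalerDl ku0_dif ![_ * zel _ _]mulrC.
- move=> [m [n [q2]]] hg.
  exists (fun x => (kut K x : A) *: n + ((kus K x : A) *: m + hfun z (g x))); split.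
    by do 2! [apply: homMD => //; first exact: functional_homM].
  apply: functional_extensionality_dep => x; rewrite zE koszul_proj2 /=.
  rewrite hfunZ q2 scalerBr !scalerA kus_dif kut_dif addrA scaleNr.
  by rewrite ![_ * zel _ _]mulrC.
- move=> _ hg; exists (fun x => hfun z (g x)); split=> //.
  by apply: functional_extensionality_dep => x; rewrite zE koszul_projS hfun0 add0r.
Qed.

Lemma kev_coboundary a (z : Z a) : coboundary (hom_cplx P M) a z -> KB a (kev (hfun z)).
Proof.
case: a z => [|a] z.
  by move/hfun_coboundary0 => z0; rewrite /= z0.
move/hfun_coboundary => [g [hg ->]].
have gl : linear g by exact: (homM_linear (Sub_ (introT (submod_predP (homM _ _) _) hg))).
have g0 : g 0 = 0 by have := gl (-1) 0 0; rewrite scaler0 addr0 scaleN1r addNr.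
have gZ p x : g (p *: x) = p *: g x by rewrite -[p *: x]addr0 gl g0 addr0.
have gB x y : g (x - y) = g x - g y.
  by rewrite addrC -scaleN1r gl scaleN1r addrC.
case: a z g hg gl g0 gZ gB => [|[|a]] z g hg gl g0 gZ gB //=.
- by exists (g (kq0 K)); rewrite kqs_dif kqt_dif !gZ.
- by exists (g (kqs K)), (g (kqt K)); rewrite kq2_dif gB !gZ.
Qed.

(** The Koszul cocycle is pulled back along the functionals of the frame; evaluating the result on
    the elements of the frame returns c up to a coboundary. *)
Lemma kev_surj_fun a c : wgraded M -> KZ a c -> exists f : P a -> M,
  [/\ homM (P a) M f, forall x, f (rdif P a x) = 0, KB a (c - kev f) &
      forall l, gdeg (l + (2 * a)%:Z) c.1 -> gdeg (l + (2 * a)%:Z) c.2 -> hom_deg l f].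
Proof.
move=> gM; have [u [v uv]] := kq0_norm K.
have [e [f [e1 e2 e3 e4 e5]]] := koszul_frame_matrix.
case: a c => [|[|[|a]]] [x y].
- move=> /= [x1 x2 y0]; exists (fun p => (ku0 K p : A) *: x); split.
  + exact: functional_homM.
  + move=> p; rewrite ku0_dif scalerDl ![zel _ _ * _]mulrC -!scalerA x1 x2.
    by rewrite !scaler0 addr0.
  + congr pair; rewrite /= ?y0 ?subr0 //; apply/eqP; rewrite subr_eq0 -subr_eq0 -opprB oppr_eq0.
    rewrite -{2}[x]scale1r -scalerBl uv scalerDl ![zel _ _ * _]mulrC -!scalerA x1 x2.
    by rewrite !scaler0 addr0.
  + by move=> l dx _; apply: functional_hom_deg.
- move=> /= xy; exists (fun p => (kus K p : A) *: x + (kut K p : A) *: y); split.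
  + by apply: homMD; apply: functional_homM.
  + move=> p; rewrite kus_dif kut_dif scaleNr ![zel _ _ * _]mulrC -!scalerA xy.
    exact: addNr.
  + by rewrite /kev e1 e2 e3 e4; apply: koszul_norm1 uv xy.
  + move=> l dx dy; have [f1 d1] := functional_hom_deg (kus K) gM dx.
    have [f2 d2] := functional_hom_deg (kut K) gM dy; split=> [p q r|d q dq].
      by rewrite f1 f2 scalerDr addrACA.
    by apply: wgdegD => //; [apply: d1|apply: d2].
- move=> /= y0; exists (fun p => (ku2 K p : A) *: x); split.
  + exact: functional_homM.
  + by move=> p; rewrite ku2_dif scale0r.
  + by rewrite /kev e5 y0; apply: koszul_norm2 uv.
  + by move=> l dx _; apply: functional_hom_deg.
- move=> /= [-> ->]; exists (fun _ => 0); split=> //.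
  + exact: span0.
  + by rewrite subr0.
  + by move=> l _ _; split=> [p q r|d q _]; [rewrite scaler0 addr0|apply: wgdeg0].
Qed.

End OneModule.
End KoszulExt.

(** * Graded isomorphisms from linear relations *)

Section LinearRelation.
Variables (k : fieldType) (n : nat) (M N : gmod k n) (rel : M -> N -> Prop).

(** A class in Ext has many Koszul representatives, so the correspondence with N is first a
    relation; the two maps are extracted from it by choice. *)
Lemma giso_relation :
  (forall a x x' y y', rel x y -> rel x' y' -> rel (a *: x + x') (a *: y + y')) ->
  (forall x, exists y, rel x y) -> (forall y, exists x, rel x y) ->
  (forall d x, gdeg d x -> exists y, gdeg d y /\ rel x y) ->
  (forall d y, gdeg d y -> exists x, gdeg d x /\ rel x y) ->
  (forall x, rel x 0 -> x = 0) -> (forall y, rel 0 y -> y = 0) -> giso M N.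
Proof.
move=> lin /choice[f fP] /choice[g gP] fd gd rel0 rel0'.
have uniq_r x y y' : rel x y -> rel x y' -> y = y'.
  move=> xy xy'; apply/eqP; rewrite -subr_eq0; apply/eqP/rel0'.
  by have := lin (-1) _ _ _ _ xy' xy; rewrite !scaleN1r addNr addrC.
have uniq_l x x' y : rel x y -> rel x' y -> x = x'.
  move=> xy xy'; apply/eqP; rewrite -subr_eq0; apply/eqP/rel0.
  by have := lin (-1) _ _ _ _ xy' xy; rewrite !scaleN1r addNr addrC.
have fl : linear f by move=> a x y; apply: uniq_r (fP _) _; apply: lin.
have gl : linear g by move=> a x y; apply: uniq_l (gP _) _; apply: lin.
have fdeg d x : gdeg d x -> gdeg d (f x).
  by move=> /fd[y [dy xy]]; rewrite (uniq_r _ _ _ (fP x) xy).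
have gdeg d y : gdeg d y -> gdeg d (g y).
  by move=> /gd[x [dx xy]]; rewrite (uniq_l _ _ _ (gP y) xy).
exists (mkgmor fl fdeg), (mkgmor gl gdeg); split=> [x|y].
  exact: uniq_l (gP (f x)) (fP x).
exact: uniq_r (fP (g y)) (gP y).
Qed.

End LinearRelation.

Lemma pair_ext (T U : Type) (p q : T * U) : p.1 = q.1 -> p.2 = q.2 -> p = q.
Proof. by case: p q => ? ? [? ?] /= -> ->. Qed.

Section Predecessor.
Variables (k : fieldType) (n : nat).

(** C^(j-1), with C^(-1) = 0, so that cones and total complexes can be written with the single index
    j. *)
Definition pre (C : nat -> gmod k n) (j : nat) : gmod k n :=
  if j is i.+1 then C i else gzero k n.

Definition dprev (C : cplx k n) (j : nat) : {linear pre C j -> C j} :=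
  match j with
  | 0 => \0
  | i.+1 => cdif C i
  end.

End Predecessor.

(** * Presentations of the cohomology of a complex of Koszul cohomologies *)

Section Presentation.
Variable k : fieldType.
Local Notation A := {mpoly k[2 + 2]}.
Local Notation zs := (zel k ord0).
Local Notation zt := (zel k ord_max).
Local Notation KZ := (kcocycle zs zt).
Local Notation KB := (kcoboundary zs zt).

Definition kdeg (M : gmod k (2 + 2)) (a : nat) (l : int) (c : M * M) : Prop :=
  gdeg (l + (2 * a)%:Z) c.1 /\ gdeg (l + (2 * a)%:Z) c.2.

(* Koszul cochains c of C^j representing a cocycle, resp. a coboundary, of the
   complex of the a-th Koszul cohomologies of C. *)
Definition hcocycle (C : cplx k (2 + 2)) a j (c : C j * C j) : Prop :=
  KZ a c /\ KB a (kmap (cdif C j) c).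

Definition hcoboundary (C : cplx k (2 + 2)) a j (c : C j * C j) : Prop :=
  exists b : pre C j * pre C j, KZ a b /\ KB a (c - kmap (dprev C j) b).

(** Linearity is asked for the left action, which is the simpler one in the models below; on
    cocycles the right action used by [HHH] follows from [diag_kcoboundary]. Surjectivity is asked
    degree by degree to make the isomorphism graded. *)
Record hpresentation (C : cplx k (2 + 2)) (a j : nat) (N : gmod k 2) := HPresentation {
  hpres :> C j * C j -> N;
  hpres_lin : forall r c c', hpres (lft r *: c + c') = r *: hpres c + hpres c';
  hpres_deg : forall l c, kdeg a l c -> gdeg l (hpres c);
  hpres_ker : forall c, hcocycle a c -> hpres c = 0 -> hcoboundary a c;
  hpres_bnd : forall c, hcocycle a c -> hcoboundary a c -> hpres c = 0;
  hpres_surj : forall l y, gdeg l y ->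
    exists c, [/\ kdeg a l c, hcocycle a c & hpres c = y] }.

Variables (P : resolution (gdiag k 2)) (K : koszul_frame P).

Section Representation.
Variables (M : gmod k (2 + 2)) (a : nat).

Definition represents (xi : gext P a M) (c : M * M) : Prop :=
  KZ a c /\ exists z, xi = qpi (coboundary (hom_cplx P M) a) z /\
    KB a (c - kev K (hfun z)).

Lemma kevP p (f g h : P a -> M) : (forall x, h x = p *: f x + g x) ->
  kev K h = p *: kev K f + kev K g.
Proof.
move: f g h; rewrite /kev.
case: a => [|[|[|b]]] f g h hE /=; rewrite ?hE; congr pair;
  by rewrite /= ?scaler0 ?addr0.
Qed.

Lemma hfun_comb p (z z' : gsub (cocycle (hom_cplx P M) a)) x :
  hfun (p *: z + z') x = p *: hfun z x + hfun z' x.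
Proof.
have E (V : lmodType A) (S : submod V) (u v : sub S) :
    sub_val (p *: u + v) = p *: sub_val u + sub_val v by exact: (linearP val).
rewrite /hfun (E _ _ z z').
by rewrite (E _ _ (sub_val z : ghom (P a) M) (sub_val z' : ghom (P a) M)).
Qed.

Lemma represents_lin p xi xi' c c' : represents xi c -> represents xi' c' ->
  represents (p *: xi + xi') (p *: c + c').
Proof.
move=> [zc [z [-> kz]]] [zc' [z' [-> kz']]]; split; first exact: kcocycle_lin.
exists (p *: z + z'); split; first by rewrite linearP.
have -> : kev K (hfun (p *: z + z')) = p *: kev K (hfun z) + kev K (hfun z').
  by apply: kevP; apply: hfun_comb.
rewrite opprD addrACA -scalerBr.
exact: kcoboundary_lin.
Qed.

Lemma represents_total xi : exists c, represents xi c.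
Proof.
rewrite -[xi]qpiE; exists (kev K (hfun (repr xi))); split; first exact: kev_cocycle.
by exists (repr xi); split=> //; rewrite subrr; apply: kcoboundary0.
Qed.

Lemma represents_deg l xi : wgraded M -> gdeg l xi ->
  exists c, kdeg a l c /\ represents xi c.
Proof.
move=> gM [z zd ->]; exists (kev K (hfun z)); split; last first.
  split; first exact: kev_cocycle.
  by exists z; split=> //; rewrite subrr; apply: kcoboundary0.
have {}zd : hom_deg l (hfun z) by [].
move: (hfun z) zd => f [_ fd]; rewrite /kdeg addrC.
case: a f fd => [|[|[|b]]] f fd /=; split;
  try exact: (wgdeg0 gM); apply: fd;
  [exact: kq0_deg|exact: kqs_deg|exact: kqt_deg|exact: kq2_deg].
Qed.

Lemma represents_eq0 xi c : wgraded M -> represents xi c -> xi = 0 <-> KB a c.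
Proof.
move=> gM [zc [z [-> kz]]]; split=> [z0|kc].
  have /kev_coboundary : coboundary (hom_cplx P M) a z.
    by rewrite -[z]subr0; apply/qpi_eq; rewrite z0 linear0.
  by move=> /(_ K) /(kcoboundaryD kz); rewrite subrK.
rewrite -(linear0 (qpi (coboundary (hom_cplx P M) a))); apply/qpi_eq; rewrite subr0.
apply: (kev_inj (K := K)) => //; rewrite -[kev _ _](subKr c).
exact: kcoboundaryB.
Qed.

Lemma represents_surj c : wgraded M -> KZ a c ->
  exists xi, represents xi c /\ forall l, kdeg a l c -> gdeg l xi.
Proof.
move=> gM zc; have [f [hf fd kf fdeg]] := kev_surj_fun K gM zc.
have [z zE] := hfun_make hf fd; exists (qpi (coboundary (hom_cplx P M) a) z); split.
  by split=> //; exists z; split=> //; rewrite zE.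
by move=> l [d1 d2]; exists z => //; rewrite -[gdeg _ _]/(hom_deg l (hfun z)) zE; apply: fdeg.
Qed.

End Representation.

Lemma represents_map (M N : gmod k (2 + 2)) (f : gmor M N) a xi c :
  represents xi c -> @represents N a (gext_map P a f xi) (kmap f c).
Proof.
move=> [zc [z [-> kz]]]; split; first exact: kmap_cocycle.
exists (cocycle_map (@cmap_cocycle _ _ _ _ (hom_cplx_map P f) a) z); split.
  exact: coh_funE.
suff -> : kmap f c - kev K (f \o hfun z) = kmap f (c - kev K (hfun z)).
  exact: kmap_coboundary.
rewrite /kev; case: a xi z {zc kz} => [|[|[|b]]] xi z; apply: (@pair_ext N N);
  by rewrite /= ?(linearB f) ?(linear0 f) ?subr0 ?subr0.
Qed.

Section Criterion.
Variables (C : cplx k (2 + 2)) (a j : nat) (N : gmod k 2).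
Hypothesis gC : forall j, wgraded (C j).
Hypothesis gN : wgraded N.
Variable phi : hpresentation C a j N.

Let X := gext_cplx P a C.

Lemma ext_cocycle (xi : X j) c : represents xi c ->
  cdif X j xi = 0 <-> KB a (kmap (cdif C j) c).
Proof. by move=> /(represents_map (cdif C j)) /(represents_eq0 (gC j.+1)). Qed.

Lemma ext_coboundary (xi : X j) c : represents xi c ->
  is_coboundary xi <-> hcoboundary a c.
Proof.
move: xi c; rewrite /hcoboundary /X; move: (gC); case: j => [|i] /= gC' xi c xic.
  rewrite (represents_eq0 (gC' 0) xic); split=> [kc|[b [zb]]].
    exists 0; split; first exact: kcocycle0.
    by rewrite (_ : kmap _ _ = 0) ?subr0.
  by rewrite (_ : kmap _ _ = 0) ?subr0.
have rb (y : gext P a (C i)) b : represents y b ->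
    xi = gext_map P a (cdif C i) y <-> KB a (c - kmap (cdif C i) b).
  move=> /(represents_map (cdif C i)) /represents_lin - /(_ (-1) xi c xic).
  rewrite !scaleN1r ![- _ + _]addrC => /(represents_eq0 (gC' i.+1)) <-.
  by split=> [->|/eqP]; [rewrite subrr|rewrite subr_eq0 => /eqP].
split=> [[y yE]|[b [zb kb]]].
  have [b yb] := represents_total y; exists b; split; first by case: yb.
  exact: (iffLR (rb y b yb)).
have [y [yb _]] := represents_surj (gC' i) zb; exists y.
exact: (iffRL (rb y b yb)).
Qed.

Lemma hcoboundary_KB c : KB a c -> @hcoboundary C a j c.
Proof.
move=> kc; exists 0; split; first exact: kcocycle0.
by rewrite (_ : kmap _ _ = 0) ?subr0 //; apply: (@pair_ext (C j) (C j)); apply: linear0.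
Qed.

Lemma hcocycle_KB c : KB a c -> @hcocycle C a j c.
Proof. by move=> kc; split; [apply: kcoboundary_cocycle|apply: kmap_coboundary]. Qed.

Lemma hpresD c c' : phi (c + c') = phi c + phi c'.
Proof. by have := hpres_lin phi 1 c c'; rewrite rmorph1 !scale1r. Qed.

Lemma hpres_rgt r c : KZ a c -> phi (rgt r *: c) = r *: phi c.
Proof.
move=> zc; have kd := diag_kcoboundary r zc.
have d0 := hpres_bnd phi (hcocycle_KB kd) (hcoboundary_KB kd).
have phi0 : phi 0 = 0 by apply: (addrI (phi 0)); rewrite -hpresD !addr0.
have := hpresD (lft r *: c - rgt r *: c) (rgt r *: c); rewrite subrK d0 add0r => <-.
by have := hpres_lin phi r c 0; rewrite phi0 !addr0.
Qed.

Definition hrel (eta : gright (coh X j)) (y : N) : Prop :=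
  exists (zeta : gsub (cocycle X j)) c, [/\ eta = qpi (coboundary X j) zeta,
    represents (sub_val zeta : gext P a (C j)) c & phi c = y].

Lemma sub_val_cocycle (zeta : gsub (cocycle X j)) : cdif X j (sub_val zeta) = 0.
Proof. by have /submod_predP := sub_valP zeta. Qed.

Theorem hpresentation_giso : giso (gright (coh X j)) N.
Proof.
have tot l eta : gdeg l eta -> exists y, gdeg l y /\ hrel eta y.
  move=> [zeta zd ->]; have [c [cd zc]] := represents_deg (gC j) zd.
  by exists (phi c); split; [apply: hpres_deg|exists zeta, c].
have surj l y : gdeg l y -> exists eta, gdeg l eta /\ hrel eta y.
  move=> /(hpres_surj phi)[c [cd [zc kc] cy]].
  have [xi [xic xid]] := represents_surj (gC j) zc.
  have xiP : (xi : X j) \in submod_pred (cocycle X j).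
    by apply/submod_predP/(ext_cocycle xic).
  exists (qpi (coboundary X j) (Sub_ xiP)); split; last by exists (Sub_ xiP), c.
  by exists (Sub_ xiP) => //; apply: xid.
have lin r eta eta' y y' : hrel eta y -> hrel eta' y' ->
    hrel (r *: eta + eta') (r *: y + y').
  move=> [z [c [-> zc <-]]] [z' [c' [-> zc' <-]]].
  exists (rgt r *: z + z'), (rgt r *: c + c'); split.
  - by rewrite linearP.
  - exact: represents_lin.
  - by rewrite hpresD hpres_rgt //; case: zc.
apply: (@giso_relation k 2 _ _ hrel) => //.
- move=> eta; have [c zc] := represents_total (sub_val (repr eta) : gext P a (C j)).
  by exists (phi c), (repr eta), c; split=> //; rewrite qpiE.
- move=> y; elim/(wgdeg_ind gN): y => [d y /surj[eta [_ ey]]|y y' [e ey] [e' ey']].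
    by exists eta.
  by exists (1 *: e + e'); rewrite -[y]scale1r; apply: lin.
- move=> eta [z [c [-> zc c0]]]; rewrite -(linear0 (qpi (coboundary X j))).
  apply/qpi_eq; rewrite subr0; apply/(ext_coboundary zc)/(hpres_ker _ c0).
  split; first by case: zc.
  by apply/(ext_cocycle zc)/sub_val_cocycle.
- move=> y [z [c [/esym z0 zc <-]]]; apply: hpres_bnd.
    split; first by case: zc.
    by apply/(ext_cocycle zc)/sub_val_cocycle.
  apply/(ext_coboundary zc).
  have : coboundary X j (z - 0) by apply/qpi_eq; rewrite linear0.
  by rewrite subr0.
Qed.
End Criterion.
End Presentation.

(* A[e] / (e^2 - y^2), the pair (a, b) being a + b e. *)
Definition xring (A : comNzRingType) (y : A) : Type := (A * A)%type.

Definition xmod (A : comNzRingType) (y : A) (V : lmodType A) : Type := (V * V)%type.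

(** * Quadratic extensions of R^e and their modules *)

Section QuadraticExtension.
Variables (A : comNzRingType) (y : A).
Local Notation xring := (xring y).
HB.instance Definition _ := GRing.Zmodule.copy xring (A * A)%type.

Definition xmul (u v : xring) : xring :=
  (u.1 * v.1 + y ^+ 2 * (u.2 * v.2), u.1 * v.2 + u.2 * v.1).
Definition xone : xring := (1, 0).

Lemma xmulA : associative xmul.
Proof. by move=> [a b] [c d] [e f]; congr pair; rewrite /=; ring. Qed.
Lemma xmulC : commutative xmul.
Proof. by move=> [a b] [c d]; congr pair; rewrite /=; ring. Qed.
Lemma xmul1 : left_id xone xmul.
Proof. by move=> [a b]; congr pair; rewrite /=; ring. Qed.
Lemma xmulDl : left_distributive xmul +%R.
Proof. by move=> [a b] [c d] [e f]; congr pair; rewrite /=; ring. Qed.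
Lemma xone_neq0 : xone != 0.
Proof. by apply/eqP => -[] /eqP; rewrite oner_eq0. Qed.
HB.instance Definition _ := GRing.Zmodule_isComNzRing.Build xring
  xmulA xmulC xmul1 xmulDl xone_neq0.

Definition xin (a : A) : xring := (a, 0).
Lemma xin_additive : zmod_morphism xin.
Proof. by move=> a b; congr pair; rewrite /= subr0. Qed.
HB.instance Definition _ := GRing.isZmodMorphism.Build A xring xin xin_additive.
Lemma xin_multiplicative : monoid_morphism xin.
Proof. by split=> // a b; congr pair; rewrite /=; ring. Qed.
HB.instance Definition _ := GRing.isMonoidMorphism.Build A xring xin xin_multiplicative.

(** The evaluation of e at y, with [xevN] the one at -y; comparing the two detects invariance under
    the reflection. *)
Definition xev (u : xring) : A := u.1 + u.2 * y.
Lemma xev_additive : zmod_morphism xev.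
Proof. by move=> [a b] [c d]; rewrite /xev /=; ring. Qed.
HB.instance Definition _ := GRing.isZmodMorphism.Build xring A xev xev_additive.
Lemma xev_multiplicative : monoid_morphism xev.
Proof. by split=> [|[a b] [c d]]; rewrite /xev /=; ring. Qed.
HB.instance Definition _ := GRing.isMonoidMorphism.Build xring A xev xev_multiplicative.

Definition xevN (u : xring) : A := u.1 - u.2 * y.
Lemma xevN_additive : zmod_morphism xevN.
Proof. by move=> [a b] [c d]; rewrite /xevN /=; ring. Qed.
HB.instance Definition _ := GRing.isZmodMorphism.Build xring A xevN xevN_additive.
Lemma xevN_multiplicative : monoid_morphism xevN.
Proof. by split=> [|[a b] [c d]]; rewrite /xevN /=; ring. Qed.
HB.instance Definition _ := GRing.isMonoidMorphism.Build xring A xevN xevN_multiplicative.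

Variable V : lmodType A.

Local Notation xmod := (xmod y V).
HB.instance Definition _ := GRing.Zmodule.copy xmod (V * V)%type.

Definition xscale (u : xring) (m : xmod) : xmod :=
  (u.1 *: m.1 + (y ^+ 2 * u.2) *: m.2, u.2 *: m.1 + u.1 *: m.2).

Lemma xscaleA u v m : xscale u (xscale v m) = xscale (u * v) m.
Proof.
case: u v m => [a b] [c d] [m n]; rewrite /xscale /=; congr pair.
  rewrite !scalerDr !scalerA addrACA -!scalerDl; congr (_ *: _ + _ *: _); ring.
rewrite !scalerDr !scalerA addrACA -!scalerDl; congr (_ *: _ + _ *: _); ring.
Qed.
Lemma xscale1 : left_id 1 xscale.
Proof.
by move=> [m n]; rewrite /xscale /= mulr0 !scale1r !scale0r addr0 add0r.
Qed.
Lemma xscaleDr : right_distributive xscale +%R.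
Proof.
move=> [a b] [m n] [m' n']; rewrite /xscale /=; congr pair;
  by rewrite /= !scalerDr addrACA.
Qed.
Lemma xscaleDl m : {morph xscale^~ m : u v / u + v}.
Proof.
move=> [a b] [c d]; rewrite /xscale /=; congr pair;
  by rewrite /= ?mulrDr !scalerDl addrACA.
Qed.
HB.instance Definition _ := GRing.Zmodule_isLmodule.Build xring xmod
  xscaleA xscale1 xscaleDr xscaleDl.

Lemma xscaleE (u : xring) (m : xmod) :
  u *: m = (u.1 *: m.1 + (y ^+ 2 * u.2) *: m.2, u.2 *: m.1 + u.1 *: m.2).
Proof. by []. Qed.

End QuadraticExtension.

Lemma half_identity (A : comNzRingType) (a b h : A) :
  h + h = 1 -> a + b + h * - a = b + h * a.
Proof. by move=> E; rewrite -{1}[a]mul1r -E; ring. Qed.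

(** * The action of R^e on the model of M (x) R over R^i *)

Section Model.
Variable k : fieldType.
Local Notation R := {mpoly k[2]}.
Local Notation A := {mpoly k[2 + 2]}.
Local Notation gmod := (gmod k (2 + 2)).
Variable i : 'I_2.

Definition yel : A := rgt 'X_i.
Definition half : A := (2^-1)%:MP.
Local Notation E := (xring yel).
Local Notation xin := (xin yel).

(** For j different from i, alpha_j is the invariant alpha_j + alpha_i / 2, which passes through the
    tensor sign, minus alpha_i / 2, in which alpha_i becomes e. *)
Definition rho_var (j : 'I_(2 + 2)) : E :=
  match fintype.split j with
  | inl j => (lft 'X_j, 0)
  | inr j => if j == i then (0, 1) else (rgt 'X_j + half * yel, - half)
  end.

(* Opaque on purpose: conversion must never unfold the substitution. *)
Lemma subst_sig (h : 'I_(2 + 2) -> E) : {f : {rmorphism A -> E} |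
  (forall c, f c%:MP = xin c%:MP) /\ (forall j, f 'X_j = h j)}.
Proof.
exists (mmap (xin \o @mpolyC (2 + 2) k) h); split=> [c|j].
  by rewrite [LHS]mmapC.
by rewrite [LHS]mmapX mmap1U.
Qed.

(* The action on M \otimes_(R^i) R = M + M \otimes alpha_i: the variable alpha_i on the
   right becomes e, while alpha_j + alpha_i / 2 is invariant. *)
Definition rho : {rmorphism A -> E} := sval (subst_sig rho_var).

(* The bimodule structure of the quadratic extension in which the left action is the
   right action of R on M. *)
Definition rho' : {rmorphism A -> E} := sval (subst_sig
  (fun j => match fintype.split j with
            | inl j => (rgt 'X_j, 0)
            | inr j => rho_var (rshift 2 j)
            end)).

Lemma rhoX j : rho 'X_j = rho_var j. Proof. exact: (proj2 (svalP (subst_sig _))). Qed.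
Lemma rhoC c : rho c%:MP = xin c%:MP. Proof. exact: (proj1 (svalP (subst_sig _))). Qed.
Lemma rho'C c : rho' c%:MP = xin c%:MP. Proof. exact: (proj1 (svalP (subst_sig _))). Qed.

Lemma rho'X j : rho' 'X_j = match fintype.split j with
  | inl j => (rgt 'X_j, 0) | inr j => rho_var (rshift 2 j) end.
Proof. exact: (proj2 (svalP (subst_sig _))). Qed.

Lemma rho_lftX j : rho (lft 'X_j) = xin (lft 'X_j).
Proof. by rewrite {1}lftX rhoX /rho_var (unsplitK (inl j)). Qed.

Lemma rho_rgtX j : rho (rgt 'X_j) =
  if j == i then (0, 1) else (rgt 'X_j + half * yel, - half).
Proof. by rewrite {1}rgtX rhoX /rho_var (unsplitK (inr j)). Qed.

Lemma rho_lft r : rho (lft r) = xin (lft r).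
Proof.
move: r; apply: (mpoly_rmorph_ext (f := rho \o @lft k 2) (g := xin \o @lft k 2)).
  by move=> c /=; rewrite lftC rhoC.
exact: rho_lftX.
Qed.

Lemma rho'_lft r : rho' (lft r) = xin (rgt r).
Proof.
move: r; apply: (mpoly_rmorph_ext (f := rho' \o @lft k 2) (g := xin \o @rgt k 2)).
  by move=> c /=; rewrite lftC rgtC rho'C.
by move=> j /=; rewrite lftX rho'X (unsplitK (inl j)).
Qed.

Lemma rho'_rgt r : rho' (rgt r) = rho (rgt r).
Proof.
move: r; apply: (mpoly_rmorph_ext (f := rho' \o @rgt k 2) (g := rho \o @rgt k 2)).
  by move=> c /=; rewrite rgtC rho'C rhoC.
by move=> j /=; rewrite rgtX rho'X (unsplitK (inr j)) [RHS]rhoX.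
Qed.

Lemma rho_yel : rho yel = (0, 1). Proof. by rewrite rho_rgtX eqxx. Qed.

(** Evaluating e at alpha_i undoes the substitution on the generators. This makes the multiplication
    map [mufun] linear. *)
Lemma xev_rho p : xev (rho p) = p.
Proof.
move: p; apply: (mpoly_rmorph_ext (f := @xev A yel \o rho) (g := idfun)).
  by move=> c /=; rewrite rhoC /xev /= mul0r addr0.
move=> j; rewrite /= -[j]splitK; case: (fintype.split j) => l /=; rewrite -?lftX -?rgtX.
  by rewrite rho_lftX /xev /= mul0r addr0.
rewrite rho_rgtX; case: eqP => [->|_]; rewrite /xev /= ?add0r ?mul1r //.
by rewrite mulNr addrK.
Qed.

Definition xdeg (d : int) (u : E) : Prop := pdeg d u.1 /\ pdeg (d - 2) u.2.

Lemma pdeg_eq n d e (p : {mpoly k[n]}) : d = e -> pdeg d p -> pdeg e p.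
Proof. by move=> ->. Qed.

Lemma yel_deg : pdeg 2 yel. Proof. by rewrite /yel rgtX; apply: pdegX. Qed.

Lemma pdegN n d (p : {mpoly k[n]}) : pdeg d p -> pdeg d (- p).
Proof. by move=> dp; rewrite -scaleN1r -[_ *: _]addr0; apply: pdeg_lin => //; apply: pdeg0. Qed.

Lemma xdegM d e u v : xdeg d u -> xdeg e v -> xdeg (d + e) (u * v).
Proof.
move=> [u1 u2] [v1 v2]; split; apply: pdegD.
- exact: pdegM.
- apply: pdeg_eq (pdegM (pdegM yel_deg yel_deg) (pdegM u2 v2)); lia.
- apply: pdeg_eq (pdegM u1 v2); lia.
- apply: pdeg_eq (pdegM u2 v1); lia.
Qed.

Lemma xdegD d u v : xdeg d u -> xdeg d v -> xdeg d (u + v).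
Proof. by move=> [u1 u2] [v1 v2]; split; apply: pdegD. Qed.

Lemma xdeg_in d p : pdeg d p -> xdeg d (xin p).
Proof. by move=> dp; split=> //; apply: pdeg0. Qed.

Lemma rho_varE j : xdeg 2 (rho_var j).
Proof.
have h0 : pdeg 0 (- half) by rewrite /half -mpolyCN; apply: pdegC.
rewrite /rho_var; case: (fintype.split j) => l.
  by apply: xdeg_in; rewrite lftX; apply: pdegX.
case: ifP => _; split.
- exact: pdeg0.
- by rewrite subrr /= -mpolyC1; apply: pdegC.
- apply: pdegD; first by rewrite rgtX; apply: pdegX.
  by apply: (@pdegM _ _ 0 2); [apply: pdegC|apply: yel_deg].
- by rewrite subrr.
Qed.

Lemma rho_deg d p : pdeg d p -> xdeg d (rho p).
Proof.
move=> dp; rewrite [p]mpolyE big_seq rmorph_sum /=.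
elim/big_ind: _ => [|u v|m mp]; [by apply: xdeg_in; apply: pdeg0|exact: xdegD|].
rewrite -mul_mpolyC rmorphM /= rhoC -[d]add0r; apply: xdegM.
  by apply: xdeg_in; apply: pdegC.
rewrite -(dp m mp) mpolyXE_id rmorph_prod mdegE.
elim/big_rec2: _ => [|j e u _ eu]; first by apply: xdeg_in; rewrite -mpolyC1; apply: pdegC.
rewrite mulnDr PoszD; apply: xdegM => //; rewrite rmorphXn /= rhoX.
elim: (m j) => [|n IH]; first by apply: xdeg_in; rewrite -mpolyC1; apply: pdegC.
by rewrite exprS mulnS PoszD; apply: xdegM => //; apply: rho_varE.
Qed.

Hypothesis two_neq0 : 2 != 0 :> k.

Lemma half_half : half + half = 1.
Proof.
have E : 2^-1 + 2^-1 = 1 :> k by rewrite -[2^-1]mul1r -mulrDl mulfV.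
by rewrite /half -mpolyCD E mpolyC1.
Qed.

(** At e = - alpha_i the value alpha_j + alpha_i / 2 - e / 2 becomes alpha_j + alpha_i, the
    reflection of alpha_j. *)
Lemma xevN_rho r : xevN (rho (rgt r)) = rgt (refl i r).
Proof.
move: r; apply: (mpoly_rmorph_ext (f := @xevN A yel \o (rho \o @rgt k 2))
  (g := @rgt k 2 \o comp_mpoly [tuple if j == i then - 'X_i else 'X_i + 'X_j | j < 2])).
  move=> c /=; rewrite rgtC rhoC /xevN /= mul0r subr0.
  by rewrite [comp_mpoly _ _]comp_mpolyC rgtC.
move=> j /=; rewrite rho_rgtX [comp_mpoly _ _]comp_mpolyXU -tnth_nth tnth_mktuple.
case: eqP => _; rewrite /xevN /= ?add0r ?mul1r ?sub0r ?rmorphN //.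
by rewrite rmorphD /= mulNr opprK -addrA -mulrDl half_half mul1r addrC.
Qed.

(** If [rho (rgt r)] is a + b e, then the evaluations a + b y and a - b y agree for invariant r.
    Hence 2 b y = 0, and b = 0 in a domain where 2 is nonzero. *)
Lemma rho_invariant r : Defs.invariant i r -> rho (rgt r) = xin (rgt r).
Proof.
move=> ri; have := xev_rho (rgt r); have := xevN_rho r; rewrite ri.
case: (rho _) => a b; rewrite /xev /xevN /= => <- /eqP.
rewrite -subr_eq0 opprD addrA [a + _]addrC addrK opprK -mulr2n -mulr_natr => /eqP E.
have y0 : yel != 0.
  apply/eqP => /(congr1 (fun p : A => p@_U_(rshift 2 i))) /eqP.
  by rewrite /yel rgtX mcoeffX eqxx mcoeff0 oner_eq0.
suff b0 : b = 0 by rewrite b0 mul0r subr0.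
apply/eqP; move/eqP: E; rewrite !mulf_eq0 (negPf y0) orbF => /orP[//|].
by rewrite -[_%:R]/(2 : A) -mpolyC_nat mpolyC_eq0 (negPf two_neq0).
Qed.

Lemma reflC c : refl i (c%:MP : R) = c%:MP. Proof. exact: comp_mpolyC. Qed.
Lemma reflD (p q : R) : refl i (p + q) = refl i p + refl i q.
Proof. exact: (rmorphD (comp_mpoly _)). Qed.
Lemma reflM (p q : R) : refl i (p * q) = refl i p * refl i q.
Proof. exact: (rmorphM (comp_mpoly _)). Qed.

Lemma invariantC c : Defs.invariant i (c%:MP : R).
Proof. exact: comp_mpolyC. Qed.
Lemma invariantD (p q : R) : Defs.invariant i p -> Defs.invariant i q -> Defs.invariant i (p + q).
Proof. by rewrite /Defs.invariant reflD => -> ->. Qed.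
Lemma invariantM (p q : R) : Defs.invariant i p -> Defs.invariant i q -> Defs.invariant i (p * q).
Proof. by rewrite /Defs.invariant reflM => -> ->. Qed.

Lemma reflX j : refl i ('X_j : R) = if j == i then - 'X_i else 'X_i + 'X_j.
Proof. by rewrite [LHS]comp_mpolyXU -tnth_nth tnth_mktuple. Qed.

(** R is generated by 1 and alpha_i over its invariants: this holds for alpha_j because alpha_j +
    alpha_i / 2 is invariant, and passes to products because alpha_i^2 is invariant. *)
Lemma invariant_split (f : R) : exists p q,
  [/\ Defs.invariant i p, Defs.invariant i q & f = p + q * 'X_i].
Proof.
have sq : Defs.invariant i ('X_i * 'X_i : R).
  by apply: (etrans (reflM _ _)); rewrite reflX eqxx mulrNN.
elim/mpoly_ring_ind: f => [c|j|f g [p [q [pi qi ->]]] [p' [q' [pi' qi' ->]]]|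
  f g [p [q [pi qi ->]]] [p' [q' [pi' qi' ->]]]].
- exists c%:MP, 0; split; rewrite ?mul0r ?addr0 //; first exact: invariantC.
  by rewrite -mpolyC0; apply: invariantC.
- case: (eqVneq j i) => [->|ji].
    exists 0, 1; split; rewrite ?mul1r ?add0r //.
      by rewrite -mpolyC0; apply: invariantC.
    by rewrite -mpolyC1; apply: invariantC.
  exists ('X_j + (2^-1)%:MP * 'X_i), (- 2^-1)%:MP; split; last 1 first.
  + by rewrite mpolyCN mulNr addrK.
  + have E : (2^-1)%:MP + (2^-1)%:MP = 1 :> R.
      rewrite -mpolyCD (_ : 2^-1 + 2^-1 = 1) ?mpolyC1 //.
      by rewrite -[2^-1]mul1r -mulrDl mulfV.
    apply: (etrans (reflD _ _)); rewrite reflM reflC !reflX eqxx (negPf ji).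
    exact: half_identity.
  exact: invariantC.
- exists (p + p'), (q + q'); split; [exact: invariantD|exact: invariantD|].
  by rewrite mulrDl addrACA.
exists (p * p' + q * q' * ('X_i * 'X_i)), (p * q' + q * p'); split.
- by apply: invariantD; [apply: invariantM|do 2! [apply: invariantM => //]].
- by apply: invariantD; apply: invariantM.
by ring.
Qed.

End Model.

(** * Elements of a tensor product as sums of pure tensors *)

Section TensorInduction.
Variable k : fieldType.
Local Notation R := {mpoly k[2]}.
Local Notation A := {mpoly k[2 + 2]}.
Local Notation gmod := (gmod k (2 + 2)).
Variables (S : R -> Prop) (M N : gmod).

(** Coefficients in R^e are absorbed, left variables by the first factor and right variables by the
    second, so sums of pure tensors already form an R^e-submodule. *)
Lemma gtens_ind (Q : gtens S M N -> Prop) :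
  (forall x y, Q (tens S x y)) -> (forall u v, Q u -> Q v -> Q (u + v)) ->
  forall u, Q u.
Proof.
move=> Qt QD; pose sum (u : gtens S M N) := exists l : seq (M * N),
  u = \sum_(p <- l) tens S p.1 p.2.
have bal := tens_balanced S M N.
have sumD u v : sum u -> sum v -> sum (u + v).
  by move=> [l ->] [l' ->]; exists (l ++ l'); rewrite big_cat.
have sumE u : sum u -> Q u.
  move=> [l ->]; apply: (big_ind Q) => [||p _]; [|exact: (QD)|exact: (Qt)].
  suff <- : tens S (0 : M) (0 : N) = 0 by apply: (Qt).
  by have := balZl bal 0 0 0; rewrite (rmorph0 (@lft k 2)) !scale0r.
have suml r u : sum u -> sum (lft r *: u).
  move=> [l ->]; exists [seq (lft r *: p.1, p.2) | p <- l].
  by rewrite big_map scaler_sumr; apply: eq_bigr => p _; rewrite /= (balZl bal).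
have sumr r u : sum u -> sum (rgt r *: u).
  move=> [l ->]; exists [seq (p.1, rgt r *: p.2) | p <- l].
  by rewrite big_map scaler_sumr; apply: eq_bigr => p _; rewrite /= (balZr bal).
move=> u; apply: (sumE); rewrite -[u]qpiE -[repr u]freeg_sumE linear_sum.
apply: (big_ind sum) => [|//|[x y] _]; first by exists [::]; rewrite big_nil.
set c := coeff _ _.
have -> : << c *g (x, y) >> = c *: << (x, y) >> :> {freeg (M * N) / A}.
  by apply/eqP/freeg_eqP => z; rewrite coeffZ !coeffU mul1r.
rewrite linearZ; apply: (@mpoly_scale_ind k (2 + 2) _ sum) => //.
- by move=> d v sv; rewrite -lftC; apply: suml.
- move=> i v sv; rewrite -[i]splitK; case: (fintype.split i) => j /=.
    by rewrite -lftX; apply: suml.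
  by rewrite -rgtX; apply: sumr.
by exists [:: (x, y)]; rewrite big_seq1.
Qed.

End TensorInduction.

Section GradedIso.
Variables (k : fieldType) (n : nat) (M N : gmod k n).

Definition gisom (f : gmor M N) := exists g : gmor N M, cancel f g /\ cancel g f.

Lemma gisom_bij (f : gmor M N) : (forall x y, f x = f y -> x = y) ->
  (forall y, exists x, f x = y) ->
  (forall d y, gdeg d y -> exists x, gdeg d x /\ f x = y) -> gisom f.
Proof.
move=> finj /choice[g gK] fd.
have gl : linear g by move=> a x y; apply: finj; rewrite linearP !gK.
have gd d y : gdeg d y -> gdeg d (g y).
  by move=> /fd[x [dx <-]]; rewrite (finj (g (f x)) x).
by exists (mkgmor gl gd); split=> [x|y]; [apply: finj; rewrite gK|apply: gK].
Qed.

Lemma gisom_wgraded (f : gmor M N) : gisom f -> wgraded N -> wgraded M.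
Proof.
move=> [g [fK gK]]; apply: (wgraded_iso (f := f)) => [x y|d y dy|d x dx].
- exact: (can_inj fK).
- by exists (g y); split; [apply: gmorP|apply: gK].
- by rewrite -[x]fK; apply: gmorP.
Qed.

End GradedIso.

(** * The functor M |-> M (x) R over R^i in the model *)

Section Induction.
Variable k : fieldType.
Local Notation R := {mpoly k[2]}.
Local Notation A := {mpoly k[2 + 2]}.
Local Notation gmod := (gmod k (2 + 2)).
Variable i : 'I_2.
Local Notation yel := (yel k i).
Local Notation half := (half k).
Local Notation E := (xring yel).

(* The bimodule M \otimes_(R^i) R, as M + M \otimes alpha_i. *)
Definition Tm (M : gmod) : gmod := @GMod k (2 + 2) (restr (rho k i) (xmod yel M))
  (fun d (m : M * M) => gdeg d m.1 /\ gdeg (d - 2) m.2).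

Lemma TmZ (M : gmod) p (m : Tm M) : p *: m =
  ((rho k i p).1 *: m.1 + (yel ^+ 2 * (rho k i p).2) *: m.2,
   (rho k i p).2 *: m.1 + (rho k i p).1 *: m.2).
Proof. by []. Qed.

Lemma TmD (M : gmod) (m m' : Tm M) : m + m' = (m.1 + m'.1, m.2 + m'.2).
Proof. by []. Qed.

Lemma Tm_in (M : gmod) p (m : Tm M) : rho k i p = xin yel p ->
  p *: m = (p *: m.1, p *: m.2).
Proof. by move=> pE; rewrite TmZ pE /= mulr0 !scale0r addr0 add0r. Qed.

Lemma Tm_lft (M : gmod) r (m : Tm M) : lft r *: m = (lft r *: m.1, lft r *: m.2).
Proof. by apply: Tm_in; apply: rho_lft. Qed.

Lemma TmC (M : gmod) c (m : Tm M) : c%:MP *: m = (c%:MP *: m.1, c%:MP *: m.2).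
Proof. by apply: Tm_in; apply: rhoC. Qed.

Lemma Tm_yel (M : gmod) (m : Tm M) : yel *: m = (yel ^+ 2 *: m.2, m.1).
Proof. by rewrite TmZ rho_yel /= mulr1 !scale0r scale1r addr0 add0r. Qed.

Lemma Tm_wgraded (M : gmod) : wgraded M -> wgraded (Tm M).
Proof.
move=> gM; split=> [d|d x y [x1 x2] [y1 y2]|e d p m ep [m1 m2]|Q Qd QD [x y]].
- by split; apply: wgdeg0.
- by split; apply: wgdegD.
- have [p1 p2] := rho_deg i ep; rewrite TmZ; split; apply: wgdegD => //=.
  + exact: wgdegZ.
  + rewrite (_ : e + d = (2 + 2 + (e - 2)) + (d - 2)); last by lia.
    by apply: wgdegZ => //; apply: pdegM => //; apply: pdegM; apply: yel_deg.
  + rewrite (_ : e + d - 2 = (e - 2) + d); last by lia.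
    exact: wgdegZ.
  + rewrite (_ : e + d - 2 = e + (d - 2)); last by lia.
    exact: wgdegZ.
have -> : (x, y) = (x, 0) + (0, y) :> Tm M by rewrite TmD /= addr0 add0r.
apply: (QD); [elim/(wgdeg_ind gM): x|elim/(wgdeg_ind gM): y].
- by move=> d x dx; apply: (Qd d); split=> //; apply: wgdeg0.
- move=> x x' Qx Qx'; suff -> : (x + x', 0) = (x, 0) + (x', 0) :> Tm M by apply: (QD).
  by rewrite TmD /= addr0.
- move=> d y dy; apply: (Qd (d + 2)); split=> //=; first exact: wgdeg0.
  by rewrite addrK.
move=> y y' Qy Qy'; suff -> : (0, y + y') = (0, y) + (0, y') :> Tm M by apply: (QD).
by rewrite TmD /= addr0.
Qed.

Section Functor.
Variables (M N : gmod) (f : {linear M -> N}).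

Definition Tfun (m : Tm M) : Tm N := (f m.1, f m.2).

Lemma Tfun_lin : linear Tfun.
Proof. by move=> p x y; rewrite /Tfun !TmZ !TmD /= !linearD !linearZ. Qed.
HB.instance Definition _ := GRing.isLinear.Build A (Tm M) (Tm N) _ Tfun Tfun_lin.

End Functor.

Definition Tmap (M N : gmod) (f : gmor M N) : gmor (Tm M) (Tm N) :=
  @GMor k (2 + 2) (Tm M) (Tm N) (Tfun f)
    (fun d m dm => conj (gmorP f (proj1 dm)) (gmorP f (proj2 dm))).

(** The model of the multiplication x (x) f |-> x f. *)
Definition mufun (M : gmod) (m : Tm M) : M := m.1 + yel *: m.2.

Lemma mufunD (M : gmod) (m m' : Tm M) : mufun (m + m') = mufun m + mufun m'.
Proof. by rewrite /mufun TmD /= scalerDr addrACA. Qed.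

Lemma mufunZ (M : gmod) p (m : Tm M) : mufun (p *: m) = p *: mufun m.
Proof.
have pE : p = (rho k i p).1 + (rho k i p).2 * yel by rewrite -[LHS](xev_rho i).
rewrite /mufun TmZ /= [in RHS]pE; case: (rho k i p) => a b /=.
rewrite [RHS]scalerDr [yel *: (_ + _)]scalerDr !scalerA addrACA -!scalerDl.
by congr (_ *: _ + _ *: _); ring.
Qed.

Lemma mufun_lin (M : gmod) : linear (@mufun M).
Proof. by move=> p m m'; rewrite mufunD mufunZ. Qed.

Lemma mufun_deg (M : gmod) : wgraded M -> forall d (m : Tm M), gdeg d m -> gdeg d (mufun m).
Proof.
move=> gM d m [m1 m2]; apply: wgdegD => //; rewrite -[d](subrK 2) addrC.
by apply: wgdegZ => //; apply: yel_deg.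
Qed.

Definition mu (M : gmod) (gM : wgraded M) : gmor (Tm M) M :=
  mkgmor (@mufun_lin M) (mufun_deg gM).

End Induction.

(** * Tensor products with B_i and with R in terms of the model *)

Section TensorIsomorphisms.
Variable k : fieldType.
Local Notation R := {mpoly k[2]}.
Local Notation A := {mpoly k[2 + 2]}.
Local Notation gmod := (gmod k (2 + 2)).
Local Notation gdiag := (gdiag k 2).

Lemma gdiag_lft r (x : gdiag) : lft r *: x = r * (x : R).
Proof. by rewrite gdiagZ mult_lft. Qed.
Lemma gdiag_rgt r (x : gdiag) : rgt r *: x = r * (x : R).
Proof. by rewrite gdiagZ mult_rgt. Qed.

Lemma lft_deg d (r : R) : pdeg d r -> pdeg d (lft r).
Proof.
move=> dr; rewrite [r]mpolyE big_seq rmorph_sum /=.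
elim/big_ind: _ => [|u v|m mr]; [exact: pdeg0|exact: pdegD|].
rewrite -mul_mpolyC rmorphM /= lftC -[d]add0r; apply: pdegM; first exact: pdegC.
rewrite -(dr m mr) mpolyXE_id rmorph_prod mdegE.
elim/big_rec2: _ => [|j e u _ eu]; first by rewrite -mpolyC1; apply: pdegC.
rewrite mulnDr PoszD; apply: pdegM => //; rewrite rmorphXn /= lftX.
elim: (m j) => [|n IH]; first by rewrite expr0 -mpolyC1; apply: pdegC.
by rewrite exprS mulnS PoszD; apply: pdegM => //; apply: pdegX.
Qed.

Lemma rgt_deg d (r : R) : pdeg d r -> pdeg d (rgt r).
Proof.
move=> dr; rewrite [r]mpolyE big_seq rmorph_sum /=.
elim/big_ind: _ => [|u v|m mr]; [exact: pdeg0|exact: pdegD|].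
rewrite -mul_mpolyC rmorphM /= rgtC -[d]add0r; apply: pdegM; first exact: pdegC.
rewrite -(dr m mr) mpolyXE_id rmorph_prod mdegE.
elim/big_rec2: _ => [|j e u _ eu]; first by rewrite -mpolyC1; apply: pdegC.
rewrite mulnDr PoszD; apply: pdegM => //; rewrite rmorphXn /= rgtX.
elim: (m j) => [|n IH]; first by rewrite expr0 -mpolyC1; apply: pdegC.
by rewrite exprS mulnS PoszD; apply: pdegM => //; apply: pdegX.
Qed.

Lemma gtens_deg S (M N : gmod) d e (x : M) (y : N) :
  gdeg d x -> gdeg e y -> @gdeg _ _ (gtens S M N) (d + e) (tens S x y).
Proof.
move=> dx ey; rewrite -[tens S x y]scale1r -mpolyC1 -[_ *: _]addr0.
by apply: kspanS (kspan0 _); exists d, e, x, y.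
Qed.

Lemma gtens_degD S (M N : gmod) d (u v : gtens S M N) :
  gdeg d u -> gdeg d v -> gdeg d (u + v).
Proof. by move=> du dv; have := kspan_lin 1 du dv; rewrite mpolyC1 scale1r. Qed.

Lemma gtens_deg_map S (M N : gmod) (W : gmod) (b : M -> N -> W) (bP : balanced S b) l :
  wgraded W -> (forall d e x y, gdeg d x -> gdeg e y -> gdeg (d + e + l) (b x y)) ->
  forall d u, gdeg d u -> gdeg (d + l) (tens_lift bP u).
Proof.
move=> gW bd d u; elim=> [|c x v [e [f [m [n [me nf ef ->]]]]] _ IH].
  by rewrite linear0; apply: wgdeg0.
have -> : tens_lift bP (c%:MP *: tens S m n + v) = c%:MP *: b m n + tens_lift bP v.
  by rewrite -(tens_liftE bP m n); apply: (tens_lift_linear bP).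
apply: wgdegD => //; rewrite -[d + l]add0r.
by apply: wgdegZ => //; [apply: pdegC|rewrite -ef; apply: bd].
Qed.

Lemma mulrAC_swap (B : comNzRingType) (h x y : B) : h * x * y = x * (h * y).
Proof. by rewrite mulrCA mulrA. Qed.

Section Induced.
Variable i : 'I_2.
Hypothesis two_neq0 : 2 != 0 :> k.
Local Notation yel := (yel k i).
Local Notation E := (xring yel).
Local Notation inv := (@Defs.invariant k i).
Local Notation W1 := (restr (rho' k i) (E^o : lmodType E)).

(** Reads f (x) g in the quadratic extension. The factor f goes to the right copy of R because it
    will multiply elements of M from the right. *)
Definition epsb (f g : gdiag) : W1 := xin yel (rgt (f : R)) * rho k i (rgt (g : R)).

Lemma epsb_balanced : balanced inv epsb.
Proof.
split=> [x x' y|x y y'|r x y|r x y|h x y Sh]; rewrite /epsb.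
- by rewrite !rmorphD mulrDl.
- by rewrite !rmorphD mulrDr.
- rewrite gdiag_lft !rmorphM -mulrA.
  by rewrite [RHS]/(rho' k i (lft r) * _) rho'_lft.
- rewrite gdiag_rgt !rmorphM mulrCA.
  by rewrite [RHS]/(rho' k i (rgt r) * _) rho'_rgt.
- rewrite gdiag_rgt gdiag_lft !rmorphM /= (rho_invariant two_neq0 Sh).
  exact: (mulrAC_swap (xin yel (rgt h)) (xin yel (rgt (x : R))) (rho k i (rgt (y : R)))).
Qed.

Definition eps : gtens inv gdiag gdiag -> E := tens_lift epsb_balanced.

Lemma epsE f g : eps (tens inv f g) = xin yel (rgt (f : R)) * rho k i (rgt (g : R)).
Proof. exact: (tens_liftE epsb_balanced f g). Qed.
Lemma epsD q q' : eps (q + q') = eps q + eps q'.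
Proof. exact: (linearD (tens_lift epsb_balanced)). Qed.
Lemma epsZ p q : eps (p *: q) = rho' k i p * eps q.
Proof.
have E0 : eps 0 = 0 by apply: (linear0 (tens_lift epsb_balanced)).
rewrite -[in LHS](addr0 (p *: q)) -[RHS]addr0 -[in RHS]E0.
exact: (tens_lift_linear epsb_balanced p q 0).
Qed.

Lemma eps_deg d q : gdeg d q -> xdeg d (eps q).
Proof.
elim=> [|c x v [e [f [m [n [me nf ef ->]]]]] _ IH].
  rewrite [eps 0]linear0; split; exact: pdeg0.
rewrite epsD; apply: xdegD => //; rewrite epsZ rho'C epsE -[d]add0r.
apply: xdegM; first by apply: xdeg_in; apply: pdegC.
rewrite -ef; apply: xdegM; first by apply: xdeg_in; apply: rgt_deg.
by apply: rho_deg; apply: rgt_deg.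
Qed.

Section OneModule.
Variable M : gmod.
Hypothesis gM : wgraded M.
Local Notation B := (Bs k i).

Definition Phib (x : M) (q : B) : Tm i M := (eps q : E) *: ((x, 0) : xmod yel M).

Lemma PhibE x q : Phib x q = ((eps q).1 *: x, (eps q).2 *: x).
Proof. by rewrite /Phib xscaleE /= !scaler0 !addr0. Qed.

Lemma Tm_rho p (m : Tm i M) : p *: m = rho k i p *: (m : xmod yel M). Proof. by []. Qed.

Lemma Phib_balanced : balanced (fun _ => True) Phib.
Proof.
split=> [x x' q|x q q'|r x q|r x q|h x q _].
- by rewrite !PhibE !scalerDr.
- by rewrite !PhibE epsD !scalerDl.
- by rewrite !PhibE Tm_lft /= !scalerA ![_ * lft r]mulrC.
- by rewrite Tm_rho /Phib scalerA -rho'_rgt -epsZ.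
- rewrite !PhibE epsZ rho'_lft !scalerA; congr pair; congr (_ *: _);
    by rewrite /= mul0r ?mulr0 addr0 mulrC.
Qed.

Definition Phifun : {linear gtensR M B -> Tm i M} := tens_lift Phib_balanced.

Lemma PhiE x q : Phifun (tens _ x q) = ((eps q).1 *: x, (eps q).2 *: x).
Proof. by rewrite -PhibE; apply: (tens_liftE Phib_balanced). Qed.

Lemma Phi_deg d u : gdeg d u -> gdeg (d + 1) (Phifun u).
Proof.
apply: gtens_deg_map; first exact: Tm_wgraded.
move=> {}d e x q dx qe; rewrite PhibE; have [q1 q2] := eps_deg qe; split.
  by rewrite (_ : d + e + 1 = (e + 1) + d); [apply: wgdegZ|lia].
by rewrite (_ : d + e + 1 - 2 = (e + 1 - 2) + d); [apply: wgdegZ|lia].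
Qed.

Definition Phi : gmor (gtensR M B) (gshift 1 (Tm i M)) :=
  @GMor k (2 + 2) (gtensR M B) (gshift 1 (Tm i M)) Phifun Phi_deg.

Local Notation b0 := (tens inv ((1 : R) : gdiag) ((1 : R) : gdiag) : B).
Local Notation b1 := (tens inv ((1 : R) : gdiag) ('X_i : gdiag) : B).

Definition Psi (m : Tm i M) : gtensR M B := tens _ m.1 b0 + tens _ m.2 b1.

Lemma PsiK m : Phifun (Psi m) = m.
Proof.
rewrite /Psi linearD !PhiE !epsE -/yel rho_yel !rmorph1 !mul1r TmD /=.
by case: m => m n; rewrite /= !scale1r !scale0r addr0 add0r.
Qed.

(** By [invariant_split] the right factor of B_i is reduced to 1 and alpha_i; the invariant
    coefficients cross to the left factor and from there to M. *)
Lemma Psi_surj u : exists m, u = Psi m.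
Proof.
have bal := tens_balanced (fun _ : R => True) M B.
move: u; apply: gtens_ind => [x q|u v [m ->] [m' ->]]; last first.
  by exists (m + m'); rewrite /Psi TmD /= !(balDl bal) addrACA.
move: x; move: q; apply: gtens_ind => [f g|q q' Qq Qq'] x; last first.
  have [m mE] := Qq x; have [m' mE'] := Qq' x.
  by exists (m + m'); rewrite (balDr bal) mE mE' /Psi TmD /= !(balDl bal) addrACA.
have ib := tens_balanced inv gdiag gdiag.
have [p [q [pi qi gE]]] := invariant_split i two_neq0 (g : R).
have E1 r (h : gdiag) : inv r -> tens inv f (lft r *: h) = lft ((f : R) * r) *:
    tens inv ((1 : R) : gdiag) h.
  move=> ri; rewrite -(balS ib) // -(balZl ib); congr tens.
  by rewrite gdiag_rgt gdiag_lft mulr1 mulrC.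
(* f (x) g equals f p (x) 1 + f q (x) alpha_i over the invariants, and x absorbs f p and f q. *)
exists (rgt ((f : R) * p) *: x, rgt ((f : R) * q) *: x).
rewrite /Psi /= !(balS bal) // -(balDr bal).
apply: (congr1 (@tens k 2 (fun _ => True) M B x)).
transitivity (tens inv f (lft p *: ((1 : R) : gdiag) + lft q *: ('X_i : gdiag))).
  by congr (tens _ _ _); rewrite !gdiag_lft mulr1 gE.
by rewrite (balDr ib) !E1.
Qed.

Lemma Phi_isom : gisom Phi.
Proof.
apply: gisom_bij => [u v|m|d m [m1 m2]].
- by have [m ->] := Psi_surj u; have [n ->] := Psi_surj v; rewrite !PsiK => ->.
- by exists (Psi m); apply: PsiK.
exists (Psi m); split; last exact: PsiK.
(* The shift in B_i puts 1 (x) 1 in degree -1 and 1 (x) alpha_i in degree 1. *)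
have d0 : gdeg (-1) b0.
  by apply: (@gtens_deg inv gdiag gdiag 0 0); rewrite -mpolyC1; apply: pdegC.
have d1 : gdeg 1 b1.
  apply: (@gtens_deg inv gdiag gdiag 0 2); last exact: pdegX.
  by rewrite -mpolyC1; apply: pdegC.
apply: gtens_degD.
  by rewrite (_ : d = (d + 1) - 1); [apply: gtens_deg|lia].
by rewrite (_ : d = (d + 1 - 2) + 1); [apply: gtens_deg|lia].
Qed.

End OneModule.

Lemma Phi_natural (M N : gmod) (f : gmor M N) u :
  Phifun N (tens_map _ f (gid (Bs k i)) u) = Tfun f (Phifun M u).
Proof.
move: u; apply: gtens_ind => [x q|u v Eu Ev]; last by rewrite !linearD /= Eu Ev.
by rewrite tens_mapE !PhiE /Tfun /= !linearZ.
Qed.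

End Induced.

Section Units.
Variable M : gmod.
Hypothesis gM : wgraded M.

Local Notation gdiag1 := (gshift 1 gdiag).

Definition runitb (x : M) (r : gdiag1) : M := rgt (r : R) *: x.

Lemma runitb_balanced : balanced (fun _ => True) runitb.
Proof.
split=> [x x' q|x q q'|r x q|r x q|h x q _]; rewrite /runitb.
- by rewrite scalerDr.
- by rewrite rmorphD scalerDl.
- by rewrite !scalerA mulrC.
- by rewrite (gdiag_rgt r (q : gdiag)) rmorphM scalerA.
- by rewrite (gdiag_lft h (q : gdiag)) rmorphM scalerA mulrC.
Qed.

Definition runitfun : {linear gtensR M gdiag1 -> M} := tens_lift runitb_balanced.

Lemma runitE x (r : gdiag1) : runitfun (tens _ x r) = rgt (r : R) *: x.
Proof. exact: (tens_liftE runitb_balanced). Qed.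

Lemma runit_deg d u : gdeg d u -> gdeg (d + 1) (runitfun u).
Proof.
apply: gtens_deg_map => // {}d e x r dx re; rewrite /runitb.
by rewrite (_ : d + e + 1 = (e + 1) + d); [apply: wgdegZ => //; apply: rgt_deg|lia].
Qed.

Definition runit : gmor (gtensR M gdiag1) (gshift 1 M) :=
  @GMor k (2 + 2) (gtensR M gdiag1) (gshift 1 M) runitfun runit_deg.

Lemma runit_isom : gisom runit.
Proof.
have bal := tens_balanced (fun _ : R => True) M gdiag1.
have E u : u = tens _ (runitfun u) ((1 : R) : gdiag1).
  move: u; apply: gtens_ind => [x r|u v Eu Ev].
    rewrite runitE (balS bal) //; congr (tens _ _ _).
    by rewrite (gdiag_lft _ ((1 : R) : gdiag)) mulr1.
  by rewrite linearD (balDl bal) -Eu -Ev.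
have E' x : runitfun (tens _ x ((1 : R) : gdiag1)) = x by rewrite runitE rmorph1 scale1r.
apply: gisom_bij => [u v uv|y|d y dy].
- by rewrite [u]E [v]E uv.
- by exists (tens (fun _ => True) (y : M) ((1 : R) : gdiag1)); apply: E'.
exists (tens (fun _ => True) (y : M) ((1 : R) : gdiag1)); split; last exact: E'.
rewrite -[d](addrK 1); apply: gtens_deg => //=.
by rewrite addNr -mpolyC1; apply: pdegC.
Qed.

Definition lunitb (r : gdiag) (x : M) : M := lft (r : R) *: x.

Lemma lunitb_balanced : balanced (fun _ => True) lunitb.
Proof.
split=> [x x' q|x q q'|r x q|r x q|h x q _]; rewrite /lunitb.
- by rewrite rmorphD scalerDl.
- by rewrite scalerDr.
- by rewrite gdiag_lft rmorphM scalerA.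
- by rewrite !scalerA mulrC.
- by rewrite gdiag_rgt rmorphM scalerA mulrC.
Qed.

Definition lunitfun : {linear gtensR gdiag M -> M} := tens_lift lunitb_balanced.

Lemma lunitE (r : gdiag) x : lunitfun (tens _ r x) = lft (r : R) *: x.
Proof. exact: (tens_liftE lunitb_balanced). Qed.

Definition lunit_inv (x : M) : gtensR gdiag M := tens _ ((1 : R) : gdiag) x.

Lemma lunit_invK x : lunitfun (lunit_inv x) = x.
Proof. by rewrite lunitE rmorph1 scale1r. Qed.

Lemma lunit_inv_surj u : u = lunit_inv (lunitfun u).
Proof.
have bal := tens_balanced (fun _ : R => True) gdiag M.
move: u; apply: gtens_ind => [r x|u v Eu Ev].
  rewrite lunitE /lunit_inv -(balS bal) //; congr (tens _ _ _).
  by rewrite gdiag_rgt mulr1.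
by rewrite linearD /lunit_inv (balDr bal) -/(lunit_inv _) -/(lunit_inv _) -Eu -Ev.
Qed.

Lemma lunit_inv_lin : linear lunit_inv.
Proof.
by move=> p x y; rewrite [LHS]lunit_inv_surj [RHS]lunit_inv_surj !linearP !lunit_invK.
Qed.

End Units.

Lemma runit_natural (M N : gmod) (f : gmor M N) u :
  runitfun N (tens_map _ f (gid _) u) = f (runitfun M u).
Proof.
move: u; apply: gtens_ind => [x q|u v Eu Ev]; last by rewrite !linearD /= Eu Ev.
by rewrite tens_mapE !runitE linearZ.
Qed.

Section Multiplication.
Variable i : 'I_2.
Hypothesis two_neq0 : 2 != 0 :> k.

Lemma xev_eps (q : Bs k i) :
  xev (@eps i two_neq0 q) = rgt (mul_mor (@Defs.invariant k i) q : R).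
Proof.
move: q; apply: gtens_ind => [f g|u v Eu Ev].
  rewrite epsE rmorphM /= xev_rho (_ : xev (xin _ _) = rgt (f : R)).
    by rewrite [mul_mor _ _]mul_funE rmorphM.
  by rewrite /xev /= mul0r addr0.
rewrite (epsD (i := i)) rmorphD /= Eu Ev -rmorphD; congr rgt.
by rewrite [in RHS](linearD (mul_mor (@Defs.invariant k i)) u v).
Qed.

Lemma mu_Phi (M : gmod) (u : gtensR M (Bs k i)) :
  mufun (@Phifun i two_neq0 M u) =
  runitfun M (tens_map _ (gid M) (gshift_mor 1 (mul_mor (@Defs.invariant k i))) u).
Proof.
move: u; apply: gtens_ind => [x q|u v Eu Ev].
  by rewrite tens_mapE PhiE runitE -xev_eps /mufun /= scalerA -scalerDl mulrC.
by rewrite !linearD /= mufunD Eu Ev.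
Qed.

End Multiplication.

End TensorIsomorphisms.

(** * Deformation retracts of complexes of bimodules *)

Section Retract.
Variable k : fieldType.
Local Notation gmod := (gmod k (2 + 2)).
Local Notation cplx := (cplx k (2 + 2)).
Local Notation zs := (zel k ord0).
Local Notation zt := (zel k ord_max).
Local Notation KZ := (kcocycle zs zt).
Local Notation KB := (kcoboundary zs zt).

Definition prefun (C D : nat -> gmod) (f : forall j, {linear C j -> D j}) (j : nat) :
    {linear pre C j -> pre D j} :=
  match j with
  | 0 => \0
  | i.+1 => f i
  end.

Lemma prefun_deg (C D : nat -> gmod) (f : forall j, gmor (C j) (D j)) j d x :
  gdeg d x -> gdeg d (prefun f j x).
Proof. by case: j x => [|j] x //; apply: gmorP. Qed.

(** One composite is the identity exactly, the other up to homotopy. The homotopy is linear without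
    a degree condition: its role is to exhibit coboundaries. *)
Record hretract (C D : cplx) := HRetract {
  hr_to : forall j, gmor (C j) (D j);
  hr_from : forall j, gmor (D j) (C j);
  hr_htpy : forall j, {linear C j -> pre C j};
  hr_to_dif : forall j x, hr_to j.+1 (cdif C j x) = cdif D j (hr_to j x);
  hr_from_dif : forall j x, hr_from j.+1 (cdif D j x) = cdif C j (hr_from j x);
  hr_toK : forall j y, hr_to j (hr_from j y) = y;
  hr_fromK : forall j x, x = hr_from j (hr_to j x) +
    (dprev C j (hr_htpy j x) + (hr_htpy j.+1 (cdif C j x) : C j)) }.

Lemma prefun_dprev (C D : cplx) (f : forall j, gmor (C j) (D j)) :
  (forall j x, f j.+1 (cdif C j x) = cdif D j (f j x)) ->
  forall j x, f j (dprev C j x) = dprev D j (prefun f j x).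
Proof. by move=> fd [|j] x; [rewrite /= linear0|apply: fd]. Qed.

Lemma dprev2 (C : cplx) j x : cdif C j (dprev C j x) = 0.
Proof. by case: j x => [|j] x; [rewrite linear0|apply: cdif2]. Qed.

Section Transport.
Variables (C D : cplx) (H : hretract C D) (a j : nat) (N : Defs.gmod k 2).
Let f := hr_to H.
Let g := hr_from H.
Let h := hr_htpy H.

Lemma kmap_lin (M M' : gmod) (u : {linear M -> M'}) p (c c' : M * M) :
  kmap u (p *: c + c') = p *: kmap u c + kmap u c'.
Proof. by apply: (@pair_ext M' M'); rewrite /= linearP. Qed.

Lemma kmapD (M M' : gmod) (u : {linear M -> M'}) (c c' : M * M) :
  kmap u (c + c') = kmap u c + kmap u c'.
Proof. by apply: (@pair_ext M' M'); rewrite /= linearD. Qed.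

Lemma kmapB (M M' : gmod) (u : {linear M -> M'}) (c c' : M * M) :
  kmap u (c - c') = kmap u c - kmap u c'.
Proof. by apply: (@pair_ext M' M'); rewrite /= linearB. Qed.

Lemma kmap_hcocycle (X Y : cplx) (u : forall j, gmor (X j) (Y j)) :
  (forall j x, u j.+1 (cdif X j x) = cdif Y j (u j x)) ->
  forall c : X j * X j, hcocycle a c -> hcocycle a (kmap (u j) c).
Proof.
move=> ud c [zc kc]; split; first exact: kmap_cocycle.
have -> : kmap (cdif Y j) (kmap (u j) c) = kmap (u j.+1) (kmap (cdif X j) c).
  by rewrite /kmap /= !ud.
exact: kmap_coboundary.
Qed.

Lemma kmap_hcoboundary (X Y : cplx) (u : forall j, gmor (X j) (Y j)) :
  (forall j x, u j.+1 (cdif X j x) = cdif Y j (u j x)) ->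
  forall c : X j * X j, hcoboundary a c -> hcoboundary a (kmap (u j) c).
Proof.
move=> ud c [b [zb kb]]; exists (kmap (prefun u j) b); split; first exact: kmap_cocycle.
have -> : kmap (dprev Y j) (kmap (prefun u j) b) = kmap (u j) (kmap (dprev X j) b).
  by rewrite /kmap /= !(prefun_dprev ud).
by rewrite -kmapB; apply: kmap_coboundary.
Qed.

Lemma hcoboundaryD (c c' : C j * C j) :
  hcoboundary a c -> hcoboundary a c' -> hcoboundary a (c + c').
Proof.
move=> [b [zb kb]] [b' [zb' kb']]; exists (b + b'); split; first exact: kcocycleD.
by rewrite kmapD opprD addrACA; apply: kcoboundaryD.
Qed.

Lemma hretract_hcoboundary c : hcocycle a c -> hcoboundary a (kmap (f j) c) ->
  @hcoboundary k C a j c.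
Proof.
move=> [zc kc] /(kmap_hcoboundary (hr_from_dif H)) gc.
have -> : c = kmap (g j) (kmap (f j) c) + (kmap (dprev C j) (kmap (h j) c) +
    kmap (h j.+1 : {linear C j.+1 -> C j}) (kmap (cdif C j) c)).
  by apply: (@pair_ext (C j) (C j)); apply: hr_fromK.
apply: hcoboundaryD; first exact: gc.
exists (kmap (h j) c); split.
  exact: kmap_cocycle.
by rewrite addrAC subrr add0r; apply: kmap_coboundary.
Qed.

Definition hretract_presentation (phi : hpresentation D a j N) : hpresentation C a j N.
Proof.
apply: (@HPresentation k C a j N (fun c => phi (kmap (f j) c))).
- by move=> r c c'; rewrite kmap_lin hpres_lin.
- by move=> l c [c1 c2]; apply: hpres_deg; split; apply: gmorP.
- move=> c zc /hpres_ker cc; apply: hretract_hcoboundary => //; apply: cc.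
  exact: (kmap_hcocycle (hr_to_dif H)).
- move=> c zc bc; apply: hpres_bnd; first exact: (kmap_hcocycle (hr_to_dif H)).
  exact: (kmap_hcoboundary (hr_to_dif H)).
move=> l y /(hpres_surj phi)[c [[c1 c2] zc cy]]; exists (kmap (g j) c); split.
- by split; apply: gmorP.
- exact: (kmap_hcocycle (hr_from_dif H)).
rewrite -cy; congr (phi _); apply: (@pair_ext (D j) (D j)); exact: hr_toK.
Defined.

End Transport.

Definition isom_retract (C D : cplx) (f : forall j, gmor (C j) (D j)) :
  (forall j x, f j.+1 (cdif C j x) = cdif D j (f j x)) ->
  (forall j, gisom (f j)) -> hretract C D.
Proof.
move=> fd fi; pose g j := sval (cid (fi j)).
have fK j x : g j (f j x) = x by have [] := svalP (cid (fi j)).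
have gK j y : f j (g j y) = y by have [] := svalP (cid (fi j)).
apply: (@HRetract C D f g (fun j => \0)) => // [j y|j x].
  by rewrite -[y in LHS]gK -fd fK.
by rewrite fK /= linear0 !addr0.
Defined.

Definition trans_retract (C D E : cplx) : hretract C D -> hretract D E -> hretract C E.
Proof.
move=> [f1 g1 h1 fd1 gd1 fK1 gK1] [f2 g2 h2 fd2 gd2 fK2 gK2].
pose h j : {linear C j -> pre C j} := h1 j \+ (prefun g1 j \o (h2 j \o f1 j)).
apply: (@HRetract C E (fun j => comp_gmor (f2 j) (f1 j)) (fun j => comp_gmor (g1 j) (g2 j)) h).
- by move=> j x; rewrite /= fd1 fd2.
- by move=> j x; rewrite /= gd2 gd1.
- by move=> j y; rewrite /= fK1 fK2.
move=> j x; rewrite {1}[x]gK1 {1}[f1 j x]gK2 /= !linearD /= -!addrA; congr (_ + _).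
rewrite -fd1 (prefun_dprev gd1); rewrite [RHS]addrCA; congr (_ + _).
by rewrite addrC -addrA.
Defined.

End Retract.

Lemma scale_comb (A : comNzRingType) (V : lmodType A) (s p : A) (a b a' b' : V) :
  s *: (p *: a + a') + (p *: b + b') = p *: (s *: a + b) + (s *: a' + b').
Proof. by rewrite !scalerDr !scalerA [s * p]mulrC addrACA. Qed.

Lemma lin_cancel (A : comNzRingType) (V W : lmodType A) (f : {linear V -> W}) (s : A)
  (m c : V) : f c = 0 -> - s *: f m + f (s *: m + c) = 0.
Proof. by move=> fc; rewrite linearD linearZ /= fc addr0 scaleNr addNr. Qed.

Lemma lin_cancel2 (A : comNzRingType) (V W : lmodType A) (f : {linear V -> W}) (s : A)
  (m c : V) (e : W) : e + f c = s *: f m + e + f (- s *: m + c).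
Proof.
by rewrite linearD linearZ /= scaleNr [s *: _ + e]addrC addrA addrK.
Qed.

(** * Tensoring with F(sigma_i) as a cone *)

Section Cone.
Variable k : fieldType.
Local Notation R := {mpoly k[2]}.
Local Notation A := {mpoly k[2 + 2]}.
Local Notation gmod := (gmod k (2 + 2)).
Local Notation cplx := (cplx k (2 + 2)).
Variable i : 'I_2.
Local Notation yel := (yel k i).

Definition sgn (j : nat) : A := (-1) ^+ j.

Lemma sgnS j : sgn j.+1 = - sgn j. Proof. by rewrite /sgn exprS mulN1r. Qed.
Lemma sgnE j : sgn j = ((-1) ^+ j)%:MP.
Proof. by rewrite /sgn rmorphXn /= mpolyCN mpolyC1. Qed.
Lemma sgn2 j : sgn j * sgn j = 1.
Proof. by rewrite /sgn -expr2 sqrr_sign. Qed.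

Lemma sgn_deg (M : gmod) j d (x : M) : wgraded M -> gdeg d x -> gdeg d (sgn j *: x).
Proof.
by move=> gM dx; rewrite -[d]add0r sgnE; apply: wgdegZ => //; apply: pdegC.
Qed.

Lemma pre_wgraded (C : nat -> gmod) : (forall j, wgraded (C j)) -> forall j, wgraded (pre C j).
Proof. by move=> gC [|j]; [exact: (@gzero_wgraded k (2 + 2))|exact: gC]. Qed.

Lemma dprev_deg (C : cplx) : (forall j, wgraded (C j)) ->
  forall j d x, gdeg d x -> gdeg d (dprev C j x).
Proof. by move=> gC [|j] d x dx; [apply: wgdeg0|apply: gmorP]. Qed.

Lemma mufun_natural (M N : gmod) (f : {linear M -> N}) (m : Tm i M) :
  mufun (Tfun f m) = f (mufun m).
Proof. by rewrite /mufun /= linearD linearZ. Qed.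

Lemma mufun0 (M : gmod) : mufun (0 : Tm i M) = 0.
Proof. by rewrite -(scale0r 0) mufunZ scale0r. Qed.

Section Objects.
Variable C : cplx.
Hypothesis gC : forall j, wgraded (C j).

Definition cone_obj (j : nat) : gmod :=
  gsum (gshift 1 (Tm i (C j))) (gshift 1 (pre C j)).

Definition cone_fun j (x : cone_obj j) : cone_obj j.+1 :=
  (Tfun (cdif C j) (x.1 : Tm i (C j)),
   sgn j *: mufun (x.1 : Tm i (C j)) + dprev C j x.2).

Lemma cone_lin j : linear (@cone_fun j).
Proof.
move=> p [x c] [x' c']; rewrite /cone_fun /=; congr pair.
  exact: (linearP (Tfun (cdif C j))).
rewrite (linearP (dprev C j)) (mufun_lin p (x : Tm i (C j)) x'); apply: scale_comb.
Qed.

Lemma cone_deg j d (x : cone_obj j) : gdeg d x -> gdeg d (cone_fun x).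
Proof.
move=> [x1 x2]; split; first by apply: (gmorP (Tmap i (cdif C j))).
apply: (wgdegD (gC j) (d := d + 1)); last exact: dprev_deg.
by apply: (sgn_deg _ (gC j)); apply: (mufun_deg (gC j)).
Qed.

Definition cone_dif j : gmor (cone_obj j) (cone_obj j.+1) := mkgmor (@cone_lin j) (@cone_deg j).

Lemma cone_dif2 j x : cone_dif j.+1 (cone_dif j x) = 0.
Proof.
case: x => x c; rewrite [LHS]/(cone_fun (cone_fun (x, c))) /cone_fun /=; congr pair.
  by rewrite /Tfun /= !cdif2.
by rewrite mufun_natural sgnS; apply: (lin_cancel _ _ (dprev2 c)).
Qed.

(* The complex C \otimes F(sigma_i), in terms of the model Tm i of C \otimes B_i. *)
Definition cone : cplx := Cplx cone_dif2.

Lemma cone_wgraded j : wgraded (cone j).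
Proof.
apply: gsum_wgraded; apply: gshift_wgraded; first exact: Tm_wgraded.
exact: pre_wgraded.
Qed.

End Objects.

Section ConeFunctor.
Variables C D : cplx.
Hypotheses (gC : forall j, wgraded (C j)) (gD : forall j, wgraded (D j)).

Definition cone_map_fun (f : forall j, gmor (C j) (D j)) j (x : cone_obj C j) : cone_obj D j :=
  (Tfun (f j) (x.1 : Tm i (C j)), prefun f j x.2).

Lemma cone_map_lin f j : linear (@cone_map_fun f j).
Proof.
move=> p [x c] [x' c']; rewrite /cone_map_fun /=; congr pair; last exact: linearP.
exact: (linearP (Tfun (f j))).
Qed.

Lemma cone_map_deg f j d (x : cone_obj C j) : gdeg d x -> gdeg d (cone_map_fun f x).
Proof.
by move=> [x1 x2]; split; [apply: (gmorP (Tmap i (f j)))|apply: prefun_deg].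
Qed.

Definition cone_map f j : gmor (cone_obj C j) (cone_obj D j) :=
  mkgmor (@cone_map_lin f j) (@cone_map_deg f j).

Lemma cone_map_dif (f : forall j, gmor (C j) (D j)) :
  (forall j x, f j.+1 (cdif C j x) = cdif D j (f j x)) ->
  forall j x, cone_map f j.+1 (cdif (cone gC) j x) = cdif (cone gD) j (cone_map f j x).
Proof.
move=> fd j [x c]; rewrite [LHS]/(cone_map_fun f (cone_fun (x, c))).
rewrite [RHS]/(cone_fun (cone_map_fun f (x, c))) /cone_fun /cone_map_fun /=; congr pair.
  by rewrite /Tfun /= !fd.
by rewrite mufun_natural linearD linearZ /= (prefun_dprev fd).
Qed.

End ConeFunctor.

Lemma prefunK (C D : cplx) (H : hretract C D) j (c : pre D j) :
  prefun (hr_to H) j (prefun (hr_from H) j c) = c.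
Proof. by case: j c => [|j] c; [apply/rowP => -[]|apply: hr_toK]. Qed.

Section ConeRetract.
Variables C D : cplx.
Hypotheses (gC : forall j, wgraded (C j)) (gD : forall j, wgraded (D j)).
Variable H : hretract C D.
Let h := hr_htpy H.

Definition cone_htpy_fun j : cone_obj C j -> pre (cone_obj C) j :=
  match j with
  | 0 => fun _ => 0
  | l.+1 => fun x => (Tfun (h l.+1 : {linear C l.+1 -> C l}) (x.1 : Tm i (C l.+1)), h l x.2)
  end.

Lemma cone_htpy_lin j : linear (@cone_htpy_fun j).
Proof.
case: j => [|j] p x y; first by rewrite /= scaler0 addr0.
rewrite /cone_htpy_fun /=; congr pair; last exact: linearP.
exact: (linearP (Tfun (h j.+1 : {linear C j.+1 -> C j}))).
Qed.

Definition cone_htpy j : {linear cone_obj C j -> pre (cone_obj C) j} :=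
  HB.pack_for {linear cone_obj C j -> pre (cone_obj C) j} (@cone_htpy_fun j)
    (GRing.isLinear.Build A _ _ _ (@cone_htpy_fun j) (@cone_htpy_lin j)).

(** A reduction of C persists when F(sigma_i) is attached on the right, so sigma_1^2 can be
    simplified before the letters of sigma_2^2 are treated. *)
Definition cone_retract : hretract (cone gC) (cone gD).
Proof.
apply: (@HRetract k (cone gC) (cone gD) (cone_map (hr_to H)) (cone_map (hr_from H)) cone_htpy).
- by apply: cone_map_dif; apply: hr_to_dif.
- by apply: cone_map_dif; apply: hr_from_dif.
- move=> j [[x y] c]; apply: pair_ext; last exact: prefunK.
  by apply: pair_ext; apply: hr_toK.
move=> [|j] [[x y] c].
  apply: pair_ext; last by apply/rowP => -[].
  by apply: pair_ext; [exact: (hr_fromK H x)|exact: (hr_fromK H y)].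
apply: pair_ext.
  by apply: pair_ext; [exact: (hr_fromK H x)|exact: (hr_fromK H y)].
rewrite [LHS](hr_fromK H c) [RHS]/(_ + ((sgn j *: mufun (Tfun (h j.+1 : {linear C j.+1 -> C j})
  ((x, y) : Tm i (C j.+1))) + dprev C j (h j c)) + (h j.+1 : {linear C j.+1 -> C j})
  (sgn j.+1 *: mufun ((x, y) : Tm i (C j.+1)) + cdif C j c))).
by congr (_ + _); rewrite mufun_natural sgnS; apply: lin_cancel2.
Qed.

End ConeRetract.
End Cone.

(** * Identification of tensor complexes with cones *)

Section TensorCone.
Variable k : fieldType.
Hypothesis two_neq0 : 2 != 0 :> k.
Local Notation R := {mpoly k[2]}.
Local Notation A := {mpoly k[2 + 2]}.
Local Notation gmod := (gmod k (2 + 2)).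
Local Notation cplx := (cplx k (2 + 2)).
Variable i : 'I_2.

Lemma gtens_zero S (M N : gmod) : (forall y : N, y = 0) -> forall u : gtens S M N, u = 0.
Proof.
move=> N0; have bal := tens_balanced S M N.
apply: gtens_ind => [x y|u v -> ->]; last by rewrite addr0.
by rewrite (N0 y); have := balZr bal 0 x 0; rewrite rmorph0 !scale0r.
Qed.

Lemma gzero_eq0 (x : gzero k (2 + 2)) : x = 0.
Proof. by apply/rowP => -[]. Qed.

Lemma row0_eq (x y : gzero k (2 + 2)) : x = y.
Proof. by apply/rowP => -[]. Qed.

Lemma Tm_gzero (x y : Tm i (gzero k (2 + 2))) : x = y.
Proof. by apply: pair_ext; apply: row0_eq. Qed.

Section Complex.
Variable C : cplx.
Hypothesis gC : forall j, wgraded (C j).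
Local Notation T := (tens_cplx C (F k i)).

Lemma idx0P j : (j + 0 == j)%N. Proof. by rewrite addn0. Qed.
Lemma idx1P j : (j + 1 == j.+1)%N. Proof. by rewrite addn1. Qed.

Definition to_cone1 j : T j -> pre C j :=
  match j with
  | 0 => fun _ => 0
  | l.+1 => fun w => runitfun (C l) (w (Idx (idx1P l)))
  end.

Definition to_cone_fun j (w : T j) : cone i gC j :=
  (Phifun i two_neq0 (C j) (w (Idx (idx0P j))), to_cone1 w).

Lemma to_cone1_lin j : linear (@to_cone1 j).
Proof.
case: j => [|j] p x y; first by rewrite /= scaler0 addr0.
exact: (linearP (runitfun (C j)) p (x (Idx (idx1P j))) (y (Idx (idx1P j)))).
Qed.

Lemma to_cone_lin j : linear (@to_cone_fun j).
Proof.
move=> p x y; apply: pair_ext; last exact: to_cone1_lin.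
exact: (linearP (Phifun i two_neq0 (C j)) p (x (Idx (idx0P j))) (y (Idx (idx0P j)))).
Qed.

Lemma to_cone_deg j d (w : T j) : gdeg d w -> gdeg d (to_cone_fun w).
Proof.
move=> dw; split; first exact: (Phi_deg two_neq0 (gC j) (dw (Idx (idx0P j)))).
by case: j w dw => [|j] w dw //; apply: (runit_deg (gC j) (dw (Idx (idx1P j)))).
Qed.

Definition to_cone j : gmor (T j) (cone i gC j) := mkgmor (@to_cone_lin j) (@to_cone_deg j).

Lemma to_cone_dif j w : to_cone j.+1 (cdif T j w) = cdif (cone i gC) j (to_cone j w).
Proof.
apply: pair_ext.
  rewrite [LHS]/(Phifun i two_neq0 (C j.+1) (_ + 0)) addr0.
  rewrite [LHS]Phi_natural; pose G (e : (j + 0 == j)%N) : Tm i (C j.+1) :=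
    Tfun (cdif C j) (Phifun i two_neq0 (C j) (w (@Idx j j 0 e))).
  exact: (congr1 G (bool_irrelevance _ _)).
rewrite [RHS]/(sgn k j *: mufun (Phifun i two_neq0 (C j) (w (Idx (idx0P j)))) +
  dprev C j (to_cone1 w)) mu_Phi.
rewrite [LHS]/(runitfun (C j) (tens_difl w (idx1P j) + tens_difr w (idx1P j))).
apply: (etrans (linearD (runitfun (C j)) _ _)); rewrite addrC; congr (_ + _).
  pose G (e : (j + 0 == j)%N) : C j := sgn k j *: runitfun (C j)
    (tens_map (fun _ => True) (gid (C j)) (gshift_mor 1 (mul_mor (@Defs.invariant k i)))
      (w (@Idx j j 0 e))).
  apply: (etrans (linearZ_LR (runitfun (C j)) _ _)).
  exact: (congr1 G (bool_irrelevance _ _)).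
case: j w => [|j] w; first exact: linear0.
rewrite [LHS]runit_natural; pose G (e : (j + 1 == j.+1)%N) : C j.+1 :=
  cdif C j (runitfun (C j) (w (@Idx j.+1 j 1 e))).
exact: (congr1 G (bool_irrelevance _ _)).
Qed.

Lemma idx0_eq a j : (a + 0 == j)%N -> j = a.
Proof. by rewrite addn0 => /eqP. Qed.
Lemma idx1_eq a j : (a + 1 == j)%N -> j = a.+1.
Proof. by rewrite addn1 => /eqP. Qed.

(** F(sigma_i) lives in degrees 0 and 1, so an element of the total complex is determined by two
    components; the casts carry them to the index that the dependent product demands. *)
Definition glue j (u : gtensR (C j) (F k i 0)) (v : gtensR (pre C j) (F k i 1)) : T j :=
  fun p => let: Idx a b e := p in
  match b return (a + b == j)%N -> gtensR (C a) (F k i b) with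
  | 0 => fun e => ecast l (gtensR (C l) (F k i 0)) (idx0_eq e) u
  | 1 => fun e => ecast l (gtensR (pre C l) (F k i 1)) (idx1_eq e) v
  | _ => fun _ => 0
  end e.

Lemma glue0 j u v : @glue j u v (Idx (idx0P j)) = u.
Proof. by rewrite /glue (eq_irrelevance (idx0_eq _) (erefl j)). Qed.

Lemma glue1 j u v : @glue j.+1 u v (Idx (idx1P j)) = v.
Proof. by rewrite /glue (eq_irrelevance (idx1_eq _) (erefl j.+1)). Qed.

Lemma ecast_deg (V : nat -> gmod) l l' (E : l = l') (x : V l) d :
  gdeg d x -> gdeg d (ecast m (V m) E x).
Proof. by case: l' / E. Qed.

Lemma glue_deg j u v d : gdeg d u -> gdeg d v -> gdeg d (@glue j u v).
Proof.
move=> du dv [a [|[|b]] e]; rewrite /glue.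
- exact: (@ecast_deg (fun l => gtensR (C l) (F k i 0)) _ _ (idx0_eq e) u d du).
- exact: (@ecast_deg (fun l => gtensR (pre C l) (F k i 1)) _ _ (idx1_eq e) v d dv).
exact: kspan0.
Qed.

Lemma to_cone_isom j : gisom (to_cone j).
Proof.
have sur m : exists w, to_cone j w = m /\ forall d, gdeg d m -> gdeg d w.
  have [f [fK fK']] := @Phi_isom k i two_neq0 _ (gC j).
  have [g [gK gK']] := runit_isom (pre_wgraded gC j).
  exists (glue (f m.1) (g m.2)); split.
    apply: pair_ext; first by rewrite [LHS]/(Phifun _ _ _ _) glue0; apply: fK'.
    case: j m f fK fK' g gK gK' => [|j] m f fK fK' g gK gK'.
      by rewrite [RHS]gzero_eq0.
    by rewrite [LHS]/(runitfun _ _) glue1; apply: gK'.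
  by move=> d [m1 m2]; apply: glue_deg; apply: gmorP.
apply: gisom_bij => [w w' ww'|m|d m dm].
- apply: functional_extensionality_dep => -[a b e].
  have [f [fK fK']] := @Phi_isom k i two_neq0 _ (gC j).
  case: b e => [|[|b]] e.
  + have E := idx0_eq e; subst a; rewrite (bool_irrelevance e (idx0P j)).
    by apply: (can_inj fK); exact: (congr1 fst ww').
  + have E := idx1_eq e; move: w w' ww' f fK fK' e; rewrite E.
    move=> w w' ww' f fK fK' e; rewrite (bool_irrelevance e (idx1P a)).
    have [g [gK gK']] := runit_isom (gC a).
    by apply: (can_inj gK); exact: (congr1 snd ww').
  + transitivity (0 : gtensR (C a) (gzero k (2 + 2))); first exact: gtens_zero gzero_eq0 _.
    by apply/esym; apply: gtens_zero gzero_eq0 _.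
- by have [w [wm _]] := sur m; exists w.
by have [w [wm wd]] := sur m; exists w; split; [apply: wd|].
Qed.

Lemma tens_cone : hretract T (cone i gC).
Proof. exact: isom_retract to_cone_dif to_cone_isom. Qed.

Lemma tens_cone_wgraded j : wgraded (T j).
Proof. exact: gisom_wgraded (to_cone_isom j) (cone_wgraded i gC j). Qed.

End Complex.

Lemma unit_wgraded j : wgraded (unit_cplx k j).
Proof.
case: j => [|j]; last exact: gzero_wgraded.
by apply: graded_wgraded; apply: gdiag_graded.
Qed.

Local Notation U := (cone i unit_wgraded).
Local Notation gdiag := (gdiag k 2).

(** The first letter of a braid word is not tensored with anything. Viewing it as a cone over the
    unit complex puts both letters of sigma_i^2 in the same form. *)
Definition F_to_cone_fun j : F k i j -> U j :=
  match j with
  | 0 => fun q => (Phifun i two_neq0 gdiag (lunit_inv (M := Bs k i) q), 0)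
  | 1 => fun x => (0, x)
  | _ => fun _ => 0
  end.

Lemma F_to_cone_lin j : linear (@F_to_cone_fun j).
Proof.
case: j => [|[|j]] p x y; apply: pair_ext; rewrite /= ?scaler0 ?addr0 //.
rewrite (lunit_inv_lin p (x : Bs k i) y).
exact: (linearP (Phifun i two_neq0 gdiag)).
Qed.

Lemma lunit_inv_deg (M : gmod) d (x : M) : gdeg d x -> gdeg d (lunit_inv x).
Proof.
by move=> dx; rewrite -[d]add0r; apply: gtens_deg => //; rewrite -mpolyC1; apply: pdegC.
Qed.

Lemma F_to_cone_deg j d (x : F k i j) : gdeg d x -> gdeg d (F_to_cone_fun x).
Proof.
case: j x => [|[|j]] x dx; split=> //.
- by apply: (Phi_deg two_neq0 (unit_wgraded 0)); apply: lunit_inv_deg.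
Qed.

Definition F_to_cone j : gmor (F k i j) (U j) :=
  mkgmor (@F_to_cone_lin j) (@F_to_cone_deg j).

Lemma F_to_cone_dif j x : F_to_cone j.+1 (cdif (F k i) j x) = cdif U j (F_to_cone j x).
Proof.
case: j x => [|[|j]] x; apply: pair_ext; try exact: Tm_gzero; try exact: row0_eq.
have E (m : gdiag) : sgn k 0 *: m + (0 : gdiag) = m by rewrite addr0 /sgn expr0 scale1r.
apply: (etrans _ (esym (E _))); rewrite mu_Phi tens_mapE runitE gdiag_rgt.
exact/esym/mulr1.
Qed.

Lemma F_to_cone_isom j : gisom (F_to_cone j).
Proof.
have [f [fK fK']] := @Phi_isom k i two_neq0 _ (unit_wgraded 0).
case: j => [|[|j]].
- pose inv := @Defs.invariant k i.
  pose g (m : U 0) : F k i 0 := tens inv (m.1.1 : gdiag) ((1 : R) : gdiag) +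
    tens inv (m.1.2 : gdiag) ('X_i : gdiag).
  have gK m : F_to_cone 0 (g m) = m.
    apply: pair_ext; last exact: row0_eq.
    have eE : eps two_neq0 (g m) = (rgt (m.1.1 : R), rgt (m.1.2 : R)).
      apply: (etrans (epsD _ _ _)); rewrite !epsE -/(yel k i) rho_yel !rmorph1.
      by apply: pair_ext; rewrite /= !(mulr0, mul0r, mulr1, addr0, add0r).
    apply: (etrans (@PhiE k i two_neq0 (unit_cplx k 0) ((1 : R) : gdiag) (g m))); rewrite eE /=.
    by rewrite !gdiag_rgt !mulr1; case: (m.1).
  apply: gisom_bij => [x y xy|m|d m [[d1 d2] _]].
  + rewrite -[x](lunit_invK (M := Bs k i)) -[y](lunit_invK (M := Bs k i)).
    by congr (lunitfun _ _); apply: (can_inj fK); apply: (congr1 fst xy).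
  + by exists (g m); apply: gK.
  + exists (g m); split; last exact: gK.
    apply: gtens_degD.
      rewrite -[d + 1]addr0; apply: gtens_deg => //.
      by rewrite -mpolyC1; apply: pdegC.
    by rewrite -[d + 1](subrK 2); apply: gtens_deg => //; apply: pdegX.
- apply: gisom_bij => [x y xy|m|d m [_ dm]].
  + exact: (congr1 snd xy).
  + by exists m.2; apply: pair_ext; first exact: Tm_gzero.
  + exists m.2; split; first exact: dm.
    by apply: pair_ext; first exact: Tm_gzero.
- apply: gisom_bij => [x y xy|m|d m _].
  + exact: row0_eq.
  + by exists 0; apply: pair_ext; [apply: Tm_gzero|apply: row0_eq].
  + by exists 0; split=> //; apply: pair_ext; [apply: Tm_gzero|apply: row0_eq].
Qed.

Lemma F_cone : hretract (F k i) U.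
Proof. exact: isom_retract F_to_cone_dif F_to_cone_isom. Qed.

End TensorCone.

Lemma sub_comb (A : comNzRingType) (V : lmodType A) (s : A) (a b b' e e' : V) :
  s *: (a + b) + e - (s *: (a + b') + e') = s *: (b - b') + (e - e').
Proof.
rewrite !scalerDr scalerN opprD addrACA; congr (_ + _).
by rewrite opprD addrACA subrr add0r.
Qed.

(** * The three-term replacement of F(sigma_i)^2 *)

Section DoubleCone.
Variable k : fieldType.
Local Notation R := {mpoly k[2]}.
Local Notation A := {mpoly k[2 + 2]}.
Local Notation gmod := (gmod k (2 + 2)).
Local Notation cplx := (cplx k (2 + 2)).
Variable i : 'I_2.
Local Notation yel := (yel k i).

(* The middle action of alpha_i on M \otimes_(R^i) R. *)
Definition theta (M : gmod) (m : Tm i M) : Tm i M := (yel *: m.1, yel *: m.2).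
Definition delta (M : gmod) (m : Tm i M) : Tm i M := yel *: m - theta m.

Lemma Tm_sgn (M : gmod) j (m : Tm i M) : sgn k j *: m = (sgn k j *: m.1, sgn k j *: m.2).
Proof. by rewrite sgnE TmC. Qed.

Lemma theta_lin (M : gmod) : linear (@theta M).
Proof.
move=> p m m'; rewrite /theta TmZ TmD TmZ TmD /=; apply: pair_ext; rewrite /= !scalerDr !scalerA.
  by rewrite ![yel * _]mulrC.
by rewrite ![yel * _]mulrC.
Qed.

Lemma delta_lin (M : gmod) : linear (@delta M).
Proof.
move=> p m m'; rewrite /delta theta_lin scalerDr !scalerA [yel * p]mulrC -scalerA.
by rewrite opprD addrACA -scalerBr.
Qed.

Lemma Tfun_lin' (M N : gmod) (f : {linear M -> N}) p (m m' : Tm i M) :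
  Tfun f (p *: m + m') = p *: Tfun f m + Tfun f m'.
Proof. exact: (linearP (Tfun f)). Qed.

Lemma theta_natural (M N : gmod) (f : {linear M -> N}) (m : Tm i M) :
  theta (Tfun f m) = Tfun f (theta m).
Proof. by rewrite /theta /Tfun /= !linearZ. Qed.

Lemma delta_natural (M N : gmod) (f : {linear M -> N}) (m : Tm i M) :
  delta (Tfun f m) = Tfun f (delta m).
Proof. by rewrite /delta theta_natural -linearZ -linearB. Qed.

Lemma mufun_theta (M : gmod) (m : Tm i M) : mufun (theta m) = yel *: mufun m.
Proof. by rewrite /mufun /theta /= scalerDr. Qed.

Lemma mufun_delta (M : gmod) (m : Tm i M) : mufun (delta m) = 0.
Proof.
rewrite /delta -scaleN1r addrC mufun_lin mufunZ mufun_theta scaleN1r.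
exact: addNr.
Qed.

Lemma delta_deg (M : gmod) d (m : Tm i M) : wgraded M -> gdeg d m -> gdeg (d + 2) (delta m).
Proof.
move=> gM dm; have gT := Tm_wgraded i gM; have [m1 m2] := dm; rewrite addrC.
apply: wgdegD => //; first by apply: wgdegZ => //; apply: yel_deg.
apply: wgdegN => //; split; first by apply: wgdegZ => //; apply: yel_deg.
by rewrite -addrA; apply: wgdegZ => //; apply: yel_deg.
Qed.

Section Objects.
Variable C : cplx.
Hypothesis gC : forall j, wgraded (C j).

Definition ddprev j : {linear pre (pre C) j -> pre C j} :=
  match j with
  | 0 => \0
  | l.+1 => dprev C l
  end.

Lemma dprev_ddprev j x : dprev C j (ddprev j x) = 0.
Proof. by case: j x => [|j] x //; apply: dprev2. Qed.

Lemma ddprev_deg j d x : gdeg d x -> gdeg d (ddprev j x).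
Proof. by case: j x => [|j] x // dx; apply: dprev_deg. Qed.

(** [Tm i] models C (x) B_i without the shift of B_i, so B_i (-1), B_i (1) and R (2) appear with the
    shifts 0, 2 and 2, attached to C^j, C^(j-1) and C^(j-2). *)
Definition dcone_obj (j : nat) : gmod :=
  gsum (Tm i (C j)) (gsum (gshift 2 (Tm i (pre C j))) (gshift 2 (pre (pre C) j))).

Definition dcone_fun j (x : dcone_obj j) : dcone_obj j.+1 :=
  (Tfun (cdif C j) x.1,
   (sgn k j *: delta x.1 + Tfun (dprev C j) (x.2.1 : Tm i (pre C j)),
    - sgn k j *: mufun (x.2.1 : Tm i (pre C j)) + ddprev j x.2.2)).

Lemma dcone_lin j : linear (@dcone_fun j).
Proof.
move=> p [v [r c]] [v' [r' c']]; apply: pair_ext; last apply: pair_ext.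
- exact: Tfun_lin'.
- rewrite [LHS]/(sgn k j *: delta (p *: v + v') + Tfun (dprev C j) (p *: r + r')).
  by rewrite delta_lin Tfun_lin'; apply: scale_comb.
rewrite [LHS]/(- sgn k j *: mufun (p *: (r : Tm i (pre C j)) + r') + ddprev j (p *: c + c')).
by rewrite mufun_lin (linearP (ddprev j)); apply: scale_comb.
Qed.

Lemma dcone_deg j d (x : dcone_obj j) : gdeg d x -> gdeg d (dcone_fun x).
Proof.
move=> [dv [dr dc]]; have gT := Tm_wgraded i (gC j); have gp := pre_wgraded gC j.
split; [exact: (gmorP (Tmap i (cdif C j)))|split].
  apply: (wgdegD gT (d := d + 2)).
    by apply: (sgn_deg _ gT); apply: (delta_deg (gC j)).
  by case: dr => dr1 dr2; split; apply: dprev_deg.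
apply: (wgdegD gp (d := d + 2)); last exact: ddprev_deg.
rewrite scaleNr; apply: (wgdegN gp (d := d + 2)); apply: (sgn_deg _ gp).
exact: (mufun_deg gp).
Qed.

Definition dcone_dif j : gmor (dcone_obj j) (dcone_obj j.+1) :=
  mkgmor (@dcone_lin j) (@dcone_deg j).

Lemma dcone_dif2 j x : dcone_dif j.+1 (dcone_dif j x) = 0.
Proof.
case: x => v [r c]; apply: pair_ext; last apply: pair_ext.
- by rewrite [LHS]/(Tfun _ (Tfun _ _)) /Tfun /= !cdif2.
- rewrite [LHS]/(sgn k j.+1 *: delta (Tfun (cdif C j) v) + Tfun (cdif C j)
    (sgn k j *: delta v + Tfun (dprev C j) (r : Tm i (pre C j)))).
  rewrite delta_natural sgnS; apply: (lin_cancel (f := Tfun (cdif C j))).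
  by apply: pair_ext; apply: dprev2.
rewrite [LHS]/(- sgn k j.+1 *: mufun (sgn k j *: delta v + Tfun (dprev C j) (r : Tm i (pre C j)))
  + dprev C j (- sgn k j *: mufun (r : Tm i (pre C j)) + ddprev j c)).
rewrite mufunD mufunZ mufun_delta scaler0 add0r mufun_natural.
by rewrite -[sgn k j.+1]opprK -sgnS sgnS opprK; apply: lin_cancel (dprev_ddprev c).
Qed.

(* The reduction B_i B_i = B_i (1) + B_i (-1) turns the twofold cone into
   C \otimes (B_i (-1) -> B_i (1) -> R (2)). *)
Definition dcone : cplx := Cplx dcone_dif2.

End Objects.
End DoubleCone.

Section ScalableGenerators.
Variables (k : fieldType) (i : 'I_2) (M N : lmodType {mpoly k[2 + 2]}) (f : M -> N).

(** R^e is generated by its left variables, the right alpha_i and the right alpha_j + alpha_i / 2.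
    Unlike alpha_j itself, these act on iterated models by simple formulas. *)
Lemma scalable_generators : (forall x y, f (x + y) = f x + f y) ->
  (forall c x, f (c%:MP *: x) = c%:MP *: f x) ->
  (forall r x, f (lft r *: x) = lft r *: f x) ->
  (forall x, f (yel k i *: x) = yel k i *: f x) ->
  (forall j, j != i -> forall x, f ((rgt 'X_j + half k * yel k i) *: x) =
     (rgt 'X_j + half k * yel k i) *: f x) ->
  forall a x, f (a *: x) = a *: f x.
Proof.
move=> fD fC fl fy fr; apply: enveloping_ind => [//|//|j|p q fp fq|p q fp fq] x.
- have [->|ji] := eqVneq j i; first exact: fy.
  have -> : rgt 'X_j = (rgt 'X_j + half k * yel k i) + (- 2^-1)%:MP * yel k i.
    by rewrite mpolyCN mulNr addrK.
  move: (rgt 'X_j + half k * yel k i) (fr j ji) => q fq.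
  by rewrite !scalerDl fD fq -!scalerA fC fy.
- by rewrite !scalerDl fD fp fq.
- by rewrite -!scalerA fp fq.
Qed.

End ScalableGenerators.

(** * Gaussian elimination in the twofold cone *)

Section DoubleConeRetract.
Variable k : fieldType.
Local Notation R := {mpoly k[2]}.
Local Notation A := {mpoly k[2 + 2]}.
Local Notation gmod := (gmod k (2 + 2)).
Local Notation cplx := (cplx k (2 + 2)).
Variable i : 'I_2.
Local Notation yel := (yel k i).
Variable C : cplx.
Hypothesis gC : forall j, wgraded (C j).
Local Notation T := (Tm i).
Local Notation C1 := (cone i gC).
Local Notation C2 := (cone i (cone_wgraded i gC)).
Local Notation D := (dcone i gC).

(* The coordinates of an element of the twofold cone: (u, v) is the component in
   C \otimes B_i \otimes B_i, regrouped along the middle tensor factor, p and q are the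
   components in C \otimes B_i coming from the first and the second copy of F(sigma_i),
   and c is the component in C. *)
Definition dcu j (x : C2 j) : T (C j) := (x.1.1.1.1, x.1.2.1.1).
Definition dcv j (x : C2 j) : T (C j) := (x.1.1.1.2, x.1.2.1.2).
Definition dcp j (x : C2 j) : T (pre C j) := (x.1.1.2, x.1.2.2).

Definition fstpre j : pre C1 j -> T (pre C j) :=
  match j with 0 => fun _ => 0 | _.+1 => fun y => y.1 end.
Definition sndpre j : pre C1 j -> pre (pre C) j :=
  match j with 0 => fun _ => 0 | _.+1 => fun y => y.2 end.
Definition mkpre j : T (pre C j) -> pre (pre C) j -> pre C1 j :=
  match j with 0 => fun _ _ => 0 | _.+1 => fun r c => (r, c) end.

Definition mkdc j (u v : T (C j)) (p : T (pre C j)) (y : pre C1 j) : C2 j :=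
  ((((u.1, v.1) : T (C j), p.1), ((u.2, v.2) : T (C j), p.2)), y).

Lemma mkdcE j (x : C2 j) : x = mkdc (dcu x) (dcv x) (dcp x) x.2.
Proof. by case: x => [[[[a b] c] [[d e] f]] y]. Qed.

Lemma fstpre_lin j : linear (@fstpre j).
Proof. by case: j => [|j] a x y //; rewrite /= scaler0 addr0. Qed.
Lemma sndpre_lin j : linear (@sndpre j).
Proof. by case: j => [|j] a x y //; rewrite /= scaler0 addr0. Qed.
Lemma fstpre0 j : fstpre (0 : pre C1 j) = 0. Proof. by case: j. Qed.
Lemma sndpre0 j : sndpre (0 : pre C1 j) = 0. Proof. by case: j. Qed.
Lemma mkpreD j r r' c c' : @mkpre j r c + mkpre r' c' = mkpre (r + r') (c + c').
Proof. by case: j r r' c c' => [|j] r r' c c'; [apply: row0_eq|]. Qed.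
Lemma mkpre_lin j a r r' c c' :
  @mkpre j (a *: r + r') (a *: c + c') = a *: mkpre r c + mkpre r' c'.
Proof. by case: j r r' c c' => [|j] r r' c c' //; rewrite /= scaler0 addr0. Qed.

Lemma fstpreK j r c : fstpre (@mkpre j r c) = r.
Proof. by case: j r c => [|j] r c //; apply: Tm_gzero. Qed.
Lemma sndpreK j r c : sndpre (@mkpre j r c) = c.
Proof. by case: j r c => [|j] r c //; apply: row0_eq. Qed.
Lemma mkpreE j y : y = @mkpre j (fstpre y) (sndpre y).
Proof. by case: j y => [|j] y; [apply: row0_eq|case: y]. Qed.

(** The two multiplications B_i B_i -> B_i become u + [theta] v and u + y v. The first is an
    isomorphism in u, so u cancels against p; the difference of the two is [delta] v, the first map
    of the three-term complex. *)
Lemma cone_difE j (u v : T (C j)) (p : T (pre C j)) y :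
  cdif C2 j (mkdc u v p y) =
  mkdc (Tfun (cdif C j) u) (Tfun (cdif C j) v)
    (sgn k j *: (u + theta v) + Tfun (dprev C j) p)
    ((sgn k j *: (u + yel *: v) + Tfun (dprev C j) (fstpre y),
      sgn k j *: (mufun p - mufun (fstpre y)) + ddprev C j (sndpre y)) : C1 j).
Proof.
apply: pair_ext.
  apply: pair_ext; apply: pair_ext => //.
    by rewrite [RHS]/((sgn k j *: (u + theta v)).1 + _) Tm_sgn.
  by rewrite [RHS]/((sgn k j *: (u + theta v)).2 + _) Tm_sgn.
have E1 : ((u.1, v.1) : T (C j)) + yel *: ((u.2, v.2) : T (C j)) = u + yel *: v.
  by rewrite !Tm_yel; apply: pair_ext => //=; rewrite addrC.
have E2 : (dprev C1 j y : C1 j).1 = Tfun (dprev C j) (fstpre y).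
  by case: j {u v p E1} y => [|j] y //; apply: pair_ext; apply: esym; apply: linear0.
have E3 : (dprev C1 j y : C1 j).2 = - sgn k j *: mufun (fstpre y) + ddprev C j (sndpre y).
  case: j {u v p E1 E2} y => [|j] y; first exact: row0_eq.
  by rewrite sgnS opprK.
apply: pair_ext.
  exact: (congr2 (fun a b : T (C j) => sgn k j *: a + b) E1 E2).
apply: (etrans (congr1 (+%R (sgn k j *: mufun p)) E3)).
by rewrite addrA scalerBr scaleNr.
Qed.

Definition dc_to_fun j (x : C2 j) : D j :=
  (dcv x, (fstpre x.2 - dcp x, sndpre x.2)).

Lemma dcu_mk j u v p y : dcu (@mkdc j u v p y) = u. Proof. by case: u. Qed.
Lemma dcv_mk j u v p y : dcv (@mkdc j u v p y) = v. Proof. by case: v. Qed.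
Lemma dcp_mk j u v p y : dcp (@mkdc j u v p y) = p. Proof. by case: p. Qed.

Lemma dc_ext j (x x' : C2 j) : dcu x = dcu x' -> dcv x = dcv x' -> dcp x = dcp x' ->
  x.2 = x'.2 -> x = x'.
Proof. by move=> e1 e2 e3 e4; rewrite (mkdcE x) (mkdcE x') e1 e2 e3 e4. Qed.

Lemma Tm2_in j (x : C2 j) a : rho k i a = xin yel a ->
  dcu (a *: x) = a *: dcu x /\ dcv (a *: x) = a *: dcv x.
Proof.
move=> ra; have E : (a *: x).1 = (a *: x.1.1, a *: x.1.2) by apply: (Tm_in (x.1) ra).
have F (w : C1 j) : (a *: w).1 = (a *: w.1.1, a *: w.1.2) by apply: (Tm_in w.1 ra).
rewrite !(Tm_in _ ra); split.
  apply: (etrans (congr1 (fun w : C1 j * C1 j => (w.1.1.1, w.2.1.1)) E)).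
  exact: (congr2 (fun w w' : C j * C j => (w.1, w'.1)) (F _) (F _)).
apply: (etrans (congr1 (fun w : C1 j * C1 j => (w.1.1.2, w.2.1.2)) E)).
exact: (congr2 (fun w w' : C j * C j => (w.2, w'.2)) (F _) (F _)).
Qed.

Lemma Tm2_yel j (x : C2 j) : dcu (yel *: x) = yel *: dcu x /\ dcv (yel *: x) = yel *: dcv x.
Proof.
have E : (yel *: x).1 = (yel ^+ 2 *: x.1.2, x.1.1) by apply: (Tm_yel (x.1 : T (C1 j))).
have F (w : C1 j) : (yel ^+ 2 *: w).1 = (yel ^+ 2 *: w.1.1, yel ^+ 2 *: w.1.2).
  suff G (m : T (C j)) : yel ^+ 2 *: m = (yel ^+ 2 *: m.1, yel ^+ 2 *: m.2) by apply: G.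
  by rewrite [in LHS]expr2 -scalerA !Tm_yel.
rewrite !Tm_yel; split.
  apply: (etrans (congr1 (fun w : C1 j * C1 j => (w.1.1.1, w.2.1.1)) E)).
  exact: (congr1 (fun w : C j * C j => (w.1, x.1.1.1.1)) (F _)).
apply: (etrans (congr1 (fun w : C1 j * C1 j => (w.1.1.2, w.2.1.2)) E)).
exact: (congr1 (fun w : C j * C j => (w.2, x.1.1.1.2)) (F _)).
Qed.

Lemma dcuvD j (x y : C2 j) : dcu (x + y) = dcu x + dcu y /\ dcv (x + y) = dcv x + dcv y.
Proof.
have E : (x + y).1 = (x.1.1 + y.1.1, x.1.2 + y.1.2).
  exact: (TmD (x.1 : T (C1 j)) (y.1 : T (C1 j))).
have F (w w' : C1 j) : (w + w').1 = (w.1.1 + w'.1.1, w.1.2 + w'.1.2).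
  exact: (TmD (w.1 : T (C j)) (w'.1 : T (C j))).
rewrite !TmD; split.
  apply: (etrans (congr1 (fun w : C1 j * C1 j => (w.1.1.1, w.2.1.1)) E)).
  exact: (congr2 (fun w w' : C j * C j => (w.1, w'.1)) (F _ _) (F _ _)).
apply: (etrans (congr1 (fun w : C1 j * C1 j => (w.1.1.2, w.2.1.2)) E)).
exact: (congr2 (fun w w' : C j * C j => (w.2, w'.2)) (F _ _) (F _ _)).
Qed.

Lemma rho_lambda j : j != i -> rho k i (rgt 'X_j + half k * yel) = xin yel (rgt 'X_j + half k * yel).
Proof.
move=> ji; rewrite rmorphD rmorphM /= rho_rgtX (negPf ji) rhoC rho_yel.
by apply: pair_ext; rewrite /= !(mulr0, mul0r, mulr1, addr0, add0r) // addNr.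
Qed.

Lemma dcuZ j a (x : C2 j) : dcu (a *: x) = a *: dcu x.
Proof.
apply: (@scalable_generators k i (C2 j) (T (C j)) (@dcu j)) => {a x}.
- by move=> x y; have [e _] := dcuvD x y; exact: e.
- by move=> c x; have [e _] := Tm2_in x (rhoC i c); exact: e.
- by move=> r x; have [e _] := Tm2_in x (rho_lft i r); exact: e.
- by move=> x; have [e _] := Tm2_yel x; exact: e.
- by move=> l li x; have [e _] := Tm2_in x (rho_lambda li); exact: e.
Qed.

Lemma dcvZ j a (x : C2 j) : dcv (a *: x) = a *: dcv x.
Proof.
apply: (@scalable_generators k i (C2 j) (T (C j)) (@dcv j)) => {a x}.
- by move=> x y; have [_ e] := dcuvD x y; exact: e.
- by move=> c x; have [_ e] := Tm2_in x (rhoC i c); exact: e.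
- by move=> r x; have [_ e] := Tm2_in x (rho_lft i r); exact: e.
- by move=> x; have [_ e] := Tm2_yel x; exact: e.
- by move=> l li x; have [_ e] := Tm2_in x (rho_lambda li); exact: e.
Qed.

Lemma dcu_lin j : linear (@dcu j).
Proof. move=> a x y; have [e _] := dcuvD (a *: x) y.
exact: (etrans e (congr1 (+%R^~ (dcu y)) (dcuZ a x))). Qed.
Lemma dcv_lin j : linear (@dcv j).
Proof. move=> a x y; have [_ e] := dcuvD (a *: x) y.
exact: (etrans e (congr1 (+%R^~ (dcv y)) (dcvZ a x))). Qed.
Lemma dcp_lin j : linear (@dcp j).
Proof.
move=> a x y; exact: (linearP (Tfun (snd : {linear C1 j -> pre C j})) a
  (x.1 : T (C1 j)) (y.1 : T (C1 j))).
Qed.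

Lemma dc_to_lin j : linear (@dc_to_fun j).
Proof.
move=> a x y; apply: pair_ext; last apply: pair_ext.
- exact: dcv_lin.
- apply: (etrans (congr2 (fun m n : T (pre C j) => m - n) (fstpre_lin a x.2 y.2)
    (dcp_lin a x y))).
  by rewrite opprD addrACA -scalerBr.
exact: sndpre_lin.
Qed.

(** With u = - [theta] v the component p of the differential stays zero. *)
Definition dc_from_fun j (x : D j) : C2 j := mkdc (- theta x.1) x.1 0 (mkpre x.2.1 x.2.2).

Lemma dc_from_lin j : linear (@dc_from_fun j).
Proof.
move=> a x y; apply: dc_ext.
- by rewrite dcu_lin !dcu_mk theta_lin opprD scalerN.
- by rewrite dcv_lin !dcv_mk.
- by rewrite dcp_lin !dcp_mk scaler0 addr0.
exact: mkpre_lin.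
Qed.

Lemma fstpre_deg j e (y : pre C1 j) : gdeg e y -> gdeg (e + 1) (fstpre y).
Proof. by case: j y => [|j] y; [split|case]. Qed.
Lemma sndpre_deg j e (y : pre C1 j) : gdeg e y -> gdeg (e + 1) (sndpre y).
Proof. by case: j y => [|j] y // []. Qed.

Lemma dc_to_deg j d (x : C2 j) : gdeg d x -> gdeg d (dc_to_fun x).
Proof.
case: x => [[[w0 p0] [w1 p1]] y] [[[[d1 d2] d3] [[d4 d5] d6]] d7].
have gp := Tm_wgraded i (pre_wgraded gC j).
have E e e' (M : gmod) (m : M) : gdeg e m -> e = e' -> gdeg e' m by move=> ? <-.
split; [split|split].
- by apply: E d2 _; lia.
- by apply: E d5 _; lia.
- apply: (wgdegD gp (d := d + 2)); first by apply: E (fstpre_deg d7) _; lia.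
  have d3' : @gdeg _ _ (pre C j) (d + 1 + 1) p0 by exact: d3.
  have d6' : @gdeg _ _ (pre C j) (d + 1 - 2 + 1) p1 by exact: d6.
  by apply: (wgdegN gp (d := d + 2)); split; [apply: E d3' _|apply: E d6' _]; lia.
by apply: E (sndpre_deg d7) _; lia.
Qed.

Lemma mkpre_deg j e r c : gdeg (e + 1) r -> gdeg (e + 1) c -> gdeg e (@mkpre j r c).
Proof. by case: j r c => [|j] r c. Qed.

Lemma dc_from_deg j d (x : D j) : gdeg d x -> gdeg d (dc_from_fun x).
Proof.
case: x => [[v0 v1] [r c]] [[d0 d1] [dr dc]].
have E e e' (M : gmod) (m : M) : gdeg e m -> e = e' -> gdeg e' m by move=> ? <-.
have gc := gC j; have gp := pre_wgraded gC j.
have Y e (m : C j) : gdeg e m -> gdeg (e + 2) (- (yel *: m)).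
  by move=> em; apply: wgdegN => //; rewrite addrC; apply: wgdegZ => //; apply: yel_deg.
split; [split; split; [split| |split|]|].
- by apply: E (Y _ _ d0) _; lia.
- by apply: E d0 _; lia.
- exact: (wgdeg0 gp).
- by apply: E (Y _ _ d1) _; lia.
- by apply: E d1 _; lia.
- exact: (wgdeg0 gp).
have E1 : d + 2 = d + 1 + 1 by lia.
have dr' : @gdeg _ _ (T (pre C j)) (d + 2) r by exact: dr.
have dc' : @gdeg _ _ (pre (pre C) j) (d + 2) c by exact: dc.
by apply: mkpre_deg; [apply: E dr' E1|apply: E dc' E1].
Qed.

Definition dc_to j : gmor (C2 j) (D j) := mkgmor (@dc_to_lin j) (@dc_to_deg j).
Definition dc_from j : gmor (D j) (C2 j) := mkgmor (@dc_from_lin j) (@dc_from_deg j).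

(** Inverts the isomorphism from u to p that is being cancelled, including its sign. *)
Definition dc_htpy_fun j : C2 j -> pre C2 j :=
  match j with
  | 0 => fun _ => 0
  | l.+1 => fun x => mkdc (sgn k l *: dcp x : T (C l)) 0 0 0
  end.

Lemma dc_htpy_lin j : linear (@dc_htpy_fun j).
Proof.
case: j => [|j] a x y; first by rewrite /= scaler0 addr0.
apply: dc_ext.
- by rewrite dcu_lin !dcu_mk dcp_lin scalerDr !scalerA [sgn k j * a]mulrC.
- by rewrite dcv_lin !dcv_mk scaler0 addr0.
- by rewrite dcp_lin !dcp_mk scaler0 addr0.
exact: (esym (etrans (addr0 (a *: (0 : pre C1 j))) (scaler0 _ a))).
Qed.

Definition dc_htpy j : {linear C2 j -> pre C2 j} :=
  HB.pack_for {linear C2 j -> pre C2 j} (@dc_htpy_fun j)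
    (GRing.isLinear.Build A _ _ _ (@dc_htpy_fun j) (@dc_htpy_lin j)).

Lemma mkdc_eq j u u' v v' p p' y y' : u = u' -> v = v' -> p = p' -> y = y' ->
  @mkdc j u v p y = mkdc u' v' p' y'.
Proof. by move=> -> -> -> ->. Qed.

Lemma scale_pick (V : lmodType A) (c y : A) (p q : V) :
  c * c = 1 -> q = 0 -> c *: (c *: p + y *: 0) + q = p.
Proof. by move=> cc ->; rewrite scaler0 !addr0 scalerA cc scale1r. Qed.

Lemma scale_cancel (V : lmodType A) (c : A) (u v q : V) :
  c * c = 1 -> - v + (- c *: q + c *: (c *: (u + v) + q)) = u.
Proof.
by move=> cc; rewrite scalerDr scalerA cc scale1r scaleNr [(u + v) + _]addrC addKr addrC addrK.
Qed.

Lemma dc_htpy_dif j (x : C2 j) (w := dprev C2 j (dc_htpy j x) : C2 j) :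
  [/\ dcu w = - sgn k j *: Tfun (dprev C j) (dcp x), dcv w = 0, dcp w = dcp x &
      w.2 = mkpre (dcp x) 0].
Proof.
case: j x @w => [|j] x w.
  split; [|exact: erefl|exact: Tm_gzero|exact: row0_eq].
  by apply/esym; apply: (etrans (congr1 ( *:%R _) (_ : _ = 0))); [|apply: scaler0].
have E : w = cdif C2 j (mkdc (sgn k j *: dcp x : T (C j)) 0 0 0) by [].
rewrite E cone_difE; split.
- rewrite dcu_mk sgnS opprK; exact: (linearZ_LR (Tfun (cdif C j))).
- rewrite dcv_mk; exact: (linear0 (Tfun (cdif C j))).
- rewrite dcp_mk (_ : theta 0 = 0) ?addr0; last by apply: pair_ext; apply: scaler0.
  rewrite scalerA sgn2 scale1r -[RHS]addr0; congr (_ + _).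
  exact: (linear0 (Tfun (dprev C j))).
have f0 := fstpre0 j; have s0 := sndpre0 j.
apply: pair_ext.
  apply: scale_pick; first exact: sgn2.
  by apply: (etrans (congr1 (Tfun (dprev C j)) f0)); apply: (linear0 (Tfun (dprev C j))).
apply: (etrans (congr2 (fun (r : T (pre C j)) (c : pre (pre C) j) =>
  sgn k j *: (mufun 0 - mufun r) + ddprev C j c) f0 s0)).
by rewrite subrr scaler0 add0r linear0.
Qed.

Lemma dcone_retract : hretract C2 D.
Proof.
apply: (@HRetract k C2 D dc_to dc_from dc_htpy) => [j x|j x|j x|j x].
- have := cone_difE (dcu x) (dcv x) (dcp x) x.2; rewrite -(mkdcE x) => ->.
  set u := dcu x; set v := dcv x; set p := dcp x; set y := x.2.
  apply: pair_ext; first exact: dcv_mk.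
  apply: pair_ext.
    pose L := sgn k j *: (u + yel *: v) + Tfun (dprev C j) (fstpre y).
    pose L' := sgn k j *: (u + theta v) + Tfun (dprev C j) p.
    transitivity (L - L').
      exact: (congr1 (fun z : T (C j) => L - z) (@dcp_mk j.+1 _ _ L' _)).
    apply: (etrans (sub_comb _ _ _ _ _ _)).
    exact: (congr1 (+%R (sgn k j *: delta v))
      (esym (linearB (Tfun (dprev C j)) (fstpre y) p))).
  have E : sgn k j *: (mufun p - mufun (fstpre y)) = - sgn k j *: mufun (fstpre y - p).
    rewrite (_ : fstpre y - p = -1 *: p + fstpre y); last by rewrite scaleN1r addrC.
    by rewrite mufun_lin scaleN1r addrC -opprB scalerN scaleNr.
  exact: (congr1 (+%R^~ (ddprev C j (sndpre y))) E).
- rewrite [LHS]/(dc_from_fun (dcone_fun x)) [dc_from j x]/(dc_from_fun x).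
  rewrite [RHS]cone_difE; apply: mkdc_eq => //.
  + apply: (etrans (congr1 -%R (theta_natural (cdif C j) x.1))).
    exact: (esym (linearN (Tfun (cdif C j)) _)).
  + rewrite addNr scaler0 add0r; exact: (esym (linear0 (Tfun (dprev C j)))).
  + rewrite fstpreK sndpreK mufun0 sub0r scalerN -scaleNr [- theta _ + _]addrC.
    exact: erefl.
- apply: pair_ext; first by rewrite [LHS]dcv_mk.
  apply: pair_ext; last exact: sndpreK.
  pose z := fstpre (mkpre x.2.1 x.2.2).
  apply: (etrans (y := z - 0)); last by rewrite subr0; apply: fstpreK.
  exact: (congr1 (fun q : T (pre C j) => z - q) (dcp_mk _ _ 0 _)).
have [Ku Kv Kp Ky] := dc_htpy_dif x.
have E := cone_difE (dcu x) (dcv x) (dcp x) x.2; rewrite -(mkdcE x) in E.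
set h := sgn k j *: (sgn k j *: (dcu x + theta (dcv x)) + Tfun (dprev C j) (dcp x)).
have Hx : dc_htpy j.+1 (cdif C2 j x) = mkdc h 0 0 0.
  rewrite E.
  by apply: mkdc_eq => //; rewrite /h; congr (_ *: _); apply: dcp_mk.
rewrite Hx; move: (dprev C2 j (dc_htpy j x)) Ku Kv Kp Ky => w Ku Kv Kp Ky {Hx E}.
set z := mkdc h 0 0 0; set y := dc_from j (dc_to j x).
have [e1 e2] := dcuvD y (w + z); have [e3 e4] := dcuvD w z.
apply: dc_ext.
- apply: (etrans (y := - theta (dcv x) + (- sgn k j *: Tfun (dprev C j) (dcp x) + h))).
    by rewrite /h; apply/esym/scale_cancel; apply: sgn2.
  have Ey : dcu y = - theta (dcv x) by exact: dcu_mk.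
  have Ez : dcu z = h by exact: dcu_mk.
  exact: (esym (etrans e1 (congr2 +%R Ey (etrans e3 (congr2 +%R Ku Ez))))).
- have Ey : dcv y = dcv x by exact: dcv_mk.
  have Ez : dcv z = 0 by exact: dcv_mk.
  have E3 : dcv x + (0 + 0) = dcv x by rewrite !addr0.
  exact: (esym (etrans (etrans e2 (congr2 +%R Ey (etrans e4 (congr2 +%R Kv Ez)))) E3)).
- have D3 (m n : C2 j) : dcp (m + n) = dcp m + dcp n.
    by have := dcp_lin 1 m n; rewrite !scale1r.
  have Ey : dcp y = 0 by exact: dcp_mk.
  have Ez : dcp z = 0 by exact: dcp_mk.
  have E3 : 0 + (dcp x + 0) = dcp x by rewrite add0r addr0.
  exact: (esym (etrans (etrans (D3 y (w + z)) (congr2 +%R Ey (etrans (D3 w z)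
    (congr2 +%R Kp Ez)))) E3)).
have Ey : y.2 = mkpre (fstpre x.2 - dcp x) (sndpre x.2) by [].
have Ez : z.2 = 0 by [].
have E3 : mkpre (fstpre x.2 - dcp x) (sndpre x.2) + (mkpre (dcp x) 0 + 0) = x.2.
  by rewrite addr0 mkpreD subrK addr0 -mkpreE.
have S (m n : C2 j) : (m + n).2 = m.2 + n.2 by exact: (linearD (snd : {linear C2 j -> pre C1 j})).
exact: (esym (etrans (etrans (S y (w + z)) (congr2 +%R Ey (etrans (S w z)
  (congr2 +%R Ky Ez)))) E3)).
Qed.

End DoubleConeRetract.

Lemma prod_lin1 (A : nzRingType) (V W : lmodType A) p (x y : V * W) :
  (p *: x + y).1 = p *: x.1 + y.1.
Proof. by []. Qed.

Lemma prod_lin2 (A : nzRingType) (V W : lmodType A) p (x y : V * W) :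
  (p *: x + y).2 = p *: x.2 + y.2.
Proof. by []. Qed.

(** * Reduction of the complex of sigma_1^2 sigma_2^2 *)

Section ThreeTermComplex.
Variables (k : fieldType) (S Y : gmod k (2 + 2)).
Variables (del : gmor S (gshift 2 S)) (m : gmor S Y).
Hypothesis m_del : forall x, m (del x) = 0.

Definition three_obj (j : nat) : gmod k (2 + 2) :=
  match j with
  | 0 => S
  | 1 => gshift 2 S
  | 2 => gshift 2 Y
  | _ => gzero k (2 + 2)
  end.

Definition three_dif (j : nat) : gmor (three_obj j) (three_obj j.+1) :=
  match j with
  | 0 => del
  | 1 => gshift_mor 2 m
  | j'.+2 => gto0 (three_obj j'.+2)
  end.

Lemma three_dif2 j x : three_dif j.+1 (three_dif j x) = 0.
Proof.
by case: j x => [|[|j]] x; [exact: m_del|exact: (erefl (0 : gzero k (2 + 2)))|].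
Qed.

Definition three_cplx : cplx k (2 + 2) := Cplx three_dif2.

Lemma three_wgraded : wgraded S -> wgraded Y -> forall j, wgraded (three_cplx j).
Proof.
move=> gS gY [|[|[|j]]]; last exact: gzero_wgraded; first exact: gS.
  exact: gshift_wgraded.
exact: gshift_wgraded.
Qed.

End ThreeTermComplex.

Section SquareOfGenerator.
Variable k : fieldType.
Hypothesis two_neq0 : 2 != 0 :> k.
Local Notation gmod := (gmod k (2 + 2)).
Local Notation cplx := (cplx k (2 + 2)).
Local Notation gdiag := (gdiag k 2).
Variable i : 'I_2.

Lemma gdiag_wgraded : wgraded gdiag.
Proof. by apply: graded_wgraded; apply: gdiag_graded. Qed.

Lemma F_wgraded j : wgraded (F k i j).
Proof. exact: gisom_wgraded (F_to_cone_isom two_neq0 i j) (cone_wgraded i (unit_wgraded k) j). Qed.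

Definition delta_mor (M : gmod) (gM : wgraded M) : gmor (Tm i M) (gshift 2 (Tm i M)) :=
  @mkgmor k (2 + 2) (Tm i M) (gshift 2 (Tm i M)) (@delta k i M) (@delta_lin k i M)
    (fun d x => @delta_deg k i M d x gM).

Definition sq_cplx : cplx :=
  @three_cplx k (Tm i gdiag) gdiag (delta_mor gdiag_wgraded) (mu i gdiag_wgraded)
    (@mufun_delta k i gdiag).

Definition sq_wgraded : forall j, wgraded (sq_cplx j) :=
  @three_wgraded k (Tm i gdiag) gdiag (delta_mor gdiag_wgraded) (mu i gdiag_wgraded)
    (@mufun_delta k i gdiag) (Tm_wgraded i gdiag_wgraded) gdiag_wgraded.

Local Notation D := (dcone i (unit_wgraded k)).

Definition to_sq_fun j : D j -> three_obj (Tm i gdiag) gdiag j :=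
  match j with
  | 0 => fun x => x.1
  | 1 => fun x => x.2.1
  | 2 => fun x => x.2.2
  | _ => fun _ => 0
  end.

Lemma to_sq_lin j : linear (@to_sq_fun j).
Proof.
case: j => [|[|[|j]]] p x y; last exact: row0_eq.
- exact: (@prod_lin1 _ (Tm i gdiag) (gsum (gshift 2 (Tm i (gzero k (2 + 2)))) (gshift 2 (gzero k (2 + 2)))) p x y).
- exact: (congr1 fst (@prod_lin2 _ (Tm i (unit_cplx k 1)) (gsum (gshift 2 (Tm i gdiag)) (gshift 2 (gzero k (2 + 2)))) p x y)).
- exact: (congr1 snd (@prod_lin2 _ (Tm i (unit_cplx k 2)) (gsum (gshift 2 (Tm i (unit_cplx k 1))) (gshift 2 gdiag)) p x y)).
Qed.

Lemma to_sq_deg j d (x : D j) : gdeg d x -> gdeg d (to_sq_fun x).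
Proof. by case: j x => [|[|[|j]]] x [x1 [x2 x3]]. Qed.

Definition to_sq j : gmor (D j) (three_obj (Tm i gdiag) gdiag j) := mkgmor (@to_sq_lin j) (@to_sq_deg j).

Lemma to_sq_dif j x : to_sq j.+1 (cdif D j x) = cdif sq_cplx j (to_sq j x).
Proof.
case: j x => [|[|j]] x; last exact: row0_eq.
- have E (m : Tm i gdiag) : sgn k 0 *: m + 0 = m by rewrite addr0 /sgn expr0 scale1r.
  by rewrite -[RHS]E; congr (_ + _); apply: (linear0 (Tfun _)).
- have E (m : gdiag) : - sgn k 1 *: m + 0 = m.
    by rewrite addr0 sgnS opprK /sgn expr0 scale1r.
  by rewrite -[RHS]E.
Qed.

Lemma to_sq_isom j : gisom (to_sq j).
Proof.
have T0 := @Tm_gzero k i; have Z0 := @row0_eq k.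
have z0 d : @gdeg k (2 + 2) (gzero k (2 + 2)) d 0 by [].
case: j => [|[|[|j]]]; apply: gisom_bij.
- by move=> x y xy; apply: pair_ext => //; apply: pair_ext; [apply: T0|apply: Z0].
- by move=> y; exists (y, 0).
- by move=> d y dy; exists (y, 0).
- move=> x y xy; apply: pair_ext; first exact: T0.
  by apply: pair_ext => //; apply: Z0.
- by move=> y; exists (0, (y, 0)).
- by move=> d y dy; exists (0, (y, 0)).
- move=> x y xy; apply: pair_ext; first exact: T0.
  by apply: pair_ext => //; apply: T0.
- by move=> y; exists (0, (0, y)).
- by move=> d y dy; exists (0, (0, y)).
- move=> x y _; apply: pair_ext; first exact: T0.
  by apply: pair_ext; [apply: T0|apply: Z0].
- by move=> y; exists 0; apply: Z0.
- by move=> d y _; exists 0; split=> //; apply: Z0.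
Qed.

Lemma sq_retract : hretract D sq_cplx.
Proof. exact: (@isom_retract k D sq_cplx to_sq to_sq_dif to_sq_isom). Qed.

Lemma F_square_retract : hretract (tens_cplx (F k i) (F k i)) sq_cplx.
Proof.
apply: trans_retract (tens_cone two_neq0 i F_wgraded) _.
apply: trans_retract (cone_retract i F_wgraded (cone_wgraded i (unit_wgraded k))
  (F_cone two_neq0 i)) _.
exact: trans_retract (dcone_retract i (unit_wgraded k)) sq_retract.
Qed.

End SquareOfGenerator.

Section Chain.
Variable k : fieldType.
Hypothesis two_neq0 : 2 != 0 :> k.
Local Notation s := (ord0 : 'I_2).
Local Notation t := (ord_max : 'I_2).

Lemma F_square_wgraded j : wgraded (tens_cplx (F k s) (F k s) j).
Proof. exact (tens_cone_wgraded two_neq0 s (F_wgraded two_neq0 s) j). Qed.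

Lemma rouquier_wgraded j : wgraded (rouquier k [:: s; s; t; t] j).
Proof.
have g2 := tens_cone_wgraded two_neq0 t F_square_wgraded.
exact (tens_cone_wgraded two_neq0 t g2 j).
Qed.

(** Nine nonzero summands, three in each direction. In the order used by [dcone_obj], and up to
    shifts, degrees 0 to 4 hold V; V, V; U, V, S; U, S; Y, where V, U, S, Y stand for B_s B_t, B_t,
    B_s, R. *)
Definition small := dcone t (@sq_wgraded k s).

Lemma rouquier_retract : hretract (rouquier k [:: s; s; t; t]) small.
Proof.
have g2 := tens_cone_wgraded two_neq0 t F_square_wgraded.
apply: trans_retract (tens_cone two_neq0 t g2) _.
apply: trans_retract (cone_retract t g2 (cone_wgraded t F_square_wgraded)
  (tens_cone two_neq0 t F_square_wgraded)) _.
apply: trans_retract (dcone_retract t (@sq_wgraded k s)).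
apply: cone_retract.
exact: (cone_retract t F_square_wgraded (@sq_wgraded k s)
  (F_square_retract two_neq0 s)).
Qed.

End Chain.

Section Combinations.
Variables (A : comNzRingType) (V : lmodType A).
Implicit Types (a b h : A) (m n : V).

Lemma comb_zs' a b h m n : a *: m + (b + h * a) *: n = a *: (m + h *: n) - b *: (- n).
Proof. by rewrite scalerDl scalerDr scalerN opprK scalerA [h * a]mulrC addrCA addrC. Qed.

Lemma comb_zt' a b h m n : a *: m + (b + h * a) *: n = b *: n - a *: (- (m + h *: n)).
Proof. by rewrite scalerDl scalerN opprK scalerDr scalerA [h * a]mulrC addrCA. Qed.

Lemma comb_zs a b h m n : a *: n - b *: m = a *: (n + h *: m) + (b + h * a) *: (- m).
Proof. by rewrite comb_zs' opprK scalerN addrK. Qed.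

Lemma comb_zt a b h m n : b *: n - a *: m = a *: (- (m + h *: n)) + (b + h * a) *: n.
Proof. by rewrite comb_zt' opprD opprK addrK. Qed.

End Combinations.

(** * Koszul cohomology groups in coordinates *)

Section KoszulForms.
Variable k : fieldType.
Local Notation R := {mpoly k[2]}.
Local Notation A := {mpoly k[2 + 2]}.
Local Notation gmod := (gmod k (2 + 2)).
Local Notation zs := (zel k ord0).
Local Notation zt := (zel k ord_max).
Local Notation KZ := (kcocycle zs zt).
Local Notation KB := (kcoboundary zs zt).

(* The Koszul cochains of a free rank one module on which both differences act by zero:
   the shape of every Koszul cohomology group that occurs. *)
Definition kvalue (a : nat) (y : R * R) : Prop :=
  match a with
  | 1 => True
  | 0 | 2 => y.2 = 0
  | _ => y = 0
  end.

Definition vdeg (d1 d2 l : int) (y : R * R) : Prop := pdeg (l + d1) y.1 /\ pdeg (l + d2) y.2.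

(* f induces an isomorphism from the a-th Koszul cohomology of M onto [kvalue a], with
   section w. *)
Record kform (M : gmod) (a : nat) (d1 d2 : int) (f : M * M -> R * R) (w : R * R -> M * M) : Prop := KForm {
  kf_lin : forall r c c', f (lft r *: c + c') = (r * (f c).1 + (f c').1, r * (f c).2 + (f c').2);
  kf_value : forall c, KZ a c -> kvalue a (f c);
  kf_eq0 : forall c, KZ a c -> f c = 0 -> KB a c;
  kf_KB : forall c, KB a c -> f c = 0;
  kf_secZ : forall y, kvalue a y -> KZ a (w y);
  kf_secK : forall y, kvalue a y -> f (w y) = y;
  kf_deg : forall l c, kdeg a l c -> vdeg d1 d2 l (f c);
  kf_sec_deg : forall l y, vdeg d1 d2 l y -> kdeg a l (w y) }.

Definition lftlin (M : gmod) (f : M -> R) :=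
  forall r m m', f (lft r *: m + m') = r * f m + f m'.

Section Coordinates.
Variables (i j : 'I_2).
Hypothesis ji : j != i.
Local Notation zi := (zel k i).
Local Notation zj := (zel k j).
Variable M : gmod.
Implicit Types c : M * M.

Definition kcomp (l : 'I_2) c : M := if l == ord0 then c.1 else c.2.
Definition kpair (l : 'I_2) (u v : M) : M * M := if l == ord0 then (u, v) else (v, u).

Lemma ord2E : (i = ord0 /\ j = ord_max) \/ (i = ord_max /\ j = ord0).
Proof.
move: ji; elim/ord2P: i; elim/ord2P: j; rewrite ?eqxx // => _; by [left|right].
Qed.

Lemma kcomp_lin l r c c' : kcomp l (r *: c + c') = r *: kcomp l c + kcomp l c'.
Proof. by rewrite /kcomp; case: ifP. Qed.

Lemma kpairE c : c = kpair i (kcomp i c) (kcomp j c).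
Proof. by rewrite /kpair /kcomp; case: ord2E => -[-> ->]; case: c => ? ?. Qed.

Lemma kcompi u v : kcomp i (kpair i u v) = u.
Proof. by rewrite /kpair /kcomp; case: (i == ord0). Qed.
Lemma kcompj u v : kcomp j (kpair i u v) = v.
Proof. by rewrite /kpair /kcomp; case: ord2E => -[-> ->]. Qed.

(* In the coordinates z_i and z_l = z_j + z_i / 2, the latter is the difference of the two
   actions of an element of R^i. *)
Definition zlin : A := zj + half k * zi.
Definition kp c : M := kcomp i c.
Definition kq c : M := kcomp j c + half k *: kcomp i c.
Definition kpq (u v : M) : M * M := kpair i u (v - half k *: u).

Lemma kp_kpq u v : kp (kpq u v) = u. Proof. exact: kcompi. Qed.
Lemma kq_kpq u v : kq (kpq u v) = v.
Proof. by rewrite /kq /kpq kcompj kcompi subrK. Qed.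
Lemma kp_lin r c c' : kp (r *: c + c') = r *: kp c + kp c'.
Proof. exact: kcomp_lin. Qed.
Lemma kq_lin r c c' : kq (r *: c + c') = r *: kq c + kq c'.
Proof.
rewrite /kq !kcomp_lin !scalerDr !scalerA [half k * r]mulrC -!addrA; congr (_ + _).
exact: addrCA.
Qed.

Lemma zlinE (m : M) : zlin *: m = zj *: m + half k *: (zi *: m).
Proof. by rewrite /zlin scalerDl scalerA. Qed.

(** An invertible change of the two elements does not affect the Koszul complex up to isomorphism.
    This lemma and the next three carry out the change to z_i and z_l, whichever of s and t the
    index i is. *)
Lemma kz0E c : KZ 0 c <-> [/\ zi *: c.1 = 0, zlin *: c.1 = 0 & c.2 = 0].
Proof.
rewrite zlinE; split=> [[e1 e2 e3]|[e1 e2 e3]].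
  have [E1 E2] : zi *: c.1 = 0 /\ zj *: c.1 = 0 by case: ord2E => -[-> ->].
  by rewrite E1 E2 scaler0 addr0.
rewrite e1 scaler0 addr0 in e2.
by case: ord2E e1 e2 => -[-> ->] e1 e2; split.
Qed.

Lemma kz1E c : KZ 1 c <-> zi *: kq c = zlin *: kp c.
Proof.
have -> : zi *: kq c = zi *: kcomp j c + half k *: (zi *: kcomp i c).
  by rewrite /kq scalerDr !scalerA [zi * half k]mulrC.
rewrite zlinE /kp; split=> [E|/addIr E].
  by congr (_ + _); move: E; rewrite /kcomp /=; case: ord2E => -[-> ->].
by move: E; rewrite /kcomp /=; case: ord2E => -[-> ->].
Qed.

Lemma kb1E c : KB 1 c <-> exists m, kp c = zi *: m /\ kq c = zlin *: m.
Proof.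
split=> [[m E]|[m [E1 E2]]]; exists m.
  have [Ei Ej] : kcomp i c = zi *: m /\ kcomp j c = zj *: m.
    by rewrite E /kcomp; case: ord2E => -[-> ->].
  by rewrite /kp /kq Ei Ej zlinE.
have Ej : kcomp j c = zj *: m.
  by apply: (addIr (half k *: kcomp i c)); rewrite -/(kq c) E2 zlinE -/(kp c) E1.
rewrite {1}[c]kpairE Ej -/(kp c) E1 /kpair; by case: ord2E => -[-> ->].
Qed.

Lemma kb2E c : KB 2 c <-> (c.2 = 0 /\ exists m n, c.1 = zi *: m + zlin *: n).
Proof.
split=> [[m [n ->]]|[c2 [m [n c1]]]] /=.
  split=> //; rewrite /zlin; case: ord2E => -[-> ->].
    by exists (n + half k *: m), (- m); apply: comb_zs.
  by exists (- (m + half k *: n)), n; apply: comb_zt.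
move: c1; rewrite /zlin; case: ord2E => -[-> ->] c1.
  by exists (- n), (m + half k *: n); apply: pair_ext => //; apply: (etrans c1); apply: comb_zs'.
by exists (- (m + half k *: n)), n; apply: pair_ext => //; apply: (etrans c1); apply: comb_zt'.
Qed.

End Coordinates.
End KoszulForms.

Lemma zelE (k : fieldType) (i : 'I_2) : zel k i = lft 'X_i - yel k i.
Proof. exact: zel_def. Qed.

(** * Koszul equations over a quadratic extension *)

Section QuadraticKoszul.
Variables (A : comNzRingType) (V : lmodType A) (x w l e : A).
Hypothesis eP : forall m : V, x *: (x *: m) - w *: m = e *: (l *: m).
Implicit Types (m n p q a b : V).

(** The equations say z_i q = l p, z_i being the matrix with rows (x, - w) and (- 1, x). Eliminating
    q0 leaves an arbitrary q1 and one element of the kernel of l. *)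
Lemma quad_cocycle p0 p1 q0 q1 : x *: q0 - w *: q1 = l *: p0 -> x *: q1 - q0 = l *: p1 ->
  q0 = x *: q1 - l *: p1 /\ l *: (p0 + x *: p1 - e *: q1) = 0.
Proof.
move=> E0 E1; have q0E : q0 = x *: q1 - l *: p1 by rewrite -E1 opprB addrC subrK.
have E : l *: p0 = e *: (l *: q1) - x *: (l *: p1).
  by rewrite -E0 q0E scalerBr addrAC eP.
split=> //; rewrite scalerBr scalerDr E !scalerA [l * x]mulrC subrK.
by rewrite [l * e]mulrC subrr.
Qed.

(** Once that kernel element vanishes and q1 = l n, the pair (x n - p1, n) is a primitive of the
    cocycle. *)
Lemma quad_bounds p0 p1 q0 q1 n : q0 = x *: q1 - l *: p1 -> p0 + x *: p1 = e *: q1 ->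
  q1 = l *: n ->
  [/\ p0 = x *: (x *: n - p1) - w *: n, p1 = x *: n - (x *: n - p1) &
      q0 = l *: (x *: n - p1)].
Proof.
move=> E0 E1 E2; split.
- rewrite scalerBr addrAC eP -E2 -E1; apply/esym/addrK.
- by rewrite opprB addrC subrK.
by rewrite scalerBr E0 E2 !scalerA [x * l]mulrC.
Qed.

Lemma quad_coboundary m0 m1 :
  x *: m0 - w *: m1 + x *: (x *: m1 - m0) - e *: (l *: m1) = 0.
Proof. by rewrite scalerBr -eP addrCA [x *: m0 - _ - _]addrAC subrr add0r subrr. Qed.

(** The map (m0, m1) |-> m0 + x m1 carries the images of z_i and of l into the image of l, because
    x^2 - w acts as a multiple of l. *)
Lemma quad_image a0 a1 b0 b1 :
  (x *: a0 - w *: a1 + l *: b0) + x *: (x *: a1 - a0 + l *: b1) =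
  l *: (e *: a1 + b0 + x *: b1).
Proof.
rewrite !scalerDr scalerN addrACA -[in RHS]addrA; congr (_ + _).
  rewrite addrCA [x *: a0 - _ - _]addrAC subrr add0r eP !scalerA.
  by rewrite [l * e]mulrC.
by rewrite !scalerA [l * x]mulrC.
Qed.

End QuadraticKoszul.

(** * Koszul cohomology of an induced bimodule *)

Section InducedForms.
Variable k : fieldType.
Local Notation R := {mpoly k[2]}.
Local Notation A := {mpoly k[2 + 2]}.
Local Notation gmod := (gmod k (2 + 2)).
Local Notation zs := (zel k ord0).
Local Notation zt := (zel k ord_max).
Local Notation KZ := (kcocycle zs zt).
Local Notation KB := (kcoboundary zs zt).
Variables (i j : 'I_2).
Hypothesis ji : j != i.
Local Notation yel := (yel k i).
Local Notation x := (lft ('X_i : R)).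
Local Notation zl := (zlin k i j).

Lemma half_deg : pdeg 0 (half k). Proof. exact: pdegC. Qed.

Lemma kpq_deg (M : gmod) a l (c : M * M) : wgraded M -> kdeg a l c ->
  gdeg (l + (2 * a)%:Z) (kp i c) /\ gdeg (l + (2 * a)%:Z) (kq i j c).
Proof.
move=> gM [d1 d2]; have C o : gdeg (l + (2 * a)%:Z) (kcomp o c) by rewrite /kcomp; case: ifP.
split; first exact: C.
by apply: wgdegD => //; rewrite -[_ + _]add0r; apply: wgdegZ half_deg _.
Qed.

Lemma kpq_kdeg (M : gmod) a l (u v : M) : wgraded M ->
  gdeg (l + (2 * a)%:Z) u -> gdeg (l + (2 * a)%:Z) v -> kdeg a l (kpq i u v).
Proof.
move=> gM du dv; have dw : gdeg (l + (2 * a)%:Z) (v - half k *: u).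
  apply: wgdegD => //; apply: wgdegN => //.
  by rewrite -[_ + _]add0r; apply: wgdegZ half_deg _.
by rewrite /kpq /kpair; case: (i == ord0); split.
Qed.

(* The kernel of z_l on M is free over k[x_s, x_t] on g with coordinate ka, its cokernel
   is free with coordinate pi, and x_i^2 - y_i^2 acts as a multiple e of z_l. *)
Record tdata (M : gmod) (dk dp : int) (ka pi : M -> R) (g : M) (sg : R -> M) (e : A) : Prop := TData {
  td_wgraded : wgraded M;
  td_ka : lftlin ka;
  td_pi : lftlin pi;
  td_ker : forall m : M, zl *: m = 0 -> m = lft (ka m) *: g;
  td_g : zl *: g = 0;
  td_kag : ka g = 1;
  td_im : forall m : M, pi (zl *: m) = 0;
  td_coker : forall m : M, pi m = 0 -> exists n, m = zl *: n;
  td_sgK : forall r, pi (sg r) = r;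
  td_e : forall m : M, x *: (x *: m) - yel ^+ 2 *: m = e *: (zl *: m);
  td_ka_deg : forall d m, gdeg d m -> pdeg (d - dk) (ka m);
  td_pi_deg : forall d m, gdeg d m -> pdeg (d - dp) (pi m);
  td_g_deg : gdeg dk g;
  td_sg_deg : forall d r, pdeg d r -> gdeg (d + dp) (sg r);
  td_e_deg : pdeg 2 e }.

Lemma lftlin0 (M : gmod) (f : M -> R) : lftlin f -> f 0 = 0.
Proof. by move=> fl; have := fl (-1) 0 0; rewrite scaler0 addr0 mulN1r addNr. Qed.

Lemma lftlinZ (M : gmod) (f : M -> R) : lftlin f -> forall r m, f (lft r *: m) = r * f m.
Proof. by move=> fl r m; have := fl r m 0; rewrite !addr0 lftlin0 ?addr0. Qed.

Lemma form_comb (B : comNzRingType) (V : lmodType B) (r u v : B) (m m' n n' p p' : V) :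
  r *: m + m' + u *: (r *: n + n') - v *: (r *: p + p') =
  r *: (m + u *: n - v *: p) + (m' + u *: n' - v *: p').
Proof.
rewrite !scalerDr scalerN !scalerA [u * r]mulrC [v * r]mulrC opprD [RHS]addrACA.
by congr (_ + _); rewrite addrACA.
Qed.

Lemma form_comb2 (B : comNzRingType) (V : lmodType B) (r u : B) (m m' n n' : V) :
  r *: m + m' + u *: (r *: n + n') = r *: (m + u *: n) + (m' + u *: n').
Proof. by rewrite !scalerDr !scalerA [u * r]mulrC addrACA. Qed.

Variables (M : gmod) (dk dp : int) (ka pi : M -> R) (g : M) (sg : R -> M) (e : A).
Hypothesis D : tdata dk dp ka pi g sg e.
Local Notation T := (Tm i M).

(** Modulo z_i the induced module collapses onto M by e |-> x_i, and x_i^2 - y_i^2 acts as a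
    multiple of z_l. What remains is the kernel of z_l in degree 0, its cokernel in degree 2, and
    one copy of each in degree 1. *)
Definition tform (a : nat) (c : T * T) : R * R :=
  match a with
  | 0 => (ka c.1.2, 0)
  | 1 => (ka ((kp i c).1 + x *: (kp i c).2 - e *: (kq i j c).2), pi (kq i j c).2)
  | 2 => (pi (c.1.1 + x *: c.1.2), 0)
  | _ => 0
  end.

(** In degree 1 the summand [e *: sg y.2] cancels the correction by e in [tform] and makes the
    cochain a cocycle. *)
Definition tsec (a : nat) (y : R * R) : T * T :=
  match a with
  | 0 => ((lft ('X_i * y.1) *: g, lft y.1 *: g), 0)
  | 1 => kpq i ((lft y.1 *: g + e *: sg y.2, 0) : T) ((x *: sg y.2, sg y.2) : T)
  | 2 => ((sg y.1, 0), 0)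
  | _ => 0
  end.

(** Koszul degree a contributes 2 a, and the coordinate subtracts [dk] or [dp]. In degree 0 it is
    read off the coefficient of alpha_i, which costs 2 more. *)
Definition tdeg1 (a : nat) : int :=
  match a with 0 => - 2 - dk | 1 => 2 - dk | 2 => 4 - dp | _ => 0 end.

Lemma zel_Tm (m : T) : zel k i *: m = (x *: m.1 - yel ^+ 2 *: m.2, x *: m.2 - m.1).
Proof. by rewrite zelE scalerBl Tm_lft Tm_yel. Qed.

Lemma rho_zlin : rho k i zl = xin yel zl.
Proof.
have E : zl = lft ('X_j + (2^-1)%:MP * 'X_i) - (rgt 'X_j + half k * yel).
  by rewrite /zlin !zelE mulrBr addrACA -opprD rmorphD rmorphM /= lftC.
have ru := rho_lft i ('X_j + (2^-1)%:MP * 'X_i : R); have rv := rho_lambda k ji.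
rewrite E; move: {E} (lft _) (rgt _ + _) ru rv => u v ru rv.
apply: etrans (rmorphB _ u v) _; rewrite ru rv; exact/esym/rmorphB.
Qed.

Lemma zlin_Tm (m : T) : zl *: m = (zl *: m.1, zl *: m.2).
Proof. exact: Tm_in rho_zlin. Qed.

Lemma T1_lin r (m m' : T) : (lft r *: m + m').1 = lft r *: m.1 + m'.1.
Proof. by rewrite TmD Tm_lft. Qed.
Lemma T2_lin r (m m' : T) : (lft r *: m + m').2 = lft r *: m.2 + m'.2.
Proof. by rewrite TmD Tm_lft. Qed.

Lemma kq2_lin r (c c' : T * T) :
  (kq i j (lft r *: c + c')).2 = lft r *: (kq i j c).2 + (kq i j c').2.
Proof. exact: etrans (congr1 snd (kq_lin i j (lft r) c c')) (T2_lin r _ _). Qed.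
Lemma kp1_lin r (c c' : T * T) :
  (kp i (lft r *: c + c')).1 = lft r *: (kp i c).1 + (kp i c').1.
Proof. exact: etrans (congr1 fst (kp_lin i (lft r) c c')) (T1_lin r _ _). Qed.
Lemma kp2_lin r (c c' : T * T) :
  (kp i (lft r *: c + c')).2 = lft r *: (kp i c).2 + (kp i c').2.
Proof. exact: etrans (congr1 snd (kp_lin i (lft r) c c')) (T2_lin r _ _). Qed.

Lemma tA_lin r (c c' : T * T) :
  ka ((kp i (lft r *: c + c')).1 + x *: (kp i (lft r *: c + c')).2 -
      e *: (kq i j (lft r *: c + c')).2) =
  r * ka ((kp i c).1 + x *: (kp i c).2 - e *: (kq i j c).2) +
  ka ((kp i c').1 + x *: (kp i c').2 - e *: (kq i j c').2).
Proof.
rewrite -(td_ka D); apply: (congr1 ka); rewrite kp1_lin kp2_lin kq2_lin; exact: form_comb.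
Qed.

Lemma tform_lin a r c c' : tform a (lft r *: c + c') =
  (r * (tform a c).1 + (tform a c').1, r * (tform a c).2 + (tform a c').2).
Proof.
have kl := td_ka D; have pl := td_pi D.
have E0 : 0 = r * 0 + 0 :> R by rewrite mulr0 addr0.
case: a => [|[|[|a]]].
- exact: (congr2 pair (etrans (congr1 ka (T2_lin r c.1 c'.1)) (kl r _ _)) E0).
- exact: (congr2 pair (tA_lin r c c') (etrans (congr1 pi (kq2_lin r c c')) (pl r _ _))).
- apply: (congr2 pair _ E0); rewrite -[RHS]pl; apply: (congr1 pi).
  apply: (etrans (congr2 (fun m n : M => m + x *: n) (T1_lin r c.1 c'.1) (T2_lin r c.1 c'.1))).
  exact: form_comb2.
- exact: (congr2 pair E0 E0).
Qed.

Lemma tform_value a c : kvalue a (tform a c).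
Proof. by case: a => [|[|[|a]]]. Qed.

Let zeP (m : M) : x *: (x *: m) - yel ^+ 2 *: m = e *: (zl *: m) := td_e D m.

Lemma ka_inj (m : M) : zl *: m = 0 -> ka m = 0 -> m = 0.
Proof. by move=> /(td_ker D) {2}-> ->; rewrite rmorph0 scale0r. Qed.

Lemma zl_lft (r : R) (m : M) : zl *: m = 0 -> zl *: (lft r *: m) = 0.
Proof. by move=> m0; rewrite scalerA mulrC -scalerA m0 scaler0. Qed.

Lemma ka_g r : ka (lft r *: g) = r.
Proof. by rewrite (lftlinZ (td_ka D)) (td_kag D) mulr1. Qed.

Lemma Tm_cocycle1 (c : T * T) : KZ 1 c <->
  x *: (kq i j c).1 - yel ^+ 2 *: (kq i j c).2 = zl *: (kp i c).1 /\
  x *: (kq i j c).2 - (kq i j c).1 = zl *: (kp i c).2.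
Proof.
split=> [/(kz1E ji) E|[E0 E1]].
  have E' := etrans (esym (zel_Tm (kq i j c))) (etrans E (zlin_Tm (kp i c))).
  by split; [exact: (congr1 fst E')|exact: (congr1 snd E')].
apply/(kz1E ji); apply: (etrans (zel_Tm (kq i j c))).
apply: (etrans (congr2 pair E0 E1)); exact: (esym (zlin_Tm (kp i c))).
Qed.

Lemma Tm_coboundary1 (c : T * T) : KB 1 c <-> exists m0 m1 : M,
  [/\ (kp i c).1 = x *: m0 - yel ^+ 2 *: m1, (kp i c).2 = x *: m1 - m0,
      (kq i j c).1 = zl *: m0 & (kq i j c).2 = zl *: m1].
Proof.
split=> [/(kb1E ji)[m [E1 E2]]|[m0 [m1 [e1 e2 e3 e4]]]].
  have E1' := etrans E1 (zel_Tm m); have E2' := etrans E2 (zlin_Tm m).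
  exists m.1, m.2; split; [exact: (congr1 fst E1')|exact: (congr1 snd E1')
    |exact: (congr1 fst E2')|exact: (congr1 snd E2')].
apply/(kb1E ji); exists ((m0, m1) : T); split.
  apply: (etrans _ (esym (zel_Tm ((m0, m1) : T)))).
  by move: (kp i c) e1 e2 => [u v] /= -> ->.
apply: (etrans _ (esym (zlin_Tm ((m0, m1) : T)))).
by move: (kq i j c) e3 e4 => [u v] /= -> ->.
Qed.

Lemma tform_eq0 a c : KZ a c -> tform a c = 0 -> KB a c.
Proof.
case: a => [|[|[|a]]] //.
- move=> /(kz0E ji)[E1 E2 c2] /(congr1 fst) Ek.
  have E1' := etrans (esym (zel_Tm c.1)) E1; have E2' := etrans (esym (zlin_Tm c.1)) E2.
  have m2 : c.1.2 = 0 by apply: ka_inj Ek; exact: (congr1 snd E2').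
  have m1 : c.1.1 = 0.
    have /eqP := congr1 snd E1'; rewrite subr_eq0 => /eqP e1.
    by apply: etrans (esym e1) _; rewrite m2 scaler0.
  apply: pair_ext; last exact: c2.
  by move: (c.1) m1 m2 => [u v] /= -> ->.
- move=> /Tm_cocycle1[E0 E1] Et; apply/Tm_coboundary1.
  have Ek : ka _ = 0 := congr1 fst Et; have Ep : pi _ = 0 := congr1 snd Et.
  have [qE l0] := quad_cocycle zeP E0 E1.
  have /eqP := ka_inj l0 Ek; rewrite subr_eq0 => /eqP E2.
  have [n nE] := td_coker D Ep.
  have [e1 e2 e3] := quad_bounds zeP qE E2 nE.
  by exists (x *: n - (kp i c).2), n.
- move=> c2 /(congr1 fst) /(td_coker D)[n nE]; apply/(kb2E ji); split; first exact: c2.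
  exists ((- c.1.2, 0) : T), ((n, 0) : T).
  apply: (etrans _ (esym (congr2 (fun u v : T => u + v) (zel_Tm ((- c.1.2, 0) : T))
    (zlin_Tm ((n, 0) : T))))).
  apply: pair_ext.
    apply: (etrans (y := x *: (- c.1.2) - yel ^+ 2 *: 0 + zl *: n)) => //.
    by rewrite -nE scaler0 subr0 scalerN addrC addrK.
  apply: (etrans (y := x *: 0 - (- c.1.2) + zl *: 0)) => //.
  by rewrite !scaler0 sub0r opprK addr0.
Qed.

Lemma tform_KB a c : KB a c -> tform a c = 0.
Proof.
have p0 := lftlin0 (td_pi D); have k0 := lftlin0 (td_ka D).
case: a => [|[|[|a]]] //.
- move=> ->; exact: (congr2 pair k0 erefl).
- move=> /Tm_coboundary1[m0 [m1 [e1 e2 e3 e4]]]; apply: (congr2 pair).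
    by rewrite e1 e2 e4 (quad_coboundary zeP) k0.
  by rewrite e4 (td_im D).
- move=> /(kb2E ji)[_ [m [n c1]]]; apply: (congr2 pair) => //.
  have E := etrans c1 (congr2 (fun u v : T => u + v) (zel_Tm m) (zlin_Tm n)).
  apply: (etrans (congr1 (fun u : T => pi (u.1 + x *: u.2)) E)).
  exact: etrans (congr1 pi (quad_image zeP _ _ _ _)) (td_im D _).
Qed.

Lemma tsec0 (v : M) : zl *: v = 0 ->
  zel k i *: ((x *: v, v) : T) = 0 /\ zl *: ((x *: v, v) : T) = 0.
Proof.
move=> v0; split.
  apply: (etrans (zel_Tm _)); apply: (congr2 pair); last exact: subrr.
  by apply: (etrans (zeP v)); rewrite v0 scaler0.
apply: (etrans (zlin_Tm _)); apply: (congr2 pair) => //.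
by apply: (etrans (y := x *: (zl *: v))); [rewrite !scalerA mulrC|rewrite v0 scaler0].
Qed.

Lemma tsecZ a y : kvalue a y -> KZ a (tsec a y).
Proof.
case: a => [|[|[|a]]] // _.
  apply/(kz0E ji); rewrite /tsec rmorphM -scalerA.
  by have [E1 E2] := tsec0 (zl_lft y.1 (td_g D)); split.
apply/Tm_cocycle1; rewrite /tsec kp_kpq (kq_kpq ji); split.
  apply: (etrans (zeP (sg y.2))).
  apply: (etrans (y := zl *: (lft y.1 *: g) + zl *: (e *: sg y.2))); last by rewrite -scalerDr.
  by rewrite (zl_lft _ (td_g D)) add0r !scalerA [zl * e]mulrC.
by apply: (etrans (subrr _)); apply: (esym (scaler0 _ _)).
Qed.

Lemma tsecK a y : kvalue a y -> tform a (tsec a y) = y.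
Proof.
case: y => A0 B0; case: a => [|[|[|a]]] v.
- apply: (congr2 pair); [exact: ka_g|exact: esym v].
- rewrite /tform /tsec kp_kpq (kq_kpq ji); apply: (congr2 pair); last exact: (td_sgK D).
  apply: (etrans (y := ka (lft A0 *: g + e *: sg B0 + x *: 0 - e *: sg B0))) => //.
  by rewrite scaler0 addr0 addrK ka_g.
- apply: (congr2 pair); last exact: esym v.
  apply: (etrans (y := pi (sg A0 + x *: 0))) => //.
  by rewrite scaler0 addr0 (td_sgK D).
exact: esym v.
Qed.

Lemma x_deg : pdeg 2 x.
Proof. by apply: lft_deg; apply: pdegX. Qed.

Lemma tform_deg a l c : kdeg a l c -> vdeg (tdeg1 a) (- dp) l (tform a c).
Proof.
have gM := td_wgraded D; have pz d : @pdeg k 2 d 0 := @pdeg0 k 2 d.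
have E d d' (r : R) : pdeg d r -> d = d' -> pdeg d' r by move=> + <-.
have EM d d' (m : M) : gdeg d m -> d = d' -> gdeg d' m by move=> + <-.
case: a => [|[|[|a]]] dc; have [[d1 d2] [d3 d4]] := dc; split; try exact: pz.
- by apply: E (td_ka_deg D d2) _; rewrite /=; lia.
- have [[p1 p2] [q1 q2]] := kpq_deg (Tm_wgraded i gM) dc.
  apply: (E _ _ _ (td_ka_deg D (d := l + 2) _)); last by rewrite /=; lia.
  apply: wgdegD => //; first apply: wgdegD => //.
  + by apply: EM (wgdegZ gM x_deg p2) _; lia.
  + by apply: wgdegN => //; apply: EM (wgdegZ gM (td_e_deg D) q2) _; lia.
- have [[p1 p2] [q1 q2]] := kpq_deg (Tm_wgraded i gM) dc.
  by apply: E (td_pi_deg D q2) _; lia.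
- apply: (E _ _ _ (td_pi_deg D (d := l + 4) _)); last by rewrite /=; lia.
  apply: (wgdegD gM d1).
  by apply: EM (wgdegZ gM x_deg d2) _; lia.
Qed.

Lemma tsec_deg a l y : vdeg (tdeg1 a) (- dp) l y -> kdeg a l (tsec a y).
Proof.
have gM := td_wgraded D; have z d : gdeg d (0 : M) := wgdeg0 gM d.
have EM d d' (m : M) : gdeg d m -> d = d' -> gdeg d' m by move=> + <-.
case: a => [|[|[|a]]] [d1 d2]; rewrite /tdeg1 in d1.
- have gd : gdeg (l - 2) (lft y.1 *: g).
    by apply: EM (wgdegZ gM (lft_deg d1) (td_g_deg D)) _; lia.
  split; last by split; apply: z.
  split; last by apply: EM gd _; lia.
  rewrite [X in gdeg _ X](_ : _ = x *: (lft y.1 *: g)); last by rewrite /= rmorphM scalerA.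
  by apply: EM (wgdegZ gM x_deg gd) _; lia.
- have sd : gdeg l (sg y.2) by apply: EM (td_sg_deg D d2) _; lia.
  apply: kpq_kdeg; first exact: Tm_wgraded.
    split; last exact: z.
    apply: wgdegD => //; first by apply: EM (wgdegZ gM (lft_deg d1) (td_g_deg D)) _; lia.
    by apply: EM (wgdegZ gM (td_e_deg D) sd) _; lia.
  split; first by apply: EM (wgdegZ gM x_deg sd) _; lia.
  by apply: EM sd _; lia.
- have sd : gdeg (l + 4) (sg y.1) by apply: EM (td_sg_deg D d1) _; lia.
  split; last by split; apply: z.
  by split; [apply: EM sd _; lia|apply: z].
- by split; split; apply: z.
Qed.

Lemma tform_kform a : kform a (tdeg1 a) (- dp) (tform a) (tsec a).
Proof.
split.
- exact: tform_lin.
- by move=> c _; apply: tform_value.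
- exact: tform_eq0.
- exact: tform_KB.
- exact: tsecZ.
- exact: tsecK.
- exact: tform_deg.
- exact: tsec_deg.
Qed.

End InducedForms.

Lemma scale_sq (B : comNzRingType) (V : lmodType B) (h : B) (z : V) :
  z + h *: (- h *: z) = (1 - h * h) *: z.
Proof. by rewrite scalerBl scale1r scalerA mulrN scaleNr. Qed.

(** * The Koszul data of R and of B_j *)

Section Instances.
Variable k : fieldType.
Local Notation R := {mpoly k[2]}.
Local Notation A := {mpoly k[2 + 2]}.
Local Notation gmod := (gmod k (2 + 2)).
Local Notation gdiag := (gdiag k 2).
Local Notation zs := (zel k ord0).
Local Notation zt := (zel k ord_max).
Local Notation KZ := (kcocycle zs zt).
Local Notation KB := (kcoboundary zs zt).

Lemma zel_gdiag i (m : gdiag) : zel k i *: m = 0.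
Proof. by rewrite zelE scalerBl gdiag_lft gdiag_rgt subrr. Qed.

Lemma zlin_gdiag i j (m : gdiag) : zlin k i j *: m = 0.
Proof. by rewrite zlinE !zel_gdiag scaler0 addr0. Qed.

(** Both differences act by zero on R, so the form is the identity. *)
Lemma diag_kform a : @kform k gdiag a (2 * a)%:Z (2 * a)%:Z id id.
Proof.
split=> //.
- move=> r [c1 c2] [d1 d2]; apply: (congr2 pair).
    exact: (congr1 (fun m : gdiag => m + d1) (gdiag_lft r c1)).
  exact: (congr1 (fun m : gdiag => m + d2) (gdiag_lft r c2)).
- by case: a => [|[|[|a]]] c // [].
- by move=> c _ ->; apply: kcoboundary0.
- case: a => [|[|[|a]]] c //.
    by move=> [m ->]; apply: (congr2 pair); apply: zel_gdiag.
  move=> [m [n ->]]; apply: (congr2 pair) => //.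
  by apply: etrans (congr2 (fun u v : gdiag => u - v) (zel_gdiag _ _) (zel_gdiag _ _)) (subrr _).
- case: a => [|[|[|a]]] y //.
    by split=> //; apply: zel_gdiag.
  by move=> _; apply: etrans (zel_gdiag _ _) (esym (zel_gdiag _ _)).
Qed.

Lemma diag_tdata i j : @tdata k i j gdiag 0 0 id id (1 : R) id 0.
Proof.
split; try by [].
- exact: gdiag_wgraded.
- move=> r m m'; exact: (congr1 (fun u : gdiag => u + m') (gdiag_lft r m)).
- move=> r m m'; exact: (congr1 (fun u : gdiag => u + m') (gdiag_lft r m)).
- by move=> m _; rewrite gdiag_lft mulr1.
- exact: zlin_gdiag.
- exact: zlin_gdiag.
- by move=> m ->; exists 0; rewrite scaler0.
- move=> m; rewrite scale0r -[yel k i ^+ 2 *: m]scalerA !gdiag_lft !gdiag_rgt.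
  exact: subrr.
- by move=> d m; rewrite subr0.
- by move=> d m; rewrite subr0.
- by rewrite -mpolyC1; apply: pdegC.
- by move=> d m; rewrite addr0.
- exact: pdeg0.
Qed.

Section Second.
Variables (i j : 'I_2).
Hypothesis ji : j != i.
Hypothesis two_neq0 : 2 != 0 :> k.
Hypothesis three_neq0 : 3 != 0 :> k.
Local Notation S := (Tm j gdiag).
Local Notation x l := ('X_l : R).

Lemma zelS (m : S) : zel k j *: m =
  (x j * (m.1 : R) - x j ^+ 2 * (m.2 : R), x j * (m.2 : R) - (m.1 : R)).
Proof.
apply: (etrans (@zel_Tm k j gdiag m)); apply: (congr2 pair).
  apply: (congr2 (fun u v : gdiag => u - v) (gdiag_lft _ _)).
  by rewrite expr2 -scalerA !gdiag_rgt mulrA.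
exact: (congr1 (fun u : gdiag => u - m.1) (gdiag_lft _ _)).
Qed.

(** alpha_i + alpha_j / 2 is invariant under s_j, so its two actions on B_j agree and z_i + z_j / 2
    vanishes there. *)
Lemma zel_otherS (m : S) : zel k i *: m = - half k *: (zel k j *: m).
Proof.
have ij : i != j by rewrite eq_sym.
have := zlinE j i m; rewrite (zlin_Tm ij) !zlin_gdiag => /esym /eqP.
by rewrite addr_eq0 => /eqP ->; rewrite scaleNr.
Qed.

Definition third : A := (3^-1)%:MP.
(** On B_j, x_i^2 - y_i^2 is (x_i + y_i) z_i, where z_i = - z_j / 2 and z_j is 4/3 of z_l; the
    constant is therefore - 2/3. *)
Definition e_sq : A := - (third + third) * (lft ('X_i : R) + yel k i).

Lemma third3 : third + third + third = 1.
Proof.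
rewrite /third -!mpolyCD -mpolyC1; congr (_%:MP).
have := divff three_neq0; move: (3^-1) => u <-; ring.
Qed.

Lemma zlinS (m : S) : zlin k i j *: m = (1 - half k * half k) *: (zel k j *: m).
Proof. by rewrite zlinE zel_otherS; apply: scale_sq. Qed.

Lemma e_sq_coef : (- (third + third)) * (1 - half k * half k) = - half k.
Proof.
have E (B : comNzRingType) (h u : B) : h + h = 1 -> u + u + u = 1 ->
  - (u + u) * (1 - h * h) = - h.
  move=> hh uu; apply/eqP; rewrite -subr_eq0; apply/eqP.
  (* The cofactors exhibit the difference in the ideal generated by h + h - 1 and u + u + u - 1. *)
  have -> : - (u + u) * (1 - h * h) - - h =
    (h + h - 1) * (u * (h + 2)) - h * (u + u + u - 1) by ring.
  by rewrite hh uu !subrr mul0r mulr0 subrr.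
apply: E; [exact: half_half|exact: third3].
Qed.

(** The constant 4/3: z_l acts on B_j as 1 - 1/4 times z_j. *)
Definition q_inv : A := (1 + 1) * (third + third).

Lemma q_invK : q_inv * (1 - half k * half k) = 1.
Proof.
have E (B : comNzRingType) (h t q : B) : h + h = 1 -> - t * q = - h -> (1 + 1) * t * q = 1.
  move=> hh E; have -> : (1 + 1) * t * q = - (- t * q + - t * q) by ring.
  by rewrite E -opprD opprK.
by apply: E e_sq_coef; exact: half_half.
Qed.

Lemma zelS_zlin (m : S) : zel k j *: m = q_inv *: (zlin k i j *: m).
Proof. by rewrite zlinS [RHS]scalerA q_invK; apply/esym/scale1r. Qed.

Lemma S_lft (r : R) (m m' : gdiag) : (lft r *: m : gdiag) + m' = r * (m : R) + (m' : R).
Proof. exact: (congr1 (fun u : gdiag => u + m') (gdiag_lft r m)). Qed.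

(** On B_j the element z_l is a unit multiple of z_j. The kernel of z_j is generated by alpha_j (x)
    1 + 1 (x) alpha_j, the pair (alpha_j, 1) of the model, and multiplication identifies its
    cokernel with R. *)
Lemma S_tdata : @tdata k i j S 2 0 (fun m : S => m.2) (fun m : S => (m.1 : R) + x j * (m.2 : R))
  (x j, 1 : R) (fun r => (r, 0)) e_sq.
Proof.
have R1 (B : comNzRingType) (r y a b c d : B) :
  r * a + b + y * (r * c + d) = r * (a + y * c) + (b + y * d) by ring.
have R2 (B : comNzRingType) (y a b : B) : y * a - y ^+ 2 * b + y * (y * b - a) = 0 by ring.
split.
- exact: Tm_wgraded (gdiag_wgraded k).
- move=> r m m'; rewrite TmD Tm_lft; exact: S_lft.
- move=> r m m'; rewrite TmD Tm_lft.
  apply: (etrans (congr2 (fun u v : R => u + x j * v) (S_lft _ _ _) (S_lft _ _ _))).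
  exact: R1.
- move=> m E0; have := zelS_zlin m; rewrite E0 scaler0 zelS.
  move=> /(congr1 snd) /eqP; rewrite subr_eq0 => /eqP E.
  apply: (etrans _ (esym (Tm_lft _ _))); apply: pair_ext.
    by apply: (etrans _ (esym (gdiag_lft _ _))); rewrite mulrC E.
  by apply: (etrans _ (esym (gdiag_lft _ _))); rewrite mulr1.
- rewrite zlinS zelS (_ : (_, _) = 0 :> S) ?scaler0 //.
  by apply: (congr2 pair); rewrite ?mulr1 -?expr2 subrr.
- by [].
- move=> m; rewrite zlinS !scalerA mulrC -scalerA zelS; exact: R2.
- move=> m /eqP; rewrite addr_eq0 => /eqP E.
  exists (q_inv *: ((- (m.2 : R), 0 : R) : S)).
  rewrite scalerA mulrC -scalerA -zelS_zlin zelS.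
  apply: pair_ext; rewrite [RHS]/=; first by rewrite mulr0 subr0 mulrN.
  by rewrite mulr0 sub0r opprK.
- by move=> r; rewrite /= mulr0 addr0.
- move=> m; rewrite zlinS [RHS]scalerA.
  have -> : e_sq * (1 - half k * half k) = - half k * (lft (x i) + yel k i).
    rewrite -e_sq_coef /e_sq; ring.
  have R3 (B : comNzRingType) (V : lmodType B) (u y : B) (n : V) :
    u *: (u *: n) - y ^+ 2 *: n = (u + y) *: ((u - y) *: n).
    by rewrite !scalerA -scalerBl; congr (_ *: _); ring.
  by rewrite R3 -zelE zel_otherS !scalerA [- _ * (_ + _)]mulrC.
- by move=> d m [].
- move=> d m [m1 m2]; rewrite subr0; apply: pdegD => //.
  by rewrite -[d](subrK 2) addrC; apply: pdegM => //; apply: pdegX.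
- by split; [apply: pdegX|rewrite -mpolyC1; apply: pdegC].
- by move=> d r dr; rewrite addr0; split=> //; apply: pdeg0.
have ne d (p : A) : pdeg d p -> pdeg d (- p) by apply: pdegN.
rewrite /e_sq -[2]add0r; apply: pdegM.
  by apply: ne; apply: pdegD; apply: pdegC.
by apply: pdegD; [apply: lft_deg; apply: pdegX|apply: yel_deg].
Qed.

End Second.
End Instances.

(* The two cofactors in each proof certify the identity modulo h + h = 1 and u + u + u = 1. *)
Section MapIdentities.
Variables (B : comNzRingType) (x z h u a b : B).
Hypotheses (hh : h + h = 1) (uu : u + u + u = 1).
Let p := a * x + - (u + u) * ((z + (z + h * x)) * b).
Let q := a + - (u + u) * (- h * b).

Lemma mapVS_fst : z * b - h * p + ((z + h * x) * b + - h * x ^+ 2 * 0) +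
  x * (- (h * q) + (- h * b + (z + h * x) * 0)) = 8 * u * z * b - x * a.
Proof.
apply/eqP; rewrite -subr_eq0; apply/eqP; rewrite /p /q.
transitivity ((h + h - 1) * (2 * u * z * b - x * a) - (u + u + u - 1) * (2 * z * b)); first ring.
by rewrite hh uu !subrr !mul0r subrr.
Qed.

Lemma mapVS_snd : q + (- h * 0 + (z + h * x) * 0) + h * (- (h * q) + (- h * b + (z + h * x) * 0)) =
  (1 - h * h) * a.
Proof.
apply/eqP; rewrite -subr_eq0; apply/eqP; rewrite /q.
transitivity (- h * b * ((h + h - 1) * (u * (h + 2)) - h * (u + u + u - 1))); first ring.
by rewrite hh uu !subrr mul0r mulr0 subrr mulr0.
Qed.
End MapIdentities.

(** * Maps between Koszul cohomology groups *)

Section FormMaps.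
Variable k : fieldType.
Local Notation R := {mpoly k[2]}.
Local Notation A := {mpoly k[2 + 2]}.
Local Notation gmod := (gmod k (2 + 2)).
Local Notation zs := (zel k ord0).
Local Notation zt := (zel k ord_max).
Local Notation KZ := (kcocycle zs zt).
Local Notation KB := (kcoboundary zs zt).

Section OneForm.
Variables (M : gmod) (a : nat) (d1 d2 : int) (f : M * M -> R * R) (w : R * R -> M * M).
Hypothesis K : kform a d1 d2 f w.

Lemma kf0 : f 0 = 0.
Proof. exact: kf_KB K _ (kcoboundary0 _ _ _ a). Qed.

Lemma kfD c c' : f (c + c') = f c + f c'.
Proof. by have := kf_lin K 1 c c'; rewrite rmorph1 scale1r !mul1r. Qed.

Lemma kfB c c' : f (c - c') = f c - f c'.
Proof.
apply: (addIr (f c')); rewrite subrK -kfD; congr f; exact: subrK.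
Qed.

Lemma kf_rep c : KZ a c -> KB a (c - w (f c)).
Proof.
move=> zc; have v := kf_value K zc; apply: (kf_eq0 K).
  exact: (kcocycleB zc (kf_secZ K v)).
by rewrite kfB (kf_secK K v) subrr.
Qed.

End OneForm.

(** A cocycle differs from the section at its own coordinates by a coboundary, so computing a map on
    the section suffices. *)
Lemma induced_form (M N : gmod) a d1 d2 e1 e2 f w f' w' (F : {linear M -> N}) (G : R * R -> R * R) :
  @kform k M a d1 d2 f w -> @kform k N a e1 e2 f' w' ->
  (forall y, kvalue a y -> f' (kmap F (w y)) = G y) ->
  forall c, KZ a c -> f' (kmap F c) = G (f c).
Proof.
move=> K K' E c zc; rewrite -(E _ (kf_value K zc)).
have /(kmap_coboundary F) /(kf_KB K') := kf_rep K zc.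
rewrite kmapB (kfB K') => /eqP; rewrite subr_eq0 => /eqP; exact.
Qed.

End FormMaps.

(** * Matrices of the multiplication maps *)

Section SmallForms.
Variable k : fieldType.
Hypothesis two_neq0 : 2 != 0 :> k.
Hypothesis three_neq0 : 3 != 0 :> k.
Local Notation R := {mpoly k[2]}.
Local Notation A := {mpoly k[2 + 2]}.
Local Notation gmod := (gmod k (2 + 2)).
Local Notation gdiag := (gdiag k 2).
Local Notation s := (ord0 : 'I_2).
Local Notation t := (ord_max : 'I_2).
Local Notation S := (Tm s gdiag).
Local Notation U := (Tm t gdiag).
Local Notation V := (Tm t S).
Local Notation xs := ('X_s : R).
Local Notation xt := ('X_t : R).
Local Notation yt := (yel k t).

Definition fS a : S * S -> R * R := tform (i := s) t (M := gdiag) id id 0 a.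
Definition wS a : R * R -> S * S := tsec s (M := gdiag) (1 : R) id 0 a.
Definition fU a : U * U -> R * R := tform (i := t) s (M := gdiag) id id 0 a.
Definition wU a : R * R -> U * U := tsec t (M := gdiag) (1 : R) id 0 a.
Definition fV a : V * V -> R * R :=
  tform (i := t) s (M := S) (fun m : S => m.2) (fun m : S => (m.1 : R) + xs * (m.2 : R)) (e_sq k t) a.
Definition wV a : R * R -> V * V :=
  tsec t (M := S) ((xs, 1 : R) : S) (fun r => (r, 0) : S) (e_sq k t) a.

Lemma fS_kform a : kform a (tdeg1 0 0 a) (- 0) (fS a) (wS a).
Proof. exact: (@tform_kform k s t erefl _ _ _ _ _ _ _ _ (diag_tdata k s t)). Qed.
Lemma fU_kform a : kform a (tdeg1 0 0 a) (- 0) (fU a) (wU a).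
Proof. exact: (@tform_kform k t s erefl _ _ _ _ _ _ _ _ (diag_tdata k t s)). Qed.
Lemma fV_kform a : kform a (tdeg1 2 0 a) (- 0) (fV a) (wV a).
Proof.
exact: (@tform_kform k t s erefl _ _ _ _ _ _ _ _
  (@S_tdata k t s erefl two_neq0 three_neq0)).
Qed.

Local Notation h := ((2^-1)%:MP : R).
Local Notation th := ((3^-1)%:MP : R).

(** The matrices of B_s B_t -> B_s and, below, of B_s B_t -> B_t, B_s -> R and B_t -> R. In degree 0
    the generator (alpha, 1) multiplies to 2 alpha, in degree 2 the generator 1 (x) 1 to 1; the
    thirds in degree 1 stem from [e_sq]. *)
Definition gVS (a : nat) (y : R * R) : R * R :=
  match a with
  | 0 => (2 * xt * y.1, 0)
  | 1 => (8 * th * xt * y.2 - xs * y.1, (1 - h * h) * y.1)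
  | _ => y
  end.
Definition gVU (a : nat) (y : R * R) : R * R :=
  match a with
  | 0 => (2 * xs * y.1, 0)
  | 1 => (2 * xs * y.1 - 4 * th * xt * y.2, y.2)
  | _ => y
  end.
Definition gSY (a : nat) (y : R * R) : R * R :=
  match a with
  | 0 => (2 * xs * y.1, 0)
  | 1 => (y.1, 2 * xs * y.2 - h * y.1)
  | _ => y
  end.
Definition gUY (a : nat) (y : R * R) : R * R :=
  match a with
  | 0 => (2 * xt * y.1, 0)
  | 1 => (2 * xt * y.2 - h * y.1, y.1)
  | _ => y
  end.

Lemma hh1 : h + h = 1.
Proof.
rewrite -mpolyCD -mpolyC1; congr (_%:MP).
by have := divff two_neq0; move: (2^-1) => u <-; ring.
Qed.
Lemma th1 : th + th + th = 1.
Proof.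
rewrite -!mpolyCD -mpolyC1; congr (_%:MP).
by have := divff three_neq0; move: (3^-1) => u <-; ring.
Qed.

Lemma mu_diag i (m : Tm i gdiag) : mufun m = (m.1 : R) + 'X_i * (m.2 : R).
Proof. exact: (congr1 (fun u : gdiag => m.1 + u) (gdiag_rgt _ _)). Qed.

Lemma pair_lft i r (a b : R) : lft r *: ((a, b) : Tm i gdiag) = (r * a, r * b).
Proof. exact: etrans (Tm_lft _ _) (congr2 pair (gdiag_lft _ _) (gdiag_lft _ _)). Qed.

Lemma halfE : half k = lft h. Proof. by rewrite lftC. Qed.

Lemma pair_half i (a b : R) : half k *: ((a, b) : Tm i gdiag) = (h * a, h * b).
Proof. by rewrite halfE pair_lft. Qed.

Lemma yt_pair (a b : R) : yt *: ((a, b) : S) =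
  ((xt + h * xs) * a + (- h * xs ^+ 2) * b, (- h) * a + (xt + h * xs) * b).
Proof.
apply: etrans (TmZ _ _) _; rewrite rho_rgtX /=.
have E1 (c : gdiag) : (rgt xt + half k * yel k s) *: c = (xt + h * xs) * (c : R).
  by rewrite halfE scalerDl gdiag_rgt -scalerA gdiag_rgt gdiag_lft mulrDl mulrA.
have E2 (c : gdiag) : - half k *: c = - h * (c : R).
  by rewrite halfE scaleNr gdiag_lft mulNr.
have E3 (c : gdiag) : (yel k s ^+ 2 * - half k) *: c = (- h * xs ^+ 2) * (c : R).
  rewrite mulrC -scalerA E2 expr2 -scalerA !gdiag_rgt; ring.
exact: (congr2 pair (congr2 (fun u v : R => u + v) (E1 a) (E3 b))
  (congr2 (fun u v : R => u + v) (E2 a) (E1 b))).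
Qed.

Lemma e_sq_pair (b : R) : e_sq k t *: ((b, 0) : S) =
  (- (th + th) * ((xt + (xt + h * xs)) * b), - (th + th) * (- h * b)).
Proof.
have E : e_sq k t = lft (- (th + th)) * (lft xt + yt).
  by rewrite /e_sq /third rmorphN rmorphD /= lftC.
have F : (lft xt + yt) *: ((b, 0) : S) = (((xt + (xt + h * xs)) * b, - h * b) : S).
  rewrite scalerDl pair_lft yt_pair; apply: (congr2 pair).
    apply: (etrans (y := xt * b + ((xt + h * xs) * b + - h * xs ^+ 2 * 0))) => //; ring.
  by apply: (etrans (y := xt * 0 + (- h * b + (xt + h * xs) * 0))) => //; ring.
rewrite E -scalerA F; exact: pair_lft.
Qed.

Lemma diag_sec1 i (y : R * R) :
  ((lft y.1 *: ((1 : R) : gdiag) + 0 *: (y.2 : gdiag), 0) : Tm i gdiag) = (y.1, 0) /\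
  ((lft ('X_i : R) *: (y.2 : gdiag), y.2) : Tm i gdiag) -
    half k *: ((y.1, 0) : Tm i gdiag) = ('X_i * y.2 - h * y.1, y.2).
Proof.
split.
  apply: (congr2 pair) => //; apply: (etrans (congr1 (fun u : gdiag => u + 0 *: (y.2 : gdiag))
    (gdiag_lft _ _))); rewrite scale0r mulr1; exact: addr0.
rewrite pair_half; apply: (congr2 pair).
  exact: (congr1 (fun u : R => u - h * y.1) (gdiag_lft _ _)).
by rewrite /= mulr0; apply: subr0.
Qed.

Lemma diag_sec0 i (b : R) : ((lft ('X_i * b) *: ((1 : R) : gdiag), lft b *: ((1 : R) : gdiag)) : Tm i gdiag) =
  ('X_i * b, b).
Proof. by apply: (congr2 pair); rewrite gdiag_lft mulr1. Qed.

Lemma wS0E y : wS 0 y = ((xs * y.1, y.1) : S, 0 : S).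
Proof. exact: (congr2 pair (diag_sec0 s y.1) erefl). Qed.
Lemma wU0E y : wU 0 y = ((xt * y.1, y.1) : U, 0 : U).
Proof. exact: (congr2 pair (diag_sec0 t y.1) erefl). Qed.
Lemma wS1E y : wS 1 y = ((y.1, 0) : S, (xs * y.2 - h * y.1, y.2) : S).
Proof.
have [E1 E2] := diag_sec1 s y.
exact: (congr2 pair E1 (etrans (congr1 (fun u : S =>
  ((lft xs *: (y.2 : gdiag), y.2) : S) - half k *: u) E1) E2)).
Qed.
Lemma wU1E y : wU 1 y = ((xt * y.2 - h * y.1, y.2) : U, (y.1, 0) : U).
Proof.
have [E1 E2] := diag_sec1 t y.
exact: (congr2 pair (etrans (congr1 (fun u : U =>
  ((lft xt *: (y.2 : gdiag), y.2) : U) - half k *: u) E1) E2) E1).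
Qed.

(** [vP] and [vQ] are the two entries in B_s of y.1 g + [e_sq] (y.2, 0), the nonzero part of the
    coordinate [kp] of the section in degree 1. *)
Definition vP (y : R * R) : R := y.1 * xs + - (th + th) * ((xt + (xt + h * xs)) * y.2).
Definition vQ (y : R * R) : R := y.1 + - (th + th) * (- h * y.2).

Lemma wV0E y : wV 0 y = ((((xt * y.1) * xs, xt * y.1) : S, (y.1 * xs, y.1) : S) : V, 0 : V).
Proof.
have E r : lft r *: ((xs, 1 : R) : S) = ((r * xs, r) : S).
  by rewrite pair_lft mulr1.
apply: (congr2 pair) => //; exact: (congr2 pair (E _) (E _)).
Qed.

Lemma wV1E y : wV 1 y = (((xt * y.2 - h * vP y, - (h * vQ y)) : S, (y.2, 0) : S) : V,
  ((vP y, vQ y) : S, 0 : S) : V).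
Proof.
have E1 : lft y.1 *: ((xs, 1 : R) : S) + e_sq k t *: ((y.2, 0) : S) = ((vP y, vQ y) : S).
  rewrite pair_lft e_sq_pair; apply: (congr2 pair) => //.
  by rewrite /vQ mulr1.
have E2 : half k *: (((vP y, vQ y) : S, 0 : S) : V) =
    (((h * vP y, h * vQ y) : S, 0 : S) : V).
  rewrite {1}/half TmC; apply: (congr2 pair); first exact: pair_half.
  exact: scaler0.
apply: (congr2 pair); last exact: (congr1 (fun u : S => (u, 0 : S) : V) E1).
apply: (etrans (congr1 (fun u : S => (((lft xt *: ((y.2, 0) : S), ((y.2, 0) : S)) : V) -
  half k *: ((u, 0 : S) : V) : V)) E1)).
apply: (etrans (congr1 (fun u : V => ((lft xt *: ((y.2, 0) : S), ((y.2, 0) : S)) : V) - u) E2)).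
apply: (congr2 pair); last exact: subr0.
apply: (etrans (congr1 (fun u : S => u - ((h * vP y, h * vQ y) : S)) (@pair_lft s xt y.2 0))).
apply: (congr2 pair); first exact: erefl.
exact: (etrans (congr1 (fun u : R => u - h * vQ y) (mulr0 xt)) (sub0r _)).
Qed.

Section Maps.
Local Notation zs := (zel k ord0).
Local Notation zt := (zel k ord_max).
Local Notation KZ := (kcocycle zs zt).

Lemma muS_form a c : KZ a c -> kmap (@mufun k s gdiag) c = gSY a (fS a c).
Proof.
move=> zc; apply: (@induced_form k S gdiag a _ _ _ _ (fS a) (wS a) id id
  (mu s (gdiag_wgraded k)) (gSY a) (fS_kform a) (diag_kform k a) _ c zc) => y.
move=> {c zc}; case: y => y1 y2; case: a => [|[|[|a]]] v.
- rewrite wS0E; apply: (etrans (congr2 pair (mu_diag _) (mu_diag _))).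
  by apply: (congr2 pair); rewrite /=; ring.
- rewrite wS1E; apply: (etrans (congr2 pair (mu_diag _) (mu_diag _))).
  by apply: (congr2 pair); rewrite /=; ring.
- rewrite [y2]v; apply: (etrans (congr2 pair (mu_diag _) (mu_diag _))).
  by apply: (congr2 pair); rewrite /=; ring.
- rewrite v; apply: (etrans (congr2 pair (mu_diag _) (mu_diag _))).
  by apply: (congr2 pair); rewrite /=; ring.
Qed.

Lemma muU_form a c : KZ a c -> kmap (@mufun k t gdiag) c = gUY a (fU a c).
Proof.
move=> zc; apply: (@induced_form k U gdiag a _ _ _ _ (fU a) (wU a) id id
  (mu t (gdiag_wgraded k)) (gUY a) (fU_kform a) (diag_kform k a) _ c zc) => y.
move=> {c zc}; case: y => y1 y2; case: a => [|[|[|a]]] v.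
- rewrite wU0E; apply: (etrans (congr2 pair (mu_diag _) (mu_diag _))).
  by apply: (congr2 pair); rewrite /=; ring.
- rewrite wU1E; apply: (etrans (congr2 pair (mu_diag _) (mu_diag _))).
  by apply: (congr2 pair); rewrite /=; ring.
- rewrite [y2]v; apply: (etrans (congr2 pair (mu_diag _) (mu_diag _))).
  by apply: (congr2 pair); rewrite /=; ring.
- rewrite v; apply: (etrans (congr2 pair (mu_diag _) (mu_diag _))).
  by apply: (congr2 pair); rewrite /=; ring.
Qed.

Lemma fS1E (a b c d : R) : fS 1 ((a, b) : S, (c, d) : S) = (a + xs * b, d + h * b).
Proof.
apply: (congr2 pair).
  apply: (etrans (y := (a + xs * b) - 0 :> R)); last exact: subr0.
  apply: (congr2 (fun u v : R => a + u - v)); first exact: gdiag_lft.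
  exact: (scale0r (kq s t (((a, b) : S, (c, d) : S) : S * S)).2).
exact: (congr1 (fun u : S => ((c, d) + u).2) (@pair_half s a b)).
Qed.

Lemma fS2E (a b c d : R) : fS 2 ((a, b) : S, (c, d) : S) = (a + xs * b, 0).
Proof. exact: (congr2 pair (congr1 (fun u : R => a + u) (gdiag_lft _ _)) erefl). Qed.

Lemma fU1E (a b c d : R) : fU 1 ((a, b) : U, (c, d) : U) = (c + xt * d, b + h * d).
Proof.
apply: (congr2 pair).
  apply: (etrans (y := (c + xt * d) - 0 :> R)); last exact: subr0.
  apply: (congr2 (fun u v : R => c + u - v)); first exact: gdiag_lft.
  exact: (scale0r (kq t s (((a, b) : U, (c, d) : U) : U * U)).2).
exact: (congr1 (fun u : U => ((a, b) + u).2) (@pair_half t c d)).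
Qed.

Lemma fU2E (a b c d : R) : fU 2 ((a, b) : U, (c, d) : U) = (a + xt * b, 0).
Proof. exact: (congr2 pair (congr1 (fun u : R => a + u) (gdiag_lft _ _)) erefl). Qed.

Lemma muV_pair (a b c d : R) : mufun (((a, b) : S, (c, d) : S) : V) =
  ((a + ((xt + h * xs) * c + (- h * xs ^+ 2) * d), b + ((- h) * c + (xt + h * xs) * d)) : S).
Proof. exact: (congr1 (fun u : S => ((a, b) : S) + u) (yt_pair c d)). Qed.

Lemma muV0 : mufun (0 : V) = ((0 : R, 0 : R) : S).
Proof. exact: mufun0. Qed.

Lemma TmuV_pair (a b c d : R) : Tfun (mu s (gdiag_wgraded k)) (((a, b) : S, (c, d) : S) : V) =
  ((a + xs * b, c + xs * d) : U).
Proof. exact: (congr2 pair (mu_diag _) (mu_diag _)). Qed.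

Lemma TmuV0 : Tfun (mu s (gdiag_wgraded k)) (0 : V) = ((0 : R, 0 : R) : U).
Proof. exact: (linear0 (Tfun (mu s (gdiag_wgraded k)))). Qed.

Lemma S_wgraded : wgraded S. Proof. exact: Tm_wgraded (gdiag_wgraded k). Qed.

Lemma wV2E y : wV 2 y = (((y.1, 0) : S, (0 : R, 0 : R) : S) : V, 0 : V).
Proof. by []. Qed.

Lemma muV_form a c : KZ a c -> fS a (kmap (@mufun k t S) c) = gVS a (fV a c).
Proof.
move=> zc; apply: (@induced_form k V S a _ _ _ _ (fV a) (wV a) (fS a) (wS a)
  (mu t S_wgraded) (gVS a) (fV_kform a) (fS_kform a) _ c zc) => y.
move=> {c zc}; case: y => y1 y2; case: a => [|[|[|a]]] v.
- rewrite wV0E; apply: (etrans (congr1 (fS 0) (congr2 pair (muV_pair _ _ _ _) muV0))).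
  apply: (congr2 pair) => //; rewrite [LHS]/= [RHS]/=.
  have E (B : comNzRingType) (x z p r : B) : p + p = 1 ->
    z * r + (- p * (r * x) + (z + p * x) * r) = 2 * z * r.
    by move=> _; ring.
  exact: E hh1.
- rewrite wV1E; apply: (etrans (congr1 (fS 1) (congr2 pair (muV_pair _ _ _ _) (muV_pair _ _ _ _)))).
  rewrite fS1E /vP /vQ /=; apply: (congr2 pair).
    exact: mapVS_fst hh1 th1.
  exact: mapVS_snd hh1 th1.
- rewrite wV2E; apply: (etrans (congr1 (fS 2) (congr2 pair (muV_pair _ _ _ _) muV0))).
  rewrite fS2E /= [y2]v; apply: (congr2 pair) => //; ring.
- rewrite v; exact: erefl.
Qed.

Lemma TmuV_form a c : KZ a c ->
  fU a (kmap (Tfun (mu s (gdiag_wgraded k)) : V -> U) c) = gVU a (fV a c).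
Proof.
move=> zc; apply: (@induced_form k V U a _ _ _ _ (fV a) (wV a) (fU a) (wU a)
  (Tmap t (mu s (gdiag_wgraded k))) (gVU a) (fV_kform a) (fU_kform a) _ c zc) => y.
move=> {c zc}; case: y => y1 y2; case: a => [|[|[|a]]] v.
- rewrite wV0E; apply: (etrans (congr1 (fU 0) (congr2 pair (TmuV_pair _ _ _ _) TmuV0))).
  by apply: (congr2 pair) => //; rewrite [LHS]/= [RHS]/=; ring.
- rewrite wV1E; apply: (etrans (congr1 (fU 1) (congr2 pair (TmuV_pair _ _ _ _) (TmuV_pair _ _ _ _)))).
  by rewrite fU1E /vP /vQ /=; apply: (congr2 pair); ring.
- rewrite wV2E; apply: (etrans (congr1 (fU 2) (congr2 pair (TmuV_pair _ _ _ _) TmuV0))).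
  rewrite fU2E /= [y2]v; apply: (congr2 pair) => //; ring.
- rewrite v; exact: erefl.
Qed.
End Maps.

End SmallForms.

(** * Cochains of direct sums *)

Section TripleCochains.
Variables (A : comNzRingType) (zs zt : A).
Local Notation KZ := (kcocycle zs zt).
Local Notation KB := (kcoboundary zs zt).

Section Pairs.
Variables (M N : lmodType A).
Implicit Type c : (M * N) * (M * N).

Definition join2 (u : M * M) (v : N * N) : (M * N) * (M * N) := ((u.1, v.1), (u.2, v.2)).

Lemma kz_join a u v : KZ a u -> KZ a v -> KZ a (join2 u v).
Proof.
case: u v => [u1 u2] [v1 v2]; case: a => [|[|[|a]]] /=.
- by move=> [a1 a2 a3] [b1 b2 b3]; split; apply: pair_ext.
- by move=> a1 b1; apply: pair_ext.
- by move=> -> ->.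
- by move=> [-> ->] [-> ->].
Qed.

Lemma kb_join a u v : KB a u -> KB a v -> KB a (join2 u v).
Proof.
case: u v => [u1 u2] [v1 v2]; case: a => [|[|[|a]]] /=.
- by move=> [-> ->] [-> ->].
- by move=> [m [-> ->]] [n [-> ->]]; exists (m, n).
- by move=> [m [n [-> ->]]] [p [q [-> ->]]]; exists (m, p), (n, q).
- by move=> [-> ->] [-> ->].
Qed.
End Pairs.

Section Triples.
Variables (M N P : lmodType A).
Local Notation T := (M * (N * P))%type.
Implicit Type c : T * T.

Definition pr1 c : M * M := (c.1.1, c.2.1).
Definition pr2 c : N * N := (c.1.2.1, c.2.2.1).
Definition pr3 c : P * P := (c.1.2.2, c.2.2.2).
Definition join3 (u : M * M) (v : N * N) (w : P * P) : T * T := join2 u (join2 v w).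

Lemma join3E c : c = join3 (pr1 c) (pr2 c) (pr3 c).
Proof. by case: c => [[? [? ?]] [? [? ?]]]. Qed.

Lemma kz3 a c : KZ a c <-> [/\ KZ a (pr1 c), KZ a (pr2 c) & KZ a (pr3 c)].
Proof.
split=> [zc|[z1 z2 z3]]; last by rewrite [c]join3E; do 2?apply: kz_join.
have z2 := kmap_cocycle (snd : {linear T -> (N * P)%type}) zc.
split.
- exact: (kmap_cocycle (fst : {linear T -> M}) zc).
- exact: (kmap_cocycle (fst : {linear (N * P)%type -> N}) z2).
- exact: (kmap_cocycle (snd : {linear (N * P)%type -> P}) z2).
Qed.

Lemma kb3 a c : KB a c <-> [/\ KB a (pr1 c), KB a (pr2 c) & KB a (pr3 c)].
Proof.
split=> [zc|[z1 z2 z3]]; last by rewrite [c]join3E; do 2?apply: kb_join.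
have z2 := kmap_coboundary (snd : {linear T -> (N * P)%type}) zc.
split.
- exact: (kmap_coboundary (fst : {linear T -> M}) zc).
- exact: (kmap_coboundary (fst : {linear (N * P)%type -> N}) z2).
- exact: (kmap_coboundary (snd : {linear (N * P)%type -> P}) z2).
Qed.

End Triples.

Lemma kb_trivial (M : lmodType A) a (c : M * M) : (forall x : M, x = 0) -> KB a c.
Proof. by move=> M0; rewrite (_ : c = 0); [apply: kcoboundary0|apply: pair_ext]. Qed.

Lemma kb_ideal (M : lmodType A) a (c : M * M) (F : M -> M) u v :
  (forall m, F m = (zs * u + zt * v) *: m) -> KZ a c -> KB a (kmap F c).
Proof.
move=> E zc; rewrite (_ : kmap F c = (zs * u + zt * v) *: c); first exact: ideal_kcoboundary.
by apply: pair_ext; apply: E.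
Qed.

End TripleCochains.

Section IdealCombinations.
Variables (B : comNzRingType) (V : lmodType B).
Implicit Types (x y q h l r : B) (n : V).

Lemma neg_comb x y q h n :
  - (q *: ((x * 1 + y * h) *: n)) = (x * - q + y * (- q * h)) *: n.
Proof. by rewrite scalerA -scaleNr; congr (_ *: _); ring. Qed.

Lemma delta_comb x y q h l r n : y = l - r ->
  r *: n - (l *: n + q *: ((x * 1 + y * h) *: n)) = (x * - q + y * (- 1 - q * h)) *: n.
Proof.
by move=> ->; rewrite scalerA -scalerDl -scalerBl; congr (_ *: _); ring.
Qed.
End IdealCombinations.

(** * Vanishing of the difference maps on Koszul cohomology *)

Section Deltas.
Variable k : fieldType.
Hypothesis two_neq0 : 2 != 0 :> k.
Hypothesis three_neq0 : 3 != 0 :> k.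
Local Notation R := {mpoly k[2]}.
Local Notation A := {mpoly k[2 + 2]}.
Local Notation gdiag := (gdiag k 2).
Local Notation s := (ord0 : 'I_2).
Local Notation t := (ord_max : 'I_2).
Local Notation zs := (zel k s).
Local Notation zt := (zel k t).
Local Notation KZ := (kcocycle zs zt).
Local Notation KB := (kcoboundary zs zt).
Local Notation S := (Tm s gdiag).
Local Notation U := (Tm t gdiag).
Local Notation V := (Tm t S).

(** On R the middle action of alpha_i is also the left one, so the difference of actions is -
    z_i. *)
Lemma delta_diag i (m : Tm i gdiag) : delta m = - zel k i *: m.
Proof.
have E (n : gdiag) : yel k i *: n = lft 'X_i *: n by rewrite gdiag_lft gdiag_rgt.
have Eth : theta m = lft 'X_i *: m.
  exact: (etrans (congr2 pair (E m.1) (E m.2)) (esym (Tm_lft _ _))).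
by rewrite /delta Eth zelE opprB scalerBl.
Qed.

Lemma deltaS_kb a (c : S * S) : KZ a c -> KB a (kmap (@delta k s gdiag) c).
Proof.
apply: (@kb_ideal _ zs zt S a c _ (-1) 0) => m.
by rewrite delta_diag mulr0 addr0 mulrN1.
Qed.

Lemma deltaU_kb a (c : U * U) : KZ a c -> KB a (kmap (@delta k t gdiag) c).
Proof.
apply: (@kb_ideal _ zs zt U a c _ 0 (-1)) => m.
by rewrite delta_diag mulr0 add0r mulrN1.
Qed.

Definition q_scalar : k := (1 + 1) * (3^-1 + 3^-1).

Lemma q_invE : q_inv k = lft (q_scalar%:MP : R).
Proof. by rewrite lftC /q_scalar /q_inv /third mpolyCM !mpolyCD mpolyC1. Qed.

Local Notation zl := (zlin k t s).

(** The componentwise action of z_s compares the left with the middle action of alpha_s. It comes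
    from R^e because z_s is 4/3 of z_l on B_s and z_l acts componentwise. *)
Lemma zsV (m : V) : (zs *: m.1, zs *: m.2) = q_inv k *: (zl *: m) :> V.
Proof.
rewrite (@zlin_Tm k t s erefl) q_invE Tm_lft -q_invE.
by apply: (congr2 pair); apply: (@zelS_zlin k t s erefl two_neq0 three_neq0).
Qed.

Lemma zlE : zl = zs * 1 + zt * half k.
Proof. by rewrite /zlin mulr1 [half k * _]mulrC. Qed.

Lemma TdeltaV_kb a (c : V * V) (F : V -> V) : (forall m, F m = (delta m.1, delta m.2)) ->
  KZ a c -> KB a (kmap F c).
Proof.
move=> FE; apply: (@kb_ideal _ zs zt V a c _ (- q_inv k) (- q_inv k * half k)) => m.
rewrite FE; apply: (etrans (congr2 pair (delta_diag _) (delta_diag _))).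
apply: (etrans (y := - ((zs *: m.1, zs *: m.2) : V))).
  by apply: (congr2 pair); rewrite scaleNr.
apply: (etrans (congr1 -%R (zsV m))).
apply: (etrans (congr1 (fun z => - (q_inv k *: (z *: (m : V)))) zlE)); exact: neg_comb.
Qed.

(** On B_s the right action of alpha_t is the left one plus z_s / 2. By [zsV] this correction lies
    in the ideal (z_s, z_t), and what is left of the difference is - z_t. *)
Lemma deltaV_kb a (c : V * V) : KZ a c -> KB a (kmap (@delta k t S) c).
Proof.
pose q := half k * q_inv k.
apply: (@kb_ideal _ zs zt V a c _ (- q) (- 1 - q * half k)) => m.
have hl : half k = lft ((2^-1)%:MP : R) by rewrite lftC.
have E (n : S) : yel k t *: n = lft 'X_t *: n + half k *: (zs *: n).
  have := @zel_otherS k t s erefl n; rewrite zelE scalerBl => /eqP.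
  by rewrite subr_eq addrC scaleNr -subr_eq opprK => /eqP <-; rewrite addrC.
have E3 : q *: (zl *: m) = (half k *: (zs *: m.1), half k *: (zs *: m.2)) :> V.
  apply: (etrans (esym (scalerA (half k) (q_inv k) (zl *: m)))).
  apply: (etrans (congr1 (fun n : V => half k *: n) (esym (zsV m)))).
  exact: (@TmC k t S (2^-1)).
have Eth : theta m = lft 'X_t *: m + q *: (zl *: m).
  exact: (etrans (congr2 pair (E m.1) (E m.2))
    (esym (congr2 (fun u v : V => u + v) (@Tm_lft k t S 'X_t m) E3))).
apply: (etrans (congr1 (fun n : V => yel k t *: (m : V) - n) Eth)).
apply: (etrans (congr1 (fun z => yel k t *: (m : V) - (lft 'X_t *: m + q *: (z *: m))) zlE)).
exact: delta_comb (zelE k t).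
Qed.

End Deltas.

(** * Cocycles and coboundaries of the reduced complex by components *)

Section DoubleConeCochains.
Variable k : fieldType.
Local Notation A := {mpoly k[2 + 2]}.
Local Notation cplx := (cplx k (2 + 2)).
Local Notation zs := (zel k ord0).
Local Notation zt := (zel k ord_max).
Local Notation KZ := (kcocycle zs zt).
Local Notation KB := (kcoboundary zs zt).
Variables (i : 'I_2) (C : cplx).
Hypothesis gC : forall j, wgraded (C j).
Local Notation D := (dcone i gC).
Local Notation T := (Tm i).
Variables (a j : nat).

Definition comp1 (c : D j * D j) : T (C j) * T (C j) := (c.1.1, c.2.1).
Definition comp2 (c : D j * D j) : T (pre C j) * T (pre C j) := (c.1.2.1, c.2.2.1).
Definition comp3 (c : D j * D j) : pre (pre C) j * pre (pre C) j := (c.1.2.2, c.2.2.2).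
Definition comps (u : T (C j) * T (C j)) (v : T (pre C j) * T (pre C j))
    (w : pre (pre C) j * pre (pre C) j) : D j * D j :=
  ((u.1, (v.1, w.1)), (u.2, (v.2, w.2))).

Lemma comp1K u v w : comp1 (comps u v w) = u. Proof. by case: u. Qed.
Lemma comp2K u v w : comp2 (comps u v w) = v. Proof. by case: v. Qed.
Lemma comp3K u v w : comp3 (comps u v w) = w. Proof. by case: w. Qed.

Definition prj1 : {linear D j -> T (C j)} := (fst : {linear D j -> T (C j)}).
Definition prj23 : {linear D j -> gsum (gshift 2 (T (pre C j))) (gshift 2 (pre (pre C) j))} :=
  (snd : {linear D j -> gsum (gshift 2 (T (pre C j))) (gshift 2 (pre (pre C) j))}).

Definition prj3 : {linear gsum (gshift 2 (T (pre C j))) (gshift 2 (pre (pre C) j)) -> pre (pre C) j} :=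
  (snd : {linear gsum (gshift 2 (T (pre C j))) (gshift 2 (pre (pre C) j)) -> pre (pre C) j}).

Lemma comp1_lin p (c c' : D j * D j) : comp1 (p *: c + c') = p *: comp1 c + comp1 c'.
Proof. exact: (kmap_lin prj1 p c c'). Qed.
Lemma comp3_lin p (c c' : D j * D j) : comp3 (p *: c + c') = p *: comp3 c + comp3 c'.
Proof.
have E := kmap_lin prj23 p c c'.
exact: (etrans (congr1 (kmap prj3) E) (kmap_lin prj3 p (kmap prj23 c) (kmap prj23 c'))).
Qed.

Lemma dc_kz (c : D j * D j) : KZ a c <-> [/\ KZ a (comp1 c), KZ a (comp2 c) & KZ a (comp3 c)].
Proof. exact: (@kz3 A zs zt (T (C j)) (T (pre C j)) (pre (pre C) j) a c). Qed.
Lemma dc_kb (c : D j * D j) : KB a c <-> [/\ KB a (comp1 c), KB a (comp2 c) & KB a (comp3 c)].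
Proof. exact: (@kb3 A zs zt (T (C j)) (T (pre C j)) (pre (pre C) j) a c). Qed.

Definition dc1 (u : T (C j) * T (C j)) : T (C j.+1) * T (C j.+1) := kmap (Tfun (cdif C j)) u.
Definition dc2 (u : T (C j) * T (C j)) (v : T (pre C j) * T (pre C j)) : T (C j) * T (C j) :=
  sgn k j *: kmap (@delta k i (C j)) u + kmap (Tfun (dprev C j)) v.
Definition dc3 (v : T (pre C j) * T (pre C j)) (w : pre (pre C) j * pre (pre C) j) :
    pre C j * pre C j :=
  - sgn k j *: kmap (@mufun k i (pre C j)) v + kmap (ddprev C j) w.

End DoubleConeCochains.

Section DoubleConeCohomology.
Variable k : fieldType.
Local Notation cplx := (cplx k (2 + 2)).
Local Notation zs := (zel k ord0).
Local Notation zt := (zel k ord_max).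
Local Notation KZ := (kcocycle zs zt).
Local Notation KB := (kcoboundary zs zt).
Variables (i : 'I_2) (C : cplx).
Hypothesis gC : forall j, wgraded (C j).
Local Notation D := (dcone i gC).
Variables (a j : nat).

Lemma dc_cocycle (c : D j * D j) : hcocycle a c <->
  [/\ KZ a (comp1 c), KZ a (comp2 c) & KZ a (comp3 c)] /\
  [/\ KB a (dc1 (comp1 c)), KB a (dc2 (comp1 c) (comp2 c)) & KB a (dc3 (comp2 c) (comp3 c))].
Proof.
by split=> [[/dc_kz zc /dc_kb bc]|[zc bc]]; split=> //; [apply/dc_kz|apply/dc_kb].
Qed.

Lemma dc_coboundary (c : D j.+1 * D j.+1) : hcoboundary a c <-> exists u v w,
  [/\ KZ a u, KZ a v & KZ a w] /\
  [/\ KB a (comp1 c - dc1 (C := C) u), KB a (comp2 c - dc2 (C := C) u v) &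
      KB a (comp3 c - dc3 (C := C) v w)].
Proof.
split=> [[b [/(dc_kz (gC := gC)) zb /(dc_kb (gC := gC)) bc]]|[u [v [w [zb bc]]]]].
  by exists (comp1 (gC := gC) b), (comp2 (gC := gC) b), (comp3 (gC := gC) b).
exists (comps gC u v w); split; first by apply/(dc_kz (gC := gC)); rewrite comp1K comp2K comp3K.
apply/(dc_kb (gC := gC)); move: zb bc; by case: u v w => [? ?] [? ?] [? ?].
Qed.

(** Decouples the summands: when [delta] is trivial on cohomology, the second component of the
    differential depends on v alone. *)
Lemma dc2_kb (u : Tm i (C j) * Tm i (C j)) (v : Tm i (pre C j) * Tm i (pre C j)) :
  KB a (kmap (@delta k i (C j)) u) -> (KB a (dc2 u v) <-> KB a (kmap (Tfun (dprev C j)) v)).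
Proof.
move=> bu; have bu' := kcoboundaryZ (sgn k j) bu.
split=> [b|b]; last exact: kcoboundaryD.
rewrite -[kmap _ v](addKr (sgn k j *: kmap (@delta k i (C j)) u)) addrC.
exact: kcoboundaryB.
Qed.

Lemma dc2_sub_kb (c u : Tm i (C j) * Tm i (C j)) (v : Tm i (pre C j) * Tm i (pre C j)) :
  KB a (kmap (@delta k i (C j)) u) -> KB a (c - kmap (Tfun (dprev C j)) v) -> KB a (c - dc2 u v).
Proof.
move=> bu b; rewrite /dc2 opprD addrA addrAC; apply: kcoboundaryB => //.
exact: kcoboundaryZ.
Qed.

End DoubleConeCohomology.

(** * Quotients of the coordinate modules *)

Section ValuePresentations.
Variable k : fieldType.
Local Notation R := {mpoly k[2]}.
Local Notation gmod := (gmod k 2).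

(* P presents N as the quotient of [kvalue a] by I. *)
Record rpres (a : nat) (e1 e2 : int) (I : R * R -> Prop) (N : gmod) (P : R * R -> N) : Prop := RPres {
  rp_lin : forall r y y', P (r * y.1 + y'.1, r * y.2 + y'.2) = r *: P y + P y';
  rp_deg : forall l y, vdeg e1 e2 l y -> gdeg l (P y);
  rp_ker : forall y, kvalue a y -> (P y = 0 <-> I y);
  rp_surj : forall l n, gdeg l n -> exists y, [/\ vdeg e1 e2 l y, kvalue a y & P y = n] }.

End ValuePresentations.

Section KoszulMaps.
Variable k : fieldType.
Local Notation A := {mpoly k[2 + 2]}.
Local Notation zs := (zel k ord0).
Local Notation zt := (zel k ord_max).
Local Notation KB := (kcoboundary zs zt).
Variable a : nat.

Lemma kmap0 (M N : gmod k (2 + 2)) (F : {linear M -> N}) : kmap F (0 : M * M) = 0.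
Proof. by apply: (@pair_ext N N); apply: (linear0 F). Qed.

Lemma sgn_kb (M : lmodType A) j (c : M * M) : KB a c -> KB a (sgn k j *: c).
Proof. exact: kcoboundaryZ. Qed.

End KoszulMaps.

Section Shifts.
Variable k : fieldType.
Local Notation A := {mpoly k[2 + 2]}.
Local Notation zs := (zel k ord0).
Local Notation zt := (zel k ord_max).
Local Notation KZ := (kcocycle zs zt).
Local Notation KB := (kcoboundary zs zt).

Lemma vdeg_shift d1 d2 l e (y : {mpoly k[2]} * {mpoly k[2]}) :
  vdeg d1 d2 (l + e) y <-> vdeg (d1 + e) (d2 + e) l y.
Proof. by rewrite /vdeg -!addrA ![e + _]addrC. Qed.

Lemma kdeg_shift (M : gmod k (2 + 2)) a l e (c : M * M) :
  @kdeg k (gshift e M) a l c <-> @kdeg k M a (l + e) c.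
Proof. by rewrite /kdeg /= addrAC. Qed.

Lemma kdeg_Tm_shift (M : gmod k (2 + 2)) i a l e (c : M * M * (M * M)) :
  @kdeg k (Tm i (gshift e M)) a l c <-> @kdeg k (Tm i M) a (l + e) c.
Proof. by rewrite /kdeg /= [l + e + _]addrAC [_ + e - 2]addrAC. Qed.

Lemma kform_diff (M : gmod k (2 + 2)) a d1 d2 f w (K : @kform k M a d1 d2 f w) (c d : M * M) :
  KZ a c -> KZ a d -> f c = f d -> KB a (c - d).
Proof.
move=> zc zd E; apply: (kf_eq0 K); first exact: kcocycleB.
by rewrite (kfB K) E subrr.
Qed.

Lemma kform_same (M : gmod k (2 + 2)) a d1 d2 f w (K : @kform k M a d1 d2 f w) (c d : M * M) :
  KB a (c - d) -> f c = f d.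
Proof. by move=> /(kf_KB K) /eqP; rewrite (kfB K) subr_eq0 => /eqP. Qed.

Lemma sgn1N : - sgn k 1 = 1. Proof. by rewrite sgnS opprK /sgn expr0. Qed.
Lemma sgn2N : - sgn k 2 = - 1. Proof. by rewrite sgnS sgn1N. Qed.
Lemma sgn3N : - sgn k 3 = 1. Proof. by rewrite sgnS sgn2N opprK. Qed.

End Shifts.

Section TrivialPresentation.
Variable k : fieldType.

Definition trivial_pres (C : cplx k (2 + 2)) (gC : forall j, wgraded (C j)) a j :
  (forall c : C j * C j, hcocycle a c -> hcoboundary a c) -> hpresentation C a j (gzero k 2).
Proof.
move=> H; apply: (@HPresentation k C a j (gzero k 2) (fun _ => 0)).
- by move=> r c c'; rewrite scaler0 addr0.
- by [].
- by move=> c zc _; apply: H.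
- by [].
move=> l y _; exists 0; split; first by split; apply: (wgdeg0 (gC j)).
  by apply: hcocycle_KB; apply: kcoboundary0.
by apply/rowP => -[].
Defined.

Lemma high_coboundary (C : cplx k (2 + 2)) a j (c : C j * C j) :
  (2 < a)%N -> hcocycle a c -> hcoboundary a c.
Proof.
by case: a => [|[|[|a]]] // _ [zc _]; apply: hcoboundary_KB; apply: zc.
Qed.

End TrivialPresentation.

(** * Cohomology of the product of two three-term complexes *)

Section ThreeTermCohomology.
Variable k : fieldType.
Local Notation R := {mpoly k[2]}.
Local Notation A := {mpoly k[2 + 2]}.
Local Notation gmod2 := (gmod k (2 + 2)).
Local Notation zs := (zel k ord0).
Local Notation zt := (zel k ord_max).
Local Notation KZ := (kcocycle zs zt).
Local Notation KB := (kcoboundary zs zt).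
Variables (i : 'I_2) (S Y : gmod2).
Variables (del : gmor S (gshift 2 S)) (m : gmor S Y).
Hypothesis m_del : forall x, m (del x) = 0.
Hypotheses (gS : wgraded S) (gY : wgraded Y).
Local Notation C := (three_cplx m_del).
Let gC : forall j, wgraded (C j) := three_wgraded m_del gS gY.
Local Notation D := (dcone i gC).
Local Notation V := (Tm i S).
Local Notation U := (Tm i Y).
Local Notation Tmu := (Tfun m : V -> U).
Local Notation muV := (@mufun k i S).
Local Notation muU := (@mufun k i Y).
Variable a : nat.
Variables (v1 v2 u1 u2 s1 s2 y1 y2 : int).
Variables (fV : V * V -> R * R) (wV : R * R -> V * V).
Variables (fU : U * U -> R * R) (wU : R * R -> U * U).
Variables (fS : S * S -> R * R) (wS : R * R -> S * S).
Variables (fY : Y * Y -> R * R) (wY : R * R -> Y * Y).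
Hypothesis fvK : kform a v1 v2 fV wV.
Hypothesis fuK : kform a u1 u2 fU wU.
Hypothesis fsK : kform a s1 s2 fS wS.
Hypothesis fyK : kform a y1 y2 fY wY.
Hypothesis deltaV0 : forall c : V * V, KZ a c -> KB a (kmap (@delta k i S) c).
Hypothesis deltaU0 : forall c : U * U, KZ a c -> KB a (kmap (@delta k i Y) c).
Hypothesis Tdel0 : forall c : V * V, KZ a c -> KB a (kmap (Tfun del : V -> V) c).
Hypothesis del0 : forall c : S * S, KZ a c -> KB a (kmap (del : S -> S) c).
Variables gVS gVU gSY gUY : R * R -> R * R.
Hypothesis muV_val : forall c : V * V, KZ a c -> fS (kmap muV c) = gVS (fV c).
Hypothesis TmuV_val : forall c : V * V, KZ a c -> fU (kmap Tmu c) = gVU (fV c).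
Hypothesis muS_val : forall c : S * S, KZ a c -> fY (kmap m c) = gSY (fS c).
Hypothesis muU_val : forall c : U * U, KZ a c -> fY (kmap muU c) = gUY (fU c).
Hypothesis VU_inj : forall y : R * R, kvalue a y -> gVU y = 0 -> y = 0.
Hypothesis VS_inj : forall y : R * R, kvalue a y -> gVS y = 0 -> y = 0.
Hypothesis UY_SY_exact : forall y y' : R * R, kvalue a y -> kvalue a y' -> gUY y + gSY y' = 0 ->
  exists2 z, kvalue a z & y = gVU z /\ y' = - gVS z.

Section Degree0.
Variables (N : gmod k 2) (P : R * R -> N).
Hypothesis HP : rpres a v1 v2 (fun y => y = 0) P.

(** Both maps leaving degree 0 are difference maps and vanish on Koszul cohomology, so all of V
    survives. *)
Definition pres0 : hpresentation D a 0 N.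
Proof.
have T0 := @Tm_gzero k i; have Z0 := @row0_eq k.
apply: (@HPresentation k D a 0 N (fun c => P (fV (comp1 c)))).
- move=> r c c'; rewrite -(rp_lin HP); apply: (congr1 P).
  exact: (etrans (congr1 fV (comp1_lin (lft r) c c')) (kf_lin fvK r (comp1 c) (comp1 c'))).
- move=> l c [[d1 _] [d2 _]]; apply: (rp_deg HP).
  by apply: (kf_deg fvK); split.
- move=> c /dc_cocycle[[z1 z2 z3] _] /(rp_ker HP (kf_value fvK z1)) f0.
  apply: hcoboundary_KB; apply/dc_kb; split; first exact: (kf_eq0 fvK z1 f0).
    by apply: kb_trivial => x; apply: T0.
  by apply: kb_trivial => x; apply: Z0.
- move=> c /dc_cocycle[[z1 _ _] _] [b [_]].
  rewrite (_ : kmap _ b = 0) ?subr0; last by [].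
  move=> /dc_kb[b1 _ _]; apply/(rp_ker HP (kf_value fvK z1)).
  exact: (kf_KB fvK b1).
move=> l n /(rp_surj HP)[y [dy vy Py]].
have [e1 e2] := kf_sec_deg fvK dy; have zw := kf_secZ fvK vy.
have gz := wgdeg0 (gzero_wgraded k (2 + 2)).
exists (@comps k i C gC 0 (wV y) 0 0); split.
- by split; split=> //; split; try split; apply: gz.
- apply/dc_cocycle; rewrite comp1K comp2K comp3K; split; first split=> //.
    exact: kcocycle0.
    exact: kcocycle0.
  split; first exact: Tdel0.
    apply: kcoboundaryD; first by apply: sgn_kb; apply: deltaV0.
    rewrite kmap0; exact: kcoboundary0.
  by apply: kb_trivial => x; apply: Z0.
rewrite comp1K -Py; congr P; exact: (kf_secK fvK vy).
Defined.
End Degree0.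

Lemma dc3_1 (v : V * V) (w : gzero k (2 + 2) * gzero k (2 + 2)) :
  dc3 (C := C) (i := i) (j := 1) v w = kmap muV v.
Proof.
apply: (etrans (congr1 (fun w' => dc3 (C := C) (i := i) (j := 1) v w') (_ : w = 0))).
  by apply: pair_ext; apply: row0_eq.
apply: (etrans (y := - sgn k 1 *: kmap muV v + 0)) => //.
by rewrite addr0 sgn1N scale1r.
Qed.

Lemma dc1_1 (u : V * V) : dc1 (C := C) (i := i) (j := 1) u = kmap Tmu u.
Proof. by []. Qed.

Lemma dc2_1_kb (u v : V * V) : KZ a u -> KZ a v ->
  KB a (dc2 (C := C) (i := i) (j := 1) u v).
Proof.
by move=> zu zv; apply/(@dc2_kb k i C a 1 u v (deltaV0 zu)); apply: Tdel0.
Qed.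

Lemma dc2_2_kb (u : U * U) (v : V * V) : KZ a u ->
  (KB a (dc2 (C := C) (i := i) (j := 2) u v) <-> KB a (kmap Tmu v)).
Proof. by move=> zu; apply: (@dc2_kb k i C a 2 u v (deltaU0 zu)). Qed.

Lemma middle_kb (u : U * U) (v : V * V) : KZ a u -> KZ a v ->
  KB a (dc2 (C := C) (i := i) (j := 2) u v) -> KB a v.
Proof.
move=> zu zv /(dc2_2_kb v zu) /(kf_KB fuK) E.
apply: (kf_eq0 fvK zv); apply: VU_inj; first exact: (kf_value fvK zv).
by rewrite -(TmuV_val zv).
Qed.

Section Degree2.
Variables (NS NU : gmod k 2) (PS : R * R -> NS) (PU : R * R -> NU).
Hypothesis HS : rpres a (s1 + 2) (s2 + 2)
  (fun y => exists2 y', kvalue a y' & y = gVS y') PS.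
Hypothesis HU : rpres a (u1 + 2) (u2 + 2)
  (fun y => exists2 y', kvalue a y' & y = gVU y') PU.

(** The middle summand V injects into U, so it contributes no cocycles; the outer summands S and U
    contribute the cokernels of the two maps from V. *)
Definition pres2 : hpresentation D a 2 (gsum NS NU).
Proof.
have Z0 := @row0_eq k; have T0 := @Tm_gzero k i.
apply: (@HPresentation k D a 2 (gsum NS NU)
  (fun c => (PS (fS (comp3 c)), PU (fU (comp1 c))))).
- move=> r c c'; apply: (congr2 pair).
    rewrite -(rp_lin HS); apply: (congr1 PS).
    exact: (etrans (congr1 fS (comp3_lin (lft r) c c')) (kf_lin fsK r (comp3 c) (comp3 c'))).
  rewrite -(rp_lin HU); apply: (congr1 PU).
  exact: (etrans (congr1 fU (comp1_lin (lft r) c c')) (kf_lin fuK r (comp1 c) (comp1 c'))).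
- move=> l c [[d1 [_ d3]] [e1 [_ e3]]]; split.
    apply: (rp_deg HS); apply/vdeg_shift; apply: (kf_deg fsK).
    by apply/(@kdeg_shift k S); split.
  apply: (rp_deg HU); apply/vdeg_shift; apply: (kf_deg fuK).
  by apply/(@kdeg_Tm_shift k Y); split.
- move=> c /dc_cocycle[[z1 z2 z3] [_ b2 _]] E.
  have b2' : KB a (comp2 c) := middle_kb z1 z2 b2.
  have /(rp_ker HS (kf_value fsK z3))[yS vS ES] := congr1 fst E.
  have /(rp_ker HU (kf_value fuK z1))[yU vU EU] := congr1 snd E.
  have zU := kf_secZ fvK vU; have zS := kf_secZ fvK vS.
  apply/(@dc_coboundary k i C gC a 1); exists (wV yU), (wV yS), 0; split.
    by split=> //; apply: kcocycle0.
  split.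
  + rewrite dc1_1; apply: (kform_diff fuK) => //.
      exact: (kmap_cocycle (Tfun m) zU).
    by rewrite (TmuV_val zU) (kf_secK fvK vU) EU.
  + exact: (kcoboundaryB b2' (dc2_1_kb zU zS)).
  + rewrite dc3_1; apply: (kform_diff fsK) => //.
      exact: (kmap_cocycle (mu i gS) zS).
    by rewrite (muV_val zS) (kf_secK fvK vS) ES.
- move=> c /dc_cocycle[[z1 z2 z3] _] /(@dc_coboundary k i C gC a 1)[u [v [w [[zu zv _] [b1 _ b3]]]]].
  rewrite dc1_1 in b1; rewrite dc3_1 in b3; apply: (congr2 pair).
    apply/(rp_ker HS (kf_value fsK z3)); exists (fV v); first exact: (kf_value fvK zv).
    by rewrite -(muV_val zv); apply: (kform_same fsK b3).
  apply/(rp_ker HU (kf_value fuK z1)); exists (fV u); first exact: (kf_value fvK zu).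
  by rewrite -(TmuV_val zu); apply: (kform_same fuK b1).
move=> l [nS nU] [/(rp_surj HS)[yS [/vdeg_shift dS vS ES]] /(rp_surj HU)[yU [/vdeg_shift dU vU EU]]].
have /(@kdeg_shift k S)[e1 e2] := kf_sec_deg fsK dS; have zS := kf_secZ fsK vS.
have /(@kdeg_Tm_shift k Y)[g1 g2] := kf_sec_deg fuK dU; have zU := kf_secZ fuK vU.
have gz := wgdeg0 (gshift_wgraded 2 (Tm_wgraded i (gC 1))).
exists (@comps k i C gC 2 (wU yU) 0 (wS yS)); split.
- exact: (conj (conj g1 (conj (gz _) e1)) (conj g2 (conj (gz _) e2))).
- apply/dc_cocycle; rewrite comp1K comp2K comp3K; split; first by split=> //; apply: kcocycle0.
  split.
  + by apply: kb_trivial => x; apply: T0.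
  + apply/(dc2_2_kb 0 zU).
    rewrite (kmap0 (Tfun m)); exact: kcoboundary0.
  + apply: kcoboundaryD; last exact: (del0 zS).
    apply: kcoboundaryZ; rewrite (kmap0 (mu i (gC 1))); exact: kcoboundary0.
rewrite comp1K comp3K; apply: (congr2 pair).
  exact: (etrans (congr1 PS (kf_secK fsK vS)) ES).
exact: (etrans (congr1 PU (kf_secK fuK vU)) EU).
Defined.

End Degree2.

(** One copy of V injects into U, the other into S, so every cocycle is trivial componentwise. *)
Lemma degree1_coboundary (c : D 1 * D 1) : hcocycle a c -> hcoboundary a c.
Proof.
have Z0 := @row0_eq k.
move=> /dc_cocycle[[z1 z2 _] [b1 _ b3]]; apply: hcoboundary_KB; apply/dc_kb.
have k1 : KB a (comp1 c).
  apply: (kf_eq0 fvK z1); apply: VU_inj; first exact: (kf_value fvK z1).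
  by rewrite -(TmuV_val z1); apply: (kf_KB fuK b1).
split=> //; last by apply: kb_trivial => x; apply: Z0.
apply: (kf_eq0 fvK z2); apply: VS_inj; first exact: (kf_value fvK z2).
rewrite -(muV_val z2); apply: (kf_KB fsK).
by rewrite -(dc3_1 (comp2 c) (comp3 c)).
Qed.

Lemma dc3_3 (v : U * U) (w : S * S) :
  dc3 (C := C) (i := i) (j := 3) v w = kmap muU v + kmap m w.
Proof.
apply: (etrans (y := - sgn k 3 *: kmap muU v + kmap m w)) => //.
by rewrite sgn3N scale1r.
Qed.

Lemma dc3_2 (v : V * V) : dc3 (C := C) (i := i) (j := 2) v 0 = - kmap muV v.
Proof.
apply: (etrans (y := - sgn k 2 *: kmap muV v + kmap del 0)) => //.
by rewrite kmap0 addr0 sgn2N scaleN1r.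
Qed.

(** This is exactness of V -> U + S -> Y in the middle; the coordinates z supplied by [UY_SY_exact]
    give the primitive, placed in the summand V of degree 2. *)
Lemma degree3_coboundary (c : D 3 * D 3) : hcocycle a c -> hcoboundary a c.
Proof.
have T0 := @Tm_gzero k i.
move=> /dc_cocycle[[_ z2 z3] [_ _ b3]].
have /UY_SY_exact : gUY (fU (comp2 c)) + gSY (fS (comp3 c)) = 0.
  rewrite -(muU_val z2) -(muS_val z3); rewrite -(kfD fyK); rewrite dc3_3 in b3; exact: (kf_KB fyK b3).
case; [exact: (kf_value fuK z2)|exact: (kf_value fsK z3)|move=> z vz [EU ES]].
have zz := kf_secZ fvK vz.
apply/(@dc_coboundary k i C gC a 2); exists 0, (wV z), 0; split.
  by split=> //; apply: kcocycle0.
split; first by apply: kb_trivial => x; apply: T0.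
  apply: (@dc2_sub_kb k i C a 2 (comp2 c) 0 (wV z) (deltaU0 (kcocycle0 _ _ U a))).
  apply: (kform_diff fuK) => //.
    exact: (kmap_cocycle (Tfun m) zz).
  by rewrite (TmuV_val zz) (kf_secK fvK vz) EU.
rewrite dc3_2; apply: (kform_diff fsK) => //.
  rewrite -scaleN1r; apply: kcocycleZ; exact: (kmap_cocycle (mu i gS) zz).
rewrite -[- kmap _ _]sub0r (kfB fsK) (kf0 fsK) (muV_val zz).
by rewrite (kf_secK fvK vz) ES sub0r.
Qed.

Section Degree4.
Variables (N : gmod k 2) (P : R * R -> N).
Hypothesis HP : rpres a (y1 + 2 + 2) (y2 + 2 + 2) (fun y => exists yU yS,
  [/\ kvalue a yU, kvalue a yS & y = gUY yU + gSY yS]) P.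

Definition pres4 : hpresentation D a 4 N.
Proof.
have Z0 := @row0_eq k; have T0 := @Tm_gzero k i.
have gz := wgdeg0 (Tm_wgraded i (gzero_wgraded k (2 + 2))).
apply: (@HPresentation k D a 4 N (fun c => P (fY (comp3 c)))).
- move=> r c c'; rewrite -(rp_lin HP); apply: (congr1 P).
  exact: (etrans (congr1 fY (comp3_lin (lft r) c c')) (kf_lin fyK r (comp3 c) (comp3 c'))).
- move=> l c [[_ [_ d3]] [_ [_ e3]]].
  apply: (rp_deg HP); apply: (iffLR (@vdeg_shift k _ _ _ 2 _)).
  apply: (iffLR (@vdeg_shift k _ _ _ 2 _)); apply: (kf_deg fyK).
  apply: (iffLR (@kdeg_shift k Y a (l + 2) 2 _)).
  by apply: (iffLR (@kdeg_shift k (gshift 2 Y) a l 2 _)); split.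
- move=> c /dc_cocycle[[_ _ z3] _] /(rp_ker HP (kf_value fyK z3))[yU [yS [vU vS E]]].
  have zU := kf_secZ fuK vU; have zS := kf_secZ fsK vS.
  apply/(@dc_coboundary k i C gC a 3); exists 0, (wU yU), (wS yS); split.
    by split=> //; apply: kcocycle0.
  split; [by apply: kb_trivial => x; apply: T0|by apply: kb_trivial => x; apply: T0|].
  have zU' := kmap_cocycle (mu i gY) zU; have zS' := kmap_cocycle m zS.
  rewrite dc3_3; apply: (kform_diff fyK z3 (kcocycleD zU' zS')).
  by rewrite E (kfD fyK) (muU_val zU) (muS_val zS) (kf_secK fuK vU) (kf_secK fsK vS).
- move=> c /dc_cocycle[[_ _ z3] _] /(@dc_coboundary k i C gC a 3)[u [v [w [[_ zv zw] [_ _]]]]].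
  rewrite dc3_3 => /(kform_same fyK) E; apply/(rp_ker HP (kf_value fyK z3)).
  exists (fU v), (fS w); split; [exact: (kf_value fuK zv)|exact: (kf_value fsK zw)|].
  by rewrite E (kfD fyK) (muU_val zv) (muS_val zw).
move=> l n /(rp_surj HP)[y [dy vy Ey]]; have zy := kf_secZ fyK vy.
have dy' := iffRL (@vdeg_shift k _ _ _ 2 _) (iffRL (@vdeg_shift k _ _ _ 2 _) dy).
have dw := iffRL (@kdeg_shift k Y a (l + 2) 2 _) (kf_sec_deg fyK dy').
have [e1 e2] := iffRL (@kdeg_shift k (gshift 2 Y) a l 2 _) dw.
exists (@comps k i C gC 4 0 0 (wY y)); split.
- exact: (conj (conj (gz _) (conj (gz _) e1)) (conj (gz _) (conj (gz _) e2))).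
- apply/dc_cocycle; rewrite comp1K comp2K comp3K; split.
    by split=> //; apply: kcocycle0.
  by split; apply: kb_trivial => x; [apply: T0|apply: T0|apply: Z0].
by rewrite comp3K (kf_secK fyK vy).
Defined.

End Degree4.

Lemma degree5_coboundary j (c : D j.+4.+1 * D j.+4.+1) : hcocycle a c -> hcoboundary a c.
Proof.
have Z0 := @row0_eq k; have T0 := @Tm_gzero k i.
move=> _; apply: hcoboundary_KB; apply/dc_kb.
by split; apply: kb_trivial => x; [apply: T0|apply: T0|apply: Z0].
Qed.

End ThreeTermCohomology.

(** * Linear algebra with 1/2 and 1/3 *)

Section ExactnessIdentities.
Variables (B : comNzRingType) (h u x z : B).
Hypotheses (hh : h + h = 1) (uu : u + u + u = 1).
Let q := (1 + 1) * (u + u).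

(** Here h, u and q are 1/2, 1/3 and 4/3. The intermediate terms of these proofs write each
    difference as a combination of quantities that vanish by the relations on h and u or by the
    assumed equations. *)
Lemma quarter_inv : q * (1 - h * h) = 1.
Proof.
apply/eqP; rewrite -subr_eq0; apply/eqP; rewrite /q.
transitivity ((h + h - 1) - (1 + 1) * ((h + h - 1) * (u * (h + 2)) - h * (u + u + u - 1))); first ring.
by rewrite hh uu !subrr mul0r mulr0 subrr mulr0 subrr.
Qed.

Lemma quarterK w : q * ((1 - h * h) * w) = w.
Proof. by rewrite mulrA quarter_inv mul1r. Qed.

Lemma quarterK' w : (1 - h * h) * (q * w) = w.
Proof. by rewrite mulrCA quarterK. Qed.

Lemma six_u : (2 : B) = 6 * u.
Proof. by transitivity (2 * (u + u + u)); [rewrite uu mulr1|ring]. Qed.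

Lemma two_h : 2 * h = 1.
Proof. by transitivity (h + h); [ring|]. Qed.

Lemma two_hK (w : B) : 2 * (h * w) = w.
Proof. by rewrite mulrA two_h mul1r. Qed.

(** The two equations form a linear system for c' and c with determinant h h - 1, so a and b
    determine the solution, and q inverts the determinant up to sign. *)
Lemma exact_one a b c c' : 2 * z * b - h * c' + c = 0 -> c' + (2 * x * a - h * c) = 0 ->
  c' = 2 * x * (- (q * a)) - 4 * u * z * b /\
  - c = 8 * u * z * b - x * (- (q * a)).
Proof.
move=> E1 E2.
have c'E : c' = 2 * x * (- (q * a)) - 4 * u * z * b.
  apply/eqP; rewrite -subr_eq0; apply/eqP.
  transitivity (q * h * (2 * z * b - h * c' + c) + q * (c' + (2 * x * a - h * c)) -
    (q * (1 - h * h) - 1) * c' - (2 * h - 1) * (q * z * b)); first by rewrite /q; ring.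
  by rewrite E1 E2 quarter_inv two_h !subrr !(mul0r, mulr0, oppr0, subr0, addr0).
split=> //; apply/eqP; rewrite -subr_eq0; apply/eqP.
transitivity (- (2 * z * b - h * c' + c) + (2 - 6 * u) * z * b
    - h * (c' - (2 * x * (- (q * a)) - 4 * u * z * b)) + (2 * h - 1) * (2 * u * z * b - x * (- (q * a)))).
  ring.
by rewrite E1 -six_u two_h -c'E !subrr !(mul0r, mulr0, oppr0, subr0, addr0).
Qed.

(** The matrix with diagonal 1 and off-diagonal - 1/2 has the inverse with diagonal 4/3 and
    off-diagonal 2/3. *)
Lemma surj_one v w : ((4 * u * v + 2 * u * w) - h * (4 * u * w + 2 * u * v) = v) /\
  ((4 * u * w + 2 * u * v) - h * (4 * u * v + 2 * u * w) = w).
Proof.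
have E a b : (4 * u * a + 2 * u * b) - h * (4 * u * b + 2 * u * a) = a.
  apply/eqP; rewrite -subr_eq0; apply/eqP.
  transitivity ((u + u + u - 1) * a - (2 * h - 1) * (2 * u * b + u * a)); first ring.
  by rewrite uu two_h !subrr !(mul0r, mulr0, oppr0, subr0, addr0).
by split; apply: E.
Qed.

(** The functional (1 - h h) y1 + x y2 eliminates a from the image of [gVS] in degree 1 and leaves
    multiples of z; the remaining constant (1 - h h) 8 u is 2, a unit. *)
Lemma coker_S a b : (1 - h * h) * (8 * u * z * b - x * a) + x * ((1 - h * h) * a) =
  z * ((1 - h * h) * 8 * u * b).
Proof. ring. Qed.

Lemma coker_S_lift (y1 y2 m : B) : (1 - h * h) * y1 + x * y2 = z * m ->
  y1 = 8 * u * z * (h * m) - x * (q * y2) /\ y2 = (1 - h * h) * (q * y2).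
Proof.
move=> E; split; last by rewrite quarterK'.
apply/eqP; rewrite -subr_eq0; apply/eqP.
transitivity (q * ((1 - h * h) * y1 + x * y2) - (q * (1 - h * h) - 1) * y1
  - q * (z * m) - (2 * h - 1) * (q * z * m)); first by rewrite /q; ring.
by rewrite E quarter_inv two_h !subrr !(mul0r, mulr0, oppr0, subr0, addr0, subrr).
Qed.

End ExactnessIdentities.

(** * Injectivity and exactness of the multiplication maps *)

Section Values.
Variable k : fieldType.
Hypothesis two_neq0 : 2 != 0 :> k.
Hypothesis three_neq0 : 3 != 0 :> k.
Local Notation R := {mpoly k[2]}.
Local Notation s := (ord0 : 'I_2).
Local Notation t := (ord_max : 'I_2).
Local Notation xs := ('X_s : R).
Local Notation xt := ('X_t : R).
Local Notation h := ((2^-1)%:MP : R).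
Local Notation th := ((3^-1)%:MP : R).
Let hh := hh1 two_neq0.
Let uu := th1 three_neq0.
Let q : R := (1 + 1) * (th + th).
Implicit Type y : R * R.

Lemma mpX_neq0 (i : 'I_2) : ('X_i : R) != 0.
Proof.
apply/eqP => /(congr1 (mcoeff U_(i)%MM)); rewrite mcoeffX eqxx mcoeff0 => /eqP.
by rewrite oner_eq0.
Qed.

Lemma X_inj (i : 'I_2) (a : R) : 'X_i * a = 0 -> a = 0.
Proof. by move=> /eqP; rewrite mulf_eq0 (negPf (mpX_neq0 i)) => /eqP. Qed.

Lemma two_inj (a : R) : 2 * a = 0 -> a = 0.
Proof.
by move=> E; rewrite -[a]mul1r -(two_h hh) [2 * h]mulrC -mulrA E mulr0.
Qed.

(** Deduced from [koszul_exact1]: substituting z_i for alpha_i embeds R in R^e, and setting the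
    right variables to zero is a left inverse. *)
Lemma regular_sequence (u v : R) : xt * u + xs * v = 0 -> exists w, u = xs * w /\ v = - (xt * w).
Proof.
pose ph (p : R) : {mpoly k[2 + 2]} := p \mPo [tuple zel k i | i < 2].
pose ev (i : 'I_(2 + 2)) : R := match fintype.split i with inl j => 'X_j | inr _ => 0 end.
pose pq (p : {mpoly k[2 + 2]}) : R := p \mPo [tuple ev i | i < 2 + 2].
have pl i : pq (lft 'X_i) = 'X_i.
  by rewrite lftX /pq comp_mpolyXU -tnth_nth tnth_mktuple /ev (unsplitK (inl i)).
have pr i : pq (rgt 'X_i) = 0.
  by rewrite rgtX /pq comp_mpolyXU -tnth_nth tnth_mktuple /ev (unsplitK (inr i)).
have pM (b c : {mpoly k[2 + 2]}) : pq (b * c) = pq b * pq c by exact: rmorphM.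
have pB (b c : {mpoly k[2 + 2]}) : pq (b - c) = pq b - pq c by exact: rmorphB.
have pN (b : {mpoly k[2 + 2]}) : pq (- b) = - pq b by exact: rmorphN.
have pz i : pq (zel k i) = 'X_i by rewrite zelE /yel pB pl pr subr0.
have pz' i : ph 'X_i = zel k i by rewrite /ph comp_mpolyXU -tnth_nth tnth_mktuple.
have pK (p : R) : pq (ph p) = p.
  apply: (@mpoly_rmorph_ext _ _ _ ((comp_mpoly [tuple ev i | i < 2 + 2]) \o
    (comp_mpoly [tuple zel k i | i < 2])) idfun) => [c|i]; first by rewrite /= !comp_mpolyC.
  exact: (etrans (congr1 pq (pz' i)) (pz i)).
move=> E; have /koszul_exact1[w [E1 E2]] : zel k s * ph v + zel k t * ph u = 0.
  by rewrite -!pz' /ph -!rmorphM -rmorphD /= addrC E rmorph0.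
exists (pq w); split.
  by rewrite -[u]pK E2 pM pz.
by rewrite -[v]pK E1 pN pM pz.
Qed.

Lemma VU_injective a y : kvalue a y -> gVU a y = 0 -> y = 0.
Proof.
case: y => y1 y2; case: a => [|[|a]] //= v E.
  have /= E1 := congr1 fst E; rewrite v; congr pair.
  by apply: (@X_inj s); apply: two_inj; rewrite mulrA.
have /= E2 := congr1 snd E; rewrite E2 in E; rewrite E2; congr pair.
have /= E1 := congr1 fst E; rewrite mulr0 subr0 in E1.
by apply: (@X_inj s); apply: two_inj; rewrite mulrA.
Qed.

Lemma VS_injective a y : kvalue a y -> gVS a y = 0 -> y = 0.
Proof.
case: y => y1 y2; case: a => [|[|a]] //= v E.
  have /= E1 := congr1 fst E; rewrite v; congr pair.
  by apply: (@X_inj t); apply: two_inj; rewrite mulrA.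
have /= E2 := congr1 snd E; have y10 : y1 = 0.
  by rewrite -(quarterK hh uu y1) E2 mulr0.
have /= E1 := congr1 fst E; rewrite y10 mulr0 subr0 in E1; rewrite y10; congr pair.
apply: (@X_inj t); apply: two_inj; apply: two_inj.
(* The coefficient of [gVS] is 8/3, and 4 = 3/2 of 8/3. *)
have e4 : 2 * (2 * (xt * y2)) = (2 * h * 4) * ((th + th + th) * (xt * y2)) by rewrite (two_h hh) uu; ring.
rewrite e4 (_ : _ * _ = 3 * h * (8 * th * xt * y2)); last ring.
by rewrite E1 mulr0.
Qed.

(** Degree 0 is the exactness of the Koszul complex of (alpha_s, alpha_t), degree 1 the linear
    system of [exact_one]; in degree 2 all maps are identities. *)
Lemma UY_SY_exact a y y' : kvalue a y -> kvalue a y' -> gUY a y + gSY a y' = 0 ->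
  exists2 z, kvalue a z & y = gVU a z /\ y' = - gVS a z.
Proof.
case: y y' => [y1 y2] [z1 z2]; case: a => [|[|[|a]]] /= v v' E.
- have /= E1 := congr1 fst E.
  have /regular_sequence[w [Eu Ev]] : xt * y1 + xs * z1 = 0.
    by apply: two_inj; rewrite mulrDr !mulrA.
  (* The factor h compensates the 2 in [gVU] and [gVS]. *)
  exists (h * w, 0) => //=; rewrite v v' Eu Ev; split.
    by congr pair; rewrite -{1}(two_hK hh w); ring.
  apply: (congr2 pair); last by rewrite oppr0.
  by rewrite -{1}(two_hK hh w) /=; ring.
- have /= E1 := congr1 fst E; have /= E2 := congr1 snd E.
  have [e1 e2] := exact_one hh uu E1 E2.
  exists (- (q * z2), y2) => //=; split; first by rewrite e1.
  apply: (congr2 pair); first by rewrite -e2 opprK.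
  by apply: (etrans (esym (quarterK' hh uu z2))); rewrite /q /=; ring.
- exists (y1, y2) => //; split=> //; apply/eqP; rewrite -addr_eq0 addrC; apply/eqP; exact: E.
- by exists 0 => //; rewrite v v' oppr0.
Qed.

Lemma span_principal (x p : R) : @Defs.span _ (greg k 2) (fun r => r = x) p <-> exists m, p = x * m.
Proof.
split=> [|[m ->]].
  elim=> [|c r v -> _ [m ->]]; first by exists 0; rewrite mulr0.
  by exists (c + m); rewrite mulrDr [x * c]mulrC.
rewrite -[x * m]addr0 mulrC; exact: (@Defs.spanS _ (greg k 2) _ m x 0 erefl (Defs.span0 _)).
Qed.

Lemma span_two (x z p : R) : @Defs.span _ (greg k 2) (fun r => r = x \/ r = z) p <->
  exists m n, p = x * m + z * n.
Proof.
split=> [|[m [n ->]]].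
  elim=> [|c r v [->|->] _ [m [n ->]]]; first by exists 0, 0; rewrite !mulr0 addr0.
    by exists (c + m), n; rewrite mulrDr addrA [x * c]mulrC.
  by exists m, (c + n); rewrite mulrDr addrCA [z * c]mulrC.
rewrite [x * m]mulrC [z * n]mulrC; apply: (@Defs.spanS _ (greg k 2) _ m x _ (or_introl erefl)).
by rewrite -[n * z]addr0; apply: (@Defs.spanS _ (greg k 2) _ n z 0 (or_intror erefl) (Defs.span0 _)).
Qed.

End Values.

(** * Graded dimensions and Poincaré series *)

Section Dimensions.
Variables (k : fieldType).
Local Notation R := {mpoly k[2]}.
Local Notation gmod := (gmod k 2).

Lemma gdim_giso (M N : gmod) d r : giso M N -> gdim N d r -> gdim M d r.
Proof.
move=> [f [g [fK gK]]] [e [de ee]]; exists (fun i => g (e i)); split.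
  by move=> i; apply: gmorP.
move=> x dx; have [c [cE cu]] := ee (f x) (gmorP f dx); exists c; split.
  by rewrite -[x]fK cE linear_sum; apply: eq_bigr => i _; rewrite linearZ.
move=> c' c'E; apply: cu; rewrite c'E linear_sum; apply: eq_bigr => i _.
by rewrite linearZ gK.
Qed.

Lemma gdim_trivial (M : gmod) d : gtrivial M -> gdim M d 0.
Proof.
move=> M0; exists (fun _ => 0); split; first by case.
move=> x _; exists 0; split; first by rewrite big_ord0; apply: M0.
by move=> c _; apply/rowP; case.
Qed.

Lemma gdim_gsum (M N : gmod) d r r' : gdim M d r -> gdim N d r' ->
  wgraded M -> wgraded N -> @gdim k 2 (gsum M N) d (r + r')%N.
Proof.
move=> [e [de ee]] [e' [de' ee']].
pose b (i : 'I_(r + r')) : gsum M N :=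
  match fintype.split i with inl j => (e j, 0) | inr j => (0, e' j) end.
have bl j : b (lshift r' j) = (e j, 0) by rewrite /b (unsplitK (inl j)).
have br j : b (rshift r j) = (0, e' j) by rewrite /b (unsplitK (inr j)).
have bE (c : 'rV[k]_(r + r')) : \sum_i (c 0 i)%:MP *: b i =
    (\sum_j (c 0 (lshift r' j))%:MP *: e j, \sum_j (c 0 (rshift r j))%:MP *: e' j).
  apply: pair_ext.
    apply: (etrans (linear_sum (fst : {linear gsum M N -> M}) _ _ _)); rewrite big_split_ord /=.
    rewrite [X in _ + X]big1 ?addr0 => [|j _]; last by rewrite br /= scaler0.
    by apply: eq_bigr => j _; rewrite bl.
  apply: (etrans (linear_sum (snd : {linear gsum M N -> N}) _ _ _)); rewrite big_split_ord /=.
  rewrite big1 ?add0r => [|j _]; last by rewrite bl /= scaler0.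
  by apply: eq_bigr => j _; rewrite br.
move=> gM gN; exists b; split.
  by move=> i; rewrite /b; case: fintype.split => j; split=> //=; [apply: (wgdeg0 gN)|apply: (wgdeg0 gM)].
move=> [x x'] [dx dx']; have [c [cE cu]] := ee x dx; have [c' [c'E cu']] := ee' x' dx'.
exists (row_mx c c'); split.
  rewrite bE; apply: (congr2 pair).
    by rewrite cE; apply: eq_bigr => j _; rewrite row_mxEl.
  by rewrite c'E; apply: eq_bigr => j _; rewrite row_mxEr.
move=> v; rewrite bE => -[v1 v2].
rewrite -[v]hsubmxK; congr row_mx; [apply: cu|apply: cu'].
  by rewrite v1; apply: eq_bigr => j _; rewrite mxE.
by rewrite v2; apply: eq_bigr => j _; rewrite mxE.
Qed.

Definition mon2 (a b : nat) : 'X_{1..2} := [multinom (if i == ord0 then a else b) | i < 2].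

Lemma qfracE n (d : int) : (exists2 m : nat, d = (2 * m)%N :> int & qfrac 0 n d = 'C((n + m).-1, m)) \/
  ((forall m : nat, (2 * m)%N != d :> int) /\ qfrac 0 n d = 0%N).
Proof.
rewrite /qfrac subr0; case: d => e; last by right.
have [oe|oe] := boolP (odd e); [right|left].
  by split=> // m; apply/eqP => -[E]; rewrite -E mul2n odd_double in oe.
by exists e./2; rewrite // mul2n even_halfK.
Qed.

(* pi presents M as the quotient of k[x_s, x_t] by a monomial ideal, and the b i are the
   monomials of degree m outside of it. *)
Lemma gdim_monomial (M : gmod) (pi : R -> M) (d : int) (m r : nat) (b : 'I_r -> 'X_{1..2}) :
  (forall a x y, pi (a *: x + y) = a%:MP *: pi x + pi y) ->
  (forall e x, gdeg e x -> exists2 p, pdeg e p & x = pi p) ->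
  (forall e p, pdeg e p -> gdeg e (pi p)) ->
  d = (2 * m)%N -> (forall i, mdeg (b i) = m) -> injective b ->
  (forall p, pi p = 0 -> forall i, p@_(b i) = 0) ->
  (forall w, mdeg w = m -> (forall i, w != b i) -> pi 'X_[w] = 0) ->
  gdim M d r.
Proof.
move=> pl pd pd' dm bm binj p0 pw.
have pi0 : pi 0 = 0 by have := pl (-1) 0 0; rewrite scaler0 addr0 mpolyCN mpolyC1 scaleN1r addNr.
have piD x y : pi (x + y) = pi x + pi y by rewrite -[x in LHS]scale1r pl mpolyC1 scale1r.
have piZ a x : pi (a *: x) = a%:MP *: pi x by rewrite -[_ *: x]addr0 pl pi0 addr0.
have pis (I : Type) (l : seq I) (F : I -> R) : pi (\sum_(j <- l) F j) = \sum_(j <- l) pi (F j).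
  by apply: (big_morph pi piD pi0).
have cb (v : 'rV[k]_r) i : (\sum_j v 0 j *: 'X_[b j] : R)@_(b i) = v 0 i.
  rewrite raddf_sum (bigD1 i) //= mcoeffZ mcoeffX eqxx mulr1 big1 ?addr0 // => j ji.
  by rewrite mcoeffZ mcoeffX (inj_eq binj) (negPf ji) mulr0.
have pb (v : 'rV[k]_r) : pi (\sum_j v 0 j *: 'X_[b j]) = \sum_j (v 0 j)%:MP *: pi 'X_[b j].
  by rewrite pis; apply: eq_bigr => j _; rewrite piZ.
exists (fun i => pi 'X_[b i]); split.
  by move=> i; apply: pd' => w; rewrite msuppX inE => /eqP ->; rewrite bm.
move=> x /pd[p dp ->]; exists (\row_i p@_(b i)); split; last first.
  move=> v; rewrite -pb => E; apply/rowP => i; rewrite mxE -[RHS](cb v).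
  apply/eqP; rewrite -subr_eq0 -mcoeffB; apply/eqP; apply: p0.
  by rewrite -scaleN1r addrC pl mpolyCN mpolyC1 scaleN1r E addNr.
rewrite -pb; set v := (\row_i p@_(b i)).
pose p' : R := p - \sum_j v 0 j *: 'X_[b j].
have p'b i : p'@_(b i) = 0 by rewrite mcoeffB cb mxE subrr.
suff E : pi p' = 0 by rewrite -[p in LHS](subrK (\sum_j v 0 j *: 'X_[b j])) piD E add0r.
rewrite [p']mpolyE pis big_seq big1 // => w wp.
rewrite piZ pw ?scaler0 //; last first.
  move=> i; apply: contraTneq wp => ->; rewrite mcoeff_msupp negbK; exact/eqP.
have dp' : pdeg d p'.
  apply: pdegD => //; apply: pdegN; elim/big_ind: _ => [|? ?|j _]; [exact: pdeg0|exact: pdegD|].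
  apply/pdegP => w' nw; rewrite mcoeffZ mcoeffX.
  have [E|_] := eqVneq (b j) w'; last by rewrite mulr0.
  by rewrite -E bm dm eqxx in nw.
by have := dp' w wp; rewrite dm => -[] /eqP; rewrite eqn_pmul2l // => /eqP.
Qed.

Lemma gdim_none (M : gmod) d : (forall x : M, gdeg d x -> x = 0) -> gdim M d 0.
Proof.
move=> M0; exists (fun _ => 0); split; first by case.
move=> x dx; exists 0; split; first by rewrite big_ord0; apply: M0.
by move=> c _; apply/rowP; case.
Qed.

Lemma pdeg_none d (p : R) : (forall m : nat, (2 * m)%N != d :> int) -> pdeg d p -> p = 0.
Proof.
move=> nd dp; apply/mpolyP => w; rewrite mcoeff0.
exact: (iffLR (pdegP d p) dp w (nd _)).
Qed.

Lemma mdeg2 (w : 'X_{1..2}) : mdeg w = (w ord0 + w ord_max)%N.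
Proof. by rewrite mdegE big_ord_recl big_ord1; congr (_ + w _)%N; apply: val_inj. Qed.

Lemma mcoeff_MX (j : 'I_2) (p : R) (w : 'X_{1..2}) : w j = 0%N -> ('X_j * p)@_w = 0.
Proof.
move=> wj; rewrite [p]mpolyE mulr_sumr raddf_sum big1 // => u _.
have E0 : 'X_j * (p@_u *: 'X_[u]) = p@_u *: 'X_[U_(j) + u] :> R by rewrite mpolyXD -scalerAr.
rewrite [LHS](congr1 (mcoeff w) E0) mcoeffZ mcoeffX; case: eqP => [E|_]; last by rewrite mulr0.
by have := congr1 (fun v : 'X_{1..2} => v j) E; rewrite mnmDE mnm1E eqxx wj.
Qed.

Lemma mpX_mem (j : 'I_2) (w : 'X_{1..2}) : w j != 0%N -> exists p : R, 'X_[w] = 'X_j * p.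
Proof.
by rewrite -lep1mP => /submK <-; exists 'X_[w - U_(j)]; rewrite mpolyXD mulrC.
Qed.

Lemma gdim_greg d : gdim (greg k 2) d (qfrac 0 2 d).
Proof.
have [[m dE ->]|[nd ->]] := qfracE 2 d; last by apply: gdim_none => p; apply: pdeg_none.
rewrite add2n /= binSn.
have mE a b : mdeg (mon2 a b) = (a + b)%N by rewrite mdeg2 !mnmE.
apply: (@gdim_monomial (greg k 2) id d m m.+1 (fun i => mon2 i (m - i))) => //.
- by move=> a x y; rewrite -mul_mpolyC.
- by move=> e x dx; exists x.
- by move=> i; rewrite mE subnKC // -ltnS.
- move=> i j /(congr1 (fun v : 'X_{1..2} => v ord0)); rewrite !mnmE /= => E.
  exact: val_inj.
- by move=> p p0 i; rewrite [p]p0 mcoeff0.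
move=> w wm nb; have lt : (w ord0 < m.+1)%N by rewrite ltnS -wm mdeg2 leq_addr.
have /eqP[] := nb (Ordinal lt); apply/mnmP => l; rewrite mnmE /=.
by move: wm; rewrite mdeg2; elim/ord2P: l => //= <-; rewrite addKn.
Qed.

Lemma qpi0P (M : gmod) (S : submod M) (x : M) : qpi S x = 0 <-> S x.
Proof. by rewrite -(linear0 (qpi S)) qpi_eq subr0. Qed.

Section QuotientDimension.
Variables (X : R -> Prop) (d : int) (m r : nat) (b : 'I_r -> 'X_{1..2}).
Local Notation Q := (@gquot_ideal k 2 X).
Local Notation I := (@spanM _ (greg k 2) X).

Lemma gdim_quotient : d = (2 * m)%N -> (forall i, mdeg (b i) = m) -> injective b ->
  (forall p, I p -> forall i, p@_(b i) = 0) ->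
  (forall w, mdeg w = m -> (forall i, w != b i) -> I 'X_[w]) -> gdim Q d r.
Proof.
move=> dm bm binj p0 pw.
have pl (a : k) (x y : R) : qpi I (a *: x + y : greg k 2) = a%:MP *: qpi I (x : greg k 2) + qpi I (y : greg k 2).
  by rewrite -linearP -mul_mpolyC.
have pd e (x : Q) : gdeg e x -> exists2 p : R, pdeg e p & x = qpi I (p : greg k 2).
  by case=> p dp ->; exists p.
have pd' e (p : R) : pdeg e p -> @gdeg k 2 Q e (qpi I (p : greg k 2)) by move=> dp; exists p.
apply: (@gdim_monomial Q (fun p : R => qpi I (p : greg k 2)) d m r b pl pd pd' dm bm binj).
  by move=> p /qpi0P; apply: p0.
by move=> w wm nb; apply/qpi0P; apply: pw.
Qed.

Lemma gdim_quotient_none : (forall m : nat, (2 * m)%N != d :> int) -> gdim Q d 0.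
Proof.
move=> nd; apply: gdim_none => q -[p dp ->].
by rewrite [p](pdeg_none nd dp); apply: (linear0 (qpi I)).
Qed.
End QuotientDimension.

Lemma gdim_line (i j : 'I_2) d : j != i ->
  gdim (gquot_ideal (fun p : R => p = 'X_j)) d (qfrac 0 1 d).
Proof.
move=> ji; have [[m dE ->]|[nd ->]] := qfracE 1 d; last exact: gdim_quotient_none.
rewrite add1n /= binn.
have Uj : (U_(i) *+ m)%MM j = 0%N by rewrite mulmnE mnm1E eq_sym (negPf ji).
apply: (@gdim_quotient _ d m 1 (fun _ => (U_(i) *+ m)%MM)) => //.
- by move=> _; rewrite mdegMn mdeg1 mul1n.
- by move=> u v _; rewrite (ord1 u) (ord1 v).
- by move=> p /span_principal[n ->] _; apply: mcoeff_MX.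
move=> w wm nb; apply/span_principal.
have [wj|/mpX_mem //] := eqVneq (w j) 0%N.
have /eqP[] := nb ord0; apply/mnmP => l; rewrite mulmnE mnm1E -wm mdeg2.
by move: ji wj {Uj nb}; elim/ord2P: i; elim/ord2P: j; elim/ord2P: l => //= _ ->;
  rewrite ?addn0 ?add0n ?mul1n.
Qed.

Lemma gdim_point d : gdim (gquot_ideal (fun p : R => p = 'X_ord0 \/ p = 'X_ord_max)) d (qfrac 0 0 d).
Proof.
have [[m dE ->]|[nd ->]] := qfracE 0 d; last exact: gdim_quotient_none.
have mem (w : 'X_{1..2}) : mdeg w != 0%N -> exists n p : R, 'X_[w] = 'X_ord0 * n + 'X_ord_max * p.
  have [w0|/mpX_mem[n ->] _] := eqVneq (w ord0) 0%N; last by exists n, 0; rewrite mulr0 addr0.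
  rewrite mdeg2 w0 add0n => /mpX_mem[p ->]; by exists 0, p; rewrite mulr0 add0r.
case: m dE => [|m] dE.
  rewrite bin0; apply: (@gdim_quotient _ d 0 1 (fun _ => 0%MM)) => //.
  - by move=> _; rewrite mdeg0.
  - by move=> u v _; rewrite (ord1 u) (ord1 v).
  - move=> p /span_two[n [p' ->]] _.
    by rewrite mcoeffD !mcoeff_MX ?addr0 ?mnm0E.
  by move=> w /eqP; rewrite mdeg_eq0 => /eqP -> /(_ ord0); rewrite eqxx.
rewrite add0n /= bin_small //.
apply: (@gdim_quotient _ d m.+1 0 (fun _ => 0%MM)) => //.
- by case.
- by case.
- by move=> p _ [].
by move=> w wm _; apply/span_two/mem; rewrite wm.
Qed.

Lemma qfrac_shift c n d : qfrac c n d = qfrac 0 n (d - c).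
Proof. by rewrite /qfrac subr0. Qed.

End Dimensions.

(** * The cokernels as explicit modules *)

Section Targets.
Variable k : fieldType.
Local Notation R := {mpoly k[2]}.
Local Notation gmod := (gmod k 2).

Lemma greg_wgraded : wgraded (greg k 2).
Proof.
split; [exact: pdeg0|by move=> d x y; apply: pdegD|by move=> i d p x; apply: pdegM|].
move=> Q Qd QD x; rewrite [x](@pcomp_sum k 2 (undup (pdegs x))) ?undup_uniq //.
  apply: (big_ind Q) => // [|d _]; first exact: (Qd 0 _ (@pdeg0 k 2 0)).
  exact: (Qd d _ (@pdeg_pcomp k 2 d x)).
by move=> d; rewrite mem_undup.
Qed.

Lemma gquot_wgraded (M : gmod) (S : submod M) : wgraded M -> wgraded (gquot S).
Proof.
move=> gM; split.
- by move=> d; exists 0; [exact: (wgdeg0 gM)|apply/esym; apply: (linear0 (qpi S))].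
- by move=> d _ _ [x dx ->] [y dy ->]; exists (x + y); [exact: (wgdegD gM)|rewrite qpiD].
- by move=> i d p _ ip [x dx ->]; exists (p *: x); [exact: (wgdegZ gM)|rewrite linearZ].
move=> Q Qd QD q; rewrite -[q]qpiE; move: (repr q) => {q}.
apply: (wgdeg_ind gM) => [d x dx|x y Qx Qy]; first by apply: (Qd d); exists x.
by rewrite qpiD; apply: QD.
Qed.

Lemma ideal_wgraded (X : R -> Prop) : wgraded (gquot_ideal X).
Proof. exact: gquot_wgraded greg_wgraded. Qed.

Lemma rpres_eq a e1 e2 e1' e2' I N (P : R * R -> gsort N) : rpres a e1 e2 I P ->
  e1 = e1' -> e2 = e2' -> @rpres k a e1' e2' I N P.
Proof. by move=> H <- <-. Qed.

Lemma rpres_shift a e1 e2 e I N P : @rpres k a e1 e2 I N P ->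
  @rpres k a (e1 + e) (e2 + e) I (gshift e N) P.
Proof.
move=> H; split; [exact: rp_lin H|..].
- by move=> l y dy; apply: (rp_deg H); apply: (iffRL (@vdeg_shift k e1 e2 l e y)).
- exact: rp_ker H.
move=> l n /(rp_surj H)[y [dy vy E]]; exists y; split=> //.
exact: (iffLR (@vdeg_shift k e1 e2 l e y)).
Qed.

Lemma rpres_ker a e1 e2 I I' N P : @rpres k a e1 e2 I N P ->
  (forall y, kvalue a y -> I y <-> I' y) -> @rpres k a e1 e2 I' N P.
Proof.
move=> H E; split; [exact: rp_lin H|exact: rp_deg H| |exact: rp_surj H].
by move=> y vy; rewrite (rp_ker H vy); apply: E.
Qed.

Lemma rpres_zero a e1 e2 (I : R * R -> Prop) : (forall y, kvalue a y -> I y) ->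
  @rpres k a e1 e2 I (gzero k 2) (fun _ => 0).
Proof.
move=> H; split=> //; first by move=> r y y'; rewrite scaler0 addr0.
  by move=> y /H.
move=> l n _; exists 0; split; [by split; apply: pdeg0|by case: a {H} => [|[|[|a]]]|].
by apply/rowP => -[].
Qed.

Lemma rpres_fst a e2 : ~~ odd a -> (a < 3)%N ->
  @rpres k a 0 e2 (fun y => y = 0) (greg k 2) (fun y => y.1).
Proof.
move=> ea a3; split=> //.
- by move=> l y [d1 _]; rewrite -[l]addr0.
- move=> [y1 y2] v; split=> [/= E|->] //; congr pair => //.
  by case: a ea a3 v => [|[|[|a]]].
move=> l n dn; exists (n, 0); split=> //; last by case: a ea a3 => [|[|[|a]]].
by split; [rewrite addr0|apply: pdeg0].
Qed.

Lemma rpres_pair : @rpres k 1 0 0 (fun y => y = 0) (gsum (greg k 2) (greg k 2)) id.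
Proof.
split=> //.
  by move=> l y [d1 d2]; rewrite !addr0 in d1 d2; split.
move=> l n [d1 d2]; exists n; split=> //; first by split; rewrite addr0.
Qed.

Lemma rpres_quot a e1 e2 (X : R -> Prop) (L : R * R -> R) (w : R -> R * R) :
  (forall r y y', L (r * y.1 + y'.1, r * y.2 + y'.2) = r * L y + L y') ->
  (forall l y, vdeg e1 e2 l y -> pdeg l (L y)) ->
  (forall p, kvalue a (w p)) -> (forall p, L (w p) = p) ->
  (forall l p, pdeg l p -> vdeg e1 e2 l (w p)) ->
  @rpres k a e1 e2 (fun y => @Defs.span _ (greg k 2) X (L y)) (gquot_ideal X)
    (fun y => qpi (@spanM _ (greg k 2) X) (L y : greg k 2)).
Proof.
move=> Ll Ld wv wK wd; split.
- by move=> r y y'; rewrite Ll -linearP.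
- by move=> l y dy; exists (L y); first exact: Ld dy.
- by move=> y _; rewrite -(linear0 (qpi _)) qpi_eq subr0.
move=> l _ [p dp ->]; exists (w p); split; [exact: wd|exact: wv|by rewrite wK].
Qed.

Lemma rpres_quot_fst a e2 (X : R -> Prop) : ~~ odd a -> (a < 3)%N ->
  @rpres k a 0 e2 (fun y => @Defs.span _ (greg k 2) X y.1) (gquot_ideal X)
    (fun y => qpi (@spanM _ (greg k 2) X) (y.1 : greg k 2)).
Proof.
move=> ea a3; apply: (@rpres_quot a 0 e2 X fst (fun p => (p, 0))) => //.
- by move=> l y [d1 _]; rewrite -[l]addr0.
- by case: a ea a3 => [|[|[|a]]].
by move=> l p dp; split; [rewrite addr0|apply: pdeg0].
Qed.

Section Values.
Hypothesis two_neq0 : 2 != 0 :> k.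
Hypothesis three_neq0 : 3 != 0 :> k.
Local Notation s := (ord0 : 'I_2).
Local Notation t := (ord_max : 'I_2).
Local Notation xs := ('X_s : R).
Local Notation xt := ('X_t : R).
Local Notation h := ((2^-1)%:MP : R).
Local Notation th := ((3^-1)%:MP : R).
Let hh := hh1 two_neq0.
Let uu := th1 three_neq0.
Local Notation R_s := (gquot_ideal (fun p : R => p = xs)).
Local Notation R_t := (gquot_ideal (fun p : R => p = xt)).
Local Notation K := (gquot_ideal (fun p : R => p = xs \/ p = xt)).
Local Notation cokV g a := (fun y : R * R => exists2 y', kvalue a y' & y = g a y').

Lemma coker_VS0 e2 : @rpres k 0 0 e2 (cokV (@gVS k) 0%N) R_t
  (fun y => qpi (@spanM _ (greg k 2) (fun p : R => p = xt)) (y.1 : greg k 2)).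
Proof.
apply: rpres_ker (rpres_quot_fst e2 _ _ _) _ => // -[y1 y2] /= ->; split.
  move=> /span_principal[n ->]; exists (h * n, 0) => //=.
  by congr pair; rewrite -{1}(two_hK hh n); ring.
move=> [[z1 z2] _ /= [->]]; apply/span_principal; exists (2 * z1); ring.
Qed.

Lemma coker_VU0 e2 : @rpres k 0 0 e2 (cokV (@gVU k) 0%N) R_s
  (fun y => qpi (@spanM _ (greg k 2) (fun p : R => p = xs)) (y.1 : greg k 2)).
Proof.
apply: rpres_ker (rpres_quot_fst e2 _ _ _) _ => // -[y1 y2] /= ->; split.
  move=> /span_principal[n ->]; exists (h * n, 0) => //=.
  by congr pair; rewrite -{1}(two_hK hh n); ring.
move=> [[z1 z2] _ /= [->]]; apply/span_principal; exists (2 * z1); ring.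
Qed.

Lemma mulC_deg c d (p : R) : pdeg d p -> pdeg d (c%:MP * p).
Proof. by move=> dp; rewrite -[d]add0r; apply: pdegM => //; apply: pdegC. Qed.

Lemma mulX_deg (i : 'I_2) d (p : R) : pdeg (d - 2) p -> pdeg d ('X_i * p).
Proof. by move=> dp; rewrite -[d](subrK 2) addrC; apply: pdegM => //; apply: pdegX. Qed.

Lemma hhE : 1 - h * h = (1 - 2^-1 * 2^-1)%:MP.
Proof. by rewrite mpolyCB mpolyC1 mpolyCM. Qed.

(** The constant 4/3 as a scalar of k, which makes its degree 0 evident. *)
Definition quarter : k := (1 + 1) * (3^-1 + 3^-1).
Lemma quarterE : (1 + 1) * (th + th) = quarter%:MP.
Proof. by rewrite /quarter mpolyCM !mpolyCD mpolyC1. Qed.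

Lemma coker_VS1 : @rpres k 1 0 (- 2) (cokV (@gVS k) 1%N) R_t
  (fun y => qpi (@spanM _ (greg k 2) (fun p : R => p = xt))
    ((1 - h * h) * y.1 + xs * y.2 : greg k 2)).
Proof.
apply: rpres_ker (@rpres_quot 1 0 (- 2) _ (fun y => (1 - h * h) * y.1 + xs * y.2)
  (fun p => (quarter%:MP * p, 0)) _ _ _ _ _) _ => //.
- by move=> r y y' /=; ring.
- move=> l y [d1 d2]; rewrite addr0 in d1; apply: pdegD.
    by rewrite hhE; apply: mulC_deg.
  exact: mulX_deg.
- by move=> p; rewrite -quarterE /= mulr0 addr0 (quarterK' hh uu).
- by move=> l p dp; split; [rewrite addr0; apply: mulC_deg|apply: pdeg0].
move=> [y1 y2] _; split.
  move=> /span_principal[n /= E]; have [E1 E2] := coker_S_lift hh uu E.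
  exists ((1 + 1) * (th + th) * y2, h * n) => //=.
  exact: (congr2 pair E1 E2).
move=> [[z1 z2] _ [-> ->]]; apply/span_principal.
exists ((1 - h * h) * 8 * th * z2); exact: coker_S.
Qed.

(** Adding 4/3 alpha_t times the second coordinate cancels the term - 4 th alpha_t in the image of
    [gVU]; what is left are the multiples of alpha_s. *)
Lemma coker_VU1 : @rpres k 1 0 (- 2) (cokV (@gVU k) 1%N) R_s
  (fun y => qpi (@spanM _ (greg k 2) (fun p : R => p = xs))
    (y.1 + xt * ((1 + 1) * (th + th) * y.2) : greg k 2)).
Proof.
apply: rpres_ker (@rpres_quot 1 0 (- 2) _ (fun y => y.1 + xt * ((1 + 1) * (th + th) * y.2))
  (fun p => (p, 0)) _ _ _ _ _) _ => //.
- by move=> r y y' /=; ring.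
- move=> l y [d1 d2]; rewrite addr0 in d1; apply: pdegD => //.
  by rewrite quarterE; apply: mulX_deg; apply: mulC_deg.
- by move=> p; rewrite /= !mulr0 addr0.
- by move=> l p dp; split; [rewrite addr0|apply: pdeg0].
move=> [y1 y2] _; split.
  move=> /span_principal[n /= E].
  have E1 : y1 = xs * n - xt * ((1 + 1) * (th + th) * y2) by rewrite -E addrK.
  exists (h * n, y2) => //=; apply: (congr2 pair) => //.
  by rewrite E1 -{1}(two_hK hh n); ring.
move=> [[z1 z2] _ [-> ->]]; apply/span_principal; exists (2 * z1) => /=; ring.
Qed.

Lemma coker_id e1 e2 (g : nat -> R * R -> R * R) : (forall y, g 2%N y = y) ->
  @rpres k 2 e1 e2 (cokV g 2%N) (gzero k 2) (fun _ => 0).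
Proof. by move=> gE; apply: rpres_zero => y vy; exists y. Qed.

Local Notation cok4 a := (fun y : R * R => exists yU yS,
  [/\ kvalue a yU, kvalue a yS & y = gUY a yU + gSY a yS]).

Lemma coker4_0 e2 : @rpres k 0 0 e2 (cok4 0%N) K
  (fun y => qpi (@spanM _ (greg k 2) (fun p : R => p = xs \/ p = xt)) (y.1 : greg k 2)).
Proof.
apply: rpres_ker (rpres_quot_fst e2 _ _ _) _ => // -[y1 y2] /= ->; split.
  move=> /span_two[u [v ->]]; exists (h * v, 0), (h * u, 0); split=> //.
  apply: (congr2 pair); last by rewrite /= addr0.
  by rewrite -{1}(two_hK hh u) -{1}(two_hK hh v) /=; ring.
move=> [[u1 u2] [[v1 v2] [_ _ [-> _]]]]; apply/span_two; exists (2 * v1), (2 * u1) => /=; ring.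
Qed.

Lemma coker4_1 e1 e2 : @rpres k 1 e1 e2 (cok4 1%N) (gzero k 2) (fun _ => 0).
Proof.
apply: rpres_zero => -[v w] _; have [E1 E2] := surj_one hh uu v w.
exists (4 * th * w + 2 * th * v, 0), (4 * th * v + 2 * th * w, 0); split=> //.
apply: (congr2 pair) => /=; rewrite !mulr0 sub0r.
  by rewrite -[v in LHS]E1 addrC.
by rewrite -[w in LHS]E2.
Qed.

Lemma coker4_2 e1 e2 : @rpres k 2 e1 e2 (cok4 2%N) (gzero k 2) (fun _ => 0).
Proof. by apply: rpres_zero => y vy; exists y, 0; split=> //; rewrite /= addr0. Qed.

End Values.
End Targets.

(** * Assembly for sigma_1^2 sigma_2^2 *)

Section SmallPresentations.
Variable k : fieldType.
Hypothesis two_neq0 : 2 != 0 :> k.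
Hypothesis three_neq0 : 3 != 0 :> k.
Local Notation R := {mpoly k[2]}.
Local Notation s := (ord0 : 'I_2).
Local Notation t := (ord_max : 'I_2).
Local Notation gdiag := (gdiag k 2).
Local Notation S := (Tm s gdiag).
Local Notation V := (Tm t S).
Local Notation del := (delta_mor s (gdiag_wgraded k)).
Local Notation m := (mu s (gdiag_wgraded k)).
Local Notation md := (@mufun_delta k s gdiag).
Local Notation gS := (Tm_wgraded s (gdiag_wgraded k)).
Local Notation gY := (gdiag_wgraded k).
Local Notation D := (small k).
Variable a : nat.

Let dV (c : V * V) zc := @deltaV_kb k two_neq0 three_neq0 a c zc.
Let dU (c : Tm t gdiag * Tm t gdiag) zc := @deltaU_kb k a c zc.
Let dS (c : S * S) zc := @deltaS_kb k a c zc.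
Let TdV (c : V * V) zc :=
  @TdeltaV_kb k two_neq0 three_neq0 a c (Tfun del : V -> V) (fun m => erefl) zc.
Let KV := fV_kform two_neq0 three_neq0 a.
Let KU := fU_kform k a.
Let KS := fS_kform k a.
Let KY := diag_kform k a.
Let mV (c : V * V) zc := @muV_form k two_neq0 three_neq0 a c zc.
Let mTV (c : V * V) zc := @TmuV_form k two_neq0 three_neq0 a c zc.
Let mS (c : S * S) zc := @muS_form k a c zc.
Let mU (c : Tm t gdiag * Tm t gdiag) zc := @muU_form k a c zc.
Let iVU y := @VU_injective k two_neq0 a y.
Let iVS y := @VS_injective k two_neq0 three_neq0 a y.
Let ex y y' := @UY_SY_exact k two_neq0 three_neq0 a y y'.

Definition small0 N P (HP : @rpres k a (tdeg1 2 0 a) (- 0) (fun y => y = 0) N P) :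
  hpresentation D a 0 N := @pres0 k t S gdiag del m md gS gY a _ _ _ _ KV dV TdV N P HP.

Definition small2 NS NU PS PU
  (HS : @rpres k a (tdeg1 0 0 a + 2) (- 0 + 2)
    (fun y => exists2 y', kvalue a y' & y = gVS a y') NS PS)
  (HU : @rpres k a (tdeg1 0 0 a + 2) (- 0 + 2)
    (fun y => exists2 y', kvalue a y' & y = gVU a y') NU PU) :
  hpresentation D a 2 (gsum NS NU) :=
  @pres2 k t S gdiag del m md gS gY a _ _ _ _ _ _ _ _ _ _ _ _ KV KU KS dV dU TdV dS
    _ _ mV mTV iVU NS NU PS PU HS HU.

Definition small4 N P
  (HP : @rpres k a ((2 * a)%:Z + 2 + 2) ((2 * a)%:Z + 2 + 2) (fun y => exists yU yS,
    [/\ kvalue a yU, kvalue a yS & y = gUY a yU + gSY a yS]) N P) :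
  hpresentation D a 4 N :=
  @pres4 k t S gdiag del m md gS gY a _ _ _ _ _ _ _ _ _ _ _ _ KU KS KY _ _ mS mU N P HP.

Lemma small_wgraded j : wgraded (D j).
Proof.
have g := @sq_wgraded k s.
apply: gsum_wgraded; first exact: (Tm_wgraded t (g j)).
apply: gsum_wgraded; apply: gshift_wgraded.
  exact: (Tm_wgraded t (pre_wgraded g j)).
exact: (pre_wgraded (pre_wgraded g)).
Qed.

Definition small1 : hpresentation D a 1 (gzero k 2).
Proof.
apply: (trivial_pres small_wgraded) => c.
exact: (@degree1_coboundary k t S gdiag del m md gS gY a _ _ _ _ _ _ _ _ _ _ _ _ KV KU KS
  _ _ mV mTV iVU iVS c).
Defined.

Definition small3 : hpresentation D a 3 (gzero k 2).
Proof.
apply: (trivial_pres small_wgraded) => c.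
exact: (@degree3_coboundary k t S gdiag del m md gS gY a _ _ _ _ _ _ _ _ _ _ _ _ _ _ _ _
  KV KU KS KY dU _ _ _ _ mV mTV mS mU ex c).
Defined.

Definition small5 j : hpresentation D a j.+4.+1 (gzero k 2).
Proof.
apply: (trivial_pres small_wgraded) => c.
exact: (@degree5_coboundary k t S gdiag del m md gS gY a j c).
Defined.

Definition small_high j : (2 < a)%N -> hpresentation D a j (gzero k 2).
Proof. by move=> a3; apply: (trivial_pres small_wgraded) => c; apply: high_coboundary. Defined.

Lemma HHH_giso (P : resolution gdiag) j N : wgraded N -> hpresentation D a j N ->
  giso (HHH P [:: s; s; t; t] a j) N.
Proof.
move=> gN phi; have [K] := koszul_frame_exists P.
exact: (hpresentation_giso K (rouquier_wgraded two_neq0) gN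
  (hretract_presentation (rouquier_retract two_neq0) phi)).
Qed.

Lemma giso_trivial (M N : gmod k 2) : giso M N -> gtrivial N -> gtrivial M.
Proof. by move=> [f [g [fK _]]] N0 x; rewrite -[x]fK (N0 (f x)); apply: (linear0 g). Qed.

Lemma gzero_trivial : gtrivial (gzero k 2).
Proof. by move=> x; apply/rowP => -[]. Qed.

Lemma HHH_trivial (P : resolution gdiag) j : hpresentation D a j (gzero k 2) ->
  gtrivial (HHH P [:: s; s; t; t] a j).
Proof.
move=> phi; apply: giso_trivial gzero_trivial.
by apply: HHH_giso phi; apply: gzero_wgraded.
Qed.

End SmallPresentations.

Theorem mainTheorem9 (k : fieldType) (char0 : [pchar k] =i pred0)
    (P : resolution (gdiag k 2)) :
  let s : 'I_2 := ord0 in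
  let t : 'I_2 := ord_max in
  let R := greg k 2 in
  let R_s := gquot_ideal (fun p : {mpoly k[2]} => p = 'X_s) in
  let R_t := gquot_ideal (fun p : {mpoly k[2]} => p = 'X_t) in
  let K := gquot_ideal (fun p : {mpoly k[2]} => p = 'X_s \/ p = 'X_t) in
  let H := HHH P [:: s; s; t; t] in
  [/\ [/\ giso (H 0 0)%N (gshift (- 4) R),
          giso (H 0 2)%N (gsum R_t R_s) &
          giso (H 0 4)%N (gshift 4 K)],
      [/\ giso (H 1 0)%N (gsum R R) &
          giso (H 1 2)%N (gsum (gshift 4 R_t) (gshift 4 R_s))],
      giso (H 2 0)%N (gshift 4 R),
      (forall a j : nat,
         (a, j) \notin [:: (0, 0); (0, 2); (0, 4); (1, 0); (1, 2); (2, 0)]%N ->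
         gtrivial (H a j)) &
      (forall (a j : nat) (d : int), gdim (H a j) d (poincare a j d))].
Proof.
move=> s t R R_s R_t K H.
have pc n : (n%:R == 0 :> k) = (n == 0)%N := (iffLR (pcharf0P k) char0) n.
have two0 : 2 != 0 :> k by rewrite pc.
have three0 : 3 != 0 :> k by rewrite pc.
have wR := greg_wgraded k; have wS := @ideal_wgraded k (fun p => p = 'X_s).
have wT := @ideal_wgraded k (fun p => p = 'X_t).
have wK := @ideal_wgraded k (fun p => p = 'X_s \/ p = 'X_t).
have h00 : giso (H 0 0)%N (gshift (- 4) R).
  apply: (HHH_giso two0 P) (gshift_wgraded _ wR) _; apply: (small0 two0 three0).
  (* The shift is [tdeg1 2 0 0], that is - 2 - 2; the second degree 4 is chosen so that 4 - 4
     matches [- 0]. *)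
  exact: rpres_eq (rpres_shift (- 4) (@rpres_fst k 0 4 erefl erefl)) erefl erefl.
have h02 : giso (H 0 2)%N (gsum R_t R_s).
  apply: (HHH_giso two0 P) (gsum_wgraded wT wS) _; apply: (small2 two0 three0).
    exact: rpres_eq (coker_VS0 two0 2) erefl erefl.
  exact: rpres_eq (coker_VU0 two0 2) erefl erefl.
have h04 : giso (H 0 4)%N (gshift 4 K).
  apply: (HHH_giso two0 P) (gshift_wgraded _ wK) _; apply: (small4 (a := 0)).
  exact: rpres_eq (rpres_shift 4 (coker4_0 two0 0)) erefl erefl.
have h10 : giso (H 1 0)%N (gsum R R).
  apply: (HHH_giso two0 P) (gsum_wgraded wR wR) _; apply: (small0 two0 three0).
  exact: rpres_eq (rpres_pair k) erefl erefl.
have h12 : giso (H 1 2)%N (gsum (gshift 4 R_t) (gshift 4 R_s)).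
  apply: (HHH_giso two0 P) (gsum_wgraded (gshift_wgraded _ wT) (gshift_wgraded _ wS)) _.
  apply: (small2 two0 three0).
    (* The degrees match as [tdeg1 0 0 1 + 2] = 0 + 4 and [- 0 + 2] = - 2 + 4. *)
    exact: (@rpres_eq k 1 _ _ _ _ _ _ _ (rpres_shift 4 (coker_VS1 two0 three0)) erefl erefl).
  exact: (@rpres_eq k 1 _ _ _ _ _ _ _ (rpres_shift 4 (coker_VU1 two0)) erefl erefl).
have h20 : giso (H 2 0)%N (gshift 4 R).
  apply: (HHH_giso two0 P) (gshift_wgraded _ wR) _; apply: (small0 two0 three0).
  exact: rpres_eq (rpres_shift 4 (@rpres_fst k 2 (- 4) erefl erefl)) erefl erefl.
have HT a j phi : gtrivial (H a j) := @HHH_trivial k two0 a P j phi.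
have h0 (a j : nat) :
    (a, j) \notin [:: (0, 0); (0, 2); (0, 4); (1, 0); (1, 2); (2, 0)]%N -> gtrivial (H a j).
  have [a3|a3 nl] := ltnP 2 a; first by move=> _; refine (HT _ _ _); exact: small_high.
  case: j nl => [|[|[|[|[|j]]]]] nl; try by refine (HT _ _ _); exact: small1.
  - by case: a a3 nl => [|[|[|a]]].
  (* The case left is a = 2, where both multiplication maps from V are the identity in coordinates
     and their cokernels vanish. *)
  - case: a a3 nl => [|[|[|a]]] // _ _.
    refine (@giso_trivial k _ (gsum (gzero k 2) (gzero k 2)) _ _).
      apply: (HHH_giso two0 P); first exact: gsum_wgraded (gzero_wgraded _ _) (gzero_wgraded _ _).
      by apply: (small2 two0 three0); apply: coker_id.
    by move=> x; apply: pair_ext; apply: gzero_trivial.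
  - by refine (HT _ _ _); exact: small3.
  - case: a a3 nl => [|[|[|a]]] // _ _; refine (HT _ _ _); apply: (small4 (a := _)).
      exact: coker4_1.
    exact: coker4_2.
  by refine (HT _ _ _); exact: small5.
split=> // a j d.
have D1 e := @gdim_line k t s e erefl; have D2 e := @gdim_line k s t e erefl.
have DR := gdim_greg k; have DK := gdim_point k.
have [|nl] := boolP ((a, j) \in [:: (0, 0); (0, 2); (0, 4); (1, 0); (1, 2); (2, 0)]%N); last first.
  rewrite (_ : poincare a j d = 0%N); first exact: gdim_trivial (h0 _ _ nl).
  by move: nl; rewrite /poincare /term; case: a => [|[|[|a]]]; case: j => [|[|[|[|[|j]]]]].
rewrite !inE => /or4P[|||/or3P[||]] /eqP[-> ->]; rewrite /poincare /term /=.
- rewrite !muln0 !addn0 qfrac_shift; exact: gdim_giso h00 (DR _).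
- rewrite !muln0 !addn0 add0n mul2n -addnn; apply: gdim_giso h02 _.
  exact: gdim_gsum (D2 d) (D1 d) wT wS.
- rewrite !muln0 !addn0 !add0n qfrac_shift; exact: gdim_giso h04 (DK _).
- rewrite !muln0 !addn0 !add0n mul2n -addnn; apply: gdim_giso h10 _.
  exact (gdim_gsum (DR d) (DR d) wR wR).
- rewrite !muln0 !addn0 !add0n mul2n -addnn qfrac_shift; apply: gdim_giso h12 _.
  by apply: gdim_gsum; [exact: D2|exact: D1|exact: gshift_wgraded|exact: gshift_wgraded].
rewrite !muln0 !add0n qfrac_shift; exact: gdim_giso h20 (DR _).
Qed.
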